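(* Let $q$ be a prime and assume the generalized Riemann hypothesis for Dirichlet $L$-functions modulo $q$. Then, for any fixed $t>0$, \[ \frac{1}{q-2}\sum_{\substack{\chi \ (\mathrm{mod}\ q) \\ \chi \ne \chi_0}} \ \underset{s=\frac{1}{2}}{\mathrm{ord}} \ L\!\left(s+ \frac{2 \pi i t }{\log q}\,,\,\chi\right) \ \le \ \frac{1}{2} \left(1+\left|\frac{\sin 4 \pi t }{4\pi t}\right|\right)^{-1} + O\!\left(\frac{1}{\log q}\right), \] where $\chi_0$ denotes the principal character modulo $q$. Consequently, for any $\varepsilon>0$, the proportion of primitive Dirichlet characters $\chi$ modulo $q$ for which $L\!\left( \frac{1}{2}+ \frac{2 \pi i t }{\log q},\chi\right) \ne 0$ is at least $1-\frac{1}{2} \left(1+\left|\frac{\sin 4 \pi t }{4\pi t}\right|\right)^{-1} - \varepsilon$ when $q$ is sufficiently large.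
   Context: $\mathrm{ord}_{s=s_0} L(s,\chi)$ denotes the order of vanishing of $L(s,\chi)$ at $s_0$ (zero if $L(s_0,\chi)\neq 0$). For $q$ prime, the non-principal characters modulo $q$ are exactly the $q-2$ primitive characters modulo $q$. *)

(* Defs.v *)
From Stdlib Require Import Reals Arith List ZArith Znumtheory.
From Stdlib Require Import Classical ClassicalEpsilon ClassicalDescription.
From Coquelicot Require Import Coquelicot.
Open Scope R_scope.

Definition is_dchar (q : nat) (chi : nat -> C) : Prop :=
  (forall m n : nat, chi (m * n)%nat = (chi m * chi n)%C) /\
  (forall n : nat, chi (n + q)%nat = chi n) /\
  (forall n : nat, chi n = 0%C <-> Nat.gcd n q <> 1%nat) /\
  chi 1%nat = 1%C.

Definition principal_char (q : nat) (n : nat) : C :=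
  if Nat.eqb (Nat.gcd n q) 1 then 1%C else 0%C.

Definition nonprincipal_char (q : nat) (chi : nat -> C) : Prop :=
  is_dchar q chi /\ chi <> principal_char q.

Definition npow_neg (n : nat) (s : C) : C :=
  (Rpower (INR n) (- Re s) * cos (Im s * ln (INR n)),
   - (Rpower (INR n) (- Re s) * sin (Im s * ln (INR n)))).

Fixpoint dpart (a : nat -> C) (s : C) (N : nat) : C :=
  match N with
  | O => 0%C
  | S M => (dpart a s M + a N * npow_neg N s)%C
  end.

(* Value of the Dirichlet series sum_{n>=1} a(n) n^{-s} as the limit of its
   partial sums.  For a non-principal character chi this converges for
   Re s > 0 and is L(s, chi) there (which covers the critical strip). *)
Definition dseries (a : nat -> C) (s : C) : C :=
  (real (Lim_seq (fun N => Re (dpart a s N))),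
   real (Lim_seq (fun N => Im (dpart a s N)))).

Definition Lfun (chi : nat -> C) (s : C) : C := dseries chi s.

(* Dirichlet eta function coefficients (-1)^{n-1}; eta(s) = (1 - 2^{1-s}) zeta(s)
   converges for Re s > 0. *)
Definition alt_sign (n : nat) : C := if Nat.odd n then 1%C else (-1)%C.
Definition eta (s : C) : C := dseries alt_sign s.

(* GRH for the Dirichlet L-functions modulo q: every zero in the critical
   strip 0 < Re s < 1 lies on Re s = 1/2.  For the principal character,
   L(s, chi_0) = (1 - q^{-s}) zeta(s) has the same zeros as zeta (equivalently
   eta) in the open strip. *)
Definition GRH_mod (q : nat) : Prop :=
  (forall chi, nonprincipal_char q chi ->
     forall s : C, 0 < Re s < 1 -> Lfun chi s = 0%C -> Re s = / 2) /\
  (forall s : C, 0 < Re s < 1 -> eta s = 0%C -> Re s = / 2).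

Definition holo_near (f : C -> C) (s0 : C) (r : R) : Prop :=
  forall s : C, Cmod (s - s0) < r -> ex_derive (K := C_AbsRing) (V := C_NormedModule) f s.

Definition vanishes_to_order (f : C -> C) (s0 : C) (m : nat) : Prop :=
  exists r : R, 0 < r /\ exists g : C -> C,
    holo_near g s0 r /\ g s0 <> 0%C /\
    forall s : C, Cmod (s - s0) < r -> f s = (Cpow (s - s0) m * g s)%C.

(* ord_{s=s0} f ; zero if f(s0) <> 0 (then m = 0 works), and by convention
   0 if no finite order exists. *)
Definition ord_at (f : C -> C) (s0 : C) : nat :=
  match excluded_middle_informative (exists m, vanishes_to_order f s0 m) with
  | left H => proj1_sig (constructive_indefinite_description _ H)
  | right _ => 0%nat
  end.

Definition enum_nonprincipal (q : nat) (l : list (nat -> C)) : Prop :=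
  NoDup l /\ forall chi, In chi l <-> nonprincipal_char q chi.

Definition sumN (l : list nat) : nat := fold_right Nat.add 0%nat l.

Definition Lshift (t : R) (q : nat) : C := (0, 2 * PI * t / ln (INR q)).

Definition half : C := (/ 2, 0).

Definition zbound (t : R) : R :=
  / 2 * / (1 + Rabs (sin (4 * PI * t) / (4 * PI * t))).

Definition nonvanishing_count (t : R) (q : nat) (l : list (nat -> C)) : nat :=
  sumN (map (fun chi =>
    if excluded_middle_informative (Lfun chi (Cplus half (Lshift t q)) <> 0%C)
    then 1%nat else 0%nat) l).

(* Main.v *)
(** Write [L = log q], [rho = 1/2 + 2 pi i t / L] and let [m chi] be the order of [L(s,chi)] at [rho].

    Instead of the explicit formula we use an inequality.  Under GRH the functional equation, in modulus form, bounds
    [ln |L(1/2-b+iy)| - ln |L(1/2+b+iy)|] by [b (L + O(log (2+|y|)))].  The maximum principle carries this bound to [Re s > 1/2]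
    for [ln |L(s-b)| - ln |L(s+b)|], even after the singularities at [rho] and its conjugate are removed with weights [mu] below
    the orders [m chi] and [m (conj chi)]; letting [b] tend to 0 gives, for [Re s > 1/2],
      [mu1 Re 1/(s-rho) + mu2 Re 1/(s - conj rho) <= (L + O(log |s+1|))/2 + Re (L'/L) (s)].

    This is integrated on [Re s = 1/2 + a], [Im s = y/L], against [|F(iy)|^2], where [F] is the Laplace transform of
    [cos (2 pi t u)] or [sin (2 pi t u)] on [-1,1], whichever makes [S = int c^2 = 1 + |sin (4 pi t)/(4 pi t)|].  Moving the [L'/L]
    term to [Re s = 3] expands it in primes; since [F^2] has exponential type 2 only [n < q^2] survive.  As [a -> 0] the Poisson
    kernels concentrate at [|y| = 2 pi t], where [|F|^2 = S^2], and Bessel's inequality gives [int |F|^2 <= 2 pi S], so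
      [(m chi + m (conj chi)) L pi S^2 <= pi S L + O(1) - Re sum_(n < q^2) Lambda(n) chi(n) n^(-1/2) ghat (log n / L)].
    On average over [chi] only [n = 1 mod q] matters, and there the linear vanishing of [ghat] at 2 makes even the trivial bound
    [Lambda(n) <= log n] sufficient.  Nonvanishing on [Re s = 1] comes from the 3-4-1 inequality, which leaves out the quadratic
    character; for it the bound [m chi = O(log q)] from the maximum principle is enough.

    The real and complex sums [rsum], [csum] run over [1..N]; [Fk chi k] is the series of [chi(n) (log n)^k n^(-s)], so
    [Fk chi 1 / Fk chi 0 = - L'/L]. *)
Require Import Defs.
From Stdlib Require Import Reals Arith List ZArith Znumtheory Lia Lra.
From Stdlib Require Import Classical ClassicalEpsilon FunctionalExtensionality Permutation.
From mathcomp Require all_boot all_algebra all_fingroup all_solvable.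
From Coquelicot Require Import Coquelicot.
Open Scope R_scope.

(** Everything takes place in [Re s > 0], where the series of [L(s,chi)] converges: there is no
    analytic continuation, no residue calculus and no product over zeros. The tools of complex
    analysis are the Cauchy-Riemann equations and the maximum principle for functions that may take
    the value [-oo]. This is why a zero enters only through an upper bound
    [ln |L(s)| <= c + m ln |s - rho|]: with [mu < m] the difference [ln |L(s)| - mu ln |s - rho|]
    still tends to [-oo] at [rho], like at every other zero on the critical line, and such points
    are harmless for the maximum principle. The result needs constants independent of [q] in the
    inequality for one character. Bounds that depend on [q], on [chi] or on the distance to the
    critical line also occur, but only where a limit removes them: as growth conditions in a strip,
    or on the horizontal edges of a contour. The factor 1/2 of the theorem comes from treating [rho]
    and its conjugate together: [g = |F|^2] is even with the peak [S^2] at both, and complex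
    conjugation permutes the characters, so the left side sums to twice the total order. *)

Module PrimitiveRoot.
Import all_boot all_algebra all_fingroup all_solvable.
Import GRing.Theory.

(** * A primitive root modulo a prime *)

Lemma modn_mod (n d : nat) : (0 < d)%N -> modn n d = Nat.modulo n d.
Proof.
  move=> d0; apply: (Nat.mod_unique _ _ (n %/ d)%N); first by apply/ltP; rewrite ltn_mod.
  by rewrite {1}(divn_eq n d) mulnC.
Qed.

Lemma expn_pow (g k : nat) : expn g k = Nat.pow g k.
Proof. by elim: k => //= k IH; rewrite expnS IH. Qed.

Lemma prime_of_Z (q : nat) : Znumtheory.prime (Z.of_nat q) -> prime.prime q.
Proof.
  move=> [H1 H2]; apply/primeP; split; first by apply/ltP; lia.
  move=> d /dvdnP [k Ek].
  have : (Z.of_nat d | Z.of_nat q)%Z by exists (Z.of_nat k); rewrite Ek; apply: Nat2Z.inj_mul.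
  move=> Hd. have [] : (d = 1 \/ d = q)%nat; last 2 first.
  - by move=> ->; rewrite eqxx.
  - by move=> ->; rewrite eqxx orbT.
  have Hp := Znumtheory.prime_divisors _ (Znumtheory.prime_intro _ H1 H2) _ Hd. lia.
Qed.

(** The unit group of a finite field is cyclic. The last clause says that the order of [g] is
    exactly [q - 1], so that discrete logarithms are well defined modulo [q - 1]. *)
Lemma exists_generator (q : nat) : Znumtheory.prime (Z.of_nat q) ->
  exists g : nat, Nat.gcd g q = 1%nat /\
    (forall n, Nat.gcd n q = 1%nat -> exists k, (k < q - 1)%coq_nat /\ Nat.modulo n q = Nat.modulo (Nat.pow g k) q) /\
    (forall i j, Nat.modulo (Nat.pow g i) q = Nat.modulo (Nat.pow g j) q <-> Nat.modulo i (q - 1) = Nat.modulo j (q - 1)).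
Proof.
  move=> HP; have Hq := prime_of_Z _ HP. have q1 := prime_gt1 Hq.
  have cop n : Nat.gcd n q = 1%nat <-> (n%:R != 0 :> 'F_q)%R.
  { have -> : ((n%:R : 'F_q)%R == 0%R) = (q %| n)%N by rewrite -(dvdn_pcharf (pchar_Fp Hq)).
    rewrite -prime_coprime //; split.
    - move=> Hg; rewrite coprime_sym /coprime. apply/eqP.
      have D : (gcdn n q %| 1)%N.
      { have [k1 E1] := dvdnP (dvdn_gcdl n q). have [k2 E2] := dvdnP (dvdn_gcdr n q).
        have : Nat.divide (gcdn n q) (Nat.gcd n q) by apply: Nat.gcd_greatest; [exists k1|exists k2].
        rewrite Hg => [[k Ek]]. by apply/dvdnP; exists k. }
      by apply/eqP; rewrite -dvdn1.
    - rewrite coprime_sym /coprime => /eqP Hg.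
      have [k1 E1] := Nat.gcd_divide_l n q. have [k2 E2] := Nat.gcd_divide_r n q.
      have : (Nat.gcd n q %| gcdn n q)%N by rewrite dvdn_gcd; apply/andP; split; apply/dvdnP; [exists k1|exists k2].
      by rewrite Hg dvdn1 => /eqP. }
  have eqF m n : ((m%:R : 'F_q)%R = n%:R%R) <-> Nat.modulo m q = Nat.modulo n q.
  { rewrite -!modn_mod //; try by apply: ltnW. split.
    - by move=> E; rewrite -!(val_Fp_nat Hq) E.
    - by move=> E; apply: val_inj; rewrite /= !(val_Fp_nat Hq). }
  have /cyclicP [x Ex] := field_unit_group_cyclic [set: {unit 'F_q}]%G.
  set g := nat_of_ord (val x).
  have Eg : (g%:R : 'F_q)%R = val x by rewrite /g natr_Zp.
  have Ek k : ((expn g k)%:R : 'F_q)%R = val (x ^+ k)%g by rewrite natrX Eg FinRing.val_unitX.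
  have Ox : #[x]%g = (q - 1)%nat.
  { rewrite /order -Ex card_finField_unit card_Fp //. by rewrite subn1. }
  exists g; split; [|split].
  - apply/cop. rewrite Eg -unitfE. exact: valP x.
  - move=> n /cop Hn.
    have Hu : (n%:R : 'F_q)%R \is a GRing.unit by rewrite unitfE.
    have : FinRing.unit 'F_q Hu \in <[x]>%g by rewrite -Ex inE.
    move/cyclePmin => [k Hk E]. exists k; split; first by apply/ltP; rewrite -Ox.
    rewrite -expn_pow. apply/eqF. rewrite Ek -E. by [].
  - move=> i j; rewrite -!expn_pow. split.
    + move/eqF; rewrite !Ek => /val_inj /eqP. rewrite eq_expg_mod_order Ox => /eqP.
      rewrite !modn_mod //; by rewrite subn_gt0.
    + move=> E; apply/eqF; rewrite !Ek; congr (val _); apply/eqP; rewrite eq_expg_mod_order Ox; apply/eqP.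
      rewrite !modn_mod //; by rewrite subn_gt0.
Qed.
End PrimitiveRoot.

Lemma exists_generator (q : nat) : prime (Z.of_nat q) ->
  exists g : nat, Nat.gcd g q = 1%nat /\
    (forall n, Nat.gcd n q = 1%nat -> exists k, (k < q - 1)%nat /\ Nat.modulo n q = Nat.modulo (g ^ k) q) /\
    (forall i j, Nat.modulo (g ^ i) q = Nat.modulo (g ^ j) q <-> Nat.modulo i (q - 1) = Nat.modulo j (q - 1)).
Proof. exact (PrimitiveRoot.exists_generator q). Qed.

(** * Complex derivatives, derivatives along real paths, the exponential function *)

Definition cder (f : C -> C) (z d : C) : Prop :=
  forall eps : R, 0 < eps -> exists del : R, 0 < del /\
    forall h : C, Cmod h < del -> Cmod (f (z + h) - f z - d*h)%C <= eps*Cmod h.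

Definition rder (f : R -> C) (t : R) (d : C) : Prop :=
  is_derive (fun x => Re (f x)) t (Re d) /\ is_derive (fun x => Im (f x)) t (Im d).

Definition cexp (z : C) : C := (exp (Re z)*cos (Im z), exp (Re z)*sin (Im z)).

Lemma C_ext (z w : C) : Re z = Re w -> Im z = Im w -> z = w.
Proof. destruct z, w; simpl; intros; subst; reflexivity. Qed.

Notation lnn n := (ln (INR n)).

Tactic Notation "le_via" uconstr(t) := eapply Rle_trans; [apply t|].
Tactic Notation "le_lt_via" uconstr(t) := eapply Rle_lt_trans; [apply t|].
Ltac C_ring := apply C_ext; unfold Re, Im; simpl; ring.
Ltac Re_ring := unfold Re, Im; simpl; ring.
Ltac Re_lra := unfold Re, Im; simpl; lra.
Ltac fun_ring := apply functional_extensionality; intros; ring.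
Ltac inv_pos := apply Rinv_0_lt_compat; lra.
Ltac div_pos := apply Rdiv_lt_0_compat; lra.
Ltac der_ring := auto_derive; trivial; ring.

Lemma Re_le_Cmod (z : C) : Re z <= Cmod z.
Proof. eapply Rle_trans; [apply Rle_abs|apply re_le_Cmod]. Qed.

Lemma Im_abs_le_Cmod (z : C) : Rabs (Im z) <= Cmod z.
Proof. eapply Rle_trans; [|apply Rmax_Cmod]. apply Rmax_r. Qed.

Lemma Cmod_le_abs (z : C) : Cmod z <= Rabs (Re z) + Rabs (Im z).
Proof.
  replace z with ((RtoC (Re z))+(0, Im z))%C by (apply C_ext; simpl; ring).
  le_via Cmod_triangle. rewrite Cmod_R. simpl. rewrite !Rplus_0_r, Rplus_0_l.
  apply Rplus_le_compat_l. unfold Cmod; simpl. rewrite Rmult_0_l, Rplus_0_l, Rmult_1_r.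
  rewrite <- sqrt_Rsqr_abs. reflexivity.
Qed.

Lemma Cmod_minus_sym (a b : C) : Cmod (a - b)%C = Cmod (b - a)%C.
Proof. rewrite <- Cmod_opp. f_equal. ring. Qed.

Lemma Cmod_minus_le (a b : C) : Cmod (a - b)%C <= Cmod a + Cmod b.
Proof. le_via Cmod_triangle. rewrite Cmod_opp. lra. Qed.

Lemma Cmod_rev_triangle (a b : C) : Rabs (Cmod a - Cmod b) <= Cmod (a - b)%C.
Proof.
  apply Rabs_le. split.
  - pose proof (Cmod_triangle (b-a)%C a) as H. replace (b-a+a)%C with b in H by ring.
    rewrite Cmod_minus_sym in H. lra.
  - pose proof (Cmod_triangle (a-b)%C b) as H. replace (a-b+b)%C with a in H by ring. lra.
Qed.

Lemma Cmod_sqr (z : C) : Cmod z*Cmod z = Re z*Re z + Im z*Im z.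
Proof.
  unfold Cmod, Re, Im. rewrite sqrt_sqrt; [ring|]. nra.
Qed.

Lemma Cmod_cexp (z : C) : Cmod (cexp z) = exp (Re z).
Proof.
  apply Rsqr_inj; [apply Cmod_ge_0|left; apply exp_pos|]. unfold Rsqr. rewrite Cmod_sqr. simpl.
  pose proof (sin2_cos2 (Im z)) as H. unfold Rsqr in H.
  nra.
Qed.

Lemma cexp_plus (z w : C) : cexp (z + w)%C = (cexp z*cexp w)%C.
Proof.
  unfold cexp. destruct z as [a b], w as [c d]; simpl.
  rewrite exp_plus, cos_plus, sin_plus. apply C_ext; simpl; ring.
Qed.

Lemma cexp_0 : cexp 0 = 1%C.
Proof. unfold cexp; simpl. rewrite exp_0, cos_0, sin_0. apply C_ext; simpl; ring. Qed.

Lemma cexp_RtoC (x : R) : cexp (RtoC x) = RtoC (exp x).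
Proof. unfold cexp, RtoC, Re, Im; simpl. rewrite cos_0, sin_0. C_ring. Qed.

Lemma cexp_neq_0 (z : C) : cexp z <> 0%C.
Proof. apply Cmod_gt_0. rewrite Cmod_cexp. apply exp_pos. Qed.

Lemma cexp_conj (z : C) : cexp (Cconj z) = Cconj (cexp z).
Proof. unfold cexp, Cconj, Re, Im; simpl. rewrite cos_neg, sin_neg. C_ring. Qed.

Lemma rder_cexp_line (w z : C) (t : R) :
  rder (fun t => cexp (w + t*z))%C t (z*cexp (w + t*z))%C.
Proof. split; unfold cexp, Re, Im; simpl; auto_derive; trivial; unfold Rminus; ring.
Qed.

Lemma rder_plus (f g : R -> C) (t : R) (d e : C) : rder f t d -> rder g t e -> rder (fun x => f x + g x)%C t (d + e)%C.
Proof.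
  intros [H1 H2] [H3 H4]. split; [apply (is_derive_plus (fun x => Re (f x)) (fun x => Re (g x)))|
    apply (is_derive_plus (fun x => Im (f x)) (fun x => Im (g x)))]; assumption.
Qed.

(* Projecting on the direction of [f b - f a] keeps the constant 1 in the vector - valued case. *)
Lemma rder_mean_value (f f' : R -> C) (a b M : R) : a <= b ->
  (forall t, a <= t <= b -> rder f t (f' t)) ->
  (forall t, a <= t <= b -> Cmod (f' t) <= M) ->
  Cmod (f b - f a)%C <= M*(b - a).
Proof.
  intros Hab Hd HM.
  set (w := (f b-f a)%C).
  destruct (Req_dec (Cmod w) 0) as [H0|H0].
  { rewrite H0. apply Rmult_le_pos; [|lra]. eapply Rle_trans; [apply Cmod_ge_0|apply (HM a); lra]. }
  pose proof (Cmod_ge_0 w) as Hw.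
  set (g := fun t => Re w*Re (f t)+Im w*Im (f t)).
  set (g' := fun t => Re w*Re (f' t)+Im w*Im (f' t)).
  assert (Hg : forall t, a <= t <= b -> is_derive g t (g' t)).
  { intros t Ht. destruct (Hd t Ht) as [H1 H2].
    apply (is_derive_plus (fun t => Re w*Re (f t)) (fun t => Im w*Im (f t)));
    apply (is_derive_scal); assumption. }
  destruct (MVT_gen g a b g') as [c [Hc He]].
  { intros x Hx. apply Hg. rewrite Rmin_left, Rmax_right in Hx; lra. }
  { intros x Hx. rewrite Rmin_left, Rmax_right in Hx by lra. apply derivable_continuous_pt.
    exists (g' x). apply is_derive_Reals. apply Hg; lra. }
  rewrite Rmin_left, Rmax_right in Hc by lra.
  assert (E1 : g b-g a = Cmod w*Cmod w).
  { rewrite Cmod_sqr. unfold g, w; simpl. unfold Re, Im. ring. }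
  assert (E2 : g' c <= Cmod w*Cmod (f' c)).
  { rewrite <- (Cmod_conj w), <- Cmod_mult. eapply Rle_trans; [|apply Re_le_Cmod].
    unfold g'. simpl. unfold Re, Im. right. ring. }
  rewrite E1 in He. specialize (HM c Hc).
  apply Rmult_le_reg_l with (Cmod w); [lra|]. rewrite He.
  rewrite <- Rmult_assoc. apply Rmult_le_compat_r; [lra|].
  nra.
Qed.

Lemma Cmod_scal (t : R) (z : C) : Cmod (t*z)%C = Rabs t*Cmod z.
Proof. rewrite Cmod_mult, Cmod_R. reflexivity. Qed.

(** The mean value inequality along the segment from 0 to [z], where [|exp (t z)| <= exp |z|].
    Applied once more, to [exp (t z) - t z], it gives the quadratic bound that follows. *)
Lemma cexp_sub1_bound (z : C) : Cmod (cexp z - 1)%C <= Cmod z*exp (Cmod z).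
Proof.
  pose proof (rder_mean_value (fun t => cexp (0+t*z))%C (fun t => z*cexp (0+t*z))%C 0 1
    (Cmod z*exp (Cmod z))) as H. cbv beta in H.
  replace (0+1%R*z)%C with z in H by ring. replace (0+0%R*z)%C with (RtoC 0) in H by ring.
  rewrite cexp_0 in H. eapply Rle_trans; [apply H|lra]; try lra.
  - intros; apply rder_cexp_line.
  - intros t Ht. rewrite Cmod_mult, Cmod_cexp. apply Rmult_le_compat_l; [apply Cmod_ge_0|].
    destruct (Req_dec (Re (0+t*z)%C) (Cmod z)) as [->|Hn]; [lra|]. left. apply exp_increasing.
    assert (Re (0+t*z)%C <= Cmod z); [|lra]. le_via Re_le_Cmod.
    rewrite Cplus_0_l, Cmod_scal. rewrite Rabs_right by lra. pose proof (Cmod_ge_0 z). nra.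
Qed.

Lemma cexp_taylor_bound (z : C) : Cmod (cexp z - 1 - z)%C <= Cmod z*Cmod z*exp (Cmod z).
Proof.
  pose proof (rder_mean_value (fun t => cexp (0+t*z)-t*z)%C (fun t => z*(cexp (0+t*z)-1))%C 0 1
    (Cmod z*Cmod z*exp (Cmod z))) as H. cbv beta in H.
  replace (0+1%R*z)%C with z in H by ring. replace (0+0%R*z)%C with (RtoC 0) in H by ring.
  rewrite cexp_0 in H. replace (cexp z-1-z)%C with (cexp z-1*z-(1-0*z))%C by ring.
  eapply Rle_trans; [apply H|lra]; try lra.
  - intros t _. replace (z*(cexp (0+t*z)-1))%C with (z*cexp (0+t*z)+(- z))%C by ring.
    apply (rder_plus (fun t => cexp (0+t*z))%C (fun t => - (t*z))%C); [apply rder_cexp_line|].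
    destruct z as [u v]; split; unfold Re, Im; simpl; der_ring.
  - intros t Ht. rewrite Cmod_mult, Rmult_assoc. apply Rmult_le_compat_l; [apply Cmod_ge_0|].
    le_via cexp_sub1_bound. rewrite Cplus_0_l, Cmod_scal, Rabs_right by lra.
    pose proof (Cmod_ge_0 z).
    apply Rmult_le_compat; [nra|left; apply exp_pos|nra|].
    destruct (Req_dec (t*Cmod z) (Cmod z)) as [->|Hn]; [lra|]. left; apply exp_increasing. nra.
Qed.

Lemma cder_const (c z : C) : cder (fun _ => c) z 0.
Proof. exists 1. split; [lra|]. intros h _. replace (c-c-0*h)%C with (RtoC 0) by ring.
  rewrite Cmod_0. pose proof (Cmod_ge_0 h). nra.
Qed.

Lemma cder_affine (a b z : C) : cder (fun w => a*w + b)%C z a.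
Proof. exists 1. split; [lra|]. intros h _.
  replace (a*(z+h)+b-(a*z+b)-a*h)%C with (RtoC 0) by ring.
  rewrite Cmod_0. pose proof (Cmod_ge_0 h). nra.
Qed.

Lemma cder_plus (f g : C -> C) (z d e : C) : cder f z d -> cder g z e -> cder (fun w => f w + g w)%C z (d + e)%C.
Proof.
  intros Hf Hg eps He. destruct (Hf (eps/2)) as [d1 [Hd1 H1]]; [lra|]. destruct (Hg (eps/2)) as [d2 [Hd2 H2]]; [lra|].
  exists (Rmin d1 d2). split; [apply Rmin_pos; assumption|]. intros h Hh.
  replace (f (z+h)+g (z+h)-(f z+g z)-(d+e)*h)%C with
    ((f (z+h)-f z-d*h)+(g (z+h)-g z-e*h))%C by ring.
  le_via Cmod_triangle.
  specialize (H1 h (Rlt_le_trans _ _ _ Hh (Rmin_l _ _))). specialize (H2 h (Rlt_le_trans _ _ _ Hh (Rmin_r _ _))). lra.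
Qed.

Lemma cder_scal (f : C -> C) (z d c : C) : cder f z d -> cder (fun w => c*f w)%C z (c*d)%C.
Proof.
  intros Hf eps He. pose proof (Cmod_ge_0 c).
  destruct (Hf (eps/(1+Cmod c))) as [d1 [Hd1 H1]]; [div_pos|].
  exists d1. split; [assumption|]. intros h Hh.
  replace (c*f (z+h)-c*f z-c*d*h)%C with (c*(f (z+h)-f z-d*h))%C by ring.
  rewrite Cmod_mult. specialize (H1 h Hh). pose proof (Cmod_ge_0 h).
  apply Rle_trans with (Cmod c*(eps/(1+Cmod c)*Cmod h)); [apply Rmult_le_compat_l; assumption|].
  replace (Cmod c*(eps/(1+Cmod c)*Cmod h)) with ((Cmod c/(1+Cmod c))*(eps*Cmod h)) by (field; lra).
  assert (Cmod c/(1+Cmod c) <= 1). { apply Rmult_le_reg_r with (1+Cmod c); [lra|]. field_simplify; lra. }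
  rewrite <- (Rmult_1_l (eps*Cmod h)) at 2. apply Rmult_le_compat_r; nra.
Qed.

Lemma cder_locally_lipschitz (f : C -> C) (z d : C) : cder f z d ->
  exists del, 0 < del /\ forall h, Cmod h < del -> Cmod (f (z + h) - f z)%C <= (Cmod d + 1)*Cmod h.
Proof.
  intros Hf. destruct (Hf 1) as [del [Hd H]]; [lra|]. exists del. split; [assumption|]. intros h Hh.
  specialize (H h Hh). replace (f (z+h)-f z)%C with ((f (z+h)-f z-d*h)+d*h)%C by ring.
  le_via Cmod_triangle. rewrite Cmod_mult. nra.
Qed.

Lemma cder_mult (f g : C -> C) (z d e : C) : cder f z d -> cder g z e ->
  cder (fun w => f w*g w)%C z (d*g z + f z*e)%C.
Proof.
  intros Hf Hg eps He.
  destruct (cder_locally_lipschitz f z d Hf) as [r1 [Hr1 L1]]. destruct (cder_locally_lipschitz g z e Hg) as [r2 [Hr2 L2]].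
  pose proof (Cmod_ge_0 (f z)). pose proof (Cmod_ge_0 (g z)). pose proof (Cmod_ge_0 d). pose proof (Cmod_ge_0 e).
  set (K := (Cmod d+1)*(Cmod e+1)). assert (HK : 0 < K) by (unfold K; nra).
  set (M := 1+Cmod (f z)+Cmod (g z)).
  assert (0 < eps/(3*M)) by (apply Rdiv_lt_0_compat; unfold M; lra).
  destruct (Hf (eps/(3*M))) as [d1 [Hd1 H5]]; [assumption|].
  destruct (Hg (eps/(3*M))) as [d2 [Hd2 H6]]; [assumption|].
  assert (H4 : 0 < eps/(3*K)) by div_pos.
  exists (Rmin (Rmin r1 r2) (Rmin (Rmin d1 d2) (eps/(3*K)))). split; [repeat apply Rmin_pos; assumption|].
  intros h Hh.
  pose proof (Rmin_l (Rmin r1 r2) (Rmin (Rmin d1 d2) (eps/(3*K)))).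
  pose proof (Rmin_r (Rmin r1 r2) (Rmin (Rmin d1 d2) (eps/(3*K)))).
  pose proof (Rmin_l r1 r2). pose proof (Rmin_r r1 r2). pose proof (Rmin_l (Rmin d1 d2) (eps/(3*K))).
  pose proof (Rmin_r (Rmin d1 d2) (eps/(3*K))). pose proof (Rmin_l d1 d2). pose proof (Rmin_r d1 d2).
  specialize (L1 h ltac:(lra)). specialize (L2 h ltac:(lra)). specialize (H5 h ltac:(lra)). specialize (H6 h ltac:(lra)).
  replace (f (z+h)*g (z+h)-f z*g z-(d*g z+f z*e)*h)%C with
   ((f (z+h)-f z-d*h)*g z+(f z*(g (z+h)-g z-e*h)+(f (z+h)-f z)*(g (z+h)-g z)))%C by ring.
  le_via Cmod_triangle.
  apply Rle_trans with (eps/3*Cmod h+(eps/3*Cmod h+eps/3*Cmod h)); [|lra].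
  pose proof (Cmod_ge_0 h) as Hh0.
  assert (E : eps/(3*M)*M = eps/3) by (unfold M; field; lra).
  apply Rplus_le_compat; [|le_via Cmod_triangle; apply Rplus_le_compat].
  - rewrite Cmod_mult. rewrite <- E. replace (eps/(3*M)*M*Cmod h) with (eps/(3*M)*Cmod h*M) by ring.
    apply Rmult_le_compat; try apply Cmod_ge_0; [assumption|unfold M; lra].
  - rewrite Cmod_mult. rewrite <- E. replace (eps/(3*M)*M*Cmod h) with (M*(eps/(3*M)*Cmod h)) by ring.
    apply Rmult_le_compat; try apply Cmod_ge_0; [unfold M; lra|assumption].
  - rewrite Cmod_mult.
    apply Rle_trans with (((Cmod d+1)*Cmod h)*((Cmod e+1)*Cmod h)).
    + apply Rmult_le_compat; try apply Cmod_ge_0; assumption.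
    + replace ((Cmod d+1)*Cmod h*((Cmod e+1)*Cmod h)) with (K*Cmod h*Cmod h) by (unfold K; ring).
      apply Rmult_le_compat_r; [assumption|].
      replace (eps/3) with (K*(eps/(3*K))) by (field; lra). nra.
Qed.

Lemma cder_comp (f g : C -> C) (z d e : C) : cder g z e -> cder f (g z) d -> cder (fun w => f (g w)) z (d*e)%C.
Proof.
  intros Hg Hf eps He.
  destruct (cder_locally_lipschitz g z e Hg) as [r [Hr L]].
  pose proof (Cmod_ge_0 d). pose proof (Cmod_ge_0 e).
  assert (E1 : 0 < eps/(2*(Cmod e+1))) by div_pos.
  destruct (Hf _ E1) as [d1 [Hd1 H1]].
  assert (E2 : 0 < eps/(2*(Cmod d+1))) by div_pos.
  destruct (Hg _ E2) as [d2 [Hd2 H2]].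
  assert (E3 : 0 < d1/(Cmod e+1)) by div_pos.
  exists (Rmin r (Rmin d2 (d1/(Cmod e+1)))). split; [repeat apply Rmin_pos; assumption|].
  intros h Hh.
  pose proof (Rmin_l r (Rmin d2 (d1/(Cmod e+1)))). pose proof (Rmin_r r (Rmin d2 (d1/(Cmod e+1)))).
  pose proof (Rmin_l d2 (d1/(Cmod e+1))). pose proof (Rmin_r d2 (d1/(Cmod e+1))).
  specialize (L h ltac:(lra)). specialize (H2 h ltac:(lra)).
  set (k := (g (z+h)-g z)%C) in *.
  assert (Hk : Cmod k < d1).
  { eapply Rle_lt_trans; [exact L|]. replace d1 with ((Cmod e+1)*(d1/(Cmod e+1))) by (field; lra).
    nra. }
  specialize (H1 k Hk). replace (g z+k)%C with (g (z+h)%C) in H1 by (unfold k; ring).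
  replace (f (g (z+h))-f (g z)-d*e*h)%C with ((f (g (z+h))-f (g z)-d*k)+d*(k-e*h))%C by ring.
  le_via Cmod_triangle. rewrite (Cmod_mult d).
  assert (eps/(2*(Cmod e+1))*Cmod k <= eps/2*Cmod h).
  { apply Rle_trans with (eps/(2*(Cmod e+1))*((Cmod e+1)*Cmod h)); [apply Rmult_le_compat_l; lra|].
    right. field. lra. }
  assert (Cmod d*Cmod (k-e*h)%C <= eps/2*Cmod h).
  { apply Rle_trans with ((Cmod d+1)*(eps/(2*(Cmod d+1))*Cmod h)).
    apply Rmult_le_compat; try apply Cmod_ge_0; lra. right. field. lra. }
  lra.
Qed.

Lemma cder_inv_at (z : C) : z <> 0%C -> cder Cinv z (- / (z*z))%C.
Proof.
  intros Hz eps He. assert (Hm : 0 < Cmod z) by (apply Cmod_gt_0; exact Hz).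
  set (m := Cmod z) in *.
  assert (E : 0 < eps*(m*m*m)/2) by (apply Rdiv_lt_0_compat; [|lra]; repeat apply Rmult_lt_0_compat; lra).
  exists (Rmin (m/2) (eps*(m*m*m)/2)). split; [apply Rmin_pos; lra|].
  intros h Hh. pose proof (Rmin_l (m/2) (eps*(m*m*m)/2)). pose proof (Rmin_r (m/2) (eps*(m*m*m)/2)).
  assert (Hzh : m/2 <= Cmod (z+h)%C).
  { pose proof (Cmod_rev_triangle (z+h)%C z) as Ht. replace (z+h-z)%C with h in Ht by ring.
    apply Rabs_le_between in Ht. unfold m in *. lra. }
  assert (Hne : (z+h)%C <> 0%C). { apply Cmod_gt_0. lra. }
  replace (/ (z+h) - / z - - / (z*z)*h)%C with (h*h/(z*z*(z+h)))%C by (field; auto).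
  rewrite Cmod_div by (repeat apply Cmult_neq_0; auto). rewrite !Cmod_mult.
  pose proof (Cmod_ge_0 h).
  apply Rle_trans with (Cmod h*Cmod h/(m*m*(m/2))).
  { apply Rmult_le_compat_l; [nra|]. apply Rinv_le_contravar; [nra|]. apply Rmult_le_compat_l; nra. }
  replace (Cmod h*Cmod h/(m*m*(m/2))) with (Cmod h*(2/(m*m*m))*Cmod h) by (field; lra).
  apply Rmult_le_compat_r; [lra|].
  apply Rle_trans with (eps*(m*m*m)/2*(2/(m*m*m))).
  apply Rmult_le_compat_r; [left; apply Rdiv_lt_0_compat; [lra|]; repeat apply Rmult_lt_0_compat; lra|lra].
  right. field. lra.
Qed.

Lemma cder_inv (f : C -> C) (z d : C) : f z <> 0%C -> cder f z d -> cder (fun w => / f w)%C z (- d/(f z*f z))%C.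
Proof.
  intros Hz Hf. pose proof (cder_comp Cinv f z _ d Hf (cder_inv_at (f z) Hz)) as H.
  replace (- d/(f z*f z))%C with (- / (f z*f z)*d)%C by (field; auto). exact H.
Qed.

Lemma cder_div (f g : C -> C) (z d e : C) : g z <> 0%C -> cder f z d -> cder g z e ->
  cder (fun w => f w/g w)%C z (d/g z - f z*e/(g z*g z))%C.
Proof.
  intros Hz Hf Hg. pose proof (cder_mult f (fun w => / g w)%C z d _ Hf (cder_inv g z e Hz Hg)) as H.
  replace (d/g z-f z*e/(g z*g z))%C with (d * / g z+f z*(- e/(g z*g z)))%C by (field; auto). exact H.
Qed.

(** Series are differentiated through this criterion, because a termwise Taylor estimate produces an
    error [K |h|^2] directly. *)
Lemma cder_quadratic (f : C -> C) (z d : C) (K r : R) : 0 < r ->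
  (forall h, Cmod h < r -> Cmod (f (z + h) - f z - d*h)%C <= K*Cmod h*Cmod h) -> cder f z d.
Proof.
  intros Hr H eps He. pose proof (Rabs_pos K).
  exists (Rmin r (eps/(Rabs K+1))). split; [apply Rmin_pos; [lra|div_pos]|].
  intros h Hh. pose proof (Rmin_l r (eps/(Rabs K+1))). pose proof (Rmin_r r (eps/(Rabs K+1))).
  eapply Rle_trans; [apply H; lra|]. apply Rmult_le_compat_r; [apply Cmod_ge_0|].
  pose proof (Cmod_ge_0 h). pose proof (Rle_abs K).
  apply Rle_trans with ((Rabs K+1)*(eps/(Rabs K+1))); [|right; field; lra].
  nra.
Qed.

Lemma cder_cexp (z : C) : cder cexp z (cexp z).
Proof.
  apply cder_quadratic with (K := exp (Re z)*exp 1) (r := 1); [lra|]. intros h Hh.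
  rewrite cexp_plus. replace (cexp z*cexp h-cexp z-cexp z*h)%C with (cexp z*(cexp h-1-h))%C by ring.
  rewrite Cmod_mult, Cmod_cexp. pose proof (cexp_taylor_bound h). pose proof (exp_pos (Re z)).
  rewrite !Rmult_assoc. apply Rmult_le_compat_l; [lra|]. eapply Rle_trans; [eassumption|].
  pose proof (Cmod_ge_0 h). pose proof (exp_increasing (Cmod h) 1 Hh).
  nra.
Qed.

Lemma rder_eps (f : R -> C) (t : R) (d : C) :
  (forall eps, 0 < eps -> exists del, 0 < del /\ forall h : R, Rabs h < del ->
     Cmod (f (t + h)%R - f t - d*h)%C <= eps*Rabs h) -> rder f t d.
Proof. split; apply is_derive_Reals; intros eps He; destruct (H (eps/2)) as [del [Hd H1]]; try lra;
    exists (mkposreal del Hd); intros h Hh0 Hh; specialize (H1 h Hh).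
  - pose proof (re_le_Cmod (f (t+h)%R-f t-d*h)%C) as H2.
    replace (Re (f (t+h)%R-f t-d*h)%C) with (Re (f (t+h))-Re (f t)-Re d*h) in H2 by Re_ring.
    replace ((Re (f (t+h))-Re (f t))/h-Re d) with ((Re (f (t+h))-Re (f t)-Re d*h)/h) by (field; auto).
    unfold Rdiv. rewrite Rabs_mult, Rabs_inv. pose proof (Rabs_pos_lt h Hh0).
    apply Rmult_lt_reg_r with (Rabs h); [lra|]. rewrite Rmult_assoc, Rinv_l by lra. nra.
  - pose proof (Im_abs_le_Cmod (f (t+h)%R-f t-d*h)%C) as H2.
    replace (Im (f (t+h)%R-f t-d*h)%C) with (Im (f (t+h))-Im (f t)-Im d*h) in H2 by Re_ring.
    replace ((Im (f (t+h))-Im (f t))/h-Im d) with ((Im (f (t+h))-Im (f t)-Im d*h)/h) by (field; auto).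
    unfold Rdiv. rewrite Rabs_mult, Rabs_inv. pose proof (Rabs_pos_lt h Hh0).
    apply Rmult_lt_reg_r with (Rabs h); [lra|]. rewrite Rmult_assoc, Rinv_l by lra. nra.
Qed.

Lemma cder_line (f : C -> C) (z0 w d : C) (t : R) : cder f (z0 + t*w)%C d ->
  rder (fun x : R => f (z0 + x*w)%C) t (d*w)%C.
Proof.
  intros Hf. apply rder_eps. intros eps He. pose proof (Cmod_ge_0 w).
  destruct (Hf (eps/(Cmod w+1))) as [del [Hd H1]]; [div_pos|].
  exists (del/(Cmod w+1)). split; [div_pos|]. intros h Hh.
  assert (E : Cmod (h*w)%C = Rabs h*Cmod w) by apply Cmod_scal.
  pose proof (Rabs_pos h).
  assert (E2 : Cmod (h*w)%C < del).
  { apply Rle_lt_trans with (Rabs h*(Cmod w+1)); [nra|].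
    replace del with (del/(Cmod w+1)*(Cmod w+1)) by (field; lra). nra. }
  specialize (H1 _ E2). rewrite RtoC_plus.
  replace (z0+(t+h)*w)%C with (z0+t*w+h*w)%C by ring.
  replace (d*w*h)%C with (d*(h*w))%C by ring. eapply Rle_trans; [exact H1|]. replace (eps*Rabs h) with (eps/(Cmod w+1)*(Rabs h*(Cmod w+1))) by (field; lra).
  apply Rmult_le_compat_l; [left; div_pos|]. nra.
Qed.

Lemma rder_horizontal (f : C -> C) (x y : R) (d : C) : cder f (x, y) d -> rder (fun x => f (x, y)) x d.
Proof.
  intros H. pose proof (cder_line f (0, y) 1 d x) as H1.
  replace ((0, y)+x*1)%C with ((x, y) : C) in H1 by (apply C_ext; simpl; ring).
  specialize (H1 H). rewrite Cmult_1_r in H1.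
  replace (fun x : R => f (x, y)) with (fun x : R => f ((0, y)+x*1)%C); [exact H1|].
  apply functional_extensionality. intros u. f_equal. apply C_ext; simpl; ring.
Qed.

Lemma rder_vertical (f : C -> C) (x y : R) (d : C) : cder f (x, y) d -> rder (fun y => f (x, y)) y (d*Ci)%C.
Proof.
  intros H. pose proof (cder_line f (x, 0) Ci d y) as H1.
  replace ((x, 0)+y*Ci)%C with ((x, y) : C) in H1 by (apply C_ext; simpl; ring).
  specialize (H1 H).
  replace (fun y : R => f (x, y)) with (fun y : R => f ((x, 0)+y*Ci)%C); [exact H1|].
  apply functional_extensionality. intros u. f_equal. apply C_ext; simpl; ring.
Qed.

(** * Semicontinuous maxima, the Laplacian and the maximum principle *)

Definition rcont (V : C -> R) (z : C) : Prop :=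
  forall eps, 0 < eps -> exists del, 0 < del /\ forall h : C, Cmod h < del -> Rabs (V (z + h)%C - V z) < eps.

Lemma rcont_comp (phi : R -> R) (V : C -> R) (z : C) : continuity_pt phi (V z) -> rcont V z -> rcont (fun w => phi (V w)) z.
Proof.
  intros Hp HV eps He. destruct (Hp eps He) as [a [Ha H]]. destruct (HV a Ha) as [d [Hd H2]].
  exists d. split; [assumption|]. intros h Hh. specialize (H2 h Hh).
  destruct (Req_dec (V z) (V (z+h)%C)) as [E|E]; [rewrite <- E, Rminus_diag, Rabs_R0; assumption|].
  apply H. split; [split; [exact I|exact E]|exact H2].
Qed.

Lemma rcont_plus (U V : C -> R) (z : C) : rcont U z -> rcont V z -> rcont (fun w => U w + V w) z.
Proof.
  intros HU HV eps He. destruct (HU (eps/2)) as [d1 [H1 H2]]; [lra|]. destruct (HV (eps/2)) as [d2 [H3 H4]]; [lra|].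
  exists (Rmin d1 d2). split; [apply Rmin_pos; assumption|]. intros h Hh.
  specialize (H2 h (Rlt_le_trans _ _ _ Hh (Rmin_l _ _))). specialize (H4 h (Rlt_le_trans _ _ _ Hh (Rmin_r _ _))).
  replace (U (z+h)%C+V (z+h)%C-(U z+V z)) with ((U (z+h)%C-U z)+(V (z+h)%C-V z)) by ring.
  le_lt_via Rabs_triang. lra.
Qed.

Lemma rcont_scal (c : R) (V : C -> R) (z : C) : rcont V z -> rcont (fun w => c*V w) z.
Proof.
  intros H. apply (rcont_comp (fun x => c*x)); [|exact H].
  apply (continuity_pt_scal id); apply derivable_continuous_pt, derivable_pt_id.
Qed.

Lemma rcont_const (c : R) (z : C) : rcont (fun _ => c) z.
Proof. intros eps He. exists 1. split; [lra|]. intros. rewrite Rminus_diag, Rabs_R0. exact He. Qed.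

Lemma rcont_Re (z : C) : rcont Re z.
Proof.
  intros eps He. exists eps. split; [lra|]. intros h Hh. eapply Rle_lt_trans; [|exact Hh].
  eapply Rle_trans; [|apply re_le_Cmod]. right. f_equal. unfold Re; simpl. ring.
Qed.

Lemma rcont_Im (z : C) : rcont Im z.
Proof.
  intros eps He. exists eps. split; [lra|]. intros h Hh. eapply Rle_lt_trans; [|exact Hh].
  eapply Rle_trans; [|apply Im_abs_le_Cmod]. right. f_equal. unfold Im; simpl. ring.
Qed.

Lemma cder_continuous (f : C -> C) (z d : C) : cder f z d ->
  forall eps, 0 < eps -> exists del, 0 < del /\ forall h, Cmod h < del -> Cmod (f (z + h) - f z)%C < eps.
Proof.
  intros Hf eps He. destruct (cder_locally_lipschitz f z d Hf) as [r [Hr H]]. pose proof (Cmod_ge_0 d).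
  exists (Rmin r (eps/(Cmod d+1))). split; [apply Rmin_pos; [lra|div_pos]|].
  intros h Hh. pose proof (Rmin_l r (eps/(Cmod d+1))). pose proof (Rmin_r r (eps/(Cmod d+1))).
  eapply Rle_lt_trans; [apply H; lra|].
  replace eps with ((Cmod d+1)*(eps/(Cmod d+1))) at 1 by (field; lra). nra.
Qed.

Lemma cder_rcont_mod (f : C -> C) (z d : C) : cder f z d -> rcont (fun w => Cmod (f w)) z.
Proof.
  intros Hf eps He. destruct (cder_continuous f z d Hf eps He) as [r [Hr H]]. exists r. split; [assumption|].
  intros h Hh. le_lt_via Cmod_rev_triangle. auto.
Qed.

Lemma cder_rcont_ln_mod (f : C -> C) (z d : C) : cder f z d -> f z <> 0%C -> rcont (fun w => ln (Cmod (f w))) z.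
Proof.
  intros Hf Hz. apply (rcont_comp ln (fun w => Cmod (f w))); [|apply cder_rcont_mod with d; exact Hf].
  apply derivable_continuous_pt. exists (/ Cmod (f z)). apply derivable_pt_lim_ln. apply Cmod_gt_0. exact Hz.
Qed.

Lemma cder_neq_0_loc (f : C -> C) (z d : C) : cder f z d -> f z <> 0%C ->
  exists r, 0 < r /\ forall h, Cmod h < r -> f (z + h)%C <> 0%C.
Proof.
  intros Hf Hz. destruct (cder_rcont_mod f z d Hf (Cmod (f z))) as [r [Hr H]]; [apply Cmod_gt_0; exact Hz|].
  exists r. split; [assumption|]. intros h Hh E. specialize (H h Hh). rewrite E, Cmod_0 in H.
  rewrite Rabs_left1 in H by (pose proof (Cmod_ge_0 (f z)); lra). lra.
Qed.

Definition in_rect (x1 x2 y1 y2 : R) (z : C) : Prop := x1 <= Re z <= x2 /\ y1 <= Im z <= y2.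

(** Bisection in the form of a supremum: [x0] is the supremum of the left ends [x] for which [Q x b]
    holds. This stands in for the compactness of the interval. *)
Lemma interval_split_accumulation (Q : R -> R -> Prop) (a b : R) : a <= b ->
  (forall x m y, x <= m -> m <= y -> Q x y -> Q x m \/ Q m y) -> Q a b ->
  exists x0, a <= x0 <= b /\ forall del, 0 < del -> exists x y, x0 - del < x /\ x <= y /\ y < x0 + del /\ a <= x /\ y <= b /\ Q x y.
Proof.
  intros Hab Hsplit HQ. destruct (completeness (fun x => a <= x <= b /\ Q x b)) as [x0 [Hub Hlub]].
  { exists b. intros x [Hx _]. lra. }
  { exists a. split; [lra|exact HQ]. }
  assert (H0 : a <= x0 <= b). { split; [apply Hub; split; [lra|exact HQ]|]. apply Hlub. intros x [Hx _]; lra. }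
  exists x0. split; [exact H0|]. intros del Hd.
  assert (Hx : exists x, a <= x <= b /\ Q x b /\ x0-del < x /\ x <= x0).
  { apply NNPP. intros Hn. assert (x0 <= x0-del); [|lra]. apply Hlub. intros x [Hx HQx].
    destruct (Rle_or_lt x (x0-del)); [assumption|]. exfalso. apply Hn. exists x. repeat split; try lra; auto. 
}
  destruct Hx as [x [Hx1 [HQx [Hx2 Hx3]]]].
  destruct (Rlt_or_le b (x0+del)) as [Hb|Hb].
  { exists x, b. repeat split; try lra; auto. }
  exists x, (x0+del/2). repeat split; try lra.
  destruct (Hsplit x (x0+del/2) b) as [H|H]; try lra; auto. assert (x0+del/2 <= x0); [|lra]. apply Hub. split; [lra|exact H].
Qed.

(** The maximum is located one coordinate at a time. An interval of real parts is kept if every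
    value of [W] on the rectangle is matched or exceeded over it; such intervals accumulate at some
    [a]. Then intervals of imaginary parts, over real parts close to [a], accumulate at some [b],
    and upper semicontinuity at [(a, b)] concludes. *)
Lemma usc_attains_max (W : C -> R) (x1 x2 y1 y2 : R) : x1 <= x2 -> y1 <= y2 ->
  (forall z, in_rect x1 x2 y1 y2 z -> forall eps, 0 < eps -> exists del, 0 < del /\
     forall w, in_rect x1 x2 y1 y2 w -> Cmod (w - z)%C < del -> W w < W z + eps) ->
  exists z0, in_rect x1 x2 y1 y2 z0 /\ forall z, in_rect x1 x2 y1 y2 z -> W z <= W z0.
Proof.
  intros Hx Hy Husc. set (K := in_rect x1 x2 y1 y2).
  destruct (interval_split_accumulation (fun a b => forall z, K z -> exists w, K w /\ a <= Re w <= b /\ W z <= W w) x1 x2 Hx)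
    as [a [Ha HA]].
  { intros x m y Hxm Hmy HQ. apply NNPP. intros Hn. apply not_or_and in Hn. destruct Hn as [N1 N2].
    apply not_all_ex_not in N1. destruct N1 as [z1 N1]. apply not_all_ex_not in N2. destruct N2 as [z2 N2].
    apply imply_to_and in N1. apply imply_to_and in N2. destruct N1 as [K1 N1], N2 as [K2 N2].
    (* If both halves failed, with witnesses [z1] and [z2], the larger of the two values could not
       be matched on the whole interval either. *)
    assert (Hm : exists z, K z /\ W z1 <= W z /\ W z2 <= W z).
    { destruct (Rle_or_lt (W z1) (W z2)); [exists z2|exists z1]; repeat split; auto; try apply K1; try apply K2; lra. }
    destruct Hm as [z [Kz [L1 L2]]]. destruct (HQ z Kz) as [w [Kw [Hw HW]]].
    destruct (Rle_or_lt (Re w) m); [apply N1|apply N2]; exists w; repeat split; auto; try apply Kw; lra. }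
  { intros z Kz. exists z. repeat split; try apply Kz; lra. }
  destruct (interval_split_accumulation
     (fun c d => forall z, K z -> forall del, 0 < del -> exists w, K w /\ Rabs (Re w-a) < del /\ c <= Im w <= d /\ W z <= W w) y1 y2 Hy)
    as [b [Hb HB]].
  { intros x m y Hxm Hmy HQ. apply NNPP. intros Hn. apply not_or_and in Hn. destruct Hn as [N1 N2].
    apply not_all_ex_not in N1. destruct N1 as [z1 N1]. apply not_all_ex_not in N2. destruct N2 as [z2 N2].
    apply imply_to_and in N1. apply imply_to_and in N2. destruct N1 as [K1 N1], N2 as [K2 N2].
    apply not_all_ex_not in N1. destruct N1 as [d1 N1]. apply not_all_ex_not in N2. destruct N2 as [d2 N2].
    apply imply_to_and in N1. apply imply_to_and in N2. destruct N1 as [P1 N1], N2 as [P2 N2].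
    assert (Hm : exists z, K z /\ W z1 <= W z /\ W z2 <= W z).
    { destruct (Rle_or_lt (W z1) (W z2)); [exists z2|exists z1]; repeat split; auto; try apply K1; try apply K2; lra. }
    destruct Hm as [z [Kz [L1 L2]]]. destruct (HQ z Kz (Rmin d1 d2) (Rmin_pos _ _ P1 P2)) as [w [Kw [Hw [Hw2 HW]]]].
    pose proof (Rmin_l d1 d2). pose proof (Rmin_r d1 d2).
    destruct (Rle_or_lt (Im w) m); [apply N1|apply N2]; exists w; repeat split; auto; try apply Kw; lra. }
  { intros z Kz del Hd. destruct (HA del Hd) as [x [y [Hx1 [Hx2 [Hx3 [Hx4 [Hx5 HQ]]]]]]].
    destruct (HQ z Kz) as [w [Kw [Hw HW]]]. exists w. repeat split; try apply Kw; try assumption. apply Rabs_def1; lra. }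
  assert (Kab : K (a, b)) by (split; Re_lra).
  exists (a, b). split; [exact Kab|]. intros z Kz.
  apply Rnot_lt_le. intros Hlt. destruct (Husc _ Kab (W z-W (a, b)) ltac:(lra)) as [del [Hd Hd2]].
  destruct (HB (del/2) ltac:(lra)) as [x [y [Hx1 [Hx2 [Hx3 [Hx4 [Hx5 HQ]]]]]]].
  destruct (HQ z Kz (del/2) ltac:(lra)) as [w [Kw [Hw1 [Hw2 HW]]]].
  specialize (Hd2 w Kw). assert (W w < W (a, b)+(W z-W (a, b))); [|lra]. apply Hd2.
  le_lt_via Cmod_le_abs. unfold Re, Im in *; simpl.
  assert (Rabs (snd w + - b) < del/2) by (apply Rabs_def1; lra). unfold Rminus in Hw1. lra.
Qed.

(** The sum of the two second partial derivatives at one point. First partial derivatives are asked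
    for only on the two segments through the point: the second derivative test uses no more, and
    [ln |f|] provides them near a point with [f <> 0]. *)
Definition lapl (V : C -> R) (x y lam : R) : Prop :=
  exists (p r : R -> R) (al be : R),
    (exists del, 0 < del /\ forall u, Rabs (u - x) < del -> is_derive (fun u => V (u, y)) u (p u)) /\ is_derive p x al /\
    (exists del, 0 < del /\ forall v, Rabs (v - y) < del -> is_derive (fun v => V (x, v)) v (r v)) /\ is_derive r y be /\
    lam = al + be.

(** The first derivative vanishes at the maximum, so a positive second derivative would make it
    positive just to the right, where [g] would then exceed its maximum. *)
Lemma second_derivative_at_max (g p : R -> R) (x del al : R) : 0 < del ->
  (forall u, Rabs (u - x) < del -> is_derive g u (p u)) -> is_derive p x al ->
  (forall u, Rabs (u - x) < del -> g u <= g x) -> al <= 0.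
Proof.
  intros Hd Hg Hp Hmax. apply Rnot_lt_le. intros Hal.
  assert (Hpx : p x = 0).
  { assert (pr : derivable_pt g x). { exists (p x). apply is_derive_Reals, Hg. rewrite Rminus_diag, Rabs_R0. exact Hd. }
    assert (E : derive_pt g x pr = p x). { apply derive_pt_eq_0. apply is_derive_Reals, Hg. rewrite Rminus_diag, Rabs_R0. exact Hd. }
    rewrite <- E. apply (deriv_maximum g (x-del) (x+del)); try lra.
    intros u H1 H2. apply Hmax. apply Rabs_def1; lra. }
  apply is_derive_Reals in Hp. destruct (Hp (al/2) ltac:(lra)) as [d H].
  pose proof (cond_pos d) as Hdp.
  set (h := Rmin d del/2).
  assert (Hh : 0 < h /\ h < d /\ h < del).
  { pose proof (Rmin_l d del). pose proof (Rmin_r d del). pose proof (Rmin_pos d del Hdp Hd). unfold h. lra. }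
  destruct (MVT_gen g x (x+h) p) as [c [Hc E]].
  { intros u Hu. rewrite Rmin_left, Rmax_right in Hu by lra. apply Hg. apply Rabs_def1; lra. }
  { intros u Hu. rewrite Rmin_left, Rmax_right in Hu by lra. apply derivable_continuous_pt. exists (p u).
    apply is_derive_Reals, Hg. apply Rabs_def1; lra. }
  rewrite Rmin_left, Rmax_right in Hc by lra.
  assert (M : g (x+h) <= g x). { apply Hmax. apply Rabs_def1; lra. }
  destruct (Req_dec c x) as [Ec|Ec].
  - (* then [g (x + h) = g x], so apply the mean value theorem strictly inside *)
    subst c.
    destruct (MVT_cor2 g p x (x+h)) as [c [E2 Hc2]]; [lra| |].
    { intros u Hu. apply is_derive_Reals, Hg. apply Rabs_def1; lra. }
    assert (0 < p c).
    { specialize (H (c-x) ltac:(lra)). rewrite Rabs_right in H by lra. specialize (H ltac:(lra)).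
      replace (x+(c-x)) with c in H by ring. rewrite Hpx in H. apply Rabs_def2 in H.
      apply Rmult_lt_reg_r with (/ (c-x)); [inv_pos|]. lra. }
    nra.
  - assert (0 < p c).
    { specialize (H (c-x) ltac:(lra)). rewrite Rabs_right in H by lra. specialize (H ltac:(lra)).
      replace (x+(c-x)) with c in H by ring. rewrite Hpx in H. apply Rabs_def2 in H.
      apply Rmult_lt_reg_r with (/ (c-x)); [inv_pos|]. lra. }
    nra.
Qed.

Lemma Cmod_horizontal (a b y : R) : Cmod ((a, y) - (b, y))%C = Rabs (a - b).
Proof.
  replace ((a, y)-(b, y))%C with (RtoC (a-b)) by C_ring. apply Cmod_R.
Qed.

Lemma Cmod_vertical (a b x : R) : Cmod ((x, a) - (x, b))%C = Rabs (a - b).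
Proof.
  replace ((x, a)-(x, b))%C with ((RtoC (a-b))*Ci)%C by C_ring.
  rewrite Cmod_mult, Cmod_R, Cmod_Ci. ring.
Qed.

Lemma lapl_at_local_max (V : C -> R) (x y lam del : R) : 0 < del -> lapl V x y lam ->
  (forall w, Cmod (w - (x, y))%C < del -> V w <= V (x, y)) -> lam <= 0.
Proof.
  intros Hd [p [r [al [be [[d1 [H1 Hp]] [Hal [[d2 [H2 Hr]] [Hbe ->]]]]]]]] Hmax.
  pose proof (Rmin_l d1 del). pose proof (Rmin_r d1 del). pose proof (Rmin_l d2 del). pose proof (Rmin_r d2 del).
  assert (al <= 0).
  { apply (second_derivative_at_max (fun u => V (u, y)) p x (Rmin d1 del)); auto using Rmin_pos.
    - intros u Hu. apply Hp. lra.
    - intros u Hu. apply Hmax. rewrite Cmod_horizontal. lra. }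
  assert (be <= 0).
  { apply (second_derivative_at_max (fun v => V (x, v)) r y (Rmin d2 del)); auto using Rmin_pos.
    - intros u Hu. apply Hr. lra.
    - intros u Hu. apply Hmax. rewrite Cmod_vertical. lra. }
  lra.
Qed.

(* [V] is thought of as [-oo] at the points of [Bad]. *)
Lemma max_principle (V : C -> R) (Bad : C -> Prop) (x1 x2 y1 y2 : R) : x1 <= x2 -> y1 <= y2 ->
  (forall z, in_rect x1 x2 y1 y2 z -> ~ Bad z -> forall eps, 0 < eps -> exists del, 0 < del /\
     forall w, in_rect x1 x2 y1 y2 w -> Cmod (w - z)%C < del -> ~ Bad w -> V w < V z + eps) ->
  (forall z, in_rect x1 x2 y1 y2 z -> Bad z -> forall M, exists del, 0 < del /\
     forall w, in_rect x1 x2 y1 y2 w -> Cmod (w - z)%C < del -> ~ Bad w -> V w < M) ->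
  (forall x y, in_rect x1 x2 y1 y2 (x, y) -> ~ Bad (x, y) -> x = x1 \/ x = x2 \/ y = y1 \/ y = y2 -> V (x, y) <= 0) ->
  (forall x y, x1 < x < x2 -> y1 < y < y2 -> ~ Bad (x, y) ->
     (exists lam, 0 < lam /\ lapl V x y lam) /\ (exists r, 0 < r /\ forall w, Cmod (w - (x, y))%C < r -> ~ Bad w)) ->
  forall z, in_rect x1 x2 y1 y2 z -> ~ Bad z -> V z <= 0.
Proof.
  intros Hx Hy Hgood Hbad Hbd Hin z Kz Gz.
  (* Exponentiating turns the value [-oo] into 0. The function [W] is upper semicontinuous, so it
     attains its maximum, and this maximum is positive, hence not at a bad point. *)
  set (W := fun w => if excluded_middle_informative (Bad w) then 0 else exp (V w)).
  assert (WG : forall w, ~ Bad w -> W w = exp (V w)).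
  { intros w Gw. unfold W. destruct (excluded_middle_informative (Bad w)); tauto. }
  assert (WB : forall w, Bad w -> W w = 0).
  { intros w Gw. unfold W. destruct (excluded_middle_informative (Bad w)); tauto. }
  destruct (usc_attains_max W x1 x2 y1 y2 Hx Hy) as [z0 [K0 Hmax]].
  { intros a Ka eps He. destruct (classic (Bad a)) as [Ba|Ga].
    - destruct (Hbad a Ka Ba (ln eps)) as [del [Hd H]]. exists del. split; [assumption|]. intros w Kw Hw.
      rewrite (WB a Ba). destruct (classic (Bad w)) as [Bw|Gw]; [rewrite (WB w Bw); lra|]. rewrite (WG w Gw).
      specialize (H w Kw Hw Gw). apply exp_increasing in H. rewrite exp_ln in H by assumption. lra.
    - set (M := ln (1+eps/exp (V a))). pose proof (exp_pos (V a)).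
      assert (0 < eps/exp (V a)) by (apply Rdiv_lt_0_compat; assumption).
      assert (HM : 0 < M). { rewrite <- ln_1. apply ln_increasing; lra. }
      destruct (Hgood a Ka Ga M HM) as [del [Hd H1]]. exists del. split; [assumption|]. intros w Kw Hw.
      rewrite (WG a Ga). destruct (classic (Bad w)) as [Bw|Gw]; [rewrite (WB w Bw); lra|]. rewrite (WG w Gw).
      specialize (H1 w Kw Hw Gw). apply exp_increasing in H1. eapply Rlt_le_trans; [exact H1|].
      rewrite exp_plus. unfold M. rewrite exp_ln by lra. right. field. lra. }
  assert (G0 : ~ Bad z0).
  { intros B0. specialize (Hmax z Kz). rewrite (WB _ B0), (WG _ Gz) in Hmax. pose proof (exp_pos (V z)). lra. }
  assert (Hle : forall w, in_rect x1 x2 y1 y2 w -> ~ Bad w -> V w <= V z0).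
  { intros w Kw Gw. specialize (Hmax w Kw). rewrite (WG _ G0), (WG _ Gw) in Hmax.
    apply Rnot_lt_le. intros Hlt. apply exp_increasing in Hlt. lra. }
  apply Rle_trans with (V z0); [apply Hle; assumption|].
  destruct z0 as [x y]. destruct K0 as [Kx Ky]. unfold Re, Im in Kx, Ky; simpl in Kx, Ky.
  destruct (classic (x = x1 \/ x = x2 \/ y = y1 \/ y = y2)) as [Hb|Hnb].
  { apply Hbd; auto. split; Re_lra. }
  apply not_or_and in Hnb. destruct Hnb as [N1 Hnb]. apply not_or_and in Hnb. destruct Hnb as [N2 Hnb].
  destruct (Hin x y ltac:(lra) ltac:(lra) G0) as [[lam [Hl HL]] [r [Hr HG]]]. set (m := Rmin (Rmin (x-x1) (x2-x)) (Rmin (y-y1) (y2-y))).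
  assert (Hm : m <= x-x1 /\ m <= x2-x /\ m <= y-y1 /\ m <= y2-y).
  { unfold m. pose proof (Rmin_l (Rmin (x-x1) (x2-x)) (Rmin (y-y1) (y2-y))).
    pose proof (Rmin_r (Rmin (x-x1) (x2-x)) (Rmin (y-y1) (y2-y))).
    pose proof (Rmin_l (x-x1) (x2-x)). pose proof (Rmin_r (x-x1) (x2-x)).
    pose proof (Rmin_l (y-y1) (y2-y)). pose proof (Rmin_r (y-y1) (y2-y)). lra. }
  assert (Hm0 : 0 < m) by (unfold m; repeat apply Rmin_pos; lra).
  assert (lam <= 0); [|lra].
  apply (lapl_at_local_max V x y lam (Rmin m r)); auto using Rmin_pos.
  intros w Hw. pose proof (Rmin_l m r). pose proof (Rmin_r m r).
  pose proof (re_le_Cmod (w-(x, y))%C) as A1. pose proof (Im_abs_le_Cmod (w-(x, y))%C) as A2.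
  unfold Re, Im in A1, A2; simpl in A1, A2. apply Rabs_le_between in A1. apply Rabs_le_between in A2.
  apply Hle; [split; unfold Re, Im; lra|]. apply HG. lra.
Qed.

Lemma lapl_plus (U V : C -> R) (x y l m : R) : lapl U x y l -> lapl V x y m -> lapl (fun w => U w + V w) x y (l + m).
Proof.
  intros [p [r [al [be [[d1 [H1 Hp]] [Hal [[d2 [H2 Hr]] [Hbe ->]]]]]]]]
         [p' [r' [al' [be' [[d1' [H1' Hp']] [Hal' [[d2' [H2' Hr']] [Hbe' ->]]]]]]]].
  exists (fun u => p u+p' u), (fun v => r v+r' v), (al+al'), (be+be'). split; [|split; [|split; [|split]]].
  - exists (Rmin d1 d1'). split; [apply Rmin_pos; assumption|]. intros u Hu.
    pose proof (Rmin_l d1 d1'). pose proof (Rmin_r d1 d1').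
    apply (is_derive_plus (fun u => U (u, y)) (fun u => V (u, y))); [apply Hp|apply Hp']; lra.
  - apply (is_derive_plus p p'); assumption.
  - exists (Rmin d2 d2'). split; [apply Rmin_pos; assumption|]. intros u Hu.
    pose proof (Rmin_l d2 d2'). pose proof (Rmin_r d2 d2').
    apply (is_derive_plus (fun u => U (x, u)) (fun u => V (x, u))); [apply Hr|apply Hr']; lra.
  - apply (is_derive_plus r r'); assumption.
  - ring.
Qed.

Lemma lapl_scal (c : R) (V : C -> R) (x y l : R) : lapl V x y l -> lapl (fun w => c*V w) x y (c*l).
Proof.
  intros [p [r [al [be [[d1 [H1 Hp]] [Hal [[d2 [H2 Hr]] [Hbe ->]]]]]]]].
  exists (fun u => c*p u), (fun v => c*r v), (c*al), (c*be). split; [|split; [|split; [|split]]].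
  - exists d1. split; [assumption|]. intros u Hu. apply (is_derive_scal (fun u => V (u, y))). auto.
  - apply is_derive_scal; assumption.
  - exists d2. split; [assumption|]. intros u Hu. apply (is_derive_scal (fun u => V (x, u))). auto.
  - apply is_derive_scal; assumption.
  - ring.
Qed.

Lemma lapl_ext_loc (U V : C -> R) (x y l r : R) : 0 < r -> (forall w, Cmod (w - (x, y))%C < r -> U w = V w) ->
  lapl U x y l -> lapl V x y l.
Proof.
  intros Hr0 He [p [r' [al [be [[d1 [H1 Hp]] [Hal [[d2 [H2 Hr]] [Hbe ->]]]]]]]].
  exists p, r', al, be. split; [|split; [|split; [|split]]]; auto.
  - exists (Rmin d1 r). split; [apply Rmin_pos; assumption|]. intros u Hu.
    pose proof (Rmin_l d1 r). pose proof (Rmin_r d1 r).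
    apply (is_derive_ext_loc (fun u => U (u, y))); [|apply Hp; lra].
    exists (mkposreal (r-Rabs (u-x)) ltac:(lra)). intros v Hv. apply He. rewrite Cmod_horizontal.
    unfold ball in Hv; simpl in Hv. unfold AbsRing_ball, abs, minus, plus, opp in Hv; simpl in Hv.
    replace (v-x) with ((v + - u)+(u-x)) by ring. le_lt_via Rabs_triang. lra.
  - exists (Rmin d2 r). split; [apply Rmin_pos; assumption|]. intros u Hu.
    pose proof (Rmin_l d2 r). pose proof (Rmin_r d2 r).
    apply (is_derive_ext_loc (fun u => U (x, u))); [|apply Hr; lra].
    exists (mkposreal (r-Rabs (u-y)) ltac:(lra)). intros v Hv. apply He. rewrite Cmod_vertical.
    unfold ball in Hv; simpl in Hv. unfold AbsRing_ball, abs, minus, plus, opp in Hv; simpl in Hv.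
    replace (v-y) with ((v + - u)+(u-y)) by ring. le_lt_via Rabs_triang. lra.
Qed.

Lemma rder_ln_mod (g : R -> C) (t : R) (d : C) : g t <> 0%C -> rder g t d ->
  is_derive (fun x => ln (Cmod (g x))) t (Re (d/g t)%C).
Proof.
  intros Hz [H1 H2]. set (a := fun x => Re (g x)) in *. set (b := fun x => Im (g x)) in *.
  change (is_derive a t (Re d)) in H1. change (is_derive b t (Im d)) in H2.
  assert (Hpos : 0 < a t*a t+b t*b t).
  { unfold a. rewrite <- Cmod_sqr. apply Cmod_gt_0 in Hz. nra. }
  apply (is_derive_ext (fun x => ln (sqrt (a x*a x+b x*b x)))).
  { intros x. f_equal. unfold Cmod, a, b, Re, Im. f_equal. ring. }
  pose proof (sqrt_lt_R0 _ Hpos) as Hs.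
  auto_derive.
  - repeat split; auto; eexists; eassumption.
  - change (Derive (fun x => a x) t) with (Derive a t). change (Derive (fun x => b x) t) with (Derive b t).
    rewrite (is_derive_unique _ _ _ H1), (is_derive_unique _ _ _ H2).
    transitivity ((a t*Re d+b t*Im d)/(a t*a t+b t*b t)).
    + replace (/ sqrt (a t*a t+b t*b t)) with (sqrt (a t*a t+b t*b t)/(a t*a t+b t*b t)).
      2:{ rewrite <- (sqrt_sqrt (a t*a t+b t*b t)) at 2 by lra. field. lra. }
      field. lra.
    + unfold a, b, Re, Im in *. simpl. field. nra.
Qed.

(** The partial derivatives of [ln |f|] are [Re (f1/f)] and [- Im (f1/f)]; by the Cauchy-Riemann
    equations for [f1/f] their derivatives in [x] and in [y] are opposite. *)
Lemma lapl_ln_mod (f f1 : C -> C) (f2 : C) (x y r : R) : 0 < r ->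
  (forall w, Cmod (w - (x, y))%C < r -> cder f w (f1 w)) -> cder f1 (x, y) f2 -> f (x, y) <> 0%C ->
  lapl (fun w => ln (Cmod (f w))) x y 0.
Proof.
  intros Hr Hf Hf1 Hz.
  assert (E0 : Cmod ((x, y)-(x, y))%C < r). { rewrite Cmod_horizontal, Rminus_diag, Rabs_R0. exact Hr. }
  destruct (cder_neq_0_loc f (x, y) _ (Hf _ E0) Hz) as [r1 [Hr1 Hne]].
  assert (Hne2 : forall w, Cmod (w-(x, y))%C < r1 -> f w <> 0%C).
  { intros w Hw. specialize (Hne _ Hw). replace ((x, y)+(w-(x, y)))%C with w in Hne by ring. exact Hne. }
  pose proof (cder_div f1 f (x, y) f2 _ Hz Hf1 (Hf _ E0)) as Hq. set (e := (f2/f (x, y)-f1 (x, y)*f1 (x, y)/(f (x, y)*f (x, y)))%C) in Hq.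
  destruct (rder_horizontal _ _ _ _ Hq) as [Hh _]. destruct (rder_vertical _ _ _ _ Hq) as [_ Hv].
  exists (fun u => Re (f1 (u, y)/f (u, y))%C), (fun v => - Im (f1 (x, v)/f (x, v))%C), (Re e), (- Im (e*Ci)%C).
  pose proof (Rmin_l r r1). pose proof (Rmin_r r r1).
  split; [|split; [exact Hh|split; [|split]]].
  - exists (Rmin r r1). split; [apply Rmin_pos; assumption|]. intros u Hu.
    assert (Hu2 : Cmod ((u, y)-(x, y))%C < Rmin r r1) by (rewrite Cmod_horizontal; exact Hu).
    apply (rder_ln_mod (fun u => f (u, y))); [apply Hne2; lra|]. apply rder_horizontal. apply Hf. lra.
  - exists (Rmin r r1). split; [apply Rmin_pos; assumption|]. intros u Hu.
    assert (Hu2 : Cmod ((x, u)-(x, y))%C < Rmin r r1) by (rewrite Cmod_vertical; exact Hu).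
    replace (- Im (f1 (x, u)/f (x, u))%C) with (Re (f1 (x, u)*Ci/f (x, u))%C).
    + apply (rder_ln_mod (fun u => f (x, u))); [apply Hne2; lra|]. apply rder_vertical. apply Hf. lra.
    + simpl. ring.
  - apply (is_derive_opp (fun v => Im (f1 (x, v)/f (x, v))%C)). exact Hv.
  - simpl. ring.
Qed.

Lemma lapl_quadratic (a b c x y : R) : lapl (fun w => a*(Re w*Re w) + b*(Im w*Im w) + c) x y (2*a + 2*b).
Proof.
  exists (fun u => 2*a*u), (fun v => 2*b*v), (2*a), (2*b). split; [|split; [|split; [|split]]]; unfold Re, Im; simpl.
  - exists 1. split; [lra|]. intros. der_ring.
  - der_ring.
  - exists 1. split; [lra|]. intros. der_ring.
  - der_ring.
  - ring.
Qed.

Lemma rcont_quadratic (a b c : R) (z : C) : rcont (fun w => a*(Re w*Re w) + b*(Im w*Im w) + c) z.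
Proof.
  apply (rcont_plus (fun w => a*(Re w*Re w)+b*(Im w*Im w)) (fun _ => c)); [|apply rcont_const].
  apply (rcont_plus (fun w => a*(Re w*Re w)) (fun w => b*(Im w*Im w))).
  - apply (rcont_comp (fun u => a*(u*u)) Re); [|apply rcont_Re].
    apply derivable_continuous_pt. exists (2*a*Re z). apply is_derive_Reals. der_ring.
  - apply (rcont_comp (fun u => b*(u*u)) Im); [|apply rcont_Im].
    apply derivable_continuous_pt. exists (2*b*Im z). apply is_derive_Reals. der_ring.
Qed.

Lemma rcont_usc (V : C -> R) (z : C) : rcont V z -> forall eps, 0 < eps -> exists del, 0 < del /\
  forall w, Cmod (w - z)%C < del -> V w < V z + eps.
Proof.
  intros H eps He. destruct (H eps He) as [d [Hd H1]]. exists d. split; [assumption|]. intros w Hw.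
  specialize (H1 _ Hw). replace (z+(w-z))%C with w in H1 by ring. apply Rabs_def2 in H1. lra.
Qed.

(** * Finite sums, limits of complex sequences, partial summation *)

Fixpoint csum (f : nat -> C) (N : nat) : C :=
  match N with O => 0%C | S M => (csum f M + f N)%C end.

Fixpoint rsum (f : nat -> R) (N : nat) : R :=
  match N with O => 0 | S M => rsum f M + f N end.

Lemma csum_ext (f g : nat -> C) (N : nat) : (forall n, (1 <= n <= N)%nat -> f n = g n) -> csum f N = csum g N.
Proof. induction N; intros H; simpl; [reflexivity|]. rewrite IHN, H; auto with arith; intros; apply H; lia. Qed.

Lemma rsum_ext (f g : nat -> R) (N : nat) : (forall n, (1 <= n <= N)%nat -> f n = g n) -> rsum f N = rsum g N.
Proof. induction N; intros H; simpl; [reflexivity|]. rewrite IHN, H; auto with arith; intros; apply H; lia. Qed.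

Lemma csum_plus (f g : nat -> C) (N : nat) : csum (fun n => f n + g n)%C N = (csum f N + csum g N)%C.
Proof. induction N; simpl; [ring|]. rewrite IHN. ring. Qed.

Lemma csum_scal (c : C) (f : nat -> C) (N : nat) : csum (fun n => c*f n)%C N = (c*csum f N)%C.
Proof. induction N; simpl; [ring|]. rewrite IHN. ring. Qed.

Lemma rsum_plus (f g : nat -> R) (N : nat) : rsum (fun n => f n + g n) N = rsum f N + rsum g N.
Proof. induction N; simpl; [ring|]. lra. Qed.

Lemma rsum_scal (c : R) (f : nat -> R) (N : nat) : rsum (fun n => c*f n) N = c*rsum f N.
Proof. induction N; simpl; [ring|]. lra. Qed.

Lemma rsum_le (f g : nat -> R) (N : nat) : (forall n, (1 <= n <= N)%nat -> f n <= g n) -> rsum f N <= rsum g N.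
Proof. induction N; intros H; simpl; [lra|]. apply Rplus_le_compat; [apply IHN; intros; apply H; lia|apply H; lia]. Qed.

Lemma rsum_nonneg (f : nat -> R) (N : nat) : (forall n, (1 <= n <= N)%nat -> 0 <= f n) -> 0 <= rsum f N.
Proof. induction N; intros H; simpl; [lra|]. apply Rplus_le_le_0_compat; [apply IHN; intros; apply H; lia|apply H; lia]. Qed.

Lemma Cmod_csum_le (f : nat -> C) (N : nat) : Cmod (csum f N) <= rsum (fun n => Cmod (f n)) N.
Proof.
  induction N; simpl; [rewrite Cmod_0; lra|]. le_via Cmod_triangle. lra.
Qed.

Lemma csum_minus (f g : nat -> C) (N : nat) : csum (fun n => f n - g n)%C N = (csum f N - csum g N)%C.
Proof. induction N; simpl; [ring|]. rewrite IHN. ring. Qed.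

Lemma csum_zero (f : nat -> C) (N : nat) : (forall n, (1 <= n <= N)%nat -> f n = 0%C) -> csum f N = 0%C.
Proof.
  intros H. induction N; simpl; [reflexivity|]. rewrite IHN, H; [ring|lia|]. intros; apply H; lia.
Qed.

Lemma csum_swap (f : nat -> nat -> C) (M N : nat) :
  csum (fun m => csum (fun n => f m n) N) M = csum (fun n => csum (fun m => f m n) M) N.
Proof.
  induction M; simpl; [symmetry; apply csum_zero; reflexivity|]. rewrite IHM. rewrite <- csum_plus. reflexivity.
Qed.

Lemma Re_csum (f : nat -> C) (N : nat) : Re (csum f N) = rsum (fun n => Re (f n)) N.
Proof. induction N; simpl; [reflexivity|]. rewrite <- IHN. reflexivity. Qed.

Lemma csum_app (f : nat -> C) (M N : nat) : csum f (M + N) = (csum f M + csum (fun n => f (M + n)%nat) N)%C.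
Proof.
  induction N; simpl; [rewrite Nat.add_0_r; ring|]. rewrite Nat.add_succ_r. simpl. rewrite IHN. ring.
Qed.

Lemma csum_conj (f : nat -> C) (N : nat) : csum (fun n => Cconj (f n)) N = Cconj (csum f N).
Proof.
  induction N; simpl; [apply C_ext; simpl; ring|]. rewrite IHN, Cplus_conj. reflexivity.
Qed.

Definition ccv (u : nat -> C) (l : C) : Prop :=
  forall eps, 0 < eps -> exists N, forall n, (N <= n)%nat -> Cmod (u n - l)%C < eps.

Lemma ccv_ext (u v : nat -> C) (l : C) : (forall n, u n = v n) -> ccv u l -> ccv v l.
Proof. intros E H eps He. destruct (H eps He) as [N HN]. exists N. intros n Hn. rewrite <- E. auto. Qed.

Lemma ccv_const (l : C) : ccv (fun _ => l) l.
Proof. intros eps He. exists 0%nat. intros. replace (l-l)%C with (RtoC 0) by ring. rewrite Cmod_0. exact He. Qed.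

Lemma ccv_le (u : nat -> C) (l : C) (B : R) (N0 : nat) : ccv u l -> (forall n, (N0 <= n)%nat -> Cmod (u n) <= B) -> Cmod l <= B.
Proof.
  intros H HB. apply Rnot_lt_le. intros Hlt. destruct (H (Cmod l-B)) as [N HN]; [lra|].
  specialize (HN (max N N0) ltac:(lia)). specialize (HB (max N N0) ltac:(lia)).
  pose proof (Cmod_rev_triangle l (u (max N N0))) as Ht. rewrite Cmod_minus_sym in HN.
  pose proof (Rle_abs (Cmod l-Cmod (u (max N N0)))). lra.
Qed.

Lemma ccv_plus (u v : nat -> C) (l m : C) : ccv u l -> ccv v m -> ccv (fun n => u n + v n)%C (l + m)%C.
Proof.
  intros H1 H2 eps He. destruct (H1 (eps/2)) as [N1 HN1]; [lra|]. destruct (H2 (eps/2)) as [N2 HN2]; [lra|].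
  exists (max N1 N2). intros n Hn. specialize (HN1 n ltac:(lia)). specialize (HN2 n ltac:(lia)).
  replace (u n+v n-(l+m))%C with ((u n-l)+(v n-m))%C by ring.
  le_lt_via Cmod_triangle. lra.
Qed.

Lemma ccv_scal (c : C) (u : nat -> C) (l : C) : ccv u l -> ccv (fun n => c*u n)%C (c*l)%C.
Proof.
  intros H eps He. pose proof (Cmod_ge_0 c). destruct (H (eps/(Cmod c+1))) as [N HN]; [div_pos|].
  exists N. intros n Hn. specialize (HN n Hn). replace (c*u n-c*l)%C with (c*(u n-l))%C by ring.
  rewrite Cmod_mult. pose proof (Cmod_ge_0 (u n-l)%C).
  apply Rle_lt_trans with ((Cmod c+1)*Cmod (u n-l)%C); [nra|].
  replace eps with ((Cmod c+1)*(eps/(Cmod c+1))) by (field; lra). nra.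
Qed.

Lemma ccv_unique (u : nat -> C) (l m : C) : ccv u l -> ccv u m -> l = m.
Proof.
  intros H1 H2. assert (E : Cmod (l-m)%C <= 0).
  { apply ccv_le with (u := fun n => (u n+(-1)*u n)%C) (N0 := 0%nat).
    - replace (l-m)%C with (l+(-1)*m)%C by ring. apply ccv_plus; [|apply ccv_scal]; assumption.
    - intros n _. replace (u n + -1*u n)%C with (RtoC 0) by ring. rewrite Cmod_0. lra. }
  pose proof (Cmod_ge_0 (l-m)%C). assert (E0 : (l-m)%C = 0%C) by (apply Cmod_eq_0; lra).
  replace l with ((l-m)+m)%C by ring. rewrite E0. ring.
Qed.

Lemma ccv_minus (u v : nat -> C) (l m : C) : ccv u l -> ccv v m -> ccv (fun n => u n - v n)%C (l - m)%C.
Proof.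
  intros H1 H2. replace (l-m)%C with (l+(-1)*m)%C by ring.
  apply ccv_ext with (fun n => u n+(-1)*v n)%C; [intros; ring|]. apply ccv_plus; [assumption|]. apply ccv_scal; assumption.
Qed.

Lemma ccv_0_le (u : nat -> C) (e : nat -> R) : (forall n, Cmod (u n) <= e n) -> is_lim_seq e 0 -> ccv u 0.
Proof.
  intros Hu He eps Hp. apply is_lim_seq_spec in He. destruct (He (mkposreal eps Hp)) as [N HN]. exists N.
  intros n Hn. specialize (HN n Hn). simpl in HN. replace (u n-0)%C with (u n) by ring.
  le_lt_via Hu. rewrite Rminus_0_r in HN. pose proof (Rle_abs (e n)). lra.
Qed.

Lemma ccv_Re (u : nat -> C) (l : C) : ccv u l -> is_lim_seq (fun n => Re (u n)) (Re l).
Proof.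
  intros H. apply is_lim_seq_spec. intros eps. destruct (H eps (cond_pos eps)) as [N HN]. exists N. intros n Hn.
  eapply Rle_lt_trans; [|apply (HN n Hn)]. eapply Rle_trans; [|apply re_le_Cmod]. right. f_equal.
Qed.

Lemma ccv_Im (u : nat -> C) (l : C) : ccv u l -> is_lim_seq (fun n => Im (u n)) (Im l).
Proof.
  intros H. apply is_lim_seq_spec. intros eps. destruct (H eps (cond_pos eps)) as [N HN]. exists N. intros n Hn.
  eapply Rle_lt_trans; [|apply (HN n Hn)]. eapply Rle_trans; [|apply Im_abs_le_Cmod]. right. f_equal.
Qed.

Lemma ccv_of_parts (u : nat -> C) (a b : R) : is_lim_seq (fun n => Re (u n)) a -> is_lim_seq (fun n => Im (u n)) b -> ccv u (a, b).
Proof.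
  intros H1 H2 eps He. apply is_lim_seq_spec in H1. apply is_lim_seq_spec in H2.
  assert (He2 : 0 < eps/2) by lra.
  destruct (H1 (mkposreal _ He2)) as [N1 HN1]. destruct (H2 (mkposreal _ He2)) as [N2 HN2]. simpl in HN1, HN2.
  exists (max N1 N2). intros n Hn. specialize (HN1 n ltac:(lia)). specialize (HN2 n ltac:(lia)).
  le_lt_via Cmod_le_abs. unfold Re, Im in *. simpl. unfold Rminus in *. lra.
Qed.

Lemma ccv_cauchy (u : nat -> C) (e : nat -> R) :
  (forall m n, (m <= n)%nat -> Cmod (u n - u m)%C <= e m) -> is_lim_seq e 0 -> exists l, ccv u l.
Proof.
  intros Hu He.
  assert (A : forall (f : C -> R), (forall z w, Rabs (f z-f w) <= Cmod (z-w)%C) -> exists a : R, is_lim_seq (fun n => f (u n)) a).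
  { intros f Hf.
    apply ex_lim_seq_cauchy_corr. intros eps. apply is_lim_seq_spec in He.
    assert (He2 : 0 < eps/2) by (pose proof (cond_pos eps); lra).
    destruct (He (mkposreal _ He2)) as [N HN]. exists N. intros n m Hn Hm. simpl in HN.
    specialize (HN N (le_n N)). rewrite Rminus_0_r in HN. pose proof (Rle_abs (e N)).
    le_lt_via Hf. replace (u n-u m)%C with ((u n-u N)-(u m-u N))%C by ring.
    le_lt_via Cmod_minus_le. pose proof (Hu N n Hn). pose proof (Hu N m Hm). lra. }
  destruct (A Re) as [a Ha].
  { intros z w. eapply Rle_trans; [|apply re_le_Cmod]. right. f_equal. }
  destruct (A Im) as [b Hb].
  { intros z w. eapply Rle_trans; [|apply Im_abs_le_Cmod]. right. f_equal. }
  exists (a, b). apply ccv_of_parts; assumption.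
Qed.

Lemma dpart_csum (a : nat -> C) (s : C) (N : nat) : dpart a s N = csum (fun n => a n*npow_neg n s)%C N.
Proof. induction N; simpl; [reflexivity|]. rewrite IHN. reflexivity. Qed.

Lemma dseries_eq (a : nat -> C) (s l : C) : ccv (dpart a s) l -> dseries a s = l.
Proof.
  intros H. unfold dseries. rewrite (is_lim_seq_unique _ _ (ccv_Re _ _ H)), (is_lim_seq_unique _ _ (ccv_Im _ _ H)).
  destruct l; reflexivity.
Qed.

Lemma npow_neg_cexp (n : nat) (s : C) : npow_neg n s = cexp (- s*lnn n)%C.
Proof.
  unfold npow_neg, Rpower. destruct s as [a b]. apply C_ext; unfold Re, Im; simpl.
  - f_equal; [f_equal; ring|]. replace (- a*0 + - b*lnn n) with (- (b*lnn n)) by ring. rewrite cos_neg. reflexivity.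
  - replace (- a*0 + - b*lnn n) with (- (b*lnn n)) by ring. rewrite sin_neg.
    replace (- a*lnn n - - b*0) with (- a*lnn n) by ring. ring.
Qed.

Lemma exp_le (x y : R) : x <= y -> exp x <= exp y.
Proof. intros [H| ->]; [left; apply exp_increasing; exact H|lra]. Qed.

Lemma ln_nonneg (x : R) : 1 <= x -> 0 <= ln x.
Proof. intros [H|<-]; [rewrite <- ln_1; left; apply ln_increasing; lra|rewrite ln_1; lra]. Qed.

Lemma ln_le' (x y : R) : 0 < x -> x <= y -> ln x <= ln y.
Proof. intros H [H1| ->]; [left; apply ln_increasing; assumption|lra]. Qed.

Lemma ln_sub_le (x y : R) : 0 < x -> x <= y -> ln y - ln x <= (y - x)/x.
Proof.
  intros Hx Hy. rewrite <- ln_div by lra. apply Rle_trans with (y/x-1); [|right; field; lra].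
  apply Rle_trans with (ln (1+(y/x-1))); [right; f_equal; ring|].
  destruct (Req_dec (y/x-1) 0) as [E|E]; [rewrite E, Rplus_0_r, ln_1; lra|].
  assert (1 <= y/x). { apply Rmult_le_reg_r with x; [lra|]. field_simplify; lra. }
  rewrite <- (ln_exp (y/x-1)) at 2. apply ln_le'; [lra|]. left. apply exp_ineq1. exact E.
Qed.

Lemma exp_pow_nat (x : R) (k : nat) : exp x ^ k = exp (INR k*x).
Proof.
  induction k; [simpl; rewrite Rmult_0_l, exp_0; reflexivity|]. rewrite S_INR. simpl. rewrite IHk, <- exp_plus. f_equal. ring.
Qed.

Lemma pow_le_exp (k : nat) (eta : R) : 0 < eta -> exists K, 0 < K /\ forall y, 0 <= y -> y ^ k <= K*exp (eta*y).
Proof.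
  (* The exponent is divided into [k + 1] shares so that [y <= exp (e y) / e] can be raised to the
     power [k]. *)
  intros He. set (e := eta/(INR k+1)). pose proof (pos_INR k).
  assert (Hp : 0 < e) by div_pos.
  exists ((/ e) ^ k). split; [apply pow_lt, Rinv_0_lt_compat; exact Hp|]. intros y Hy.
  apply Rle_trans with ((/ e*exp (e*y)) ^ k).
  - apply pow_incr. split; [assumption|]. apply Rmult_le_reg_l with e; [assumption|].
    rewrite <- Rmult_assoc, Rinv_r by lra.
    destruct (Req_dec (e*y) 0) as [E|E]; [rewrite E, exp_0; lra|]. pose proof (exp_ineq1 (e*y) E). lra.
  - rewrite Rpow_mult_distr. apply Rmult_le_compat_l; [apply pow_le; left; apply Rinv_0_lt_compat; exact Hp|].
    rewrite exp_pow_nat. apply exp_le. replace (eta*y) with ((INR k+1)*(e*y)) by (unfold e; field; lra).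
    nra.
Qed.

Lemma lim_exp_ln_decay (d : R) : 0 < d -> is_lim_seq (fun n => exp (- d*lnn (S n))) 0.
Proof.
  intros Hd. apply is_lim_seq_spec. intros eps. pose proof (cond_pos eps) as He.
  destruct (nfloor_ex (exp (- ln eps/d)) (Rlt_le _ _ (exp_pos _))) as [N [_ HN]].
  exists N. intros n Hn. rewrite Rminus_0_r, Rabs_right by (apply Rle_ge, Rlt_le, exp_pos).
  rewrite <- (exp_ln eps He). apply exp_increasing.
  assert (- ln eps/d < lnn (S n)).
  { rewrite <- (ln_exp (- ln eps/d)). apply ln_increasing; [apply exp_pos|].
    rewrite S_INR. apply le_INR in Hn. lra. }
  assert (- ln eps < d*lnn (S n)); [|lra]. replace (- ln eps) with (d*(- ln eps/d)) by (field; lra).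
  nra.
Qed.

Lemma abel_summation (a w : nat -> C) (N : nat) :
  csum (fun n => a n*w n)%C N = (csum a N*w (S N) + csum (fun n => csum a n*(w n - w (S n))) N)%C.
Proof. induction N; simpl; [ring|]. rewrite IHN. ring. Qed.

(** Comparison of the sum of [n^(-1-d)] with an integral. The first term is bounded separately,
    because for [M = 0] the integral over [[0,1]] would diverge; this is the 1 in [1 + 1/d]. *)
Lemma rsum_power_tail (d : R) (M N : nat) : 0 < d ->
  rsum (fun n => exp (- d*lnn (M + n))/INR (M + n)) N <= (1 + / d)*exp (- d*lnn (S M)).
Proof.
  intros Hd.
  assert (Step : forall x, 1 <= x -> exp (- d*ln (x+1))/(x+1) <= / d*(exp (- d*ln x)-exp (- d*ln (x+1)))).
  { intros x Hx. destruct (MVT_cor2 (fun x => - / d*exp (- d*ln x)) (fun x => exp (- d*ln x)/x) x (x+1)) as [c [E Hc]]; [lra| |].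
    - intros c Hc. auto_derive; [lra|]. field. lra.
    - replace (/ d*(exp (- d*ln x)-exp (- d*ln (x+1)))) with (exp (- d*ln c)/c*(x+1-x)) by (rewrite <- E; ring).
      replace (x+1-x) with 1 by ring. rewrite Rmult_1_r.
      assert (ln c <= ln (x+1)) by (apply ln_le'; lra).
      apply Rmult_le_compat; [left; apply exp_pos|left; inv_pos| |apply Rinv_le_contravar; lra].
      apply exp_le. nra. }
  destruct N as [|N]; [cbn [rsum]; assert (0 < / d) by inv_pos; pose proof (exp_pos (- d*lnn (S M))); apply Rmult_le_pos; lra|].
  assert (G : rsum (fun n => exp (- d*lnn (M+n))/INR (M+n)) (S N) <=
     exp (- d*lnn (S M)) + / d*(exp (- d*lnn (S M))-exp (- d*lnn (S M+N)))).
  { induction N.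
    - simpl. rewrite Nat.add_1_r, Nat.add_0_r. rewrite Rminus_diag, Rmult_0_r, Rplus_0_l, Rplus_0_r.
      change (match M with O => 1 | S _ => INR M+1 end) with (INR (S M)).
      rewrite <- (Rmult_1_r (exp (- d*lnn (S M)))) at 2. apply Rmult_le_compat_l; [left; apply exp_pos|].
      rewrite <- Rinv_1. apply Rinv_le_contravar; [lra|]. rewrite S_INR. pose proof (pos_INR M). lra.
    - change (rsum (fun n => exp (- d*lnn (M+n))/INR (M+n)) (S (S N))) with
        (rsum (fun n => exp (- d*lnn (M+n))/INR (M+n)) (S N)+exp (- d*ln (INR (M+S (S N))))/INR (M+S (S N))).
      replace (M+S (S N))%nat with (S (S M+N)) by lia. replace (S M+S N)%nat with (S (S M+N)) by lia.
      rewrite (S_INR (S M+N)). assert (1 <= INR (S M+N)).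
      { change 1 with (INR 1). apply le_INR. lia. }
      pose proof (Step _ H). lra. } assert (0 < / d) by inv_pos. pose proof (exp_pos (- d*lnn (S M+N))). nra.
Qed.

Lemma rsum_app (f : nat -> R) (M N : nat) : rsum f (M + N) = rsum f M + rsum (fun n => f (M + n)%nat) N.
Proof.
  induction N; simpl; [rewrite Nat.add_0_r; ring|]. rewrite Nat.add_succ_r. simpl. lra.
Qed.

(** Partial summation: the two boundary terms contribute 2 and the sum of the differences [1 + 1/d]
    to the constant [3 + 1/d]. *)
Lemma abel_tail (a w : nat -> C) (Q A d : R) (M N : nat) : 0 < d -> 0 <= Q -> 0 <= A ->
  (forall n, Cmod (csum a n) <= Q) ->
  (forall n, (1 <= n)%nat -> Cmod (w n) <= A*exp (- d*lnn n)) ->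
  (forall n, (1 <= n)%nat -> Cmod (w n - w (S n))%C <= A*(exp (- d*lnn n)/INR n)) ->
  (M <= N)%nat ->
  Cmod (csum (fun n => a n*w n)%C N - csum (fun n => a n*w n)%C M)%C <= Q*A*(3 + / d)*exp (- d*lnn (S M)).
Proof.
  intros Hd HQ HA Ha Hw Hdw HMN. rewrite (abel_summation a w N), (abel_summation a w M).
  replace N with (M+(N-M))%nat by lia. rewrite (csum_app (fun n => csum a n*(w n-w (S n)))%C M (N-M)).
  set (K := (N-M)%nat). set (E := exp (- d*lnn (S M))).
  replace (csum a (M+K)*w (S (M+K)) +
     (csum (fun n : nat => csum a n*(w n-w (S n))) M +
      csum (fun n : nat => csum a (M+n)*(w (M+n)%nat-w (S (M+n)))) K) -
     (csum a M*w (S M)+csum (fun n : nat => csum a n*(w n-w (S n))) M))%C with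
   ((csum a (M+K)*w (S (M+K))-csum a M*w (S M))+csum (fun n : nat => csum a (M+n)*(w (M+n)%nat-w (S (M+n)))) K)%C by ring.
  assert (Hdec : forall n, (S M <= n)%nat -> exp (- d*lnn n) <= E).
  { intros n Hn. apply exp_le. assert (lnn (S M) <= lnn n); [|nra].
    apply ln_le'; [apply lt_0_INR; lia|apply le_INR; exact Hn]. }
  assert (P0 : 0 <= Q*A) by nra.
  assert (B1 : forall n, (M <= n)%nat -> Cmod (csum a n*w (S n))%C <= Q*A*E).
  { intros n Hn. rewrite Cmod_mult. rewrite Rmult_assoc. apply Rmult_le_compat; try apply Cmod_ge_0; [apply Ha|].
    eapply Rle_trans; [apply Hw; lia|]. apply Rmult_le_compat_l; [assumption|]. apply Hdec; lia. }
  le_via Cmod_triangle.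
  apply Rle_trans with ((Q*A*E+Q*A*E)+Q*A*((1 + / d)*E)); [|unfold E; right; ring].
  apply Rplus_le_compat.
  - le_via Cmod_minus_le. apply Rplus_le_compat; apply B1; lia.
  - le_via Cmod_csum_le.
    apply Rle_trans with (rsum (fun n => Q*A*(exp (- d*lnn (M+n))/INR (M+n))) K).
    + apply rsum_le. intros n Hn. rewrite Cmod_mult, Rmult_assoc. apply Rmult_le_compat; try apply Cmod_ge_0; [apply Ha|].
      apply Hdw. lia.
    + rewrite rsum_scal. apply Rmult_le_compat_l; [assumption|]. apply rsum_power_tail. exact Hd.
Qed.

(* The hypotheses of [abel_tail] for [w n = phi (ln n)]. *)
Lemma abel_tail_log (a : nat -> C) (phi phi' : R -> C) (Q A d : R) (M N : nat) : 0 < d -> 0 <= Q -> 0 <= A ->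
  (forall n, Cmod (csum a n) <= Q) ->
  (forall y, 0 <= y -> rder phi y (phi' y)) ->
  (forall y, 0 <= y -> Cmod (phi y) <= A*exp (- d*y)) ->
  (forall y, 0 <= y -> Cmod (phi' y) <= A*exp (- d*y)) ->
  (M <= N)%nat ->
  Cmod (csum (fun n => a n*phi (lnn n))%C N - csum (fun n => a n*phi (lnn n))%C M)%C
    <= Q*A*(3 + / d)*exp (- d*lnn (S M)).
Proof.
  intros Hd HQ HA Ha Hder Hp Hp' HMN. apply (abel_tail a (fun n => phi (lnn n)) Q A d); auto.
  - intros n Hn. apply Hp. apply ln_nonneg. change 1 with (INR 1). apply le_INR; exact Hn.
  - intros n Hn. assert (H1 : 1 <= INR n) by (change 1 with (INR 1); apply le_INR; exact Hn).
    rewrite Cmod_minus_sym. rewrite S_INR. pose proof (ln_nonneg _ H1).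
    assert (lnn n <= ln (INR n+1)) by (apply ln_le'; lra).
    le_via (rder_mean_value phi phi' (lnn n) (ln (INR n+1)) (A*exp (- d*lnn n))).
    + assumption.
    + intros t Ht. apply Hder. lra.
    + intros t Ht. eapply Rle_trans; [apply Hp'; lra|]. apply Rmult_le_compat_l; [assumption|]. apply exp_le. nra.
    + pose proof (ln_sub_le (INR n) (INR n+1) ltac:(lra) ltac:(lra)) as H2.
      replace (INR n+1-INR n) with 1 in H2 by ring.
      replace (A*(exp (- d*lnn n)/INR n)) with (A*exp (- d*lnn n)*(1/INR n)) by (field; lra).
      apply Rmult_le_compat_l; [|exact H2]. apply Rmult_le_pos; [assumption|left; apply exp_pos].
Qed.

Lemma rder_mult (f g : R -> C) (t : R) (d e : C) : rder f t d -> rder g t e ->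
  rder (fun x => f x*g x)%C t (d*g t + f t*e)%C.
Proof.
  intros [H1 H2] [H3 H4].
  assert (P : forall (u v : R -> R) du dv, is_derive u t du -> is_derive v t dv -> is_derive (fun x => u x*v x) t (du*v t+u t*dv)).
  { intros u v du dv Hu Hv. apply is_derive_Reals in Hu. apply is_derive_Reals in Hv. apply is_derive_Reals.
    apply (derivable_pt_lim_mult u v t du dv Hu Hv). }
  split.
  - replace (Re (d*g t+f t*e)%C) with ((Re d*Re (g t)+Re (f t)*Re e)-(Im d*Im (g t)+Im (f t)*Im e))
      by Re_ring.
    apply (is_derive_minus (fun x => Re (f x)*Re (g x)) (fun x => Im (f x)*Im (g x))); apply P; assumption.
  - replace (Im (d*g t+f t*e)%C) with ((Re d*Im (g t)+Re (f t)*Im e)+(Im d*Re (g t)+Im (f t)*Re e))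
      by Re_ring.
    apply (is_derive_plus (fun x => Re (f x)*Im (g x)) (fun x => Im (f x)*Re (g x))); apply P; assumption.
Qed.

Lemma rder_RtoC (p : R -> R) (t d : R) : is_derive p t d -> rder (fun x => RtoC (p x)) t (RtoC d).
Proof. split; [exact H|]. apply (is_derive_const 0 t). Qed.

Lemma rder_const (c : C) (t : R) : rder (fun _ => c) t 0.
Proof. split; [exact (is_derive_const (Re c) t)|exact (is_derive_const (Im c) t)]. Qed.

Lemma rder_ext (f g : R -> C) (t : R) (d : C) : (forall x, f x = g x) -> rder f t d -> rder g t d.
Proof. intros E. replace g with f; [auto|]. apply functional_extensionality; exact E. Qed.

Lemma rder_eq (f : R -> C) (t : R) (d e : C) : d = e -> rder f t d -> rder f t e.
Proof. intros ->; auto. Qed.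

Lemma rder_cexp_lin (z : C) (t : R) : rder (fun y => cexp (z*y)%C) t (z*cexp (z*t)%C)%C.
Proof.
  pose proof (rder_cexp_line 0 z t) as H. replace (0+t*z)%C with (z*t)%C in H by ring.
  eapply rder_ext; [|exact H]. intros x. simpl. f_equal. ring.
Qed.

(** * Dirichlet series whose coefficients have bounded partial sums *)

Definition Fk (chi : nat -> C) (k : nat) (s : C) : C := dseries (fun n => chi n*RtoC (lnn n ^ k))%C s.

Lemma Lfun_Fk (chi : nat -> C) : Lfun chi = Fk chi 0.
Proof.
  apply functional_extensionality. intros s. unfold Lfun, Fk. f_equal. apply functional_extensionality. intros n. simpl. ring.
Qed.

(** At [y = log n] this is [(log n)^k n^(-s)]. Partial summation is done in the variable [log n],
    where the weights are smooth. *)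
Definition log_kernel (k : nat) (s : C) (y : R) : C := (RtoC (y ^ k)*cexp (- s*y))%C.

Definition log_kernel' (k : nat) (s : C) (y : R) : C :=
  (RtoC (INR k*y ^ pred k)*cexp (- s*y) + RtoC (y ^ k)*(- s*cexp (- s*y)))%C.

Lemma rder_log_kernel (k : nat) (s : C) (y : R) : rder (log_kernel k s) y (log_kernel' k s y).
Proof.
  apply (rder_mult (fun y => RtoC (y ^ k)) (fun y => cexp (- s*y)%C)); [|apply rder_cexp_lin].
  apply (rder_RtoC (fun y => y ^ k)). apply is_derive_Reals. apply derivable_pt_lim_pow.
Qed.

Lemma dpart_log_kernel (chi : nat -> C) (k : nat) (s : C) (N : nat) :
  dpart (fun n => chi n*RtoC (lnn n ^ k))%C s N = csum (fun n => chi n*log_kernel k s (lnn n))%C N.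
Proof.
  rewrite dpart_csum. apply csum_ext. intros n _. rewrite npow_neg_cexp. unfold log_kernel. ring.
Qed.

Lemma Cmod_cexp_real_mult (s : C) (y : R) : Cmod (cexp (- s*y)%C) = exp (- Re s*y).
Proof. rewrite Cmod_cexp. f_equal. unfold Re; simpl. ring. Qed.

(** Half of the decay [exp (- y Re s)] is spent on the powers of [y]. *)
Lemma log_kernel_bound (k : nat) (s : C) : 0 < Re s -> exists A, 0 < A /\ forall y, 0 <= y ->
  Cmod (log_kernel k s y) <= A*exp (- (Re s/2)*y) /\ Cmod (log_kernel' k s y) <= A*exp (- (Re s/2)*y).
Proof.
  intros Hs. destruct (pow_le_exp k (Re s/2)) as [K1 [HK1 H1]]; [lra|].
  destruct (pow_le_exp (pred k) (Re s/2)) as [K2 [HK2 H2]]; [lra|].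
  pose proof (pos_INR k) as Hk. pose proof (Cmod_ge_0 s) as Hs0.
  exists (K1+(INR k*K2+K1*Cmod s)). split; [nra|]. intros y Hy. specialize (H1 y Hy). specialize (H2 y Hy).
  assert (E : exp (Re s/2*y)*exp (- Re s*y) = exp (- (Re s/2)*y)) by (rewrite <- exp_plus; f_equal; field).
  pose proof (exp_pos (- Re s*y)) as P.
  assert (B1 : y ^ k*exp (- Re s*y) <= K1*exp (- (Re s/2)*y)).
  { nra. }
  assert (B2 : y ^ pred k*exp (- Re s*y) <= K2*exp (- (Re s/2)*y)).
  { nra. }
  pose proof (pow_le y k Hy). pose proof (pow_le y (pred k) Hy).
  assert (T1 : 0 <= INR k*K2*exp (- (Re s/2)*y)) by (apply Rmult_le_pos; nra).
  assert (T2 : 0 <= K1*Cmod s*exp (- (Re s/2)*y)) by (apply Rmult_le_pos; nra).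
  assert (T3 : 0 <= K1*exp (- (Re s/2)*y)) by nra.
  split.
  - unfold log_kernel. rewrite Cmod_mult, Cmod_R, Cmod_cexp_real_mult, Rabs_right by lra. lra.
  - le_via Cmod_triangle. rewrite !Cmod_mult, !Cmod_R, Cmod_opp, Cmod_cexp_real_mult.
    rewrite !Rabs_right by nra.
    nra.
Qed.

Lemma lim_scal_decay (K d : R) : 0 < d -> is_lim_seq (fun n => K*exp (- d*lnn (S n))) 0.
Proof.
  intros Hd. replace (Finite 0) with (Rbar_mult K 0) by (simpl; f_equal; ring).
  apply is_lim_seq_scal_l. apply lim_exp_ln_decay; exact Hd.
Qed.

Section BoundedPartialSums.
Variables (chi : nat -> C) (Q : R).
Hypothesis HQ : forall n, Cmod (csum chi n) <= Q.

Lemma partial_sum_bound_nonneg : 0 <= Q.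
Proof. eapply Rle_trans; [apply Cmod_ge_0|apply (HQ 0)]. Qed.

Lemma Fk_conv (k : nat) (s : C) : 0 < Re s -> ccv (csum (fun n => chi n*log_kernel k s (lnn n))%C) (Fk chi k s).
Proof.
  intros Hs. destruct (log_kernel_bound k s Hs) as [A [HA HB]].
  assert (Hd : 0 < Re s/2) by lra.
  destruct (ccv_cauchy (csum (fun n => chi n*log_kernel k s (lnn n))%C)
    (fun M => Q*A*(3 + / (Re s/2))*exp (- (Re s/2)*lnn (S M)))) as [l Hl].
  - intros m n Hmn. apply (abel_tail_log chi (log_kernel k s) (log_kernel' k s)); auto; try lra.
    + apply partial_sum_bound_nonneg.
    + intros; apply rder_log_kernel.
    + intros y Hy; apply HB; exact Hy.
    + intros y Hy; apply HB; exact Hy.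
  - apply lim_scal_decay; exact Hd.
  - replace (Fk chi k s) with l; [exact Hl|]. symmetry. apply dseries_eq.
    eapply ccv_ext; [|exact Hl]. symmetry. apply dpart_log_kernel.
Qed.

(** For [k = 0] there are no powers of [y] to absorb, so the full rate [N^(- Re s)] is available,
    with a constant explicit in [s]; [vm_sum_limit] relies on this rate. *)
Lemma Lfun_tail (s : C) (N : nat) : 0 < Re s ->
  Cmod (Fk chi 0 s - csum (fun n => chi n*log_kernel 0 s (lnn n))%C N)%C
    <= Q*(1 + Cmod s)*(3 + / Re s)*exp (- Re s*lnn (S N)).
Proof.
  intros Hs. pose proof (Cmod_ge_0 s).
  apply ccv_le with (u := fun n => (csum (fun n => chi n*log_kernel 0 s (lnn n))%C n-csum (fun n => chi n*log_kernel 0 s (lnn n))%C N)%C) (N0 := N).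
  - apply ccv_minus; [apply Fk_conv; exact Hs|apply ccv_const].
  - intros n Hn. apply (abel_tail_log chi (log_kernel 0 s) (log_kernel' 0 s)); auto; try lra.
    + apply partial_sum_bound_nonneg.
    + intros; apply rder_log_kernel.
    + intros y Hy. unfold log_kernel. rewrite Cmod_mult, Cmod_R, Cmod_cexp_real_mult. simpl. rewrite Rabs_R1.
      pose proof (exp_pos (- Re s*y)). nra.
    + intros y Hy. unfold log_kernel'. simpl.
      replace ((0*1)%R*cexp (- s*y)+1*(- s*cexp (- s*y)))%C with (- s*cexp (- s*y))%C.
      2:{ rewrite Rmult_0_l. ring. }
      rewrite Cmod_mult, Cmod_opp, Cmod_cexp_real_mult.
      pose proof (exp_pos (- Re s*y)). nra.
Qed.

Lemma Lfun_bound (s : C) : 0 < Re s -> Cmod (Fk chi 0 s) <= Q*(1 + Cmod s)*(3 + / Re s).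
Proof.
  intros Hs. pose proof (Lfun_tail s 0 Hs) as H. simpl in H. rewrite ln_1, Rmult_0_r, exp_0, Rmult_1_r in H.
  replace (Fk chi 0 s-0)%C with (Fk chi 0 s) in H by ring. exact H.
Qed.

(** The Taylor error [exp (- h y) - 1 + h y], multiplied by the kernel, is again a smooth weight in
    [y = log n]; it and its derivative are [O(|h|^2)] with exponential decay. Partial summation
    applied to this weight differentiates a conditionally convergent series term by term. *)
Lemma Fk_cder (k : nat) (s : C) : 0 < Re s -> cder (Fk chi k) s (- Fk chi (S k) s)%C.
Proof.
  (* One share of [Re s / 4] pays for the powers of [y] and another for [exp (|h| y)], which leaves
     the decay rate [Re s / 2]. *)
  intros Hs. set (eta := Re s/4). assert (He : 0 < eta) by (unfold eta; lra).
  destruct (pow_le_exp (k+1) eta He) as [K1 [HK1 H1]]. destruct (pow_le_exp (k+2) eta He) as [K2 [HK2 H2]].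
  destruct (pow_le_exp (pred k+2) eta He) as [K3 [HK3 H3]].
  pose proof (pos_INR k) as Hk. pose proof (Cmod_ge_0 s) as Hs0. pose proof partial_sum_bound_nonneg as HQ0.
  set (A := INR k*K3+K2*Cmod s+K1+K2).
  assert (HA : 0 < A) by (unfold A; nra).
  apply cder_quadratic with (K := Q*A*(3 + / (Re s/2))) (r := eta); [exact He|]. intros h Hh.
  assert (Hsh : 0 < Re (s+h)%C).
  { pose proof (re_le_Cmod h) as H4. apply Rabs_le_between in H4. unfold eta, Re in *; simpl. lra. }
  set (E := fun y : R => (cexp (- h*y)-1+h*y)%C).
  set (phi := fun y : R => (log_kernel k s y*E y)%C).
  set (phi' := fun y : R => (log_kernel' k s y*E y+log_kernel k s y*(h*(1-cexp (- h*y))))%C).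
  assert (Eq : forall y, phi y = (log_kernel k (s+h) y-log_kernel k s y-(- log_kernel (S k) s y)*h)%C).
  { intros y. unfold phi, E, log_kernel. replace (- (s+h)*y)%C with (- s*y + - h*y)%C by ring.
    rewrite cexp_plus. replace (y ^ S k) with (y ^ k*y) by (simpl; ring). rewrite RtoC_mult. ring. }
  replace (Fk chi k (s+h)-Fk chi k s - - Fk chi (S k) s*h)%C with
    ((Fk chi k (s+h)-Fk chi k s)+h*Fk chi (S k) s)%C by ring.
  pose proof (Cmod_ge_0 h) as Hh0.
  apply ccv_le with (u := csum (fun n => chi n*phi (lnn n))%C) (N0 := 0%nat).
  { eapply ccv_ext; [|apply ccv_plus; [apply ccv_minus; apply Fk_conv; assumption|apply ccv_scal; apply (Fk_conv (S k)); assumption]].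
    intros n. simpl. rewrite <- csum_minus, <- csum_scal, <- csum_plus. apply csum_ext. intros m _. rewrite Eq. ring. }
  intros n _.
  pose proof (abel_tail_log chi phi phi' Q (A*(Cmod h*Cmod h)) (Re s/2) 0 n) as T.
  replace (csum (fun n : nat => (chi n*phi (lnn n))%C) n-csum (fun n : nat => (chi n*phi (lnn n))%C) 0)%C with
    (csum (fun n0 : nat => chi n0*phi (lnn n0)) n)%C in T by (simpl; ring).
  simpl INR in T. rewrite ln_1, Rmult_0_r, exp_0 in T.
  eapply Rle_trans; [apply T|right; ring]; auto; try lra; try lia; clear T.
  - nra.
  - intros y Hy. apply (rder_mult (log_kernel k s) E); [apply rder_log_kernel|].
    apply rder_eq with (- h*cexp (- h*y)+h)%C; [ring|].
    apply (rder_plus (fun y => cexp (- h*y)-1)%C (fun y => h*y)%C).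
    + apply rder_eq with (- h*cexp (- h*y)+0)%C; [ring|].
      apply (rder_plus (fun y => cexp (- h*y))%C (fun _ => Copp 1)); [apply rder_cexp_lin|].
      apply rder_const.
    + apply rder_eq with (0*y+h*1)%C; [ring|]. apply (rder_mult (fun _ => h) (fun y => RtoC y)).
      * apply rder_const.
      * apply (rder_RtoC (fun y => y)). apply (is_derive_id y).
  - intros y Hy.
    assert (Ey : Cmod (E y) <= Cmod h*Cmod h*(y*y)*exp (eta*y)).
    { unfold E. replace (cexp (- h*y)-1+h*y)%C with (cexp (- h*y)-1-(- h*y))%C by ring.
      le_via cexp_taylor_bound. rewrite Cmod_mult, Cmod_opp, Cmod_R, Rabs_right by lra.
      replace (Cmod h*y*(Cmod h*y)) with (Cmod h*Cmod h*(y*y)) by ring.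
      apply Rmult_le_compat_l; [nra|]. apply exp_le. nra. }
    unfold phi, log_kernel. rewrite !Cmod_mult, Cmod_R, Cmod_cexp_real_mult.
    pose proof (pow_le y k Hy). rewrite Rabs_right by lra.
    apply Rle_trans with (y ^ k*exp (- Re s*y)*(Cmod h*Cmod h*(y*y)*exp (eta*y))).
    { apply Rmult_le_compat_l; [|exact Ey]. pose proof (exp_pos (- Re s*y)). nra. }
    replace (y ^ k*exp (- Re s*y)*(Cmod h*Cmod h*(y*y)*exp (eta*y))) with
      ((Cmod h*Cmod h)*(y ^ (k+2)*(exp (- Re s*y)*exp (eta*y)))) by (rewrite pow_add; simpl; ring).
    replace (A*(Cmod h*Cmod h)*exp (- (Re s/2)*y)) with ((Cmod h*Cmod h)*(A*exp (- (Re s/2)*y))) by ring.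
    apply Rmult_le_compat_l; [nra|].
    apply Rle_trans with (K2*exp (eta*y)*(exp (- Re s*y)*exp (eta*y))).
    { apply Rmult_le_compat_r; [|apply H2; exact Hy]. rewrite <- exp_plus. left; apply exp_pos. }
    rewrite Rmult_assoc, <- !exp_plus. replace (eta*y+(- Re s*y+eta*y)) with (- (Re s/2)*y) by (unfold eta; field).
    apply Rmult_le_compat_r; [left; apply exp_pos|]. unfold A. nra.
  - intros y Hy.
    assert (Ey : Cmod (E y) <= Cmod h*Cmod h*(y*y)*exp (eta*y)).
    { unfold E. replace (cexp (- h*y)-1+h*y)%C with (cexp (- h*y)-1-(- h*y))%C by ring.
      le_via cexp_taylor_bound. rewrite Cmod_mult, Cmod_opp, Cmod_R, Rabs_right by lra.
      replace (Cmod h*y*(Cmod h*y)) with (Cmod h*Cmod h*(y*y)) by ring.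
      apply Rmult_le_compat_l; [nra|]. apply exp_le. nra. }
    assert (Dy : Cmod (h*(1-cexp (- h*y)))%C <= Cmod h*Cmod h*y*exp (eta*y)).
    { rewrite Cmod_mult, Cmod_minus_sym.
      replace (Cmod h*Cmod h*y*exp (eta*y)) with (Cmod h*(Cmod h*y*exp (eta*y))) by ring.
      apply Rmult_le_compat_l; [assumption|]. le_via cexp_sub1_bound.
      rewrite Cmod_mult, Cmod_opp, Cmod_R, Rabs_right by lra. apply Rmult_le_compat_l; [nra|]. apply exp_le. nra. }
    pose proof (pow_le y k Hy) as Y1. pose proof (pow_le y (pred k) Hy) as Y2. le_via Cmod_triangle. rewrite (Cmod_mult (log_kernel' k s y)), (Cmod_mult (log_kernel k s y)).
    apply Rle_trans with ((INR k*y ^ pred k+y ^ k*Cmod s)*exp (- Re s*y)*(Cmod h*Cmod h*(y*y)*exp (eta*y))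
       + (y ^ k*exp (- Re s*y))*(Cmod h*Cmod h*y*exp (eta*y))).
    { apply Rplus_le_compat.
      - apply Rmult_le_compat; try apply Cmod_ge_0; [|exact Ey]. le_via Cmod_triangle.
        rewrite !Cmod_mult, !Cmod_R, Cmod_opp, Cmod_cexp_real_mult. rewrite !Rabs_right by nra. right; ring.
      - apply Rmult_le_compat; try apply Cmod_ge_0; [|exact Dy]. unfold log_kernel.
        rewrite Cmod_mult, Cmod_R, Cmod_cexp_real_mult, Rabs_right by lra. lra. }
    replace ((INR k*y ^ pred k+y ^ k*Cmod s)*exp (- Re s*y)*(Cmod h*Cmod h*(y*y)*exp (eta*y))
       + (y ^ k*exp (- Re s*y))*(Cmod h*Cmod h*y*exp (eta*y))) with
      ((Cmod h*Cmod h)*((INR k*y ^ (pred k+2)+y ^ (k+2)*Cmod s+y ^ (k+1))*(exp (- Re s*y)*exp (eta*y))))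
      by (rewrite !pow_add; simpl; ring).
    replace (A*(Cmod h*Cmod h)*exp (- (Re s/2)*y)) with ((Cmod h*Cmod h)*(A*exp (- (Re s/2)*y))) by ring.
    apply Rmult_le_compat_l; [nra|].
    apply Rle_trans with (A*exp (eta*y)*(exp (- Re s*y)*exp (eta*y))).
    { apply Rmult_le_compat_r; [rewrite <- exp_plus; left; apply exp_pos|]. specialize (H1 y Hy). specialize (H2 y Hy). specialize (H3 y Hy).
      pose proof (exp_pos (eta*y)). unfold A. nra. }
    rewrite Rmult_assoc, <- !exp_plus. replace (eta*y+(- Re s*y+eta*y)) with (- (Re s/2)*y) by (unfold eta; field). lra.
Qed.

End BoundedPartialSums.

(** * Sums over lists and roots of unity *)

Definition lsum {A : Type} (f : A -> R) (l : list A) : R := fold_right (fun a s => f a + s) 0 l.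
Definition lcsum {A : Type} (f : A -> C) (l : list A) : C := fold_right (fun a s => f a + s)%C 0%C l.

Lemma lsum_perm {A : Type} (f : A -> R) (l l' : list A) : Permutation l l' -> lsum f l = lsum f l'.
Proof. induction 1; simpl; lra. Qed.

Lemma lcsum_perm {A : Type} (f : A -> C) (l l' : list A) : Permutation l l' -> lcsum f l = lcsum f l'.
Proof. induction 1; simpl; [reflexivity|rewrite IHPermutation; reflexivity|ring|congruence]. Qed.

Lemma lsum_map {A B : Type} (g : A -> B) (f : B -> R) (l : list A) : lsum f (map g l) = lsum (fun a => f (g a)) l.
Proof. induction l; simpl; [reflexivity|]. lra. Qed.

Lemma lcsum_map {A B : Type} (g : A -> B) (f : B -> C) (l : list A) : lcsum f (map g l) = lcsum (fun a => f (g a)) l.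
Proof. induction l; simpl; [reflexivity|]. rewrite IHl; reflexivity. Qed.

Lemma lsum_ext {A : Type} (f g : A -> R) (l : list A) : (forall a, In a l -> f a = g a) -> lsum f l = lsum g l.
Proof. induction l; simpl; intros H; [reflexivity|]. rewrite IHl, H; auto. Qed.

Lemma lcsum_ext {A : Type} (f g : A -> C) (l : list A) : (forall a, In a l -> f a = g a) -> lcsum f l = lcsum g l.
Proof. induction l; simpl; intros H; [reflexivity|]. rewrite IHl, H; auto. Qed.

Lemma lsum_le {A : Type} (f g : A -> R) (l : list A) : (forall a, In a l -> f a <= g a) -> lsum f l <= lsum g l.
Proof. induction l; simpl; intros H; [lra|]. apply Rplus_le_compat; [apply H; auto|apply IHl; auto]. Qed.

Lemma lsum_plus {A : Type} (f g : A -> R) (l : list A) : lsum (fun a => f a + g a) l = lsum f l + lsum g l.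
Proof. induction l; simpl; [ring|]. lra. Qed.

Lemma lsum_scal {A : Type} (c : R) (f : A -> R) (l : list A) : lsum (fun a => c*f a) l = c*lsum f l.
Proof. induction l; simpl; [ring|]. lra. Qed.

Lemma lsum_const {A : Type} (c : R) (l : list A) : lsum (fun _ => c) l = INR (length l)*c.
Proof. induction l; simpl length; [simpl; ring|]. rewrite S_INR. simpl lsum. lra. Qed.

Lemma Re_lcsum {A : Type} (f : A -> C) (l : list A) : Re (lcsum f l) = lsum (fun a => Re (f a)) l.
Proof. induction l; simpl; [reflexivity|]. rewrite <- IHl. reflexivity. Qed.

Lemma lcsum_app {A : Type} (f : A -> C) (l l' : list A) : lcsum f (l ++ l') = (lcsum f l + lcsum f l')%C.
Proof. induction l; simpl; [ring|]. rewrite IHl; ring. Qed.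

Lemma lsum_rsum_swap {A : Type} (f : nat -> A -> R) (l : list A) (N : nat) :
  lsum (fun a => rsum (fun n => f n a) N) l = rsum (fun n => lsum (f n) l) N.
Proof.
  induction l; simpl; [induction N; simpl; [reflexivity|rewrite <- IHN; ring]|]. rewrite IHl, <- rsum_plus. reflexivity.
Qed.

Lemma csum_lcsum (f : nat -> C) (N : nat) : csum f N = lcsum f (seq 1 N).
Proof.
  induction N; [reflexivity|]. rewrite seq_S, lcsum_app, <- IHN. simpl. ring.
Qed.

(** For the quadratic character: at most one entry of the list is charged with the weaker bound
    [B]. *)
Lemma lsum_unique_le {A : Type} (P : A -> Prop) (l : list A) (B : R) : 0 <= B -> NoDup l ->
  (forall a b, In a l -> In b l -> P a -> P b -> a = b) ->
  lsum (fun a => if excluded_middle_informative (P a) then B else 0) l <= B.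
Proof.
  intros HB Hn. induction Hn as [|a l Ha Hn IH]; intros Hu; simpl; [exact HB|].
  destruct (excluded_middle_informative (P a)) as [Pa|Pa].
  - assert (E : lsum (fun a => if excluded_middle_informative (P a) then B else 0) l = lsum (fun _ => 0) l).
    { apply lsum_ext. intros b Hb. destruct (excluded_middle_informative (P b)) as [Pb|]; [|reflexivity].
      exfalso. apply Ha. rewrite (Hu a b); simpl; auto. }
    rewrite E, lsum_const. lra.
  - rewrite Rplus_0_l. apply IH. intros x y Hx Hy. apply Hu; simpl; auto.
Qed.

Definition unity (m a : nat) : C := cexp (0, 2*PI*INR a/INR m).

Lemma unity_0 (m : nat) : unity m 0 = 1%C.
Proof. unfold unity. simpl INR. replace (2*PI*0/INR m) with 0 by (unfold Rdiv; ring). apply cexp_0. Qed.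

Lemma unity_add (m a b : nat) : unity m (a + b) = (unity m a*unity m b)%C.
Proof.
  unfold unity. rewrite <- cexp_plus. f_equal. rewrite plus_INR. apply C_ext; unfold Re, Im; simpl; unfold Rdiv; ring.
Qed.

Lemma unity_pow (m a k : nat) : Cpow (unity m a) k = unity m (a*k).
Proof.
  induction k; simpl; [rewrite Nat.mul_0_r, unity_0; reflexivity|].
  rewrite IHk. replace (a*S k)%nat with (a+a*k)%nat by lia. rewrite unity_add. reflexivity.
Qed.

Lemma unity_eq_1 (m a : nat) : (0 < m)%nat -> unity m a = 1%C <-> (a mod m = 0)%nat.
Proof.
  intros Hm. pose proof (lt_0_INR m Hm) as Hm'. pose proof PI_RGT_0.
  assert (F : forall k, unity m (m*k) = 1%C).
  { intros k. unfold unity. rewrite mult_INR. replace (2*PI*(INR m*INR k)/INR m) with (0+2*INR k*PI) by (field; lra).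
    apply C_ext; unfold cexp, Re, Im; simpl; rewrite ?cos_period, ?sin_period, exp_0, ?cos_0, ?sin_0; ring. }
  split.
  - intros E. set (r := (a mod m)%nat). assert (Hr : (r < m)%nat) by (apply Nat.mod_upper_bound; lia).
    assert (Er : unity m r = 1%C).
    { rewrite (Nat.div_mod a m) in E by lia. rewrite unity_add, F, Cmult_1_l in E. exact E. }
    unfold unity, cexp in Er. unfold Re, Im in Er; simpl in Er. rewrite exp_0 in Er. injection Er as E1 E2.
    set (x := 2*PI*INR r/INR m) in *.
    assert (Hs : sin (x/2) = 0).
    { replace x with (2*(x/2)) in E1 by field. rewrite cos_2a_sin in E1. nra. }
    destruct (Nat.eq_dec r 0) as [|Hr0]; [assumption|exfalso].
    assert (0 < INR r) by (apply lt_0_INR; lia). assert (INR r < INR m) by (apply lt_INR; lia).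
    assert (0 < sin (x/2)); [|lra]. apply sin_gt_0.
    + unfold x. replace (2*PI*INR r/INR m/2) with (PI*(INR r/INR m)) by (field; lra).
      apply Rmult_lt_0_compat; [lra|div_pos].
    + unfold x. replace (2*PI*INR r/INR m/2) with (PI*(INR r/INR m)) by (field; lra).
      rewrite <- (Rmult_1_r PI) at 2. apply Rmult_lt_compat_l; [lra|]. apply Rmult_lt_reg_r with (INR m); [lra|]. field_simplify; lra.
  - intros E. rewrite (Nat.div_mod a m) by lia. rewrite E, Nat.add_0_r. apply F.
Qed.

Lemma unity_mod (m a b : nat) : (0 < m)%nat -> (a mod m = b mod m)%nat -> unity m a = unity m b.
Proof.
  intros Hm E. rewrite (Nat.div_mod a m), (Nat.div_mod b m) by lia. rewrite E, !unity_add.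
  assert (F : forall k, unity m (m*k) = 1%C). { intros k. apply unity_eq_1; [assumption|]. rewrite Nat.mul_comm. apply Nat.Div0.mod_mul. }
  rewrite !F. reflexivity.
Qed.

Lemma Cmod_unity (m a : nat) : Cmod (unity m a) = 1.
Proof. unfold unity. rewrite Cmod_cexp. apply exp_0. Qed.

Lemma unity_neq_0 (m a : nat) : unity m a <> 0%C.
Proof. apply cexp_neq_0. Qed.

(** As [|w| = 1], one has [w = exp (i al)], where the sign of [Im w] decides between the two angles
    with cosine [Re w]. Then [m al = 2 pi k] for an integer [k], and [j] is [k] reduced modulo
    [m]. *)
Lemma root_of_unity_classification (m : nat) (w : C) : (0 < m)%nat -> Cpow w m = 1%C -> exists j, (j < m)%nat /\ w = unity m j.
Proof.
  intros Hm E. pose proof (lt_0_INR m Hm) as Hm'.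
  assert (Hw : Cmod w = 1).
  { assert (H : Cmod w ^ m = 1) by (rewrite <- Cmod_pow, E; apply Cmod_1).
    pose proof (Cmod_ge_0 w). destruct (Rtotal_order (Cmod w) 1) as [L|[L|L]]; [|exact L|]; exfalso.
    - assert (Cmod w ^ m < 1); [|lra]. destruct m; [lia|]. simpl. 
      assert (Cmod w ^ m <= 1). { rewrite <- (pow1 m). apply pow_incr; lra. }
      nra.
    - assert (1 < Cmod w ^ m); [|lra]. apply Rlt_pow_R1; assumption. }
  assert (Hang : exists al, w = cexp (0, al)).
  { pose proof (Cmod_sqr w) as S. rewrite Hw in S.
    assert (Hr : -1 <= Re w <= 1) by (split; nra).
    assert (Hsin : sin (acos (Re w)) = Rabs (Im w)).
    { rewrite sin_acos by lra. rewrite <- sqrt_Rsqr_abs. f_equal. unfold Rsqr. lra. }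
    destruct (Rle_or_lt 0 (Im w)) as [Hi|Hi].
    - exists (acos (Re w)). change (w = (exp 0*cos (acos (Re w)), exp 0*sin (acos (Re w)))). rewrite exp_0, cos_acos, Hsin, Rabs_right by lra.
      C_ring.
    - exists (- acos (Re w)). change (w = (exp 0*cos (- acos (Re w)), exp 0*sin (- acos (Re w)))). rewrite exp_0, cos_neg, sin_neg, cos_acos, Hsin, Rabs_left by lra.
      C_ring. }
  destruct Hang as [al ->].
  assert (P : forall k, Cpow (cexp (0, al)) k = cexp (0, INR k*al)).
  { induction k; [simpl; rewrite Rmult_0_l; symmetry; apply cexp_0|]. rewrite S_INR. simpl Cpow. rewrite IHk, <- cexp_plus. f_equal.
    C_ring. }
  rewrite P in E. set (x := INR m*al) in *.
  assert (Hs : sin (x/2) = 0).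
  { injection E as E1 E2. rewrite exp_0 in E1.
    replace x with (2*(x/2)) in E1 by field. rewrite cos_2a_sin in E1. nra. }
  apply sin_eq_0_0 in Hs. destruct Hs as [k Hk].
  set (j := Z.to_nat (k mod Z.of_nat m)).
  assert (Hmz : (0 < Z.of_nat m)%Z) by lia. pose proof (Z.mod_pos_bound k _ Hmz) as Hb.
  exists j. split; [unfold j; lia|].
  assert (Hj : INR j = IZR k-INR m*IZR (k/Z.of_nat m)).
  { unfold j. rewrite (INR_IZR_INZ (Z.to_nat (k mod Z.of_nat m))), Z2Nat.id by lia. rewrite Z.mod_eq by lia. rewrite minus_IZR, mult_IZR, <- INR_IZR_INZ. reflexivity. } assert (Ea : al = 2*PI*INR j/INR m+2*IZR (k/Z.of_nat m)*PI).
  { rewrite Hj. apply Rmult_eq_reg_l with (INR m); [|lra]. fold x. replace x with (2*(x/2)) by field. rewrite Hk. field. lra. }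
  rewrite Ea. apply C_ext; unfold cexp, Re, Im; simpl.
  - f_equal. set (z := (k/Z.of_nat m)%Z). destruct (Z_le_gt_dec 0 z) as [Hz|Hz].
    + replace (IZR z) with (INR (Z.to_nat z)) by (rewrite INR_IZR_INZ, Z2Nat.id; auto). apply cos_period.
    + rewrite <- (cos_period _ (Z.to_nat (- z))). rewrite (INR_IZR_INZ (Z.to_nat (- z))), Z2Nat.id, opp_IZR by lia. f_equal. ring.
  - f_equal. set (z := (k/Z.of_nat m)%Z). destruct (Z_le_gt_dec 0 z) as [Hz|Hz].
    + replace (IZR z) with (INR (Z.to_nat z)) by (rewrite INR_IZR_INZ, Z2Nat.id; auto). apply sin_period.
    + rewrite <- (sin_period _ (Z.to_nat (- z))). rewrite (INR_IZR_INZ (Z.to_nat (- z))), Z2Nat.id, opp_IZR by lia. f_equal. ring.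
Qed.

(** * Residues and Dirichlet characters modulo a prime *)

Lemma gcd_mod_eq (n m q : nat) : (n mod q = m mod q)%nat -> Nat.gcd n q = Nat.gcd m q.
Proof.
  intros E. destruct (Nat.eq_dec q 0) as [->|Hq]; [simpl in E; subst; reflexivity|].
  rewrite (Nat.gcd_comm n), (Nat.gcd_comm m). rewrite <- (Nat.gcd_mod n q), <- (Nat.gcd_mod m q) by assumption. auto.
Qed.

Lemma gcd_one_l (q : nat) : Nat.gcd 1 q = 1%nat.
Proof. auto. Qed.

Lemma nat_prime_gt1 (q : nat) : prime (Z.of_nat q) -> (1 < q)%nat.
Proof. intros [H _]. lia. Qed.

Lemma nat_prime_gcd_not_1 (q n : nat) : prime (Z.of_nat q) -> Nat.gcd n q <> 1%nat -> (n mod q = 0)%nat.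
Proof.
  intros Hp Hn. pose proof (nat_prime_gt1 q Hp).
  destruct (Nat.gcd_divide_l n q) as [k1 E1]. destruct (Nat.gcd_divide_r n q) as [k2 E2].
  assert (D : (Z.of_nat (Nat.gcd n q) | Z.of_nat q)%Z). { exists (Z.of_nat k2). lia. }
  destruct (prime_divisors _ Hp _ D) as [A|[A|[A|A]]]; try lia.
  assert (A' : Nat.gcd n q = q) by lia. rewrite A' in E1. rewrite E1. apply Nat.Div0.mod_mul.
Qed.

Lemma gcd_mul_coprime (q m n : nat) : Nat.gcd (m*n) q = 1%nat <-> Nat.gcd m q = 1%nat /\ Nat.gcd n q = 1%nat.
Proof.
  split.
  - split.
    + apply Nat.divide_1_r. rewrite <- H. apply Nat.gcd_greatest; [|apply Nat.gcd_divide_r].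
      apply Nat.divide_trans with m; [apply Nat.gcd_divide_l|]. exists n. lia.
    + apply Nat.divide_1_r. rewrite <- H. apply Nat.gcd_greatest; [|apply Nat.gcd_divide_r].
      apply Nat.divide_trans with n; [apply Nat.gcd_divide_l|]. exists m. lia.
  - intros [H1 H2]. set (d := Nat.gcd (m*n) q).
    assert (D1 : Nat.divide d (m*n)) by apply Nat.gcd_divide_l. assert (D2 : Nat.divide d q) by apply Nat.gcd_divide_r.
    assert (G : Nat.gcd d m = 1%nat).
    { apply Nat.divide_1_r. rewrite <- H1. apply Nat.gcd_greatest; [apply Nat.gcd_divide_r|].
      apply Nat.divide_trans with d; [apply Nat.gcd_divide_l|assumption]. }
    apply (Nat.gauss d m n D1) in G. apply Nat.divide_1_r. rewrite <- H2. apply Nat.gcd_greatest; assumption.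
Qed.

Section Periodic.
Variables (q : nat) (h : nat -> C).
Hypothesis Hq : (0 < q)%nat.
Hypothesis Hper : forall n, h (n + q)%nat = h n.

Lemma periodic_mul_add (n k : nat) : h (n + q*k)%nat = h n.
Proof.
  induction k; [f_equal; lia|]. replace (n+q*S k)%nat with ((n+q*k)+q)%nat by lia. rewrite Hper. exact IHk.
Qed.

Lemma periodic_mod (n : nat) : h (n mod q)%nat = h n.
Proof.
  rewrite <- (periodic_mul_add (n mod q) (n/q)). f_equal. rewrite Nat.add_comm. symmetry. apply Nat.div_mod. lia.
Qed.

Lemma csum_period_seq0 : csum h q = lcsum h (seq 0 q).
Proof.
  destruct q as [|p]; [lia|]. rewrite csum_lcsum. rewrite (seq_S p 1), lcsum_app. simpl lcsum.
  replace (h (S p)) with (h 0%nat); [ring|]. symmetry. apply (Hper 0).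
Qed.

(** Multiplication by [m] permutes the residue classes. *)
Lemma csum_reindex (m : nat) : Nat.gcd m q = 1%nat -> csum (fun a => h (a*m)%nat) q = csum h q.
Proof.
  intros Hm.
  assert (E0 : csum (fun a => h (a*m)%nat) q = lcsum (fun a => h (a*m)%nat) (seq 0 q)).
  { destruct q as [|p]; [lia|]. rewrite csum_lcsum. rewrite (seq_S p 1), lcsum_app. simpl lcsum.
    replace (h (m+p*m)%nat) with (h 0%nat); [ring|]. replace (m+p*m)%nat with (0+S p*m)%nat by lia.
    clear -Hper. induction m; [f_equal; lia|]. replace (0+S p*S m)%nat with ((0+S p*m)+S p)%nat by lia. rewrite Hper. exact IHm. }
  rewrite E0, csum_period_seq0.
  rewrite (lcsum_ext (fun a => h (a*m)%nat) (fun a => h ((a*m) mod q)%nat)) by (intros; symmetry; apply periodic_mod).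
  rewrite <- (lcsum_map (fun a => ((a*m) mod q)%nat) h). apply lcsum_perm.
  apply NoDup_Permutation_bis.
  - apply FinFun.Injective_map_NoDup_in; [|apply seq_NoDup].
    intros x y Hx Hy E. apply in_seq in Hx. apply in_seq in Hy.
    assert (W : forall a b, (a <= b)%nat -> (b < q)%nat -> ((a*m) mod q = (b*m) mod q)%nat -> a = b).
    { intros a b Hab Hb Em. assert (D : Nat.divide q ((b-a)*m)).
      { rewrite Nat.mul_sub_distr_r. exists (b*m/q-a*m/q)%nat.
        rewrite (Nat.div_mod (b*m) q) at 1 by lia. rewrite (Nat.div_mod (a*m) q) at 1 by lia.
        rewrite Nat.mul_sub_distr_r. lia. }
      rewrite Nat.mul_comm in D. apply Nat.gauss in D; [|rewrite Nat.gcd_comm; exact Hm].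
      destruct D as [k Ek]. destruct k; [lia|]. lia. }
    destruct (Nat.le_gt_cases x y); [apply W; lia|symmetry; apply W; lia].
  - rewrite length_map. lia.
  - intros x Hx. apply in_map_iff in Hx. destruct Hx as [a [<- Ha]]. apply in_seq. split; [lia|].
    apply Nat.mod_upper_bound. lia.
Qed.

(** Whole periods cancel, and fewer than [q] terms of modulus at most 1 remain. *)
Lemma csum_period_bound : csum h q = 0%C -> (forall n, Cmod (h n) <= 1) -> forall N, Cmod (csum h N) <= INR q.
Proof.
  intros H0 H1 N.
  assert (Z : forall k, csum h (q*k) = 0%C).
  { induction k; [rewrite Nat.mul_0_r; reflexivity|]. replace (q*S k)%nat with (q*k+q)%nat by lia. rewrite csum_app, IHk.
    rewrite (csum_ext _ h) by (intros n _; rewrite (Nat.add_comm (q*k)); apply periodic_mul_add). rewrite H0. ring. }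
  rewrite (Nat.div_mod N q) by lia. rewrite csum_app, Z, Cplus_0_l.
  le_via Cmod_csum_le. apply Rle_trans with (rsum (fun _ => 1) (N mod q)).
  - apply rsum_le. auto.
  - assert (E : forall n, rsum (fun _ => 1) n = INR n). { induction n; [reflexivity|]. rewrite S_INR. simpl rsum. lra. }
    rewrite E. apply le_INR. pose proof (Nat.mod_upper_bound N q). lia.
Qed.
End Periodic.

Section Characters.
Variable q : nat.
Hypothesis Hp : prime (Z.of_nat q).

Lemma dchar_pow (chi : nat -> C) (g k : nat) : is_dchar q chi -> chi (g ^ k)%nat = Cpow (chi g) k.
Proof.
  intros [Hm [_ [_ H1]]]. induction k; [exact H1|]. simpl. rewrite Hm, IHk. reflexivity.
Qed.

Lemma dchar_mod_eq (chi : nat -> C) (m n : nat) : is_dchar q chi -> (m mod q = n mod q)%nat -> chi m = chi n.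
Proof.
  intros [_ [Hper _]] E. pose proof (nat_prime_gt1 q Hp).
  rewrite <- (periodic_mod q chi ltac:(lia) Hper m), <- (periodic_mod q chi ltac:(lia) Hper n). auto.
Qed.

Lemma dchar_generator (chi : nat -> C) (g : nat) : is_dchar q chi ->
  (forall i j, (g ^ i mod q)%nat = (g ^ j mod q)%nat <-> (i mod (q - 1))%nat = (j mod (q - 1))%nat) ->
  Cpow (chi g) (q - 1) = 1%C.
Proof.
  intros Hc Hg. rewrite <- (dchar_pow chi g (q-1) Hc). destruct Hc as [Hm [Hper [H0 H1]]]. rewrite <- H1.
  apply dchar_mod_eq; [repeat split; auto; apply H0|].
  change 1%nat with (g ^ 0)%nat at 2. apply Hg. rewrite Nat.Div0.mod_same. symmetry. apply Nat.Div0.mod_0_l.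
Qed.

Lemma dchar_mod_1 (chi : nat -> C) (n : nat) : is_dchar q chi -> Nat.gcd n q = 1%nat -> Cmod (chi n) = 1.
Proof.
  intros Hc Hn. destruct (exists_generator q Hp) as [g [_ [Hg1 Hg2]]]. pose proof (nat_prime_gt1 q Hp).
  destruct (root_of_unity_classification (q-1) (chi g)) as [j [_ Hj]]; [lia|apply dchar_generator; assumption|].
  destruct (Hg1 n Hn) as [k [_ Hk]]. rewrite (dchar_mod_eq chi n (g ^ k) Hc Hk), dchar_pow, Cmod_pow, Hj, Cmod_unity by assumption.
  apply pow1.
Qed.

Lemma dchar_mod_le_1 (chi : nat -> C) (n : nat) : is_dchar q chi -> Cmod (chi n) <= 1.
Proof.
  intros Hc. destruct (Nat.eq_dec (Nat.gcd n q) 1) as [E|E]; [rewrite dchar_mod_1; auto; lra|].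
  destruct Hc as [_ [_ [H0 _]]]. apply H0 in E. rewrite E, Cmod_0. lra.
Qed.

Lemma principal_is_dchar : is_dchar q (principal_char q).
Proof.
  unfold principal_char. split; [|split; [|split]].
  - intros m n. destruct (Nat.eqb_spec (Nat.gcd (m*n) q) 1) as [E|E].
    + apply gcd_mul_coprime in E. destruct E as [-> ->]. simpl. ring.
    + destruct (Nat.eqb_spec (Nat.gcd m q) 1) as [E1|E1]; [|ring]. destruct (Nat.eqb_spec (Nat.gcd n q) 1) as [E2|E2]; [|ring].
      exfalso. apply E. apply gcd_mul_coprime. auto.
  - intros n. rewrite (gcd_mod_eq (n+q) n q); [reflexivity|]. rewrite <- (Nat.mul_1_l q) at 1. apply Nat.Div0.mod_add.
  - intros n. destruct (Nat.eqb_spec (Nat.gcd n q) 1) as [E|E]; split; intros H; auto; [|contradiction]. apply C1_nz in H. contradiction.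
  - reflexivity.
Qed.

Lemma dchar_ext (chi psi : nat -> C) : is_dchar q chi -> is_dchar q psi ->
  (forall n, Nat.gcd n q = 1%nat -> chi n = psi n) -> chi = psi.
Proof.
  intros [_ [_ [H0 _]]] [_ [_ [H1 _]]] E. apply functional_extensionality. intros n.
  destruct (Nat.eq_dec (Nat.gcd n q) 1) as [G|G]; [apply E; exact G|].
  rewrite (proj2 (H0 n) G), (proj2 (H1 n) G). reflexivity.
Qed.

Lemma nonprincipal_witness (chi : nat -> C) : nonprincipal_char q chi -> exists b, Nat.gcd b q = 1%nat /\ chi b <> 1%C.
Proof.
  intros [Hc Hn]. apply NNPP. intros Hno. apply Hn. apply dchar_ext; [exact Hc|apply principal_is_dchar|].
  intros n Gn. unfold principal_char. rewrite (proj2 (Nat.eqb_eq _ _) Gn). apply NNPP. intros E. apply Hno. exists n; auto.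
Qed.

(** Multiplying the sum by some [chi b <> 1] only permutes its terms. *)
Lemma nonprincipal_sum_0 (chi : nat -> C) : nonprincipal_char q chi -> csum chi q = 0%C.
Proof.
  intros Hc. destruct (nonprincipal_witness chi Hc) as [b [Gb Hb]]. destruct Hc as [[Hm [Hper [H0 H1]]] _].
  pose proof (nat_prime_gt1 q Hp).
  pose proof (csum_reindex q chi ltac:(lia) Hper b Gb) as E.
  rewrite (csum_ext _ (fun a => chi b*chi a)%C) in E by (intros; rewrite Hm; ring). rewrite csum_scal in E.
  assert (E2 : ((chi b-1)*csum chi q = 0)%C). { replace ((chi b-1)*csum chi q)%C with (chi b*csum chi q-csum chi q)%C by ring. rewrite E. ring. }
  destruct (classic (csum chi q = 0%C)) as [Z|Z]; [exact Z|exfalso]. revert E2. apply Cmult_neq_0; [|exact Z].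
  intros E3. apply Hb. replace (chi b) with ((chi b-1)+1)%C by ring. rewrite E3. ring.
Qed.

Lemma nonprincipal_partial_sums (chi : nat -> C) : nonprincipal_char q chi -> forall N, Cmod (csum chi N) <= INR q.
Proof.
  intros Hc. pose proof (nat_prime_gt1 q Hp). apply csum_period_bound; [lia|apply Hc|apply nonprincipal_sum_0; exact Hc|].
  intros n. apply dchar_mod_le_1. apply Hc.
Qed.

Definition conj_char (chi : nat -> C) (n : nat) : C := Cconj (chi n).

Lemma Cconj_eq_0 (z : C) : Cconj z = 0%C <-> z = 0%C.
Proof.
  split; intros H; [rewrite <- (Cconj_conj z), H|rewrite H]; apply C_ext; simpl; ring.
Qed.

Lemma conj_is_dchar (chi : nat -> C) : is_dchar q chi -> is_dchar q (conj_char chi).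
Proof.
  intros [Hm [Hper [H0 H1]]]. unfold conj_char. split; [|split; [|split]].
  - intros m n. rewrite Hm. apply Cmult_conj.
  - intros n. rewrite Hper. reflexivity.
  - intros n. rewrite Cconj_eq_0. apply H0.
  - rewrite H1. apply C_ext; simpl; ring.
Qed.

Lemma conj_char_invol (chi : nat -> C) : conj_char (conj_char chi) = chi.
Proof. apply functional_extensionality. intros n. apply Cconj_conj. Qed.

Lemma conj_principal : conj_char (principal_char q) = principal_char q.
Proof.
  apply functional_extensionality. intros n. unfold conj_char, principal_char. destruct (Nat.eqb _ _); apply C_ext; simpl; ring.
Qed.

Lemma conj_nonprincipal (chi : nat -> C) : nonprincipal_char q chi -> nonprincipal_char q (conj_char chi).
Proof.
  intros [Hc Hn]. split; [apply conj_is_dchar; exact Hc|]. intros E. apply Hn.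
  rewrite <- (conj_char_invol chi), E. apply conj_principal.
Qed.

Lemma conj_char_perm (l : list (nat -> C)) : enum_nonprincipal q l -> Permutation (map conj_char l) l.
Proof.
  intros [Hnd Hin]. apply NoDup_Permutation; [|exact Hnd|].
  - apply FinFun.Injective_map_NoDup; [|exact Hnd]. intros a b E. rewrite <- (conj_char_invol a), E. apply conj_char_invol.
  - intros chi. rewrite in_map_iff. split.
    + intros [psi [<- H]]. apply Hin. apply conj_nonprincipal. apply Hin. exact H.
    + exists (conj_char chi). split; [apply conj_char_invol|]. apply Hin. apply conj_nonprincipal. apply Hin. exact H.
Qed.

Definition sqr_char (chi : nat -> C) (n : nat) : C := (chi n*chi n)%C.

Lemma sqr_is_dchar (chi : nat -> C) : is_dchar q chi -> is_dchar q (sqr_char chi).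
Proof.
  intros [Hm [Hper [H0 H1]]]. unfold sqr_char. split; [|split; [|split]].
  - intros m n. rewrite Hm. ring.
  - intros n. rewrite Hper. reflexivity.
  - intros n. rewrite <- H0. split; intros H; [|rewrite H; ring].
    apply NNPP. intros Hn. revert H. apply Cmult_neq_0; exact Hn.
  - rewrite H1. ring.
Qed.

(** The value at a generator is a square root of 1. The value 1 would make the character principal,
    so it is -1, and this determines the character. *)
Lemma quadratic_unique (chi psi : nat -> C) : nonprincipal_char q chi -> nonprincipal_char q psi ->
  sqr_char chi = principal_char q -> sqr_char psi = principal_char q -> chi = psi.
Proof.
  intros Hc Hs E1 E2. destruct (exists_generator q Hp) as [g [Gg [Hg1 Hg2]]].
  assert (A : forall chi, nonprincipal_char q chi -> sqr_char chi = principal_char q -> chi g = Copp 1).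
  { intros c Hnc Ec. assert (E : (c g*c g = 1)%C).
    { change (sqr_char c g = 1%C). rewrite Ec. unfold principal_char. rewrite (proj2 (Nat.eqb_eq _ _) Gg). reflexivity. }
    assert (F : ((c g-1)*(c g+1) = 0)%C). { replace ((c g-1)*(c g+1))%C with (c g*c g-1)%C by ring. rewrite E. ring. }
    destruct (classic ((c g+1)%C = 0%C)) as [Z|Z]; [replace (c g) with ((c g+1)-1)%C by ring; rewrite Z; ring|].
    exfalso. destruct (classic ((c g-1)%C = 0%C)) as [Z2|Z2]; [|revert F; apply Cmult_neq_0; assumption].
    assert (Z3 : c g = 1%C) by (replace (c g) with ((c g-1)+1)%C by ring; rewrite Z2; ring).
    apply (proj2 Hnc). apply dchar_ext; [apply Hnc|apply principal_is_dchar|]. intros n Gn.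
    destruct (Hg1 n Gn) as [k [_ Hk]]. rewrite (dchar_mod_eq c n (g ^ k)), dchar_pow, Z3; try apply Hnc; auto.
    unfold principal_char. rewrite (proj2 (Nat.eqb_eq _ _) Gn). clear. induction k; simpl; [reflexivity|]. rewrite IHk. ring. }
  apply dchar_ext; [apply Hc|apply Hs|]. intros n Gn. destruct (Hg1 n Gn) as [k [_ Hk]].
  rewrite (dchar_mod_eq chi n (g ^ k)), (dchar_mod_eq psi n (g ^ k)); try apply Hc; try apply Hs; auto.
  rewrite !dchar_pow, !A; try apply Hc; try apply Hs; auto.
Qed.

Lemma geometric_unity (m k : nat) : (0 < m)%nat -> (k mod m <> 0)%nat -> lcsum (fun j => unity m (j*k)) (seq 0 m) = 0%C.
Proof.
  intros Hm Hk.
  assert (G : forall N, ((unity m k-1)*lcsum (fun j => unity m (j*k)) (seq 0 N) = unity m (N*k)-1)%C).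
  { induction N; [simpl; rewrite unity_0; ring|]. rewrite seq_S, lcsum_app. simpl lcsum.
    replace (unity m (S N*k)) with (unity m k*unity m (N*k))%C by (rewrite <- unity_add; reflexivity).
    replace ((unity m k-1)*(lcsum (fun j : nat => unity m (j*k)) (seq 0 N)+(unity m (N*k)+0)))%C with
      ((unity m k-1)*lcsum (fun j : nat => unity m (j*k)) (seq 0 N)+(unity m k-1)*unity m (N*k))%C by ring.
    rewrite IHN. ring. }
  specialize (G m). rewrite (proj2 (unity_eq_1 m (m*k) Hm)) in G by (rewrite Nat.mul_comm; apply Nat.Div0.mod_mul).
  apply NNPP. intros Z. assert (G0 : ((unity m k-1)*lcsum (fun j : nat => unity m (j*k)) (seq 0 m) = 0)%C) by (rewrite G; ring).
  revert G0. apply Cmult_neq_0; [|exact Z]. intros E. apply Hk. apply unity_eq_1; [exact Hm|].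
  replace (unity m k) with ((unity m k-1)+1)%C by ring. rewrite E. ring.
Qed.

(** The characters are [n -> unity (q - 1) (j ind n)] with [ind] the discrete logarithm. There are
    no others, because the value at the generator is a root of unity of order dividing [q - 1]; the
    index [j = 0] is the principal one. *)
Lemma exists_enum_nonprincipal : exists l0, enum_nonprincipal q l0 /\ length l0 = (q - 2)%nat /\
  forall n, Nat.gcd n q = 1%nat -> lcsum (fun chi => chi n) l0 = if Nat.eq_dec (n mod q) 1 then RtoC (INR (q - 2)) else (- (1))%C.
Proof.
  destruct (exists_generator q Hp) as [g [Gg [Hg1 Hg2]]]. pose proof (nat_prime_gt1 q Hp) as Hq.
  set (m := (q-1)%nat) in *. assert (Hm : (0 < m)%nat) by lia.
  (* The discrete logarithm, meaningful for [n] prime to [q] and then determined modulo [q - 1]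
     only; this suffices, since it is used inside [unity m]. *)
  set (ind := fun n => epsilon (inhabits 0%nat) (fun k => (n mod q = g ^ k mod q)%nat)).
  assert (Hind : forall n, Nat.gcd n q = 1%nat -> (n mod q = g ^ ind n mod q)%nat).
  { intros n Gn. apply epsilon_spec. destruct (Hg1 n Gn) as [k [_ Hk]]. exists k; exact Hk. }
  set (ch := fun j n => if Nat.eqb (Nat.gcd n q) 1 then unity m (j*ind n) else 0%C).
  assert (Hch1 : forall j n, Nat.gcd n q = 1%nat -> ch j n = unity m (j*ind n)).
  { intros j n Gn. unfold ch. rewrite (proj2 (Nat.eqb_eq _ _) Gn). reflexivity. }
  assert (Hidx : forall n k, Nat.gcd n q = 1%nat -> (n mod q = g ^ k mod q)%nat -> (ind n mod m = k mod m)%nat).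
  { intros n k Gn Hk. apply Hg2. rewrite <- (Hind n Gn). exact Hk. }
  assert (Umul : forall j a b, (a mod m = b mod m)%nat -> unity m (j*a) = unity m (j*b)).
  { intros j a b E. apply unity_mod; [exact Hm|]. rewrite (Nat.Div0.mul_mod j a), (Nat.Div0.mul_mod j b), E. reflexivity. }
  assert (Hdc : forall j, is_dchar q (ch j)).
  { split; [|split; [|split]].
    - intros a b. destruct (Nat.eq_dec (Nat.gcd (a*b) q) 1) as [E|E].
      + pose proof E as E'. apply gcd_mul_coprime in E'. destruct E' as [Ea Eb]. rewrite !Hch1 by assumption. rewrite <- unity_add, <- Nat.mul_add_distr_l.
        apply Umul. apply Hidx; [exact E|]. rewrite Nat.pow_add_r, (Nat.Div0.mul_mod a b), (Nat.Div0.mul_mod (g ^ ind a)).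
        auto.
      + unfold ch. rewrite (proj2 (Nat.eqb_neq _ _) E). destruct (Nat.eqb_spec (Nat.gcd a q) 1) as [E1|E1]; [|ring].
        destruct (Nat.eqb_spec (Nat.gcd b q) 1) as [E2|E2]; [|ring]. exfalso. apply E. apply gcd_mul_coprime; auto.
    - intros n. assert (E : ((n+q) mod q = n mod q)%nat) by (rewrite <- (Nat.mul_1_l q) at 1; apply Nat.Div0.mod_add).
      destruct (Nat.eq_dec (Nat.gcd n q) 1) as [Gn|Gn].
      + rewrite !Hch1; [|assumption|rewrite (gcd_mod_eq _ _ _ E); assumption]. apply Umul.
        apply Hidx; [rewrite (gcd_mod_eq _ _ _ E); assumption|]. rewrite E. auto.
      + unfold ch. rewrite (gcd_mod_eq _ _ _ E). rewrite (proj2 (Nat.eqb_neq _ _) Gn). reflexivity.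
    - intros n. unfold ch. destruct (Nat.eqb_spec (Nat.gcd n q) 1) as [E|E]; split; intros H; auto; [|contradiction].
      exfalso. revert H. apply unity_neq_0.
    - apply unity_eq_1; [exact Hm|].
      rewrite Nat.Div0.mul_mod, (Hidx 1%nat 0%nat), Nat.Div0.mod_0_l, Nat.mul_0_r; [apply Nat.Div0.mod_0_l|apply gcd_one_l|reflexivity]. }
  assert (Hgj : forall j, ch j g = unity m j).
  { intros j. rewrite Hch1 by exact Gg. rewrite (Umul j (ind g) 1%nat); [f_equal; lia|]. apply Hidx; [exact Gg|]. f_equal. simpl. lia. }
  assert (Hinj : forall i j, (i < m)%nat -> (j < m)%nat -> ch i = ch j -> i = j).
  { assert (W : forall i j, (i <= j)%nat -> (j < m)%nat -> ch i = ch j -> i = j).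
    { intros i j Hij Hj E. assert (Eg : ch i g = ch j g) by (rewrite E; reflexivity). rewrite !Hgj in Eg.
      replace j with (i+(j-i))%nat in Eg by lia. rewrite unity_add in Eg.
      assert (U : unity m (j-i) = 1%C).
      { replace (unity m (j-i)) with (/ unity m i*(unity m i*unity m (j-i)))%C by (field; apply unity_neq_0).
        rewrite <- Eg. field. apply unity_neq_0. }
      apply unity_eq_1 in U; [|exact Hm]. rewrite Nat.mod_small in U by lia. lia. }
    intros i j Hi Hj E. destruct (Nat.le_gt_cases i j); [apply W; auto|symmetry; apply W; auto; lia]. }
  assert (Hpr : ch 0%nat = principal_char q).
  { apply dchar_ext; [apply Hdc|apply principal_is_dchar|]. intros n Gn. rewrite Hch1 by exact Gn. unfold principal_char.
    rewrite (proj2 (Nat.eqb_eq _ _) Gn). apply unity_0. }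
  exists (map ch (seq 1 (m-1))). split; [split|split].
  - apply FinFun.Injective_map_NoDup_in; [|apply seq_NoDup]. intros x y Hx Hy. apply in_seq in Hx. apply in_seq in Hy. apply Hinj; lia.
  - intros chi. rewrite in_map_iff. split.
    + intros [j [<- Hj]]. apply in_seq in Hj. split; [apply Hdc|]. rewrite <- Hpr. intros E. apply Hinj in E; lia.
    + intros [Hc Hn]. destruct (root_of_unity_classification m (chi g) Hm) as [j [Hj Ej]].
      { apply dchar_generator; [exact Hc|exact Hg2]. }
      assert (E : ch j = chi).
      { apply dchar_ext; [apply Hdc|exact Hc|]. intros n Gn. rewrite Hch1 by exact Gn.
        rewrite (dchar_mod_eq chi n (g ^ ind n) Hc (Hind n Gn)), dchar_pow, Ej, unity_pow by exact Hc. reflexivity. }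
      exists j. split; [exact E|]. apply in_seq. destruct j; [|lia]. exfalso. apply Hn. rewrite <- E. exact Hpr.
  - rewrite length_map, length_seq. lia.
  - intros n Gn. rewrite lcsum_map.
    rewrite (lcsum_ext _ (fun j => unity m (j*ind n))) by (intros; apply Hch1; exact Gn).
    destruct (Nat.eq_dec (n mod q) 1) as [E|E].
    + assert (Ei : (ind n mod m = 0)%nat).
      { rewrite (Hidx n 0%nat Gn); [apply Nat.Div0.mod_0_l|]. rewrite E. symmetry. apply Nat.mod_small. lia. }
      rewrite (lcsum_ext _ (fun _ => 1%C)).
      * replace (q-2)%nat with (length (seq 1 (m-1))) by (rewrite length_seq; unfold m; lia).
        induction (seq 1 (m-1)); [reflexivity|]. simpl length. rewrite S_INR. simpl lcsum. rewrite IHl, RtoC_plus. ring.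
      * intros j _. apply unity_eq_1; [exact Hm|]. rewrite Nat.Div0.mul_mod, Ei, Nat.mul_0_r. apply Nat.Div0.mod_0_l.
    + assert (Ei : (ind n mod m <> 0)%nat).
      { intros Ei. apply E. rewrite (Hind n Gn). rewrite (proj2 (Hg2 (ind n) 0%nat)); [simpl; apply Nat.mod_small; lia|].
        rewrite Ei. symmetry. apply Nat.Div0.mod_0_l. }
      (* The geometric sum over all [j < q - 1] vanishes and its term at [j = 0] is 1, so the
         nonprincipal characters contribute -1. *)
      pose proof (geometric_unity m (ind n) Hm Ei) as G. destruct m as [|m']; [lia|]. simpl lcsum in G. rewrite unity_0 in G. simpl Nat.sub. rewrite Nat.sub_0_r.
      replace (lcsum (fun j : nat => unity (S m') (j*ind n)) (seq 1 m')) with ((1+lcsum (fun j : nat => unity (S m') (j*ind n)) (seq 1 m'))-1)%C by ring.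
      unfold lcsum at 1. unfold lcsum in G. rewrite G. ring.
Qed.

Lemma enum_nonprincipal_length (l : list (nat -> C)) : enum_nonprincipal q l -> length l = (q - 2)%nat.
Proof.
  intros [H1 H2]. destruct exists_enum_nonprincipal as [l0 [[H3 H4] [H5 _]]]. rewrite <- H5. apply Permutation_length.
  apply NoDup_Permutation; auto. intros x. rewrite H2, H4. reflexivity.
Qed.

(** Any two enumerations are permutations of each other. The summand 1 on the right accounts for the
    missing principal character. *)
Lemma enum_nonprincipal_orthogonality (l : list (nat -> C)) (n : nat) : enum_nonprincipal q l ->
  Rabs (lsum (fun chi => Re (chi n)) l) <= (if Nat.eq_dec (n mod q) 1 then INR q else 0) + 1.
Proof.
  intros Hl. pose proof Hl as [H1 H2]. destruct exists_enum_nonprincipal as [l0 [[H3 H4] [H5 H6]]].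
  assert (P : Permutation l l0) by (apply NoDup_Permutation; auto; intros x; rewrite H2, H4; reflexivity).
  rewrite (lsum_perm _ _ _ P), <- (Re_lcsum (fun chi => chi n)).
  pose proof (pos_INR q).
  destruct (Nat.eq_dec (Nat.gcd n q) 1) as [Gn|Gn].
  - rewrite (H6 n Gn). destruct (Nat.eq_dec (n mod q) 1).
    + unfold Re, RtoC; simpl. pose proof (pos_INR (q-2)). rewrite Rabs_right by lra. assert (INR (q-2) <= INR q) by (apply le_INR; lia). lra.
    + unfold Re; simpl. rewrite Rabs_Ropp, Rabs_R1. lra.
  - rewrite (lcsum_ext _ (fun _ => 0%C)).
    + replace (lcsum (fun _ : nat -> C => 0%C) l0) with (RtoC 0) by (clear; induction l0; simpl; [reflexivity|rewrite <- IHl0; ring]).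
      unfold Re; simpl. rewrite Rabs_R0. destruct (Nat.eq_dec (n mod q) 1); lra.
    + intros chi Hc. apply H4 in Hc. destruct Hc as [[_ [_ [H0 _]]] _]. apply H0. exact Gn.
Qed.
End Characters.

(** * The von Mangoldt function and its convolution identity *)

Definition nprime (p : nat) : Prop := (1 < p)%nat /\ forall d, Nat.divide d p -> d = 1%nat \/ d = p.

Lemma nprime_coprime (p a : nat) : nprime p -> ~ Nat.divide p a -> Nat.gcd p a = 1%nat.
Proof.
  intros [H1 H2] H. destruct (H2 (Nat.gcd p a)) as [E|E]; [apply Nat.gcd_divide_l|exact E|].
  exfalso. apply H. rewrite <- E. apply Nat.gcd_divide_r.
Qed.

Lemma nprime_divides_pow (p r j : nat) : nprime p -> nprime r -> Nat.divide p (r ^ j) -> p = r.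
Proof.
  intros Hp Hr. induction j; intros H.
  - apply Nat.divide_1_r in H. destruct Hp; lia.
  - destruct (classic (Nat.divide p r)) as [D|D].
    + destruct Hr as [_ Hr]. destruct (Hr p D); [destruct Hp; lia|assumption].
    + apply IHj. apply (Nat.gauss p r); [exact H|]. apply nprime_coprime; assumption.
Qed.

Lemma exists_nprime_divisor (n : nat) : (1 < n)%nat -> exists p, nprime p /\ Nat.divide p n.
Proof.
  induction n as [n IH] using (well_founded_induction lt_wf). intros Hn.
  destruct (classic (nprime n)) as [H|H]; [exists n; split; [exact H|apply Nat.divide_refl]|].
  assert (exists d, Nat.divide d n /\ d <> 1%nat /\ d <> n) as [d [D [D1 D2]]].
  { apply NNPP. intros Hno. apply H. split; [exact Hn|]. intros d D. apply NNPP. intros Hd. apply Hno. exists d.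
    split; [exact D|]. lia. }
  pose proof (Nat.divide_pos_le d n ltac:(lia) D). assert (d <> 0%nat). { intros ->. apply Nat.divide_0_l in D. lia. }
  destruct (IH d ltac:(lia) ltac:(lia)) as [p [Hp Hpd]]. exists p. split; [exact Hp|]. apply Nat.divide_trans with d; assumption.
Qed.

(** The prime is picked by description; by [nprime_divides_pow] it does not depend on the choice. *)
Definition vonmangoldt (n : nat) : R :=
  match excluded_middle_informative (exists p, nprime p /\ exists k, n = (p ^ S k)%nat) with
  | left H => ln (INR (proj1_sig (constructive_indefinite_description _ H)))
  | right _ => 0
  end.

Lemma vonmangoldt_prime_pow (p k : nat) : nprime p -> vonmangoldt (p ^ S k) = lnn p.
Proof.
  intros Hp. unfold vonmangoldt. destruct (excluded_middle_informative _) as [H|H].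
  - destruct (constructive_indefinite_description _ H) as [r [Hr [j Hj]]]. simpl proj1_sig. replace r with p; [reflexivity|].
    apply (nprime_divides_pow p r (S j)); auto. rewrite <- Hj. exists (p ^ k)%nat. simpl. lia.
  - exfalso. apply H. exists p. split; [exact Hp|]. exists k. reflexivity.
Qed.

Lemma vonmangoldt_cases (n : nat) : vonmangoldt n = 0 \/ exists p k, nprime p /\ n = (p ^ S k)%nat /\ vonmangoldt n = lnn p.
Proof.
  destruct (classic (exists p, nprime p /\ exists k, n = (p ^ S k)%nat)) as [[p [Hp [k ->]]]|H].
  - right. exists p, k. split; [exact Hp|]. split; [reflexivity|]. apply vonmangoldt_prime_pow; exact Hp.
  - left. unfold vonmangoldt. destruct (excluded_middle_informative _); [contradiction|reflexivity].
Qed.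

Lemma vonmangoldt_nonneg (n : nat) : 0 <= vonmangoldt n.
Proof.
  destruct (vonmangoldt_cases n) as [->|[p [k [[Hp _] [_ ->]]]]]; [lra|]. apply ln_nonneg. change 1 with (INR 1). apply le_INR. lia.
Qed.

Lemma vonmangoldt_le_ln (n : nat) : (1 <= n)%nat -> vonmangoldt n <= lnn n.
Proof.
  intros Hn. destruct (vonmangoldt_cases n) as [->|[p [k [[Hp _] [E ->]]]]].
  - apply ln_nonneg. change 1 with (INR 1). apply le_INR. lia.
  - apply ln_le'; [apply lt_0_INR; lia|]. apply le_INR. subst n. simpl. assert (p ^ k <> 0)%nat by (apply Nat.pow_nonzero; lia). nia.
Qed.

Definition dvd (d n : nat) : bool := Nat.eqb (n mod d) 0.

Lemma dvd_spec (d n : nat) : (1 <= d)%nat -> dvd d n = true <-> Nat.divide d n.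
Proof. intros Hd. unfold dvd. rewrite Nat.eqb_eq. apply Nat.Lcm0.mod_divide. Qed.

Lemma rsum_zero (f : nat -> R) (N : nat) : (forall n, (1 <= n <= N)%nat -> f n = 0) -> rsum f N = 0.
Proof.
  intros H. induction N; simpl; [reflexivity|]. rewrite IHN, H; [ring|lia|]. intros; apply H; lia.
Qed.

Lemma rsum_indicator (c : nat) (x : R) (N : nat) : (1 <= c <= N)%nat -> rsum (fun d => if Nat.eqb d c then x else 0) N = x.
Proof.
  induction N; intros H; [lia|]. cbn [rsum]. destruct (Nat.eqb_spec (S N) c) as [E|E].
  - rewrite rsum_zero by (intros n Hn; cbv beta; destruct (Nat.eqb_spec n c); [lia|reflexivity]). ring.
  - rewrite IHN by lia. ring.
Qed.

(* Passing from [m] to [p m] adds exactly one prime power divisor, [p ^ (v + 1)] with [v] the [p]-adic valuation of [m]. *)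
Lemma vonmangoldt_divisor_sum (n N : nat) : (1 <= n <= N)%nat -> rsum (fun d => if dvd d n then vonmangoldt d else 0) N = lnn n.
Proof.
  revert N. induction n as [n IH] using (well_founded_induction lt_wf). intros N Hn.
  destruct (Nat.eq_dec n 1) as [->|Hn1].
  - rewrite rsum_zero; [simpl INR; rewrite ln_1; ring|].
    intros d Hd. destruct (dvd d 1) eqn:D; [|ring]. apply dvd_spec in D; [|lia]. apply Nat.divide_1_r in D. subst d.
    destruct (vonmangoldt_cases 1) as [->|[p [k [[Hp _] [E _]]]]]; [ring|].
    simpl in E. assert (p ^ k <> 0)%nat by (apply Nat.pow_nonzero; lia). nia.
  - destruct (exists_nprime_divisor n ltac:(lia)) as [p [Hp [m Hm]]].
    assert (Hp1 : (1 < p)%nat) by apply Hp. assert (Hm1 : (1 <= m)%nat) by lia. assert (Hmn : (m < n)%nat) by nia.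
    assert (Hv : forall m, (1 <= m)%nat -> exists v, Nat.divide (p ^ v) m /\ ~ Nat.divide (p ^ S v) m).
    { clear -Hp1. induction m as [m IH] using (well_founded_induction lt_wf). intros Hm.
      destruct (classic (Nat.divide p m)) as [[k Hk]|D].
      - destruct (IH k ltac:(nia) ltac:(lia)) as [v [[c D1] D2]]. exists (S v). split.
        + exists c. simpl. lia.
        + intros [c' D3]. apply D2. exists c'. simpl in D3. simpl. apply Nat.mul_cancel_r with p; [lia|]. lia.
      - exists 0%nat. split; [simpl; apply Nat.divide_1_l|]. simpl. rewrite Nat.mul_1_r. exact D. }
    destruct (Hv m Hm1) as [v [[c Dv] Dv2]].
    set (P := (p ^ S v)%nat).
    assert (HP : (1 <= P <= N)%nat).
    { split; [unfold P; assert (p ^ S v <> 0)%nat by (apply Nat.pow_nonzero; lia); lia|].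
      apply Nat.le_trans with n; [|lia]. apply Nat.divide_pos_le; [lia|]. exists c. unfold P. simpl. lia. }
    rewrite (rsum_ext _ (fun d => (if dvd d m then vonmangoldt d else 0)+(if Nat.eqb d P then lnn p else 0))).
    + rewrite rsum_plus, (IH m Hmn N ltac:(lia)), (rsum_indicator P _ N HP). rewrite Hm, mult_INR, ln_mult; [reflexivity| |]; apply lt_0_INR; lia.
    + intros d Hd. destruct (Nat.eqb_spec d P) as [->|Ed].
      * assert (D1 : dvd P n = true). { apply dvd_spec; [lia|]. exists c. unfold P. simpl. lia. }
        assert (D2 : dvd P m = false). { destruct (dvd P m) eqn:E; [|reflexivity]. exfalso. apply Dv2. apply dvd_spec; [|exact E]. lia. }
        rewrite D1, D2. unfold P. rewrite vonmangoldt_prime_pow by exact Hp. ring.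
      * rewrite Rplus_0_r. destruct (dvd d m) eqn:D1.
        { apply dvd_spec in D1; [|lia]. replace (dvd d n) with true; [reflexivity|]. symmetry. apply dvd_spec; [lia|].
          apply Nat.divide_trans with m; [exact D1|]. exists p. lia. }
        destruct (dvd d n) eqn:D2; [|reflexivity]. apply dvd_spec in D2; [|lia].
        destruct (vonmangoldt_cases d) as [E|[r [j [Hr [E _]]]]]; [exact E|exfalso].
        assert (D3 : ~ Nat.divide d m). { intros D. apply dvd_spec in D; [congruence|lia]. }
        destruct (Nat.eq_dec r p) as [->|Hrp].
        -- rewrite E in D2. destruct D2 as [e D2].
           assert (D4 : m = (e*p ^ j)%nat). { simpl in D2. apply Nat.mul_cancel_r with p; [lia|]. lia. }
           destruct (Nat.le_gt_cases j v) as [Hjv|Hjv].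
           ++ destruct (Nat.eq_dec j v) as [->|Hne]; [apply Ed; exact E|]. apply D3. rewrite E. exists (c*p ^ (v-S j))%nat.
              rewrite <- Nat.mul_assoc, <- Nat.pow_add_r. replace (v-S j+S j)%nat with v by lia. exact Dv.
           ++ apply Dv2. exists (e*p ^ (j-S v))%nat. rewrite <- Nat.mul_assoc, <- Nat.pow_add_r. replace (j-S v+S v)%nat with j by lia. exact D4.
        -- apply D3. rewrite Hm in D2. rewrite Nat.mul_comm in D2. apply (Nat.gauss d p); [exact D2|].
           rewrite Nat.gcd_comm. apply nprime_coprime; [exact Hp|]. intros D. rewrite E in D. apply nprime_divides_pow in D; auto.
Qed.

Lemma csum_multiples (d : nat) (g : nat -> C) (N : nat) : (1 <= d)%nat ->
  csum (fun n => if dvd d n then g n else 0%C) N = csum (fun m => g (d*m)%nat) (N/d).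
Proof.
  intros Hd. induction N; [rewrite Nat.Div0.div_0_l; reflexivity|]. simpl csum. rewrite IHN.
  destruct (dvd d (S N)) eqn:D.
  - apply dvd_spec in D; [|exact Hd]. destruct D as [k Ek].
    assert (E1 : (S N/d = k)%nat). { rewrite Ek. apply Nat.div_mul. lia. }
    assert (E2 : (N/d = k-1)%nat). { symmetry. apply Nat.div_unique with (d-1)%nat; [lia|]. destruct k; [lia|]. nia. }
    rewrite E1, E2. destruct k; [lia|]. simpl Nat.sub. rewrite Nat.sub_0_r. simpl csum. do 2 f_equal. lia.
  - replace (S N/d)%nat with (N/d)%nat; [ring|].
    apply Nat.div_unique with (S (N mod d)).
    + pose proof (Nat.mod_upper_bound N d ltac:(lia)). destruct (Nat.eq_dec (S (N mod d)) d) as [E|E]; [|lia].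
      assert (dvd d (S N) = true); [|congruence]. apply dvd_spec; [lia|]. exists (S (N/d)). pose proof (Nat.div_mod N d ltac:(lia)). lia.
    + pose proof (Nat.div_mod N d ltac:(lia)). lia.
Qed.

(** Expand [ln n] into the sum of [vonmangoldt d] over [d | n], exchange the sums and write
    [n = d m]; for completely multiplicative [f] the factor [f d] comes out. *)
Lemma log_convolution (f : nat -> C) (N : nat) : (forall m n, (1 <= m)%nat -> (1 <= n)%nat -> f (m*n)%nat = (f m*f n)%C) ->
  csum (fun n => RtoC (lnn n)*f n)%C N = csum (fun d => RtoC (vonmangoldt d)*f d*csum f (N/d))%C N.
Proof.
  intros Hf.
  rewrite (csum_ext _ (fun n => csum (fun d => if dvd d n then RtoC (vonmangoldt d)*f n else 0)%C N)).
  - rewrite csum_swap. apply csum_ext. intros d Hd. rewrite csum_multiples by lia. rewrite <- csum_scal. apply csum_ext.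
    intros m Hm. rewrite Hf by lia. ring.
  - intros n Hn. rewrite <- (vonmangoldt_divisor_sum n N Hn).
    assert (E : forall M, RtoC (rsum (fun d => if dvd d n then vonmangoldt d else 0) M) = csum (fun d => if dvd d n then RtoC (vonmangoldt d) else 0%C) M).
    { induction M; [reflexivity|]. simpl. rewrite RtoC_plus, IHM. destruct (dvd (S M) n); reflexivity. }
    rewrite E, Cmult_comm, <- csum_scal. apply csum_ext. intros d _. destruct (dvd d n); ring.
Qed.

(** The function [phi x exp (- K x)] is nonincreasing. *)
Lemma gronwall (phi phi' : R -> R) (K a b : R) : a <= b ->
  (forall x, a <= x <= b -> is_derive phi x (phi' x)) -> (forall x, a <= x <= b -> phi' x <= K*phi x) ->
  phi b <= phi a*exp (K*(b - a)).
Proof.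
  intros Hab Hd HK. set (g := fun x => phi x*exp (- K*x)). set (g' := fun x => (phi' x-K*phi x)*exp (- K*x)).
  assert (Hg : forall x, a <= x <= b -> is_derive g x (g' x)).
  { intros x Hx. unfold g'. replace ((phi' x-K*phi x)*exp (- K*x)) with (phi' x*exp (- K*x)+phi x*(- K*exp (- K*x))) by ring.
    apply is_derive_Reals. apply (derivable_pt_lim_mult phi (fun x => exp (- K*x))); apply is_derive_Reals; [apply Hd; exact Hx|].
    der_ring. }
  destruct (MVT_gen g a b g') as [c [Hc E]].
  { intros x Hx. rewrite Rmin_left, Rmax_right in Hx by lra. apply Hg; lra. }
  { intros x Hx. rewrite Rmin_left, Rmax_right in Hx by lra. apply derivable_continuous_pt. exists (g' x). apply is_derive_Reals, Hg; lra. }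
  rewrite Rmin_left, Rmax_right in Hc by lra.
  assert (g b <= g a).
  { specialize (HK c Hc). assert (g' c <= 0). { unfold g'. pose proof (exp_pos (- K*c)). nra. } nra. } replace (phi b) with (phi b*exp (- K*b)*exp (K*b)).
  2:{ rewrite Rmult_assoc, <- exp_plus. replace (- K*b+K*b) with 0 by ring. rewrite exp_0. ring. }
  replace (phi a*exp (K*(b-a))) with (phi a*exp (- K*a)*exp (K*b)).
  2:{ rewrite Rmult_assoc, <- exp_plus. do 2 f_equal. ring. }
  apply Rmult_le_compat_r; [left; apply exp_pos|exact H].
Qed.

Lemma exp_ln_power (s : R) (n : nat) : (1 <= n)%nat -> exp (- s*lnn n) = exp (- (s - 1)*lnn n)/INR n.
Proof.
  intros Hn. assert (0 < INR n) by (apply lt_0_INR; lia). replace (- s*lnn n) with (- (s-1)*lnn n + - lnn n) by ring.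
  rewrite exp_plus, exp_Ropp, exp_ln by assumption. reflexivity.
Qed.

Lemma ln_INR_nonneg (n : nat) : 0 <= lnn n.
Proof.
  (* For [n = 0] the logarithm has its default value 0. *)
  destruct n; [simpl; unfold ln; destruct (Rlt_dec 0 0) as [H|]; [exfalso; apply (Rlt_irrefl 0 H)|apply Rle_refl]|]. apply ln_nonneg. rewrite S_INR. pose proof (pos_INR n). lra.
Qed.

(** With [vonmangoldt n <= ln n] the logarithm costs half of the excess exponent [s - 1]. *)
Lemma vonmangoldt_tail (s : R) : 1 < s -> exists K, 0 < K /\ forall N M,
  rsum (fun n => vonmangoldt (N + n)*exp (- s*lnn (N + n))) M <= K*exp (- ((s - 1)/2)*lnn (S N)).
Proof.
  intros Hs. set (d := (s-1)/2). assert (Hd : 0 < d) by (unfold d; lra).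
  destruct (pow_le_exp 1 d Hd) as [K [HK H]].
  exists (K*(1 + / d)). assert (0 < / d) by (apply Rinv_0_lt_compat; exact Hd). split; [nra|]. intros N M.
  apply Rle_trans with (rsum (fun n => K*(exp (- d*lnn (N+n))/INR (N+n))) M).
  - apply rsum_le. intros n Hn. rewrite exp_ln_power by lia. set (y := lnn (N+n)).
    assert (Hy : 0 <= y) by apply ln_INR_nonneg. assert (Hp : 0 < INR (N+n)) by (apply lt_0_INR; lia).
    specialize (H y Hy).
    pose proof (vonmangoldt_le_ln (N+n) ltac:(lia)) as V. fold y in V.
    unfold Rdiv. rewrite <- !Rmult_assoc. apply Rmult_le_compat_r; [left; apply Rinv_0_lt_compat; exact Hp|].
    apply Rle_trans with (K*exp (d*y)*exp (- (s-1)*y)); [apply Rmult_le_compat_r; [left; apply exp_pos|lra]|].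
    rewrite Rmult_assoc, <- exp_plus. right. do 2 f_equal. unfold d. field.
  - rewrite rsum_scal. rewrite Rmult_assoc. apply Rmult_le_compat_l; [lra|]. apply rsum_power_tail. exact Hd.
Qed.

(** * The Dirichlet series of [-L'/L] to the right of 1 *)

Definition vm_sum (chi : nat -> C) (s : C) (N : nat) : C := csum (fun n => RtoC (vonmangoldt n)*(chi n*cexp (- s*lnn n)))%C N.

Section LogDerivative.
Variables (q : nat) (chi : nat -> C).
Hypothesis Hp : prime (Z.of_nat q).
Hypothesis Hchi : nonprincipal_char q chi.

Let f (s : C) (n : nat) : C := (chi n*cexp (- s*lnn n))%C.

Lemma char_term_mult (s : C) (m n : nat) : (1 <= m)%nat -> (1 <= n)%nat -> f s (m*n)%nat = (f s m*f s n)%C.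
Proof.
  intros Hm Hn. unfold f. destruct Hchi as [[Hmul _] _]. rewrite Hmul. rewrite mult_INR, ln_mult by (apply lt_0_INR; lia).
  rewrite RtoC_plus. replace (- s*(lnn m+lnn n))%C with (- s*lnn m + - s*lnn n)%C by ring. rewrite cexp_plus. ring.
Qed.

Lemma char_term_mod (s : C) (n : nat) : Cmod (f s n) <= exp (- Re s*lnn n).
Proof.
  unfold f. rewrite Cmod_mult, Cmod_cexp_real_mult. pose proof (dchar_mod_le_1 q Hp chi n (proj1 Hchi)).
  pose proof (exp_pos (- Re s*lnn n)). nra.
Qed.

Lemma Fk0_partial (s : C) (N : nat) : csum (fun n => chi n*log_kernel 0 s (lnn n))%C N = csum (f s) N.
Proof. apply csum_ext. intros n _. unfold f, log_kernel. simpl. ring. Qed.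

Lemma vm_sum_term_bound (s : C) (n : nat) : Cmod (RtoC (vonmangoldt n)*f s n)%C <= vonmangoldt n*exp (- Re s*lnn n).
Proof.
  rewrite Cmod_mult, Cmod_R, Rabs_right by (apply Rle_ge, vonmangoldt_nonneg). apply Rmult_le_compat_l; [apply vonmangoldt_nonneg|apply char_term_mod].
Qed.

(** By [log_convolution] the difference of the [N]-th partial sum of [Fk chi 1 s] and
    [vm_sum chi s N] times [L(s)] is the sum over [m <= N] of [Lambda(m) chi(m) m^(-s)] times minus
    the tail of [L(s)] beyond [N/m]. The tail bound [(N/m)^(- Re s)] cancels the size of [m^(-s)],
    so the total is [O(N^(1 - Re s) log N)]. *)
Lemma vm_sum_limit (s : C) : 1 < Re s -> ccv (fun N => vm_sum chi s N*Fk chi 0 s)%C (Fk chi 1 s).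
Proof.
  intros Hs. set (sg := Re s) in *.
  pose proof (nonprincipal_partial_sums q Hp chi Hchi) as HQ.
  pose proof (Fk_conv chi (INR q) HQ 1 s ltac:(fold sg; lra)) as H1.
  set (K := INR q*(1+Cmod s)*(3 + / sg)).
  assert (HK : 0 <= K). { pose proof (pos_INR q). pose proof (Cmod_ge_0 s). assert (0 < / sg) by inv_pos.
    apply Rmult_le_pos; [nra|lra]. }
  replace (Fk chi 1 s) with (Fk chi 1 s-0)%C by ring.
  apply ccv_ext with (fun N => csum (fun n => chi n*log_kernel 1 s (lnn n))%C N -
    (csum (fun n => chi n*log_kernel 1 s (lnn n))%C N-vm_sum chi s N*Fk chi 0 s))%C; [intros; ring|].
  apply ccv_minus; [exact H1|].
  set (d := (sg-1)/2). assert (Hd : 0 < d) by (unfold d; lra).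
  destruct (pow_le_exp 1 d Hd) as [K1 [HK1 HE]].
  intros eps Heps.
  assert (LIM : is_lim_seq (fun n => (K*K1)*exp (- d*lnn (S n))) 0) by (apply lim_scal_decay; exact Hd).
  apply is_lim_seq_spec in LIM. destruct (LIM (mkposreal eps Heps)) as [N0 HN0]. exists (S N0). intros N HN.
  destruct N as [|N]; [lia|]. specialize (HN0 N ltac:(lia)). rewrite Rminus_0_r in HN0.
  eapply Rle_lt_trans; [|eapply Rle_lt_trans; [apply Rle_abs|exact HN0]]. set (n := S N). set (y := lnn n).
  assert (Hn : 0 < INR n) by (apply lt_0_INR; unfold n; lia).
  assert (Hy : 0 <= y) by apply ln_INR_nonneg.
  rewrite (csum_ext (fun n => chi n*log_kernel 1 s (lnn n))%C (fun n => RtoC (lnn n)*f s n)%C)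
    by (intros; unfold f, log_kernel; rewrite pow_1; ring).
  rewrite (log_convolution (f s) n (char_term_mult s)).
  unfold vm_sum. rewrite (Cmult_comm _ (Fk chi 0 s)), <- csum_scal, <- csum_minus.
  replace (csum (fun m => RtoC (vonmangoldt m)*f s m*csum (f s) (n/m)-Fk chi 0 s*(RtoC (vonmangoldt m)*(chi m*cexp (- s*lnn m))))%C n-0)%C
    with (csum (fun m => RtoC (vonmangoldt m)*f s m*(csum (f s) (n/m)-Fk chi 0 s))%C n).
  2:{ unfold Cminus at 2. rewrite Copp_0, Cplus_0_r. apply csum_ext. intros m _. unfold f. ring. }
  le_via Cmod_csum_le.
  apply Rle_trans with (rsum (fun _ => (K*y*exp (- sg*y))*1) n).
  - apply rsum_le. intros m Hm. rewrite Cmod_mult, Rmult_1_r.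
    assert (Hm0 : 0 < INR m) by (apply lt_0_INR; lia).
    assert (T : Cmod (csum (f s) (n/m)-Fk chi 0 s)%C <= K*exp (- sg*(y-lnn m))).
    { rewrite Cmod_minus_sym, <- Fk0_partial. eapply Rle_trans; [apply (Lfun_tail chi (INR q) HQ s (n/m)); fold sg; lra|]. fold sg.
      apply Rmult_le_compat_l; [exact HK|]. apply exp_le.
      assert (y-lnn m <= ln (INR (S (n/m)))); [|nra]. unfold y. rewrite <- ln_div by assumption. apply ln_le'; [apply Rdiv_lt_0_compat; assumption|].
      apply Rmult_le_reg_r with (INR m); [assumption|]. unfold Rdiv. rewrite Rmult_assoc, Rinv_l, Rmult_1_r by lra. rewrite <- mult_INR. apply le_INR.
      pose proof (Nat.div_mod n m ltac:(lia)). pose proof (Nat.mod_upper_bound n m ltac:(lia)). nia. }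
    pose proof (vm_sum_term_bound s m) as B.
    assert (V : vonmangoldt m <= y). { eapply Rle_trans; [apply vonmangoldt_le_ln; lia|]. apply ln_le'; [assumption|]. apply le_INR. lia. }
    apply Rle_trans with ((vonmangoldt m*exp (- sg*lnn m))*(K*exp (- sg*(y-lnn m)))).
    { apply Rmult_le_compat; try apply Cmod_ge_0; assumption. }
    replace (vonmangoldt m*exp (- sg*lnn m)*(K*exp (- sg*(y-lnn m)))) with
      (vonmangoldt m*(K*(exp (- sg*lnn m)*exp (- sg*(y-lnn m))))) by ring.
    rewrite <- exp_plus. replace (- sg*lnn m + - sg*(y-lnn m)) with (- sg*y) by ring.
    replace (K*y*exp (- sg*y)) with (y*(K*exp (- sg*y))) by ring.
    apply Rmult_le_compat_r; [|exact V]. apply Rmult_le_pos; [exact HK|left; apply exp_pos].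
  - rewrite rsum_scal. assert (E : forall k, rsum (fun _ => 1) k = INR k). { induction k; [reflexivity|]. rewrite S_INR. simpl rsum. lra. }
    rewrite E. unfold y at 2. rewrite exp_ln_power by (unfold n; lia). fold y.
    replace (K*y*(exp (- (sg-1)*y)/INR n)*INR n) with (K*(y*exp (- (sg-1)*y))) by (field; lra).
    rewrite Rmult_assoc. apply Rmult_le_compat_l; [exact HK|].
    specialize (HE y Hy). simpl in HE. rewrite Rmult_1_r in HE.
    apply Rle_trans with (K1*exp (d*y)*exp (- (sg-1)*y)); [apply Rmult_le_compat_r; [left; apply exp_pos|exact HE]|].
    rewrite Rmult_assoc, <- exp_plus. right. do 2 f_equal. unfold d. field.
Qed.

Lemma vm_sum_tail (s0 : R) : 1 < s0 -> exists K, 0 < K /\ forall s M N, s0 <= Re s -> (M <= N)%nat ->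
  Cmod (vm_sum chi s N - vm_sum chi s M)%C <= K*exp (- ((s0 - 1)/2)*lnn (S M)).
Proof.
  intros Hs0. destruct (vonmangoldt_tail s0 Hs0) as [K [HK H]]. exists K. split; [exact HK|]. intros s M N Hs HMN.
  unfold vm_sum. replace N with (M+(N-M))%nat by lia. rewrite csum_app.
  match goal with |- Cmod (?a + ?b - ?a)%C <= _ => replace (a+b-a)%C with b by ring end.
  le_via Cmod_csum_le. eapply Rle_trans; [|apply (H M (N-M)%nat)]. apply rsum_le. intros n Hn.
  le_via (vm_sum_term_bound s (M+n)). apply Rmult_le_compat_l; [apply vonmangoldt_nonneg|]. apply exp_le.
  pose proof (ln_INR_nonneg (M+n)). nra.
Qed.

(** The relation is stated as a product, since the nonvanishing of [Fk chi 0] in [Re s > 1] is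
    deduced from it in [Lfun_neq_0_right]. The constant [K] serves the whole half-plane. *)
Lemma log_derivative_series (s0 : R) : 1 < s0 -> exists K, 0 < K /\ forall s, s0 <= Re s ->
  exists g, ccv (vm_sum chi s) g /\ Fk chi 1 s = (g*Fk chi 0 s)%C /\
    forall N, Cmod (g - vm_sum chi s N)%C <= K*exp (- ((s0 - 1)/2)*lnn (S N)).
Proof.
  intros Hs0. destruct (vm_sum_tail s0 Hs0) as [K [HK H]]. exists K. split; [exact HK|]. intros s Hs.
  destruct (ccv_cauchy (vm_sum chi s) (fun M => K*exp (- ((s0-1)/2)*lnn (S M)))) as [g Hg].
  - auto.
  - apply lim_scal_decay. lra.
  - exists g. split; [exact Hg|]. split.
    + apply ccv_unique with (fun N => vm_sum chi s N*Fk chi 0 s)%C; [apply vm_sum_limit; lra|].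
      apply ccv_ext with (fun N => Fk chi 0 s*vm_sum chi s N)%C; [intros; ring|]. replace (g*Fk chi 0 s)%C with (Fk chi 0 s*g)%C by ring.
      apply ccv_scal. exact Hg.
    + intros N. apply ccv_le with (u := fun n => (vm_sum chi s n-vm_sum chi s N)%C) (N0 := N).
      * apply ccv_minus; [exact Hg|apply ccv_const].
      * auto.
Qed.

Lemma Lfun_near_1 (s : C) : 3 <= Re s -> Cmod (Fk chi 0 s - 1)%C <= 3/8.
Proof.
  intros Hs. pose proof (nonprincipal_partial_sums q Hp chi Hchi) as HQ.
  apply ccv_le with (u := fun N => (csum (fun n => chi n*log_kernel 0 s (lnn n))%C N-1)%C) (N0 := 1%nat).
  - apply ccv_minus; [apply (Fk_conv chi (INR q) HQ); lra|apply ccv_const].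
  - intros N HN. rewrite Fk0_partial. replace N with (1+(N-1))%nat by lia. rewrite csum_app.
    assert (E1 : csum (f s) 1 = 1%C).
    { simpl. unfold f. destruct Hchi as [[_ [_ [_ H1]]] _]. rewrite H1. simpl INR. rewrite ln_1.
      replace (- s*0%R)%C with (RtoC 0) by ring. rewrite cexp_0. ring. }
    rewrite E1. match goal with |- Cmod (?a + ?b - ?c)%C <= _ => replace (a+b-c)%C with b by ring end.
    le_via Cmod_csum_le.
    apply Rle_trans with (rsum (fun n => exp (- (2)*lnn (1+n))/INR (1+n)) (N-1)).
    + apply rsum_le. intros n Hn. le_via char_term_mod.
      replace (exp (- (2)*lnn (1+n))/INR (1+n)) with (exp (- (3-1)*lnn (1+n))/INR (1+n)) by (do 3 f_equal; ring).
      rewrite <- exp_ln_power by lia. apply exp_le. pose proof (ln_INR_nonneg (1+n)). nra.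
    (* With [d = 2] and summation from [n = 2] the bound is [(1 + 1/2) 2^(-2) = 3/8]. *)
    + eapply Rle_trans; [apply rsum_power_tail; lra|]. replace (INR 2) with 2 by (simpl; ring).
      replace (- (2)*ln 2) with (- (ln 2+ln 2)) by ring. rewrite exp_Ropp, exp_plus, exp_ln by lra. lra.
Qed.

Lemma Lfun_lower (s : C) : 3 <= Re s -> 5/8 <= Cmod (Fk chi 0 s).
Proof.
  intros Hs. pose proof (Lfun_near_1 s Hs). pose proof (Cmod_rev_triangle 1%C (Fk chi 0 s)) as T. rewrite Cmod_1, Cmod_minus_sym in T.
  pose proof (Rle_abs (1-Cmod (Fk chi 0 s))). lra.
Qed.

Lemma Lfun_upper (s : C) : 3 <= Re s -> Cmod (Fk chi 0 s) <= 11/8.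
Proof.
  intros Hs. pose proof (Lfun_near_1 s Hs). pose proof (Cmod_rev_triangle (Fk chi 0 s) 1%C) as T. rewrite Cmod_1 in T.
  pose proof (Rle_abs (Cmod (Fk chi 0 s)-1)). lra.
Qed.

Lemma Lfun_cder (k : nat) (s : C) : 0 < Re s -> cder (Fk chi k) s (- Fk chi (S k) s)%C.
Proof. apply (Fk_cder chi (INR q)). apply nonprincipal_partial_sums; assumption. Qed.

(** Instead of an Euler product: along a horizontal line [|L|^2] satisfies a linear differential
    inequality, because [L' = - g L] with [g] bounded. A zero would therefore propagate to
    [Re s = 3], where [|L| >= 5/8]. *)
Lemma Lfun_neq_0_right (s : C) : 1 < Re s -> Fk chi 0 s <> 0%C.
Proof.
  intros Hs E. destruct s as [a t]. unfold Re in Hs; simpl in Hs.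
  destruct (Rle_or_lt 3 a) as [H3|H3].
  { pose proof (Lfun_lower (a, t)) as L. specialize (L H3). rewrite E, Cmod_0 in L. lra. }
  destruct (log_derivative_series a Hs) as [K [HK H]].
  set (phi := fun x => Re (Fk chi 0 (x, t))*Re (Fk chi 0 (x, t))+Im (Fk chi 0 (x, t))*Im (Fk chi 0 (x, t))).
  set (phi' := fun x => let F := Fk chi 0 (x, t) in let D := (- Fk chi 1 (x, t))%C in 2*(Re F*Re D+Im F*Im D)).
  assert (G : phi 3 <= phi a*exp (2*K*(3-a))).
  { apply (gronwall phi phi'); [lra| |].
    - intros x Hx. destruct (rder_horizontal (Fk chi 0) x t (- Fk chi 1 (x, t))%C) as [H1 H2]; [apply Lfun_cder; Re_lra|].
      unfold phi'. set (D := (- Fk chi 1 (x, t))%C) in *.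
      replace (2*(Re (Fk chi 0 (x, t))*Re D+Im (Fk chi 0 (x, t))*Im D)) with
        ((Re D*Re (Fk chi 0 (x, t))+Re (Fk chi 0 (x, t))*Re D)+(Im D*Im (Fk chi 0 (x, t))+Im (Fk chi 0 (x, t))*Im D)) by ring.
      apply is_derive_Reals in H1. apply is_derive_Reals in H2. apply is_derive_Reals.
      apply (derivable_pt_lim_plus (fun x => Re (Fk chi 0 (x, t))*Re (Fk chi 0 (x, t))) (fun x => Im (Fk chi 0 (x, t))*Im (Fk chi 0 (x, t)))).
      + apply (derivable_pt_lim_mult (fun x => Re (Fk chi 0 (x, t))) (fun x => Re (Fk chi 0 (x, t)))); assumption.
      + apply (derivable_pt_lim_mult (fun x => Im (Fk chi 0 (x, t))) (fun x => Im (Fk chi 0 (x, t)))); assumption.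
    - intros x Hx. destruct (H (x, t)) as [g [_ [Eg Hg]]]; [Re_lra|]. specialize (Hg 0%nat).
      unfold vm_sum in Hg; simpl csum in Hg. simpl INR in Hg. rewrite ln_1, Rmult_0_r, exp_0 in Hg.
      replace (g-0)%C with g in Hg by ring.
      unfold phi, phi'. rewrite Eg. set (F := Fk chi 0 (x, t)). pose proof (re_le_Cmod g) as R1. apply Rabs_le_between in R1.
      replace (2*(Re F*Re (- (g*F))+Im F*Im (- (g*F)))) with (- (2*Re g)*(Re F*Re F+Im F*Im F)) by Re_ring.
      nra. }
  assert (P0 : phi a = 0). { unfold phi. rewrite E. unfold Re, Im; simpl. ring. } pose proof (Lfun_lower (3, t)) as L. unfold Re in L at 1; simpl in L.
  assert (phi 3 = Cmod (Fk chi 0 (3, t))*Cmod (Fk chi 0 (3, t))) by (rewrite Cmod_sqr; reflexivity). nra.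
Qed.
End LogDerivative.

(** * Nonvanishing on the line [Re s = 1] *)

Lemma csum_RtoC (f : nat -> R) (N : nat) : csum (fun n => RtoC (f n)) N = RtoC (rsum f N).
Proof. induction N; [reflexivity|]. cbn [csum rsum]. rewrite IHN, RtoC_plus. reflexivity. Qed.

Lemma derive_nonpos_le (f f' : R -> R) (a b : R) : a <= b ->
  (forall x, a <= x <= b -> is_derive f x (f' x)) -> (forall x, a <= x <= b -> f' x <= 0) -> f b <= f a.
Proof.
  intros Hab Hd Hn. pose proof (gronwall f f' 0 a b Hab Hd) as H. rewrite Rmult_0_l, exp_0, Rmult_1_r in H. apply H.
  intros x Hx. rewrite Rmult_0_l. auto.
Qed.

Lemma exp_mult_le_1 (y s : R) : 0 <= y -> 1 <= s -> y*exp (- s*y) <= 1.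
Proof.
  intros Hy Hs. apply Rmult_le_reg_r with (exp (s*y)); [apply exp_pos|]. rewrite Rmult_assoc, <- exp_plus.
  replace (- s*y+s*y) with 0 by ring. rewrite exp_0, Rmult_1_r, Rmult_1_l.
  destruct (Req_dec y 0) as [->|H0]; [left; apply exp_pos|]. pose proof (exp_ineq1 y H0).
  assert (exp y <= exp (s*y)) by (apply exp_le; nra). lra.
Qed.

(** [G] is an antiderivative of [x^(-s) ln x], which decreases from 3 on; the comparison with the
    integral starts there, and the first three terms are at most 1 each. *)
Lemma log_power_sum_bound (s : R) (N : nat) : 1 < s ->
  rsum (fun n => lnn n*exp (- s*lnn n)) N <= / ((s - 1)*(s - 1)) + 3.
Proof.
  intros Hs. set (e := fun n => lnn n*exp (- s*lnn n)).
  set (G := fun x => - (ln x/(s-1) + / ((s-1)*(s-1)))*exp (- (s-1)*ln x)).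
  assert (Hinv : 0 < / ((s-1)*(s-1))) by (apply Rinv_0_lt_compat; nra).
  assert (E1 : forall n, e n <= 1). { intros n. apply exp_mult_le_1; [apply ln_INR_nonneg|lra]. }
  assert (Ge : forall x, 1 <= x -> G x <= 0).
  { intros x Hx. unfold G. pose proof (ln_nonneg x Hx). pose proof (exp_pos (- (s-1)*ln x)).
    assert (0 <= ln x/(s-1)). { apply Rmult_le_pos; [lra|left; inv_pos]. } nra. }
  assert (ln3 : 1 <= ln 3). { rewrite <- (ln_exp 1). apply ln_le'; [apply exp_pos|apply exp_le_3]. }
  assert (G3 : - G 3 <= / ((s-1)*(s-1))).
  { unfold G. set (u := (s-1)*ln 3).
    replace (- (- (ln 3/(s-1) + / ((s-1)*(s-1)))*exp (- (s-1)*ln 3))) with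
      (/ ((s-1)*(s-1))*((1+u)*exp (- u))).
    2:{ unfold u. replace (- (s-1)*ln 3) with (- ((s-1)*ln 3)) by ring. field. lra. }
    rewrite <- (Rmult_1_r (/ ((s-1)*(s-1)))) at 2. apply Rmult_le_compat_l; [lra|].
    assert (Hu : 0 < u) by (unfold u; nra). apply Rmult_le_reg_r with (exp u); [apply exp_pos|].
    rewrite Rmult_assoc, <- exp_plus. replace (- u+u) with 0 by ring. rewrite exp_0. pose proof (exp_ineq1 u). lra. }
  assert (Step : forall x, 3 <= x -> ln (x+1)*exp (- s*ln (x+1)) <= G (x+1)-G x).
  { intros x Hx. destruct (MVT_cor2 G (fun x => ln x*exp (- s*ln x)) x (x+1)) as [c [E Hc]]; [lra| |].
    - intros c Hc. unfold G. auto_derive; [lra|].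
      replace (exp (- s*ln c)) with (exp (- (s-1)*ln c)/c).
      2:{ replace (- s*ln c) with (- (s-1)*ln c + - ln c) by ring. rewrite exp_plus, exp_Ropp, exp_ln by lra. reflexivity. }
      field. lra.
    - rewrite E. replace (x+1-x) with 1 by ring. rewrite Rmult_1_r.
      set (a := ln c). set (b := ln (x+1)).
      assert (Ha : 1 <= a). { apply Rle_trans with (ln 3); [exact ln3|apply ln_le'; lra]. }
      assert (Hab : a <= b) by (apply ln_le'; lra).
      apply Rmult_le_reg_r with (exp (s*b)); [apply exp_pos|]. rewrite !Rmult_assoc, <- !exp_plus.
      replace (- s*b+s*b) with 0 by ring. rewrite exp_0. replace (- s*a+s*b) with (s*(b-a)) by ring.
      apply Rle_trans with (a*(1+(b-a))); [nra|]. apply Rmult_le_compat_l; [lra|].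
      destruct (Req_dec (b-a) 0) as [->|Hn]; [rewrite Rmult_0_r, exp_0; lra|].
      pose proof (exp_ineq1 (b-a) Hn). assert (exp (b-a) <= exp (s*(b-a))) by (apply exp_le; nra). lra. }
  assert (B : forall k, rsum e (3+k) <= 3+G (INR (3+k))-G 3).
  { induction k.
    - rewrite Nat.add_0_r. replace (INR 3) with 3 by (simpl; ring). cbn [rsum]. pose proof (E1 1%nat). pose proof (E1 2%nat). pose proof (E1 3%nat). lra.
    - rewrite Nat.add_succ_r. cbn [rsum]. rewrite S_INR. specialize (Step (INR (3+k))). rewrite <- S_INR in Step |- *.
      assert (3 <= INR (3+k)). { rewrite plus_INR. replace (INR 3) with 3 by (simpl; ring). pose proof (pos_INR k). lra. } unfold e at 2. lra. }
  destruct (Nat.le_gt_cases 3 N) as [H|H].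
  - replace N with (3+(N-3))%nat by lia. le_via B.
    assert (G (INR (3+(N-3))) <= 0). { apply Ge. change 1 with (INR 1). apply le_INR. lia. } lra.
  - apply Rle_trans with (rsum (fun _ => 1) N); [apply rsum_le; intros; apply E1|]. destruct N as [|[|[|N]]]; simpl; try lra. lia.
Qed.

Lemma power_sum_lower (s : R) (N : nat) : 1 < s ->
  (1 - exp (- (s - 1)*lnn (S N)))/(s - 1) <= rsum (fun n => exp (- s*lnn n)) N.
Proof.
  intros Hs. induction N.
  - simpl. rewrite ln_1, Rmult_0_r, exp_0. lra.
  - eapply Rle_trans; [|apply Rplus_le_compat_r; exact IHN].
    set (x := INR (S N)). assert (Hx : 1 <= x). { change 1 with (INR 1). apply le_INR. lia. }
    rewrite (S_INR (S N)). fold x.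
    destruct (MVT_cor2 (fun x => - exp (- (s-1)*ln x)/(s-1)) (fun x => exp (- s*ln x)) x (x+1)) as [c [E Hc]]; [lra| |].
    + intros c Hc. auto_derive; [lra|].
      replace (exp (- s*ln c)) with (exp (- (s-1)*ln c)/c).
      2:{ replace (- s*ln c) with (- (s-1)*ln c + - ln c) by ring. rewrite exp_plus, exp_Ropp, exp_ln by lra. reflexivity. }
      field. lra.
    + assert (exp (- s*ln c) <= exp (- s*ln x)). { apply exp_le. assert (ln x <= ln c) by (apply ln_le'; lra). nra. } lra.
Qed.

(** The bound [1/(s-1) + O(1)] for [- zeta'/zeta], from finite sums of nonnegative terms. The
    product of the sum [Z] up to [D] and the partial sum of [zeta] up to [M] is part of the
    convolution identity up to [D M], hence at most [1/(s-1)^2 + 3]. Dividing by the lower bound of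
    [power_sum_lower] and letting [M] grow leaves [1/(s-1) + 3 (s-1)]. *)
Lemma vonmangoldt_sum_near_1 (s : R) (D : nat) : 1 < s <= 2 ->
  rsum (fun n => vonmangoldt n*exp (- s*lnn n)) D <= / (s - 1) + 3.
Proof.
  intros Hs. set (e := fun n => exp (- s*lnn n)). set (Z := rsum (fun n => vonmangoldt n*e n) D).
  assert (He : forall n, 0 < e n) by (intros; apply exp_pos).
  assert (Conv : forall N, rsum (fun n => lnn n*e n) N = rsum (fun d => vonmangoldt d*e d*rsum e (N/d)) N).
  { intros N. apply RtoC_inj. rewrite <- !csum_RtoC.
    rewrite (csum_ext _ (fun n => RtoC (lnn n)*RtoC (e n))%C) by (intros; apply RtoC_mult).
    rewrite (log_convolution (fun n => RtoC (e n)) N).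
    - apply csum_ext. intros d _. rewrite csum_RtoC, <- !RtoC_mult. reflexivity.
    - intros m n Hm Hn. unfold e. rewrite <- RtoC_mult, <- exp_plus. do 2 f_equal. rewrite mult_INR, ln_mult by (apply lt_0_INR; lia). ring. }
  assert (Mono : forall a b, (a <= b)%nat -> rsum e a <= rsum e b).
  { intros a b Hab. replace b with (a+(b-a))%nat by lia. rewrite rsum_app.
    assert (0 <= rsum (fun n => e (a+n)%nat) (b-a)) by (apply rsum_nonneg; intros; left; apply He). lra. }
  assert (HZ : forall M, Z*rsum e M <= / ((s-1)*(s-1))+3).
  { intros M. destruct (Nat.eq_dec M 0) as [->|HM].
    { simpl. assert (0 < / ((s-1)*(s-1))) by (apply Rinv_0_lt_compat; nra). lra. }
    eapply Rle_trans; [|apply (log_power_sum_bound s (D*M)); lra]. rewrite Conv.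
    set (F := fun d => vonmangoldt d*e d*rsum e (D*M/d)).
    assert (HF : rsum F (D*M) = rsum F D+rsum (fun n => F (D+n)%nat) (D*M-D)) by (rewrite <- rsum_app; f_equal; nia).
    assert (0 <= rsum (fun n => F (D+n)%nat) (D*M-D)).
    { apply rsum_nonneg. intros n _. apply Rmult_le_pos; [apply Rmult_le_pos; [apply vonmangoldt_nonneg|left; apply He]|].
      apply rsum_nonneg. intros; left; apply He. }
    assert (Z*rsum e M <= rsum F D); [|lra].
    unfold Z. rewrite Rmult_comm, <- rsum_scal. apply rsum_le. intros d Hd. rewrite Rmult_comm.
    apply Rmult_le_compat_l; [apply Rmult_le_pos; [apply vonmangoldt_nonneg|left; apply He]|]. apply Mono.
    apply Nat.div_le_lower_bound; nia. }
  assert (Z0 : 0 <= Z). { apply rsum_nonneg. intros n _. apply Rmult_le_pos; [apply vonmangoldt_nonneg|left; apply He]. }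
  assert (B : forall M, Z*(1-1*exp (- (s-1)*lnn (S M))) <= / (s-1)+3).
  { intros M. specialize (HZ M). pose proof (power_sum_lower s M ltac:(lra)) as L. rewrite Rmult_1_l.
    set (u := 1-exp (- (s-1)*lnn (S M))) in *.
    assert (Z*(u/(s-1)) <= / ((s-1)*(s-1))+3).
    { eapply Rle_trans; [|exact HZ]. apply Rmult_le_compat_l; [exact Z0|exact L]. }
    replace (Z*u) with ((s-1)*(Z*(u/(s-1)))) by (field; lra).
    apply Rle_trans with ((s-1)*(/ ((s-1)*(s-1))+3)); [apply Rmult_le_compat_l; lra|].
    rewrite Rmult_plus_distr_l. apply Rplus_le_compat; [right; field; lra|lra]. }
  assert (Lim : is_lim_seq (fun M => Z*(1-1*exp (- (s-1)*lnn (S M)))) (Z*(1-0))).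
  { apply (is_lim_seq_scal_l _ Z (1-0)). apply (is_lim_seq_minus' _ _ 1 0); [apply is_lim_seq_const|]. apply lim_scal_decay. lra. }
  pose proof (is_lim_seq_le _ _ _ _ B Lim (is_lim_seq_const (/ (s-1)+3))) as F. change (Z*(1-0) <= / (s-1)+3) in F. change (Z <= / (s-1)+3). lra.
Qed.

Section OneLine.
Variables (q : nat) (chi : nat -> C).
Hypothesis Hp : prime (Z.of_nat q).
Hypothesis Hchi : nonprincipal_char q chi.
Hypothesis Hsq : nonprincipal_char q (sqr_char chi).

Lemma three_four_one (x t : R) (N : nat) :
  0 <= 3*rsum (fun n => vonmangoldt n*exp (- x*lnn n)) N + 4*Re (vm_sum chi (x, t) N) + Re (vm_sum (sqr_char chi) (x, 2*t) N).
Proof.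
  unfold vm_sum. rewrite !Re_csum, <- !rsum_scal, <- !rsum_plus. apply rsum_nonneg. intros n Hn.
  set (y := lnn n). set (w := (chi n*cexp (0, (- t*y)%R))%C).
  assert (E1 : (chi n*cexp (- (x, t)*y))%C = (exp (- x*y)*w)%C).
  { unfold w. replace (- (x, t)*y)%C with (RtoC (- x*y)+(0, (- t*y)%R))%C by C_ring.
    rewrite cexp_plus. rewrite cexp_RtoC. ring. }
  assert (E2 : (sqr_char chi n*cexp (- (x, (2*t)%R)*y))%C = (exp (- x*y)*(w*w))%C).
  { unfold w, sqr_char. replace (- (x, (2*t)%R)*y)%C with (RtoC (- x*y)+((0, (- t*y)%R)+(0, (- t*y)%R)))%C by C_ring.
    rewrite !cexp_plus. rewrite cexp_RtoC. ring. }
  rewrite E1, E2.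
  replace (3*(vonmangoldt n*exp (- x*y))+4*Re (vonmangoldt n*(exp (- x*y)*w))%C+Re (vonmangoldt n*(exp (- x*y)*(w*w)))%C)
    with (vonmangoldt n*exp (- x*y)*(3+4*Re w+(Re w*Re w-Im w*Im w))) by Re_ring.
  apply Rmult_le_pos; [apply Rmult_le_pos; [apply vonmangoldt_nonneg|left; apply exp_pos]|].
  assert (Cw : Cmod w = Cmod (chi n)). { unfold w. rewrite Cmod_mult, Cmod_cexp. unfold Re; simpl. rewrite exp_0. ring. }
  destruct (Nat.eq_dec (Nat.gcd n q) 1) as [G|G].
  (* With [|w| = 1] the expression is [2 (1 + Re w)^2]. *)
  - rewrite (dchar_mod_1 q Hp chi n (proj1 Hchi) G) in Cw. pose proof (Cmod_sqr w) as S. rewrite Cw in S. nra.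
  - assert (w = 0%C). { unfold w. destruct Hchi as [[_ [_ [H0 _]]] _]. rewrite (proj2 (H0 n) G). ring. }
    rewrite H. unfold Re, Im; simpl. lra.
Qed.

(** The 3-4-1 inequality makes [B] nonincreasing on [(1,2]], so [B x >= B 2]. A zero at [1 + i t]
    would give [4 ln |L| <= 4 ln (x - 1) + O(1)], hence [B x <= ln (x - 1) + O(1)], which tends to
    [-oo] at 1. *)
Lemma Lfun_one_line_neq_0 (t : R) : Fk chi 0 (1, t) <> 0%C.
Proof.
  intros E0. set (psi := sqr_char chi) in *.
  set (A := fun x => 4*ln (Cmod (Fk chi 0 (x, t)))+ln (Cmod (Fk psi 0 (x, 2*t)))).
  (* The two subtracted terms absorb [3 (1/(x-1) + 3)], which bounds three times the sum of
     [vonmangoldt n n^(-x)]. *)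
  set (B := fun x => A x-3*ln (x-1)-9*x).
  assert (HB : forall x, 1 < x <= 2 -> B 2 <= B x).
  { intros x Hx.
    set (B' := fun x => 4*Re (- Fk chi 1 (x, t)/Fk chi 0 (x, t))%C+Re (- Fk psi 1 (x, (2*t)%R)/Fk psi 0 (x, (2*t)%R))%C-3/(x-1)-9).
    apply (derive_nonpos_le B B'); [lra| |].
    - intros y Hy.
      assert (D1 : is_derive (fun x => ln (Cmod (Fk chi 0 (x, t)))) y (Re (- Fk chi 1 (y, t)/Fk chi 0 (y, t))%C)).
      { apply (rder_ln_mod (fun x => Fk chi 0 (x, t))); [apply (Lfun_neq_0_right q chi Hp Hchi); Re_lra|].
        apply rder_horizontal. apply (Lfun_cder q chi Hp Hchi). Re_lra. }
      assert (D2 : is_derive (fun x => ln (Cmod (Fk psi 0 (x, 2*t)))) y (Re (- Fk psi 1 (y, (2*t)%R)/Fk psi 0 (y, (2*t)%R))%C)).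
      { apply (rder_ln_mod (fun x => Fk psi 0 (x, 2*t))); [apply (Lfun_neq_0_right q psi Hp Hsq); Re_lra|].
        apply rder_horizontal. apply (Lfun_cder q psi Hp Hsq). Re_lra. }
      apply (is_derive_minus (fun x => 4*ln (Cmod (Fk chi 0 (x, t)))+ln (Cmod (Fk psi 0 (x, 2*t)))-3*ln (x-1)) (fun x => 9*x) y _ 9).
      + apply (is_derive_minus (fun x => 4*ln (Cmod (Fk chi 0 (x, t)))+ln (Cmod (Fk psi 0 (x, 2*t)))) (fun x => 3*ln (x-1)) y _ (3/(y-1))).
        * apply (is_derive_plus (fun x => 4*ln (Cmod (Fk chi 0 (x, t))))); [apply (is_derive_scal (fun x => ln (Cmod (Fk chi 0 (x, t)))))|]; assumption.
        * auto_derive; [lra|]. field. lra.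
      + der_ring.
    - intros y Hy. unfold B'.
      destruct (log_derivative_series q chi Hp Hchi y ltac:(lra)) as [K1 [_ H1]]. destruct (H1 (y, t)) as [g1 [C1 [E1 _]]]; [Re_lra|].
      destruct (log_derivative_series q psi Hp Hsq y ltac:(lra)) as [K2 [_ H2]]. destruct (H2 (y, 2*t)) as [g2 [C2 [E2 _]]]; [Re_lra|].
      assert (N1 : Fk chi 0 (y, t) <> 0%C) by (apply (Lfun_neq_0_right q chi Hp Hchi); Re_lra).
      assert (N2 : Fk psi 0 (y, (2*t)%R) <> 0%C) by (apply (Lfun_neq_0_right q psi Hp Hsq); Re_lra).
      rewrite E1, E2. replace (- (g1*Fk chi 0 (y, t))/Fk chi 0 (y, t))%C with (- g1)%C by (field; exact N1).
      replace (- (g2*Fk psi 0 (y, (2*t)%R))/Fk psi 0 (y, (2*t)%R))%C with (- g2)%C by (field; exact N2).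
      assert (P : forall N, - (3*(/ (y-1)+3)) <= 4*Re (vm_sum chi (y, t) N)+Re (vm_sum psi (y, 2*t) N)).
      { intros N. pose proof (three_four_one y t N). pose proof (vonmangoldt_sum_near_1 y N ltac:(lra)). fold psi in H. lra. }
      assert (Lm : is_lim_seq (fun N => 4*Re (vm_sum chi (y, t) N)+Re (vm_sum psi (y, 2*t) N)) (4*Re g1+Re g2)).
      { apply (is_lim_seq_plus' _ _ (4*Re g1) (Re g2)); [apply (is_lim_seq_scal_l _ 4 (Re g1)); apply ccv_Re; exact C1|apply ccv_Re; exact C2]. }
      pose proof (is_lim_seq_le _ _ _ _ P (is_lim_seq_const (- (3*(/ (y-1)+3)))) Lm) as F. change (- (3*(/ (y-1)+3)) <= 4*Re g1+Re g2) in F.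
      change (Re (- g1)%C) with (- Re g1). change (Re (- g2)%C) with (- Re g2). lra. }
  pose proof (Lfun_cder q chi Hp Hchi 0 (1, t) ltac:(Re_lra)) as D.
  destruct (cder_locally_lipschitz _ _ _ D) as [del [Hd L]]. rewrite E0 in L.
  set (K := Cmod (- Fk chi 1 (1, t))%C+1) in L. assert (HK : 0 < K) by (unfold K; pose proof (Cmod_ge_0 (- Fk chi 1 (1, t))%C); lra).
  set (M := INR q*(1+(2+Rabs (2*t)))*(3+1)+1).
  assert (UB : forall h, 0 < h -> h < del -> h <= 1 -> B 2 <= ln h+(4*ln K+ln M)).
  { intros h H0 H1 H2. eapply Rle_trans; [apply (HB (1+h)); lra|]. unfold B, A.
    replace (1+h-1) with h by ring.
    assert (N1 : Fk chi 0 ((1+h)%R, t) <> 0%C) by (apply (Lfun_neq_0_right q chi Hp Hchi); Re_lra).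
    assert (N2 : Fk psi 0 ((1+h)%R, (2*t)%R) <> 0%C) by (apply (Lfun_neq_0_right q psi Hp Hsq); Re_lra).
    assert (L1 : Cmod (Fk chi 0 ((1+h)%R, t)) <= K*h).
    { specialize (L (RtoC h)). rewrite Cmod_R, Rabs_right in L by lra. specialize (L H1).
      replace ((1, t)+h)%C with (((1+h)%R, t) : C) in L by C_ring.
      replace (Fk chi 0 ((1+h)%R, t)-0)%C with (Fk chi 0 ((1+h)%R, t)) in L by ring. exact L. }
    assert (L2 : Cmod (Fk psi 0 ((1+h)%R, (2*t)%R)) <= M).
    { pose proof (Lfun_bound psi (INR q) (nonprincipal_partial_sums q Hp psi Hsq) ((1+h)%R, (2*t)%R)) as U. unfold Re in U; simpl in U. unfold M.
      pose proof (Cmod_le_abs ((1+h)%R, (2*t)%R)) as CA. unfold Re, Im in CA; simpl in CA. rewrite (Rabs_right (1+h)) in CA by lra.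
      assert (I1 : / (1+h) <= 1). { rewrite <- Rinv_1. apply Rinv_le_contravar; lra. }
      assert (I2 : 0 < / (1+h)) by inv_pos.
      pose proof (pos_INR q). pose proof (Cmod_ge_0 ((1+h)%R, (2*t)%R)).
      assert (INR q*(1+Cmod ((1+h)%R, (2*t)%R))*(3 + / (1+h)) <= INR q*(1+(2+Rabs (2*t)))*(3+1)); [|lra].
      apply Rmult_le_compat; [nra|lra|apply Rmult_le_compat_l; lra|lra]. }
    assert (ln (Cmod (Fk chi 0 ((1+h)%R, t))) <= ln K+ln h).
    { rewrite <- ln_mult by assumption. apply ln_le'; [apply Cmod_gt_0; exact N1|exact L1]. }
    assert (ln (Cmod (Fk psi 0 ((1+h)%R, (2*t)%R))) <= ln M).
    { apply ln_le'; [apply Cmod_gt_0; exact N2|exact L2]. }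
    lra. }
  set (c := B 2-(4*ln K+ln M)-1).
  set (h := Rmin (Rmin (del/2) 1) (exp c)).
  assert (Hh : 0 < h) by (unfold h; repeat apply Rmin_pos; try lra; apply exp_pos).
  assert (h <= del/2 /\ h <= 1 /\ h <= exp c) as [h1 [h2 h3]].
  { unfold h. pose proof (Rmin_l (Rmin (del/2) 1) (exp c)). pose proof (Rmin_r (Rmin (del/2) 1) (exp c)).
    pose proof (Rmin_l (del/2) 1). pose proof (Rmin_r (del/2) 1). lra. }
  specialize (UB h Hh ltac:(lra) h2). assert (ln h <= c). { rewrite <- (ln_exp c). apply ln_le'; assumption. }
  unfold c in *. lra.
Qed.

Lemma Lfun_neq_0_half (HG : GRH_mod q) (s : C) : / 2 < Re s -> Fk chi 0 s <> 0%C.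
Proof.
  intros Hs E. destruct (Rtotal_order (Re s) 1) as [H|[H|H]].
  - destruct HG as [HG _]. assert (Re s = / 2); [|lra]. apply (HG chi Hchi); [lra|]. rewrite Lfun_Fk. exact E.
  - destruct s as [a t]. unfold Re in H; simpl in H. subst a. apply (Lfun_one_line_neq_0 t). exact E.
  - revert E. apply (Lfun_neq_0_right q chi Hp Hchi). exact H.
Qed.
End OneLine.

(** * A Schwarz lemma and the growth of the logarithmic derivative *)

Lemma rcont_mult (U V : C -> R) (z : C) : rcont U z -> rcont V z -> rcont (fun w => U w*V w) z.
Proof.
  intros HU HV.
  assert (Sq : forall W, rcont W z -> rcont (fun w => W w*W w) z).
  { intros W HW. apply (rcont_comp (fun u => u*u) W); [|exact HW]. apply derivable_continuous_pt. exists (2*W z).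
    apply is_derive_Reals. der_ring. }
  replace (fun w => U w*V w) with (fun w => / 4*((U w+V w)*(U w+V w))+(- / 4)*((U w + -1*V w)*(U w + -1*V w))).
  - apply (rcont_plus (fun w => / 4*((U w+V w)*(U w+V w))) (fun w => (- / 4)*((U w + -1*V w)*(U w + -1*V w)))).
    + apply (rcont_scal (/ 4) (fun w => (U w+V w)*(U w+V w))). apply Sq. apply rcont_plus; assumption.
    + apply (rcont_scal (- / 4) (fun w => (U w + -1*V w)*(U w + -1*V w))). apply Sq. apply rcont_plus; [assumption|]. apply rcont_scal; assumption.
  - apply functional_extensionality. intros w. field.
Qed.

Lemma neg_ln_derivatives (g p : R -> R) (A x del al : R) : 0 < del ->
  (forall u, Rabs (u - x) < del -> is_derive g u (p u)) -> is_derive p x al -> g x < A ->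
  (exists d, 0 < d /\ forall u, Rabs (u - x) < d -> is_derive (fun u => - ln (A - g u)) u (p u/(A - g u))) /\
  is_derive (fun u => p u/(A - g u)) x (al/(A - g x) + p x*p x/((A - g x)*(A - g x))).
Proof.
  intros Hd Hg Hp HA.
  assert (Hgx : is_derive g x (p x)) by (apply Hg; rewrite Rminus_diag, Rabs_R0; exact Hd).
  assert (Hc : continuity_pt g x). { apply derivable_continuous_pt. exists (p x). apply is_derive_Reals. exact Hgx. }
  destruct (Hc (A-g x) ltac:(lra)) as [d1 [Hd1 H1]].
  assert (Near : forall u, Rabs (u-x) < d1 -> g u < A).
  { intros u Hu. destruct (Req_dec x u) as [<-|E]; [exact HA|].
    assert (Rabs (g u-g x) < A-g x) by (apply H1; repeat split; auto). apply Rabs_def2 in H. lra. }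
  split.
  - exists (Rmin del d1). split; [apply Rmin_pos; assumption|]. intros u Hu. pose proof (Rmin_l del d1). pose proof (Rmin_r del d1).
    assert (Hu1 := Hg u ltac:(lra)). assert (Hu2 := Near u ltac:(lra)).
    replace (p u/(A-g u)) with (- (- p u * / (A-g u))) by (field; lra).
    apply (is_derive_opp (fun u => ln (A-g u))). apply (is_derive_comp ln (fun u => A-g u)).
    + apply is_derive_Reals. apply derivable_pt_lim_ln. lra.
    + replace (- p u) with (0-p u) by ring. apply (is_derive_minus (fun _ => A) g); [apply (is_derive_const A u)|exact Hu1].
  - replace (al/(A-g x)+p x*p x/((A-g x)*(A-g x))) with ((al*(A-g x)-(0-p x)*p x)/(Rsqr (A-g x))).
    2:{ unfold Rsqr. field. lra. }
    apply is_derive_Reals. apply (derivable_pt_lim_div p (fun u => A-g u)).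
    + apply is_derive_Reals. exact Hp.
    + apply is_derive_Reals. apply (is_derive_minus (fun _ => A) g); [apply (is_derive_const A x)|exact Hgx].
    + lra.
Qed.

(** For harmonic [u] the Laplacian of [- ln (A - u)] is [|grad u|^2 / (A - u)^2], and the gradient
    of [ln |f|] has length [|f'/f|]. *)
Lemma lapl_neg_ln_ln_mod (f f1 : C -> C) (f2 : C) (x y r A : R) : 0 < r ->
  (forall w, Cmod (w - (x, y))%C < r -> cder f w (f1 w)) -> cder f1 (x, y) f2 -> f (x, y) <> 0%C -> ln (Cmod (f (x, y))) < A ->
  lapl (fun w => - ln (A - ln (Cmod (f w)))) x y
    (Cmod (f1 (x, y)/f (x, y))%C*Cmod (f1 (x, y)/f (x, y))%C/((A - ln (Cmod (f (x, y))))*(A - ln (Cmod (f (x, y)))))).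
Proof.
  intros Hr Hf Hf1 Hz HA.
  assert (E0 : Cmod ((x, y)-(x, y))%C < r). { rewrite Cmod_horizontal, Rminus_diag, Rabs_R0. exact Hr. }
  destruct (cder_neq_0_loc f (x, y) _ (Hf _ E0) Hz) as [r1 [Hr1 Hne]].
  assert (Hne2 : forall w, Cmod (w-(x, y))%C < r1 -> f w <> 0%C).
  { intros w Hw. specialize (Hne _ Hw). replace ((x, y)+(w-(x, y)))%C with w in Hne by ring. exact Hne. }
  pose proof (cder_div f1 f (x, y) f2 _ Hz Hf1 (Hf _ E0)) as Hq. set (e := (f2/f (x, y)-f1 (x, y)*f1 (x, y)/(f (x, y)*f (x, y)))%C) in Hq.
  destruct (rder_horizontal _ _ _ _ Hq) as [Hh _]. destruct (rder_vertical _ _ _ _ Hq) as [_ Hv].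
  pose proof (Rmin_l r r1). pose proof (Rmin_r r r1).
  destruct (neg_ln_derivatives (fun u => ln (Cmod (f (u, y)))) (fun u => Re (f1 (u, y)/f (u, y))%C) A x (Rmin r r1) (Re e)) as [X1 X2].
  { apply Rmin_pos; assumption. }
  { intros u Hu. assert (Hu2 : Cmod ((u, y)-(x, y))%C < Rmin r r1) by (rewrite Cmod_horizontal; exact Hu).
    apply (rder_ln_mod (fun u => f (u, y))); [apply Hne2; lra|]. apply rder_horizontal. apply Hf. lra. }
  { exact Hh. }
  { exact HA. }
  destruct (neg_ln_derivatives (fun v => ln (Cmod (f (x, v)))) (fun v => - Im (f1 (x, v)/f (x, v))%C) A y (Rmin r r1) (- Im (e*Ci)%C)) as [Y1 Y2].
  { apply Rmin_pos; assumption. }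
  { intros u Hu. assert (Hu2 : Cmod ((x, u)-(x, y))%C < Rmin r r1) by (rewrite Cmod_vertical; exact Hu).
    replace (- Im (f1 (x, u)/f (x, u))%C) with (Re (f1 (x, u)*Ci/f (x, u))%C).
    + apply (rder_ln_mod (fun u => f (x, u))); [apply Hne2; lra|]. apply rder_vertical. apply Hf. lra.
    + simpl. ring. }
  { apply (is_derive_opp (fun v => Im (f1 (x, v)/f (x, v))%C)). exact Hv. }
  { exact HA. }
  eexists _, _, _, _. split; [exact X1|]. split; [exact X2|]. split; [exact Y1|]. split; [exact Y2|]. rewrite Cmod_sqr. set (h := (f1 (x, y)/f (x, y))%C). set (v := A-ln (Cmod (f (x, y)))).
  assert (v <> 0) by (unfold v; lra). clearbody e h v. unfold Re. simpl. lra.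
Qed.

(** The constant curvature of the hyperbolic metric of the disc, whose density is proportional to
    [1 / (R0^2 - |z - c|^2)]. *)
Lemma lapl_ln_disc (a b R0 x y : R) : Cmod ((x, y) - (a, b))%C < R0 ->
  lapl (fun w => ln (R0*R0 - ((Re w - a)*(Re w - a) + (Im w - b)*(Im w - b)))) x y
   (- (4*(R0*R0))/((R0*R0 - ((x - a)*(x - a) + (y - b)*(y - b)))*(R0*R0 - ((x - a)*(x - a) + (y - b)*(y - b))))).
Proof.
  intros Hin. set (r := Cmod ((x, y)-(a, b))%C) in *.
  assert (Pos : forall w, Cmod (w-(x, y))%C < R0-r -> 0 < R0*R0-((Re w-a)*(Re w-a)+(Im w-b)*(Im w-b))).
  { intros w Hw. assert (Cmod (w-(a, b))%C < R0).
    { replace (w-(a, b))%C with ((w-(x, y))+((x, y)-(a, b)))%C by ring. le_lt_via Cmod_triangle. fold r. lra. }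
    pose proof (Cmod_sqr (w-(a, b))%C) as S. pose proof (Cmod_ge_0 (w-(a, b))%C).
    replace (Re (w-(a, b))%C) with (Re w-a) in S by Re_ring.
    replace (Im (w-(a, b))%C) with (Im w-b) in S by Re_ring. nra. }
  assert (P0 : 0 < R0*R0-((x-a)*(x-a)+(y-b)*(y-b))).
  { apply (Pos (x, y)). rewrite Cmod_horizontal, Rminus_diag, Rabs_R0. lra. }
  set (D := R0*R0-((x-a)*(x-a)+(y-b)*(y-b))) in *.
  exists (fun u => - (2*(u-a))/(R0*R0-((u-a)*(u-a)+(y-b)*(y-b)))),
         (fun v => - (2*(v-b))/(R0*R0-((x-a)*(x-a)+(v-b)*(v-b)))),
         (- 2/D-4*((x-a)*(x-a))/(D*D)), (- 2/D-4*((y-b)*(y-b))/(D*D)).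
  split; [|split; [|split; [|split]]].
  - exists (R0-r). split; [lra|]. intros u Hu. rewrite <- (Cmod_horizontal u x y) in Hu. specialize (Pos _ Hu). unfold Re, Im in *; simpl in *.
    auto_derive; [unfold Rminus in Pos; lra|]. field. lra.
  - auto_derive; unfold D, Rminus in *; [lra|]. lra.
  - exists (R0-r). split; [lra|]. intros u Hu. rewrite <- (Cmod_vertical u y x) in Hu. specialize (Pos _ Hu). unfold Re, Im in *; simpl in *.
    auto_derive; [unfold Rminus in Pos; lra|]. field. lra.
  - auto_derive; unfold D, Rminus in *; [lra|]. lra.
  - replace (R0*R0) with (D+((x-a)*(x-a)+(y-b)*(y-b))) at 1 by (unfold D; ring). field. lra.
Qed.

(* Ahlfors' form of the Schwarz lemma: at a maximum of [|f1/f0| (R^2 - |z - s0|^2)/(A - ln |f0|)] the Laplacian of its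
   logarithm is nonpositive, and only the last two factors are not harmonic. *)
Lemma log_derivative_schwarz (f0 f1 f2 f3 : C -> C) (a b R0 A : R) : 0 < R0 ->
  (forall z, Cmod (z - (a, b))%C <= R0 -> cder f0 z (f1 z) /\ cder f1 z (f2 z) /\ cder f2 z (f3 z) /\ f0 z <> 0%C /\ ln (Cmod (f0 z)) < A) ->
  Cmod (f1 (a, b)/f0 (a, b))%C <= 2*(A - ln (Cmod (f0 (a, b))))/R0.
Proof.
  intros HR H.
  set (dd := fun w : C => R0*R0-((Re w-a)*(Re w-a)+(Im w-b)*(Im w-b))).
  set (v := fun w => A-ln (Cmod (f0 w))).
  set (E := fun w => Cmod (f1 w/f0 w)%C*dd w * / v w).
  assert (Hdd : forall w, dd w = R0*R0-Cmod (w-(a, b))%C*Cmod (w-(a, b))%C).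
  { intros w. rewrite Cmod_sqr. auto. }
  assert (Hv : forall z, Cmod (z-(a, b))%C <= R0 -> 0 < v z).
  { intros z Hz. destruct (H z Hz) as [_ [_ [_ [_ HA]]]]. unfold v. lra. }
  assert (Hnn : forall z, Cmod (z-(a, b))%C <= R0 -> 0 <= E z).
  { intros z Hz. apply Rmult_le_pos; [apply Rmult_le_pos; [apply Cmod_ge_0|]|left; apply Rinv_0_lt_compat, Hv, Hz].
    rewrite Hdd. pose proof (Cmod_ge_0 (z-(a, b))%C). nra. }
  assert (Hcont : forall z, Cmod (z-(a, b))%C <= R0 -> rcont E z).
  { intros z Hz. destruct (H z Hz) as [D0 [D1 [_ [N0 HA]]]].
    apply (rcont_mult (fun w => Cmod (f1 w/f0 w)%C*dd w) (fun w => / v w)).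
    - apply (rcont_mult (fun w => Cmod (f1 w/f0 w)%C) dd).
      + eapply cder_rcont_mod. apply cder_div; eassumption.
      + unfold dd. replace (fun w : C => R0*R0-((Re w-a)*(Re w-a)+(Im w-b)*(Im w-b))) with
          (fun w => (-1*(Re w*Re w) + -1*(Im w*Im w)+(R0*R0-a*a-b*b))+(2*a*Re w+2*b*Im w)).
        * apply (rcont_plus (fun w => -1*(Re w*Re w) + -1*(Im w*Im w)+(R0*R0-a*a-b*b)) (fun w => 2*a*Re w+2*b*Im w)); [apply rcont_quadratic|].
          apply (rcont_plus (fun w => 2*a*Re w) (fun w => 2*b*Im w)); apply rcont_scal; [apply rcont_Re|apply rcont_Im].
        * apply functional_extensionality. intros w. ring.
    - apply (rcont_comp (fun u => / (A-u)) (fun w => ln (Cmod (f0 w)))).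
      + apply derivable_continuous_pt. exists (1/((A-ln (Cmod (f0 z)))*(A-ln (Cmod (f0 z))))). apply is_derive_Reals. auto_derive; [lra|]. field. lra.
      + apply cder_rcont_ln_mod with (f1 z); assumption. }
  (* Since [E >= 0] on the closed disc, its extension by 0 to the surrounding square is upper
     semicontinuous. *)
  set (W := fun w => if Rle_dec (Cmod (w-(a, b))%C) R0 then E w else 0).
  assert (E0 : Cmod ((a, b)-(a, b))%C = 0) by (rewrite Cmod_horizontal, Rminus_diag, Rabs_R0; reflexivity).
  destruct (usc_attains_max W (a-R0) (a+R0) (b-R0) (b+R0)) as [z0 [K0 Hmax]]; try lra.
  { intros z Kz eps He. unfold W. destruct (Rle_dec (Cmod (z-(a, b))%C) R0) as [Hz|Hz].
    - destruct (rcont_usc E z (Hcont z Hz) eps He) as [d [Hd Hu]]. exists d. split; [exact Hd|]. intros w _ Hw.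
      destruct (Rle_dec (Cmod (w-(a, b))%C) R0); [apply Hu; exact Hw|]. pose proof (Hnn z Hz). lra.
    - exists (Cmod (z-(a, b))%C-R0). split; [lra|]. intros w _ Hw.
      destruct (Rle_dec (Cmod (w-(a, b))%C) R0) as [Hw2|]; [|lra].
      assert (Cmod (z-(a, b))%C <= Cmod (w-z)%C+Cmod (w-(a, b))%C); [|lra].
      rewrite (Cmod_minus_sym w z). replace (z-(a, b))%C with ((z-w)+(w-(a, b)))%C by ring. apply Cmod_triangle. }
  assert (Kc : in_rect (a-R0) (a+R0) (b-R0) (b+R0) (a, b)) by (split; Re_lra).
  pose proof (Hmax (a, b) Kc) as M0.
  assert (Wc : W (a, b) = E (a, b)). { unfold W. destruct (Rle_dec (Cmod ((a, b)-(a, b))%C) R0); [reflexivity|lra]. }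
  assert (Hc0 : 0 < v (a, b)) by (apply Hv; lra).
  assert (Ec : E (a, b) = Cmod (f1 (a, b)/f0 (a, b))%C*(R0*R0) * / v (a, b)).
  { unfold E. rewrite Hdd, E0. ring. }
  assert (Goal2 : E (a, b) <= 2*R0).
  2:{ rewrite Ec in Goal2. apply Rmult_le_reg_r with (R0*R0 * / v (a, b)).
      { apply Rmult_lt_0_compat; [nra|apply Rinv_0_lt_compat; exact Hc0]. }
      fold (v (a, b)). replace (2*v (a, b)/R0*(R0*R0 * / v (a, b))) with (2*R0) by (field; lra). lra. }
  rewrite <- Wc. apply Rle_trans with (W z0); [exact M0|].
  apply Rnot_lt_le. intros Hlt.
  assert (Hz0 : Cmod (z0-(a, b))%C <= R0). { unfold W in Hlt. destruct (Rle_dec (Cmod (z0-(a, b))%C) R0); lra. }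
  assert (Wz : W z0 = E z0). { unfold W. destruct (Rle_dec (Cmod (z0-(a, b))%C) R0); [reflexivity|contradiction]. }
  rewrite Wz in Hlt.
  assert (Hvz := Hv z0 Hz0).
  assert (Hr : Cmod (z0-(a, b))%C < R0).
  { destruct Hz0 as [Hr|Hr]; [exact Hr|exfalso]. unfold E in Hlt. rewrite Hdd, Hr in Hlt. lra. }
  destruct z0 as [x y]. destruct (H (x, y) Hz0) as [D0 [D1 [D2 [N0 HA]]]].
  assert (N1 : f1 (x, y) <> 0%C).
  { intros E1. unfold E in Hlt. rewrite E1 in Hlt. replace (0/f0 (x, y))%C with (RtoC 0) in Hlt by (field; exact N0). rewrite Cmod_0 in Hlt. lra. }
  set (r0 := R0-Cmod ((x, y)-(a, b))%C).
  assert (In : forall w, Cmod (w-(x, y))%C < r0 -> Cmod (w-(a, b))%C < R0).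
  { intros w Hw. replace (w-(a, b))%C with ((w-(x, y))+((x, y)-(a, b)))%C by ring. le_lt_via Cmod_triangle. unfold r0 in Hw. lra. }
  assert (Hr0 : 0 < r0) by (unfold r0; lra).
  destruct (cder_neq_0_loc f1 (x, y) _ D1 N1) as [r1 [Hr1 Hne]].
  set (U := fun w => ln (Cmod (f1 w))+(-1)*ln (Cmod (f0 w))+(ln (dd w) + - ln (v w))).
  assert (LU : lapl U x y ((0 + -1*0)+(- (4*(R0*R0))/(dd (x, y)*dd (x, y))+Cmod (f1 (x, y)/f0 (x, y))%C*Cmod (f1 (x, y)/f0 (x, y))%C/(v (x, y)*v (x, y))))).
  { apply (lapl_plus (fun w => ln (Cmod (f1 w))+(-1)*ln (Cmod (f0 w))) (fun w => ln (dd w) + - ln (v w))).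
    - apply (lapl_plus (fun w => ln (Cmod (f1 w))) (fun w => (-1)*ln (Cmod (f0 w)))).
      + apply (lapl_ln_mod f1 f2 (f3 (x, y)) x y r0); auto. intros w Hw. apply H. left. apply In, Hw.
      + apply (lapl_scal (-1) (fun w => ln (Cmod (f0 w)))). apply (lapl_ln_mod f0 f1 (f2 (x, y)) x y r0); auto. intros w Hw. apply H. left. apply In, Hw.
    - apply (lapl_plus (fun w => ln (dd w)) (fun w => - ln (v w))).
      + apply (lapl_ln_disc a b R0 x y). exact Hr.
      + apply (lapl_neg_ln_ln_mod f0 f1 (f2 (x, y)) x y r0); auto. intros w Hw. apply H. left. apply In, Hw. }
  assert (UE : forall w, Cmod (w-(x, y))%C < Rmin r0 r1 -> U w = ln (E w) /\ 0 < E w).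
  { intros w Hw. pose proof (Rmin_l r0 r1). pose proof (Rmin_r r0 r1). assert (Hw1 := In w ltac:(lra)).
    destruct (H w ltac:(lra)) as [_ [_ [_ [Nw _]]]]. assert (Nw1 : f1 w <> 0%C).
    { specialize (Hne (w-(x, y))%C ltac:(lra)). replace ((x, y)+(w-(x, y)))%C with w in Hne by ring. exact Hne. }
    assert (Vw := Hv w ltac:(lra)). assert (Dw : 0 < dd w). { rewrite Hdd. pose proof (Cmod_ge_0 (w-(a, b))%C). nra. }
    apply Cmod_gt_0 in Nw as Nw'. apply Cmod_gt_0 in Nw1 as Nw1'. assert (Iw : 0 < / v w) by (apply Rinv_0_lt_compat; exact Vw).
    assert (Q0 : 0 < Cmod (f1 w/f0 w)%C) by (rewrite Cmod_div by exact Nw; apply Rdiv_lt_0_compat; assumption).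
    split.
    - unfold U, E. rewrite ln_mult, ln_mult, ln_Rinv, Cmod_div, ln_div by (try apply Rmult_lt_0_compat; assumption). ring.
    - apply Rmult_lt_0_compat; [apply Rmult_lt_0_compat|]; assumption. }
  assert (Hm : 0 < Rmin r0 r1) by (apply Rmin_pos; assumption).
  pose proof (lapl_at_local_max U x y _ (Rmin r0 r1) Hm LU) as LM.
  assert (LM2 : forall w, Cmod (w-(x, y))%C < Rmin r0 r1 -> U w <= U (x, y)).
  { intros w Hw. destruct (UE w Hw) as [-> Pw]. destruct (UE (x, y)) as [-> P0]; [rewrite Cmod_horizontal, Rminus_diag, Rabs_R0; exact Hm|].
    apply ln_le'; [exact Pw|]. rewrite <- Wz. pose proof (Rmin_l r0 r1). assert (Hw1 := In w ltac:(lra)).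
    assert (Ww : W w = E w). { unfold W. destruct (Rle_dec (Cmod (w-(a, b))%C) R0); [reflexivity|lra]. } rewrite <- Ww. apply Hmax.
    pose proof (re_le_Cmod (w-(a, b))%C) as B1. pose proof (Im_abs_le_Cmod (w-(a, b))%C) as B2. apply Rabs_le_between in B1. apply Rabs_le_between in B2.
    unfold Re, Im in B1, B2; simpl in B1, B2. split; unfold Re, Im; lra. }
  specialize (LM LM2). set (D := dd (x, y)) in *. set (V := v (x, y)) in *. set (l := Cmod (f1 (x, y)/f0 (x, y))%C) in *.
  assert (HD : 0 < D). { unfold D. rewrite Hdd. pose proof (Cmod_ge_0 ((x, y)-(a, b))%C). nra. }
  assert (EE : E (x, y) = l*D/V) by reflexivity.
  assert (Q : l*D/V*(l*D/V) <= 4*(R0*R0)).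
  { assert (X : (0 + -1*0+(- (4*(R0*R0))/(D*D)+l*l/(V*V)))*(D*D) <= 0*(D*D)) by nra.
    replace ((0 + -1*0+(- (4*(R0*R0))/(D*D)+l*l/(V*V)))*(D*D)) with (l*D/V*(l*D/V)-4*(R0*R0)) in X by (field; lra). lra. } nra.
Qed.

Lemma ln_lt_self (x : R) : 0 < x -> ln x < x.
Proof. intros H. pose proof (exp_ineq1 (ln x)) as E. rewrite exp_ln in E by exact H. lra. Qed.

Section Growth.
Variables (q : nat) (chi : nat -> C).
Hypothesis Hp : prime (Z.of_nat q).
Hypothesis Hchi : nonprincipal_char q chi.

Lemma Lfun_bound_strip (s : C) : / 4 <= Re s -> Cmod (Fk chi 0 s) <= 7*INR q*(1 + Cmod s).
Proof.
  intros Hs. pose proof (Lfun_bound chi (INR q) (nonprincipal_partial_sums q Hp chi Hchi) s ltac:(lra)) as H.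
  eapply Rle_trans; [exact H|]. assert (/ Re s <= 4). { rewrite <- (Rinv_inv 4). apply Rinv_le_contravar; lra. }
  pose proof (pos_INR q). pose proof (Cmod_ge_0 s).
  replace (7*INR q*(1+Cmod s)) with (INR q*(1+Cmod s)*7) by ring. apply Rmult_le_compat_l; nra.
Qed.

Lemma Lfun_ln_lower_right (s : C) : 3 <= Re s -> - ln (Cmod (Fk chi 0 s)) <= 1.
Proof.
  intros Hs. pose proof (Lfun_lower q chi Hp Hchi s Hs) as L.
  assert (ln (5/8) <= ln (Cmod (Fk chi 0 s))) by (apply ln_le'; lra).
  assert (- ln (5/8) <= 1); [|lra]. rewrite <- ln_Rinv by lra.
  rewrite <- (ln_exp 1). apply ln_le'; [lra|]. pose proof (exp_ineq1 1). lra.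
Qed.

Lemma vm_limit_bound : exists K, 0 < K /\ forall s, 3 <= Re s -> Cmod (Fk chi 1 s/Fk chi 0 s)%C <= K.
Proof.
  destruct (log_derivative_series q chi Hp Hchi 3 ltac:(lra)) as [K [HK H]]. exists K. split; [exact HK|]. intros s Hs.
  destruct (H s Hs) as [g [_ [E Hg]]]. specialize (Hg 0%nat). unfold vm_sum in Hg; simpl csum in Hg. simpl INR in Hg.
  rewrite ln_1, Rmult_0_r, exp_0, Rmult_1_r in Hg. replace (g-0)%C with g in Hg by ring.
  assert (N : Fk chi 0 s <> 0%C) by (apply (Lfun_neq_0_right q chi Hp Hchi); lra).
  rewrite E. replace (g*Fk chi 0 s/Fk chi 0 s)%C with g by (field; exact N). exact Hg.
Qed.

Hypothesis Hnz : forall s, / 2 < Re s -> Fk chi 0 s <> 0%C.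

(** The Schwarz lemma on discs of radius [a/2] bounds [|L'/L|] by a multiple of [v = A - ln |L|],
    with a majorant [A] linear in [|Im s|]. This is a differential inequality for [v] along
    horizontal lines, so [v] grows at most by a constant factor on the way from [Re s = 3], where it
    is known. The constant depends on [a] and [q]; only linear growth is used later. *)
Lemma log_derivative_growth (a : R) : 0 < a <= 1 -> exists K, 0 < K /\ forall s, / 2 + a <= Re s ->
  Cmod (Fk chi 1 s/Fk chi 0 s)%C <= K*(1 + Rabs (Im s)) /\ - ln (Cmod (Fk chi 0 s)) <= K*(1 + Rabs (Im s)).
Proof.
  intros Ha. destruct vm_limit_bound as [K1 [HK1 H1]].
  set (R0 := a/2). set (B := 35*INR q+1). pose proof (pos_INR q) as Hq.
  set (Ex := exp (2/R0*3)). assert (HEx : 1 <= Ex). { rewrite <- exp_0. apply exp_le. apply Rmult_le_pos; [|lra]. left. apply Rdiv_lt_0_compat; unfold R0; lra. }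
  set (K2 := (B+1)*Ex).
  assert (HK2 : 0 < K2) by (unfold K2, B; nra).
  assert (HR : 0 < R0) by (unfold R0; lra). assert (HiR : 0 < 2/R0) by div_pos.
  exists (K1+(1+K2+2/R0*K2)). split; [nra|]. intros s Hs. destruct s as [x t]. unfold Re in Hs; simpl in Hs. unfold Im; simpl snd.
  pose proof (Rabs_pos t) as Ht.
  destruct (Rle_or_lt 3 x) as [H3|H3].
  { split.
    - eapply Rle_trans; [apply H1; exact H3|]. assert (0 < 2/R0*K2) by nra. nra.
    - eapply Rle_trans; [apply Lfun_ln_lower_right; exact H3|]. assert (0 < 2/R0*K2) by nra. nra. }
  set (A := B*(1+Rabs t)).
  set (v := fun u => A-ln (Cmod (Fk chi 0 (u, t)))).
  assert (HA : forall u z, / 2+a <= u <= 3 -> Cmod (z-(u, t))%C <= R0 -> / 2 < Re z /\ ln (Cmod (Fk chi 0 z)) < A).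
  { intros u z Hu Hz. pose proof (re_le_Cmod (z-(u, t))%C) as B1. pose proof (Im_abs_le_Cmod (z-(u, t))%C) as B2.
    unfold Re, Im in B1, B2; simpl in B1, B2. apply Rabs_le_between in B1.
    assert (Hz1 : / 2 < Re z) by (unfold Re, R0 in *; lra). split; [exact Hz1|].
    eapply Rlt_le_trans; [apply ln_lt_self; apply Cmod_gt_0, Hnz, Hz1|].
    eapply Rle_trans; [apply Lfun_bound_strip; lra|].
    assert (Cmod z <= 4+Rabs t).
    { le_via Cmod_le_abs. rewrite (Rabs_right (Re z)) by lra.
      assert (Rabs (Im z) <= Rabs t+R0). { replace (Im z) with (t+(Im z-t)) by ring. le_via Rabs_triang.
        unfold Im. unfold Rminus in *. lra. }
      unfold Re, R0 in *. lra. }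
    unfold A, B. nra. }
  assert (Sch : forall u, / 2+a <= u <= 3 -> Cmod (Fk chi 1 (u, t)/Fk chi 0 (u, t))%C <= 2/R0*v u).
  { intros u Hu.
    pose proof (log_derivative_schwarz (Fk chi 0) (fun z => - Fk chi 1 z)%C (fun z => Fk chi 2 z) (fun z => - Fk chi 3 z)%C u t R0 A HR) as S.
    assert (N : Fk chi 0 (u, t) <> 0%C) by (apply Hnz; Re_lra).
    replace (Fk chi 1 (u, t)/Fk chi 0 (u, t))%C with (- (- Fk chi 1 (u, t)/Fk chi 0 (u, t)))%C by (field; exact N).
    rewrite Cmod_opp. unfold v. replace (2/R0*(A-ln (Cmod (Fk chi 0 (u, t))))) with (2*(A-ln (Cmod (Fk chi 0 (u, t))))/R0) by (field; lra).
    apply S. intros z Hz. destruct (HA u z Hu Hz) as [Hz1 Hz2].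
    assert (Hz0 : 0 < Re z) by lra.
    split; [apply (Lfun_cder q chi Hp Hchi); exact Hz0|]. split.
    - pose proof (cder_scal _ _ _ (-1) (Lfun_cder q chi Hp Hchi 1 z Hz0)) as D.
      replace (fun z0 => - Fk chi 1 z0)%C with (fun z0 => -1*Fk chi 1 z0)%C by fun_ring.
      replace (Fk chi 2 z) with (-1 * - Fk chi 2 z)%C by ring. exact D.
    - split; [apply (Lfun_cder q chi Hp Hchi); exact Hz0|]. auto. }
  assert (V3 : v 3 <= A+1). { unfold v. pose proof (Lfun_ln_lower_right (3, t)) as L. unfold Re in L; simpl in L. lra. }
  (* Gronwall's inequality is run from 3 to the left, hence the reflection; the path is shorter than
     3. *)
  assert (Vx : v x <= v 3*Ex).
  { pose proof (gronwall (fun y => v (- y)) (fun y => - - Re (- Fk chi 1 ((- y)%R, t)/Fk chi 0 ((- y)%R, t))%C) (2/R0) (- (3)) (- x) ltac:(lra)) as G.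
    cbv beta in G. rewrite !Ropp_involutive in G. le_via G; clear G.
    - intros y Hy.
      assert (D : is_derive (fun u => ln (Cmod (Fk chi 0 (u, t)))) (- y) (Re (- Fk chi 1 ((- y)%R, t)/Fk chi 0 ((- y)%R, t))%C)).
      { apply (rder_ln_mod (fun u => Fk chi 0 (u, t))); [apply Hnz; Re_lra|]. apply rder_horizontal. apply (Lfun_cder q chi Hp Hchi). Re_lra. }
      set (d := Re (- Fk chi 1 ((- y)%R, t)/Fk chi 0 ((- y)%R, t))%C) in *.
      replace (- - d) with (0-(-1)*d) by ring.
      apply (is_derive_minus (fun _ => A) (fun y => ln (Cmod (Fk chi 0 ((- y)%R, t))))); [apply (is_derive_const A y)|].
      apply (is_derive_comp (fun u => ln (Cmod (Fk chi 0 (u, t)))) (fun y => - y)); [exact D|].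
      der_ring.
    - intros y Hy. rewrite Ropp_involutive.
      assert (N : Fk chi 0 ((- y)%R, t) <> 0%C) by (apply Hnz; Re_lra).
      le_via Re_le_Cmod.
      replace (- Fk chi 1 ((- y)%R, t)/Fk chi 0 ((- y)%R, t))%C with (- (Fk chi 1 ((- y)%R, t)/Fk chi 0 ((- y)%R, t)))%C by (field; exact N).
      rewrite Cmod_opp. apply Sch. lra.
    - assert (Hv3 : 0 <= v 3).
      { unfold v. destruct (HA 3 (3, t)) as [_ L]; [lra|rewrite Cmod_horizontal, Rminus_diag, Rabs_R0; lra|]. lra. }
      apply Rmult_le_compat_l; [exact Hv3|]. apply exp_le. nra. }
  assert (Vf : v x <= K2*(1+Rabs t)).
  { eapply Rle_trans; [exact Vx|]. unfold K2. apply Rle_trans with ((A+1)*Ex); [apply Rmult_le_compat_r; lra|]. unfold A. nra. } assert (P2 : 0 <= K2*(1+Rabs t)) by nra.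
  split.
  - eapply Rle_trans; [apply Sch; lra|]. nra.
  - assert (- ln (Cmod (Fk chi 0 (x, t))) <= v x). { unfold v. assert (0 <= A) by (unfold A, B; nra). lra. } nra.
Qed.
End Growth.

(** * Limits of primitives and Mellin transforms *)

Lemma rder_compare (F f : R -> C) (G g : R -> R) (a b : R) : a <= b ->
  (forall t, a <= t <= b -> rder F t (f t)) -> (forall t, a <= t <= b -> is_derive G t (g t)) ->
  (forall t, a <= t <= b -> Cmod (f t) <= g t) -> Cmod (F b - F a)%C <= G b - G a.
Proof.
  intros Hab HF HG Hle. set (w := (F b-F a)%C). pose proof (Cmod_ge_0 w) as Hw.
  set (phi := fun t => (Re w*Re (F t)+Im w*Im (F t))-Cmod w*G t).
  assert (D : phi b <= phi a).
  { apply (derive_nonpos_le phi (fun t => (Re w*Re (f t)+Im w*Im (f t))-Cmod w*g t)); [exact Hab| |].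
    - intros t Ht. destruct (HF t Ht) as [H1 H2]. specialize (HG t Ht).
      apply (is_derive_minus (fun t => Re w*Re (F t)+Im w*Im (F t)) (fun t => Cmod w*G t)); [|apply is_derive_scal; exact HG].
      apply (is_derive_plus (fun t => Re w*Re (F t)) (fun t => Im w*Im (F t))); apply is_derive_scal; assumption.
    - intros t Ht. specialize (Hle t Ht). assert (Re w*Re (f t)+Im w*Im (f t) <= Cmod w*Cmod (f t)); [|nra].
      rewrite <- (Cmod_conj w), <- Cmod_mult. eapply Rle_trans; [|apply Re_le_Cmod]. unfold Cconj, Re, Im; simpl. right; ring. }
  destruct (Req_dec (Cmod w) 0) as [Z|Z].
  -
    pose proof (derive_nonpos_le (fun t => - G t) (fun t => - g t) a b Hab) as M.
    assert (- G b <= - G a); [|lra]. apply M; [intros t Ht; apply (is_derive_opp G); apply HG; exact Ht|].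
    intros t Ht. specialize (Hle t Ht). pose proof (Cmod_ge_0 (f t)). lra.
  - apply Rmult_le_reg_l with (Cmod w); [lra|]. rewrite Cmod_sqr. unfold phi in D.
    replace (Re w*Re w+Im w*Im w) with ((Re w*Re (F b)+Im w*Im (F b))-(Re w*Re (F a)+Im w*Im (F a))) by (unfold w, Re, Im; simpl; ring). lra.
Qed.

Lemma rder_continuous (g : R -> C) (w : R) (d : C) : rder g w d -> continuous (fun x => Re (g x)) w /\ continuous (fun x => Im (g x)) w.
Proof. intros [H1 H2]. split; apply (ex_derive_continuous (V := R_NormedModule)); eexists; eassumption. Qed.

Lemma rder_primitive (g g' : R -> C) : (forall w, rder g w (g' w)) -> exists H : R -> C, H 0 = 0%C /\ forall w, rder H w (g w).
Proof.
  intros Hg. exists (fun w => (RInt (fun x => Re (g x)) 0 w, RInt (fun x => Im (g x)) 0 w)). split.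
  - rewrite !RInt_point. reflexivity.
  - split; unfold Re at 1, Im at 1; simpl.
    + apply (is_derive_RInt (fun x => Re (g x)) _ 0 w); [|apply (rder_continuous g w _ (Hg w))].
      apply filter_forall. intros b. apply (RInt_correct (V := R_CompleteNormedModule)). apply (ex_RInt_continuous (V := R_CompleteNormedModule)). intros z _. apply (rder_continuous g z _ (Hg z)).
    + apply (is_derive_RInt (fun x => Im (g x)) _ 0 w); [|apply (rder_continuous g w _ (Hg w))].
      apply filter_forall. intros b. apply (RInt_correct (V := R_CompleteNormedModule)). apply (ex_RInt_continuous (V := R_CompleteNormedModule)). intros z _. apply (rder_continuous g z _ (Hg z)).
Qed.

Lemma rder_limit_pinfty (F f : R -> C) (B c : R) : 0 < c -> 0 <= B ->
  (forall w, 0 <= w -> rder F w (f w)) -> (forall w, 0 <= w -> Cmod (f w) <= B*exp (- c*w)) ->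
  exists l, forall w, 0 <= w -> Cmod (F w - l)%C <= B/c*exp (- c*w).
Proof.
  intros Hc HB HF Hf.
  assert (Ca : forall a b, 0 <= a <= b -> Cmod (F b-F a)%C <= B/c*exp (- c*a)).
  { intros a b Hab. le_via (rder_compare F f (fun w => - (B/c)*exp (- c*w)) (fun w => B*exp (- c*w))).
    - lra.
    - intros t Ht. apply HF. lra.
    - intros t Ht. auto_derive; trivial. field. lra.
    - intros t Ht. apply Hf. lra.
    - pose proof (exp_pos (- c*b)). assert (0 <= B/c) by (apply Rmult_le_pos; [lra|left; inv_pos]). nra. }
  destruct (ccv_cauchy (fun n => F (INR n)) (fun n => B/c*exp (- c*INR n))) as [l Hl].
  - intros m n Hmn. apply Ca. split; [apply pos_INR|apply le_INR; exact Hmn].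
  - replace (Finite 0) with (Rbar_mult (B/c) 0) by (simpl; f_equal; ring). apply is_lim_seq_scal_l.
    apply is_lim_seq_spec. intros eps. pose proof (cond_pos eps) as He.
    destruct (nfloor_ex (Rabs (ln eps/c)) (Rabs_pos _)) as [N [_ HN]]. exists (S N). intros n Hn.
    rewrite Rminus_0_r, Rabs_right by (apply Rle_ge, Rlt_le, exp_pos). rewrite <- (exp_ln eps He). apply exp_increasing.
    apply le_INR in Hn. rewrite S_INR in Hn. pose proof (Rle_abs (- (ln eps/c))) as Q. rewrite Rabs_Ropp in Q.
    assert (- (ln eps/c) < INR n) by lra. apply Rmult_lt_compat_l with (r := c) in H; [|lra]. replace (c * - (ln eps/c)) with (- ln eps) in H by (field; lra). lra.
  - exists l. intros w Hw. destruct (nfloor_ex w Hw) as [N [_ HN]]. rewrite Cmod_minus_sym.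
    apply ccv_le with (u := fun n => (F (INR n)-F w)%C) (N0 := S N); [apply ccv_minus; [exact Hl|apply ccv_const]|].
    intros n Hn. apply Ca. apply le_INR in Hn. rewrite S_INR in Hn. lra.
Qed.

Lemma rder_reflect (F f : R -> C) (w : R) : rder F (- w) (f (- w)) -> rder (fun x => F (- x)) w (Copp (f (- w))).
Proof.
  intros [H1 H2]. split.
  - change (Re (Copp (f (- w)))) with (- Re (f (- w))). replace (- Re (f (- w))) with (-1*Re (f (- w))) by ring.
    apply (is_derive_comp (fun x => Re (F x)) (fun x => - x)); [exact H1|der_ring].
  - change (Im (Copp (f (- w)))) with (- Im (f (- w))). replace (- Im (f (- w))) with (-1*Im (f (- w))) by ring.
    apply (is_derive_comp (fun x => Im (F x)) (fun x => - x)); [exact H2|der_ring].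
Qed.

Lemma rder_limit_minfty (F f : R -> C) (B c : R) : 0 < c -> 0 <= B ->
  (forall w, w <= 0 -> rder F w (f w)) -> (forall w, w <= 0 -> Cmod (f w) <= B*exp (c*w)) ->
  exists l, forall w, w <= 0 -> Cmod (F w - l)%C <= B/c*exp (c*w).
Proof.
  intros Hc HB HF Hf. destruct (rder_limit_pinfty (fun w => F (- w)) (fun w => Copp (f (- w))) B c Hc HB) as [l Hl].
  - intros w Hw. apply rder_reflect. apply HF. lra.
  - intros w Hw. rewrite Cmod_opp. eapply Rle_trans; [apply Hf; lra|]. right. do 2 f_equal. ring.
  - exists l. intros w Hw. specialize (Hl (- w) ltac:(lra)). rewrite Ropp_involutive in Hl. eapply Rle_trans; [exact Hl|]. right. do 2 f_equal. ring.
Qed.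

Lemma rder_shift (F : R -> C) (f : C) (a v : R) : rder F (v + a) f -> rder (fun x => F (x + a)) v f.
Proof.
  intros [H1 H2]. split.
  - replace (Re f) with (1*Re f) by ring. apply (is_derive_comp (fun x => Re (F x)) (fun x => x+a)); [exact H1|der_ring].
  - replace (Im f) with (1*Im f) by ring. apply (is_derive_comp (fun x => Im (F x)) (fun x => x+a)); [exact H2|der_ring].
Qed.

Lemma rder_scal (c : C) (F : R -> C) (v : R) (f : C) : rder F v f -> rder (fun x => c*F x)%C v (c*f)%C.
Proof. intros H. apply rder_eq with (0*F v+c*f)%C; [ring|]. apply (rder_mult (fun _ => c) F); [apply rder_const|exact H]. Qed.

Lemma rder_csum (F : nat -> R -> C) (f : nat -> C) (v : R) (N : nat) : (forall n, (1 <= n <= N)%nat -> rder (F n) v (f n)) ->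
  rder (fun x => csum (fun n => F n x) N) v (csum f N).
Proof.
  intros H. induction N; cbn [csum]; [apply rder_const|]. apply (rder_plus (fun x => csum (fun n => F n x) N) (F (S N))); [apply IHN; intros; apply H; lia|apply H; lia].
Qed.

Section MellinKernel.
Variables k k' : R -> R.
Hypothesis Hder : forall u, is_derive k u (k' u).
Hypothesis Hk : forall be w, 0 <= be <= 1 -> Rabs (k (exp w)) <= 2*exp ((1 + be)*w).
Hypothesis Hk' : forall be w, 0 <= be <= 1 -> Rabs (exp w*k' (exp w)) <= 2*exp ((1 + be)*w).

(** With [u = exp w] this is [k(u) u^(-s-2) du]. By hypothesis [k(u)] is [O(u^2)] at 0 and [O(u)] at
    infinity, so the integral converges for [0 < Re s < 1]. *)
Definition mellin_integrand (s : C) (w : R) : C := (RtoC (k (exp w))*cexp (- (s + 1)*w))%C.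

Lemma rder_kexp (w : R) : is_derive (fun w => k (exp w)) w (exp w*k' (exp w)).
Proof. apply (is_derive_comp k exp); [apply Hder|]. apply is_derive_exp. Qed.

Lemma mellin_integrand_der (s : C) (w : R) : exists d, rder (mellin_integrand s) w d.
Proof.
  eexists. apply (rder_mult (fun w => RtoC (k (exp w))) (fun w => cexp (- (s+1)*w)%C)); [|apply rder_cexp_lin].
  apply (rder_RtoC (fun w => k (exp w))). apply rder_kexp.
Qed.

Lemma mellin_integrand_bound (s : C) (be w : R) : 0 <= be <= 1 -> Cmod (mellin_integrand s w) <= 2*exp ((be - Re s)*w).
Proof.
  intros Hb. unfold mellin_integrand. rewrite Cmod_mult, Cmod_R, Cmod_cexp_real_mult.
  apply Rle_trans with (2*exp ((1+be)*w)*exp (- Re (s+1)%C*w)); [apply Rmult_le_compat_r; [left; apply exp_pos|apply Hk; exact Hb]|].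
  rewrite Rmult_assoc, <- exp_plus. right. do 2 f_equal. unfold Re; simpl. ring.
Qed.

(** The improper integral is represented by a primitive [H] and its limits at both ends, with rates;
    the functional equation compares primitives rather than integrals. The Mellin transform is
    [hp - hm]. *)
Definition is_mellin (s : C) (H : R -> C) (hp hm : C) : Prop :=
  H 0 = 0%C /\ (forall w, rder H w (mellin_integrand s w)) /\
  (forall w, 0 <= w -> Cmod (H w - hp)%C <= 4/Re s*exp (- (Re s/2)*w)) /\
  (forall w, w <= 0 -> Cmod (H w - hm)%C <= 4/(1 - Re s)*exp ((1 - Re s)/2*w)).

Lemma mellin_exists (s : C) : 0 < Re s < 1 -> exists H hp hm, is_mellin s H hp hm.
Proof.
  intros Hs. destruct (rder_primitive (mellin_integrand s) (fun w => epsilon (inhabits (RtoC 0)) (fun d => rder (mellin_integrand s) w d))) as [H [H0 H1]].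
  { intros w. apply epsilon_spec. apply mellin_integrand_der. }
  destruct (rder_limit_pinfty H (mellin_integrand s) 2 (Re s/2)) as [hp Hp]; try lra.
  { auto. }
  { intros w Hw. eapply Rle_trans; [apply (mellin_integrand_bound s (Re s/2)); lra|]. right. do 2 f_equal. field. }
  destruct (rder_limit_minfty H (mellin_integrand s) 2 ((1-Re s)/2)) as [hm Hm]; try lra.
  { auto. }
  { intros w Hw. eapply Rle_trans; [apply (mellin_integrand_bound s ((1+Re s)/2)); lra|]. right. do 2 f_equal. field. }
  exists H, hp, hm. split; [exact H0|]. split; [exact H1|]. split; intros w Hw.
  - eapply Rle_trans; [apply Hp; exact Hw|]. right. field. lra.
  - eapply Rle_trans; [apply Hm; exact Hw|]. right. field. lra.
Qed.

Definition mellin (s : C) : C := epsilon (inhabits (RtoC 0)) (fun K => exists H hp hm, is_mellin s H hp hm /\ K = (hp - hm)%C).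

Lemma mellin_spec (s : C) : 0 < Re s < 1 -> exists H hp hm, is_mellin s H hp hm /\ mellin s = (hp - hm)%C.
Proof.
  intros Hs. unfold mellin. apply epsilon_spec. destruct (mellin_exists s Hs) as [H [hp [hm HH]]]. exists (hp-hm)%C, H, hp, hm. auto.
Qed.

Lemma mellin_bound (s : C) : / 4 <= Re s <= 3/4 -> Cmod (mellin s) <= 32.
Proof.
  intros Hs. destruct (mellin_spec s ltac:(lra)) as [H [hp [hm [[H0 [_ [H2 H3]]] ->]]]].
  specialize (H2 0 ltac:(lra)). specialize (H3 0 ltac:(lra)). rewrite H0, Rmult_0_r, exp_0 in H2, H3.
  assert (4/Re s <= 16). { apply Rmult_le_reg_r with (Re s); [lra|]. unfold Rdiv. rewrite Rmult_assoc, Rinv_l by lra. lra. }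
  assert (4/(1-Re s) <= 16). { apply Rmult_le_reg_r with (1-Re s); [lra|]. unfold Rdiv. rewrite Rmult_assoc, Rinv_l by lra. lra. }
  replace (hp-hm)%C with ((0-hm)-(0-hp))%C by ring. le_via Cmod_minus_le. lra.
Qed.

(** The difference of the primitives for [s + h] and [s] has a derivative of size [|h|] that decays
    at both ends; [c] is a fraction of the distance of [s] from the edges of the strip. The
    resulting continuity carries the functional equation to the critical line itself. *)
Lemma mellin_lipschitz (s : C) : 0 < Re s < 1 -> exists K r, 0 < r /\ forall h, Cmod h < r -> Cmod (mellin (s + h) - mellin s)%C <= K*Cmod h.
Proof.
  intros Hs. set (c := Rmin (Re s) (1-Re s)/8).
  assert (Hc : 0 < c /\ 8*c <= Re s /\ 8*c <= 1-Re s).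
  { unfold c. pose proof (Rmin_l (Re s) (1-Re s)). pose proof (Rmin_r (Re s) (1-Re s)). assert (0 < Rmin (Re s) (1-Re s)) by (apply Rmin_pos; lra). lra. }
  destruct (pow_le_exp 1 c) as [B [HB HE]]; [lra|]. destruct (mellin_spec s Hs) as [H [hp [hm [[H0 [H1 [H2 H3]]] E]]]].
  exists (2*(2*B/c)), c. split; [lra|]. intros h Hh. pose proof (Cmod_ge_0 h) as Hh0.
  pose proof (re_le_Cmod h) as Rh. apply Rabs_le_between in Rh.
  assert (Hsh : 0 < Re (s+h)%C < 1) by (unfold Re in *; simpl; lra).
  destruct (mellin_spec (s+h)%C Hsh) as [G [gp [gm [[G0 [G1 [G2 G3]]] E']]]].
  set (D := fun w => (G w-H w)%C).
  assert (HD : forall w, rder D w (mellin_integrand (s+h) w-mellin_integrand s w)%C).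
  { intros w. apply (rder_plus G (fun w => - H w)%C); [apply G1|].
    apply rder_ext with (fun w => -1*H w)%C; [intros; ring|]. apply rder_eq with (-1*mellin_integrand s w)%C; [ring|]. apply rder_scal. apply H1. }
  assert (HDb : forall be w, 0 <= be <= 1 -> Cmod (mellin_integrand (s+h) w-mellin_integrand s w)%C <= 2*exp ((be-Re s)*w)*(Cmod h*(B*exp (2*c*Rabs w)))).
  { intros be w Hb. unfold mellin_integrand. replace (- (s+h+1)*w)%C with (- (s+1)*w + - h*w)%C by ring. rewrite cexp_plus.
    replace (RtoC (k (exp w))*(cexp (- (s+1)*w)*cexp (- h*w))-RtoC (k (exp w))*cexp (- (s+1)*w))%C with (mellin_integrand s w*(cexp (- h*w)-1))%C by (unfold mellin_integrand; ring).
    rewrite Cmod_mult. apply Rmult_le_compat; try apply Cmod_ge_0; [apply mellin_integrand_bound; exact Hb|].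
    le_via cexp_sub1_bound. rewrite Cmod_mult, Cmod_opp, Cmod_R. rewrite Rmult_assoc. apply Rmult_le_compat_l; [exact Hh0|].
    specialize (HE (Rabs w) (Rabs_pos w)). pose proof (Rabs_pos w) as Hw.
    apply Rle_trans with (B*exp (c*Rabs w)*exp (c*Rabs w)); [apply Rmult_le_compat; [lra|left; apply exp_pos|lra|apply exp_le; nra]|].
    rewrite Rmult_assoc, <- exp_plus. right. do 2 f_equal. ring. }
  assert (Lp : exists l, forall w, 0 <= w -> Cmod (D w-l)%C <= 2*B*Cmod h/c*exp (- c*w)).
  { apply rder_limit_pinfty with (f := fun w => (mellin_integrand (s+h) w-mellin_integrand s w)%C); [lra|nra|intros; apply HD|]. intros w Hw.
    eapply Rle_trans; [apply (HDb 0); lra|]. rewrite Rabs_right by lra.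
    replace (2*exp ((0-Re s)*w)*(Cmod h*(B*exp (2*c*w)))) with (2*B*Cmod h*(exp ((0-Re s)*w)*exp (2*c*w))) by ring.
    rewrite <- exp_plus. apply Rmult_le_compat_l; [nra|]. apply exp_le. nra. }
  assert (Lm : exists l, forall w, w <= 0 -> Cmod (D w-l)%C <= 2*B*Cmod h/c*exp (c*w)).
  { apply rder_limit_minfty with (f := fun w => (mellin_integrand (s+h) w-mellin_integrand s w)%C); [lra|nra|intros; apply HD|]. intros w Hw.
    eapply Rle_trans; [apply (HDb 1); lra|]. rewrite Rabs_left1 by lra.
    replace (2*exp ((1-Re s)*w)*(Cmod h*(B*exp (2*c * - w)))) with (2*B*Cmod h*(exp ((1-Re s)*w)*exp (2*c * - w))) by ring.
    rewrite <- exp_plus. apply Rmult_le_compat_l; [nra|]. apply exp_le. nra. }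
  destruct Lp as [lp Lp]. destruct Lm as [lm Lm].
  (* By uniqueness of limits, the limit of the difference of the primitives is the difference of
     their limits. *)
  assert (Uq : forall (u v : R -> C) l m c1 B1 c2 B2 c3 B3, 0 < c1 -> 0 < c2 -> 0 < c3 -> (forall w, 0 <= w -> Cmod (u w-l)%C <= B1*exp (- c1*w)) ->
     (forall w, 0 <= w -> Cmod (v w-m)%C <= B2*exp (- c2*w)) -> forall n, (forall w, 0 <= w -> Cmod (u w-v w-n)%C <= B3*exp (- c3*w)) -> n = (l-m)%C).
  { assert (Tq : forall (u : R -> C) l c1 B1, 0 < c1 -> (forall w, 0 <= w -> Cmod (u w-l)%C <= B1*exp (- c1*w)) -> ccv (fun N => u (lnn (S N))) l).
    { intros u l c1 B1 Hc1 Hu. assert (ccv (fun N => u (lnn (S N))-l)%C 0).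
      { apply ccv_0_le with (fun N => B1*exp (- c1*lnn (S N))); [intros n; apply Hu, ln_INR_nonneg|]. apply lim_scal_decay; exact Hc1. }
      replace l with (0+l)%C by ring. eapply ccv_ext; [|apply ccv_plus; [exact H4|apply (ccv_const l)]]. intros n. simpl. ring. }
    intros u v l m c1 B1 c2 B2 c3 B3 Hc1 Hc2 Hc3 Hu Hv n Hn.
    apply ccv_unique with (fun N => u (lnn (S N))-v (lnn (S N)))%C.
    - apply (Tq (fun w => u w-v w)%C n c3 B3 Hc3). exact Hn.
    - apply ccv_minus; [apply (Tq u l c1 B1)|apply (Tq v m c2 B2)]; assumption. }
  assert (Ep : lp = (gp-hp)%C).
  { apply (Uq G H gp hp (Re (s+h)%C/2) (4/Re (s+h)%C) (Re s/2) (4/Re s) c (2*B*Cmod h/c)); try lra; assumption. }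
  assert (Em : lm = (gm-hm)%C).
  { apply (Uq (fun w => G (- w)) (fun w => H (- w)) gm hm ((1-Re (s+h)%C)/2) (4/(1-Re (s+h)%C)) ((1-Re s)/2) (4/(1-Re s)) c (2*B*Cmod h/c)); try lra.
    - intros w Hw. eapply Rle_trans; [apply G3; lra|]. right. do 2 f_equal. ring.
    - intros w Hw. eapply Rle_trans; [apply H3; lra|]. right. do 2 f_equal. ring.
    - intros w Hw. eapply Rle_trans; [apply (Lm (- w)); lra|]. right. do 2 f_equal. ring. }
  rewrite E, E'. replace (gp-gm-(hp-hm))%C with ((gp-hp)-(gm-hm))%C by ring. rewrite <- Ep, <- Em.
  specialize (Lp 0 ltac:(lra)). specialize (Lm 0 ltac:(lra)). rewrite Rmult_0_r, exp_0 in Lp, Lm.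
  assert (D0 : D 0 = 0%C) by (unfold D; rewrite G0, H0; ring). rewrite D0 in Lp, Lm.
  replace (lp-lm)%C with ((0-lm)-(0-lp))%C by ring. le_via Cmod_minus_le. lra.
Qed.
End MellinKernel.

(** * The kernels [1 - cos u] and [u - sin u], and a Fourier series *)

Definition kcos (u : R) : R := 1 - cos u.
(** [kcos] and [ksin] are the second integrals from 0 of [cos] and [sin]. They are [O(u^2)] at 0 and
    [O(u)] at infinity, which places their Mellin transforms in the critical strip. *)
Definition ksin (u : R) : R := u - sin u.

Lemma kcos_der (u : R) : is_derive kcos u (sin u).
Proof. unfold kcos. der_ring. Qed.

Lemma ksin_der (u : R) : is_derive ksin u (kcos u).
Proof. unfold ksin, kcos. der_ring. Qed.

Lemma abs_sin_le (u : R) : 0 < u -> Rabs (sin u) <= u.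
Proof.
  intros Hu. pose proof (sin_lt_x u Hu). pose proof (SIN_bound u). apply Rabs_le.
  destruct (Rle_or_lt 1 u); [lra|]. pose proof PI2_1. pose proof (sin_ge_0 u ltac:(lra) ltac:(lra)). lra.
Qed.

Lemma kcos_le_sqr (u : R) : 0 < u -> 0 <= kcos u <= u*u/2.
Proof.
  intros Hu. unfold kcos. pose proof (COS_bound u). split; [lra|].
  replace u with (2*(u/2)) at 1 by field. rewrite cos_2a_sin. pose proof (abs_sin_le (u/2) ltac:(lra)) as H0. apply Rabs_le_between in H0. nra.
Qed.

Lemma kcos_bound (be w : R) : -1 <= be <= 1 -> Rabs (kcos (exp w)) <= 2*exp ((1 + be)*w).
Proof.
  intros Hb. set (u := exp w). assert (Hu : 0 < u) by apply exp_pos. pose proof (kcos_le_sqr u Hu). rewrite Rabs_right by lra.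
  destruct (Rle_or_lt w 0) as [Hw|Hw].
  - assert (u*u <= exp ((1+be)*w)). { unfold u. rewrite <- exp_plus. apply exp_le. nra. } lra.
  - assert (1 <= exp ((1+be)*w)). { apply Rle_trans with (exp 0); [rewrite exp_0; lra|]. apply exp_le. nra. } unfold kcos in *. pose proof (COS_bound u). lra.
Qed.

Lemma exp_regimes (be w : R) : 0 <= be <= 1 -> (w <= 0 /\ exp w <= 1 /\ exp w*exp w <= exp ((1 + be)*w)) \/ (0 < w /\ 1 < exp w /\ exp w <= exp ((1 + be)*w)).
Proof. destruct (Rle_or_lt w 0) as [Hw|Hw].
  - left. split; [exact Hw|]. split; [rewrite <- exp_0; apply exp_le; exact Hw|]. rewrite <- exp_plus. apply exp_le. nra.
  - right. split; [exact Hw|]. split; [rewrite <- exp_0; apply exp_increasing; exact Hw|]. apply exp_le. nra.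
Qed.

Lemma kcos_bound' (be w : R) : 0 <= be <= 1 -> Rabs (exp w*sin (exp w)) <= 2*exp ((1 + be)*w).
Proof.
  intros Hb. pose proof (exp_pos w) as Hu. pose proof (abs_sin_le (exp w) Hu) as H1. rewrite Rabs_mult, (Rabs_right (exp w)) by lra.
  assert (Rabs (sin (exp w)) <= 1) by (apply Rabs_le; apply SIN_bound).
  destruct (exp_regimes be w Hb) as [[_ [H2 H3]]|[_ [H2 H3]]]; nra.
Qed.

Lemma ksin_bound (be w : R) : 0 <= be <= 1 -> Rabs (ksin (exp w)) <= 2*exp ((1 + be)*w).
Proof.
  intros Hb. pose proof (exp_pos w) as Hu. pose proof (abs_sin_le (exp w) Hu) as H1. apply Rabs_le_between in H1. pose proof (sin_lt_x (exp w) Hu).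
  unfold ksin. rewrite Rabs_right by lra.
  destruct (exp_regimes be w Hb) as [[_ [H2 H3]]|[_ [H2 H3]]]; [|lra].
  assert (ksin (exp w)-exp w*exp w <= ksin 0-0*0).
  { apply (derive_nonpos_le (fun u => ksin u-u*u) (fun u => kcos u-2*u)); [lra| |].
    - intros x Hx. apply (is_derive_minus ksin (fun u => u*u) x (kcos x) (2*x)); [apply ksin_der|der_ring].
    - intros x Hx. destruct (Req_dec x 0) as [->|Hx0]; [unfold kcos; rewrite cos_0; lra|]. pose proof (kcos_le_sqr x ltac:(lra)). nra. }
  unfold ksin in H0. rewrite sin_0 in H0. lra.
Qed.

Lemma ksin_bound' (be w : R) : 0 <= be <= 1 -> Rabs (exp w*kcos (exp w)) <= 2*exp ((1 + be)*w).
Proof.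
  intros Hb. pose proof (exp_pos w) as Hu. pose proof (kcos_le_sqr (exp w) Hu) as H1. rewrite Rabs_right by nra.
  assert (kcos (exp w) <= 2) by (unfold kcos; pose proof (COS_bound (exp w)); lra).
  destruct (exp_regimes be w Hb) as [[_ [H2 H3]]|[_ [H2 H3]]]; nra.
Qed.

Lemma real_mean_value (f f' : R -> R) (a b M : R) : a <= b -> (forall t, a <= t <= b -> is_derive f t (f' t)) ->
  (forall t, a <= t <= b -> Rabs (f' t) <= M) -> Rabs (f b - f a) <= M*(b - a).
Proof.
  intros Hab Hd HM. rewrite <- Cmod_R, RtoC_minus. apply (rder_mean_value (fun t => RtoC (f t)) (fun t => RtoC (f' t))); [exact Hab| |].
  - intros t Ht. apply rder_RtoC. auto.
  - intros t Ht. rewrite Cmod_R. auto.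
Qed.

Lemma is_derive_rsum (f : nat -> R -> R) (f' : nat -> R) (x : R) (N : nat) : (forall n, (1 <= n <= N)%nat -> is_derive (f n) x (f' n)) ->
  is_derive (fun x => rsum (fun n => f n x) N) x (rsum f' N).
Proof.
  intros H. induction N; cbn [rsum]; [apply (is_derive_const 0 x)|].
  apply (is_derive_plus (fun x => rsum (fun n => f n x) N) (f (S N))); [apply IHN; intros; apply H; lia|apply H; lia].
Qed.

Lemma dirichlet_kernel (M : nat) (t : R) : 2*sin (t/2)*rsum (fun m => cos (INR m*t)) M = sin ((INR M + / 2)*t) - sin (t/2).
Proof.
  induction M; [simpl; replace ((0 + / 2)*t) with (t/2) by field; ring|]. cbn [rsum]. rewrite Rmult_plus_distr_l, IHM, S_INR.
  replace ((INR M + / 2)*t) with ((INR M+1)*t-t/2) by field. replace ((INR M+1 + / 2)*t) with ((INR M+1)*t+t/2) by field.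
  rewrite sin_plus, sin_minus. ring.
Qed.

Definition sawsum (M : nat) (th : R) : R := rsum (fun m => kcos (INR m*th)/(INR m*INR m)) M.

(** From [1 - cos u <= 2 u^(1/2)] the sum is [O(d^(1/2))] uniformly in [M]. This covers a
    neighbourhood of 0, where the differentiated series does not converge uniformly. *)
Lemma sawsum_small (M : nat) (d : R) : 0 < d -> 0 <= sawsum M d <= 6*exp (/ 2*ln d).
Proof. split.
  - apply rsum_nonneg. intros m Hm. assert (0 < INR m) by (apply lt_0_INR; lia). apply Rmult_le_pos; [|left; apply Rinv_0_lt_compat; nra].
    unfold kcos. pose proof (COS_bound (INR m*d)). lra.
  - apply Rle_trans with (rsum (fun m => 2*exp (/ 2*ln d)*(exp (- / 2*lnn (0+m))/INR (0+m))) M).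
    + apply rsum_le. intros m Hm. simpl Nat.add. assert (Hm0 : 0 < INR m) by (apply lt_0_INR; lia).
      pose proof (kcos_bound (- / 2) (ln (INR m*d)) ltac:(lra)) as B. rewrite exp_ln in B by nra.
      assert (B2 : kcos (INR m*d) <= 2*exp ((1 + - / 2)*ln (INR m*d))) by (eapply Rle_trans; [apply Rle_abs|exact B]).
      rewrite ln_mult in B2 by assumption. replace ((1 + - / 2)*(lnn m+ln d)) with (/ 2*ln d+(- / 2*lnn m+lnn m)) in B2 by field.
      rewrite !exp_plus, exp_ln in B2 by assumption. unfold Rdiv.
      replace (2*exp (/ 2*ln d)*(exp (- / 2*lnn m) * / INR m)) with (2*(exp (/ 2*ln d)*(exp (- / 2*lnn m)*INR m)) * / (INR m*INR m)) by (field; lra).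
      apply Rmult_le_compat_r; [left; apply Rinv_0_lt_compat; nra|exact B2].
    + rewrite rsum_scal. pose proof (rsum_power_tail (/ 2) 0 M ltac:(lra)) as T. simpl INR in T at 3. rewrite ln_1, Rmult_0_r, exp_0 in T.
      replace (6*exp (/ 2*ln d)) with (2*exp (/ 2*ln d)*3) by ring. apply Rmult_le_compat_l; [pose proof (exp_pos (/ 2*ln d)); lra|lra].
Qed.

(** The second derivative of the error [e] is half the Dirichlet kernel, whose integral is [O(1/M)]
    away from 0, and [e'] vanishes at [PI]. So [e' = O(1/M)] on [[d, PI]], while [e d] is small by
    [sawsum_small]. *)
Lemma sawsum_limit_half (th : R) : 0 <= th <= PI -> is_lim_seq (fun M => sawsum M th) (PI*th/2 - th*th/4).
Proof.
  intros Hth. pose proof PI_4 as P4. apply is_lim_seq_spec. intros eps. pose proof (cond_pos eps) as He.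
  destruct (Req_dec th 0) as [->|Hn].
  { exists 0%nat. intros n _. unfold sawsum. rewrite rsum_zero; [replace (0-(PI*0/2-0*0/4)) with 0 by field; rewrite Rabs_R0; exact He|].
    intros m _. unfold kcos. rewrite Rmult_0_r, cos_0. lra. }
  set (e1 := Rmin 1 (eps/40)). assert (H1 : 0 < e1 /\ e1 <= 1 /\ e1 <= eps/40).
  { unfold e1. pose proof (Rmin_l 1 (eps/40)). pose proof (Rmin_r 1 (eps/40)). assert (0 < Rmin 1 (eps/40)) by (apply Rmin_pos; lra). lra. }
  set (d := Rmin th (e1*e1)). assert (Hd : 0 < d /\ d <= th /\ d <= e1*e1).
  { unfold d. pose proof (Rmin_l th (e1*e1)). pose proof (Rmin_r th (e1*e1)). assert (0 < Rmin th (e1*e1)) by (apply Rmin_pos; nra). lra. }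
  set (s0 := sin (d/2)). assert (Hs0 : 0 < s0) by (apply sin_gt_0; lra).
  set (C1 := PI/(2*(s0*s0))+1 + / s0).
  destruct (nfloor_ex (8*C1/eps)) as [N [_ HN]].
  { apply Rmult_le_pos; [|left; inv_pos]. unfold C1. assert (0 < / s0) by inv_pos.
    assert (0 < PI/(2*(s0*s0))) by (apply Rdiv_lt_0_compat; nra). lra. }
  exists (S N). intros M HM. apply le_INR in HM. rewrite S_INR in HM.
  set (m2 := 2*INR M+1). assert (Hm2 : 8*C1/eps < m2) by (unfold m2; pose proof (pos_INR M); lra).
  assert (Hm0 : 0 < m2) by (unfold m2; pose proof (pos_INR M); lra).
  set (e := fun t => sawsum M t-(PI*t/2-t*t/4)).
  set (e' := fun t => rsum (fun m => sin (INR m*t)/INR m) M-(PI/2-t/2)).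
  (* An integration by parts in disguise: the derivative of the added term cancels the kernel
     [sin ((M + 1/2) t) / (2 sin (t/2))] and leaves a remainder [O(1/M)]. *)
  set (h := fun t => e' t+cos ((INR M + / 2)*t)/(m2*sin (t/2))).
  assert (Hsin : forall t, d <= t <= PI -> s0 <= sin (t/2)). { intros t Ht. apply sin_incr_1; lra. }
  assert (De : forall t, is_derive e t (e' t)).
  { intros t. apply (is_derive_minus (sawsum M) (fun t => PI*t/2-t*t/4) t _ (PI/2-t/2)).
    - apply (is_derive_rsum (fun m t => kcos (INR m*t)/(INR m*INR m)) (fun m => sin (INR m*t)/INR m)). intros m Hm.
      assert (0 < INR m) by (apply lt_0_INR; lia). unfold kcos. auto_derive; trivial. field. lra.
    - auto_derive; trivial. field. }
  assert (Dh : forall t, d <= t <= PI -> is_derive h t (- cos ((INR M + / 2)*t)*cos (t/2)/(2*m2*(sin (t/2)*sin (t/2))))).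
  { intros t Ht. specialize (Hsin t Ht).
    replace (- cos ((INR M + / 2)*t)*cos (t/2)/(2*m2*(sin (t/2)*sin (t/2)))) with
     ((rsum (fun m => cos (INR m*t)) M + / 2)+(- (sin ((INR M + / 2)*t)/(2*sin (t/2)))-cos ((INR M + / 2)*t)*cos (t/2)/(2*m2*(sin (t/2)*sin (t/2))))).
    2:{ replace (rsum (fun m => cos (INR m*t)) M) with ((sin ((INR M + / 2)*t)-sin (t/2))/(2*sin (t/2))) by (rewrite <- dirichlet_kernel; field; lra). field. lra. } apply (is_derive_plus e' (fun t => cos ((INR M + / 2)*t)/(m2*sin (t/2)))).
    - replace (rsum (fun m => cos (INR m*t)) M + / 2) with (rsum (fun m => cos (INR m*t)) M-(- / 2)) by ring.
      apply (is_derive_minus (fun t => rsum (fun m => sin (INR m*t)/INR m) M) (fun t => PI/2-t/2) t _ (- / 2)).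
      + apply (is_derive_rsum (fun m t => sin (INR m*t)/INR m) (fun m => cos (INR m*t))). intros m Hm.
        assert (0 < INR m) by (apply lt_0_INR; lia). auto_derive; trivial. field. lra.
      + auto_derive; trivial. field.
    - auto_derive; [unfold Rdiv in *; nra|]. unfold m2 in *. unfold Rdiv in *. field. split; nra. }
  assert (Bh : forall t, d <= t <= PI -> Rabs (h PI-h t) <= / (2*m2*(s0*s0))*(PI-t)).
  { intros t Ht. apply (real_mean_value h (fun t => - cos ((INR M + / 2)*t)*cos (t/2)/(2*m2*(sin (t/2)*sin (t/2))))); [lra|intros; apply Dh; lra|].
    intros u Hu. specialize (Hsin u ltac:(lra)). unfold Rdiv. rewrite !Rabs_mult, Rabs_Ropp.
    assert (Rabs (cos ((INR M + / 2)*u)) <= 1) by (apply Rabs_le, COS_bound). assert (Rabs (cos (u * / 2)) <= 1) by (apply Rabs_le, COS_bound).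
    pose proof (Rabs_pos (cos ((INR M + / 2)*u))). pose proof (Rabs_pos (cos (u * / 2))).
    assert (Hi : Rabs (/ (2*m2*(sin (u * / 2)*sin (u * / 2)))) <= / (2*m2*(s0*s0))).
    { rewrite Rabs_right by (apply Rle_ge; left; apply Rinv_0_lt_compat; repeat apply Rmult_lt_0_compat; lra).
      apply Rinv_le_contravar; [repeat apply Rmult_lt_0_compat; lra|]. apply Rmult_le_compat_l; nra. }
    rewrite <- (Rmult_1_l (/ (2*m2*(s0*s0)))). apply Rmult_le_compat; [nra|apply Rabs_pos|nra|exact Hi]. }
  assert (HPi : Rabs (h PI) <= / m2).
  { unfold h, e'. rewrite rsum_zero.
    - rewrite sin_PI2. replace (0-(PI/2-PI/2)+cos ((INR M + / 2)*PI)/(m2*1)) with (cos ((INR M + / 2)*PI) * / m2) by (field; lra).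
      rewrite Rabs_mult, (Rabs_right (/ m2)) by (apply Rle_ge; left; inv_pos).
      rewrite <- (Rmult_1_l (/ m2)) at 2. apply Rmult_le_compat_r; [left; inv_pos|]. apply Rabs_le, COS_bound.
    - intros m _. replace (sin (INR m*PI)) with 0; [unfold Rdiv; ring|]. symmetry. apply sin_eq_0_1. exists (Z.of_nat m). rewrite <- INR_IZR_INZ. reflexivity. }
  assert (Be : forall t, d <= t <= PI -> Rabs (e' t) <= C1/m2).
  { intros t Ht. specialize (Bh t Ht). specialize (Hsin t Ht).
    replace (e' t) with (h PI-(h PI-h t)-cos ((INR M + / 2)*t)/(m2*sin (t/2))) by (unfold h; ring).
    le_via Rabs_triang. rewrite Rabs_Ropp. eapply Rle_trans; [apply Rplus_le_compat_r; apply Rabs_triang|]. rewrite Rabs_Ropp.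
    assert (Rabs (cos ((INR M + / 2)*t)/(m2*sin (t/2))) <= / s0 * / m2).
    { unfold Rdiv. rewrite Rabs_mult, <- Rinv_mult. rewrite <- (Rmult_1_l (/ (s0*m2))). apply Rmult_le_compat; try apply Rabs_pos; [apply Rabs_le, COS_bound|]. rewrite Rabs_right by (apply Rle_ge; left; apply Rinv_0_lt_compat; nra). apply Rinv_le_contravar; nra. }
    assert (/ (2*m2*(s0*s0))*(PI-t) <= PI/(2*(s0*s0)) * / m2).
    { replace (PI/(2*(s0*s0)) * / m2) with (/ (2*m2*(s0*s0))*PI) by (field; lra). apply Rmult_le_compat_l; [left; apply Rinv_0_lt_compat; repeat apply Rmult_lt_0_compat; lra|lra]. }
    unfold C1 in *. lra. }
  assert (Ee : Rabs (e th-e d) <= C1/m2*(th-d)).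
  { apply (real_mean_value e e'); [lra|intros; apply De|]. intros t Ht. apply Be. lra. }
  assert (Ed : Rabs (e d) <= 9*e1).
  { unfold e. pose proof (sawsum_small M d ltac:(lra)) as [S1 S2].
    assert (exp (/ 2*ln d) <= e1).
    { rewrite <- (exp_ln e1) by lra. apply exp_le. assert (ln d <= ln (e1*e1)) by (apply ln_le'; lra). rewrite ln_mult in H by lra. lra. } apply Rabs_le. nra. }
  assert (C1/m2*(th-d) < eps/2).
  { assert (C1/m2 < eps/8).
    { apply Rmult_lt_reg_r with m2; [lra|]. unfold Rdiv. rewrite Rmult_assoc, Rinv_l by lra.
      apply Rmult_lt_compat_r with (r := eps/8) in Hm2; [|lra]. replace (8*C1/eps*(eps/8)) with C1 in Hm2 by (field; lra). lra. } nra. }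
  change (Rabs (e th) < eps). replace (e th) with ((e th-e d)+e d) by ring. le_lt_via Rabs_triang. lra.
Qed.

Lemma sawsum_limit (th : R) : Rabs th <= 2*PI -> is_lim_seq (fun M => sawsum M th) (PI*Rabs th/2 - th*th/4).
Proof.
  assert (A : forall t, 0 <= t <= 2*PI -> is_lim_seq (fun M => sawsum M t) (PI*t/2-t*t/4)).
  { intros t Ht. destruct (Rle_or_lt t PI) as [H|H]; [apply sawsum_limit_half; lra|].
    replace (PI*t/2-t*t/4) with (PI*(2*PI-t)/2-(2*PI-t)*(2*PI-t)/4) by field.
    apply is_lim_seq_ext with (fun M => sawsum M (2*PI-t)); [|apply sawsum_limit_half; lra].
    intros M. apply rsum_ext. intros m _. unfold kcos. replace (INR m*(2*PI-t)) with (- (INR m*t)+2*INR m*PI) by ring.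
    rewrite cos_period, cos_neg. reflexivity. }
  intros H. destruct (Rle_or_lt 0 th) as [H0|H0]; [rewrite Rabs_right in * by lra; apply A; lra|].
  rewrite Rabs_left in * by lra. replace (th*th) with (- th * - th) by ring.
  apply is_lim_seq_ext with (fun M => sawsum M (- th)); [|apply A; lra].
  intros M. apply rsum_ext. intros m _. unfold kcos. do 2 f_equal. replace (INR m * - th) with (- (INR m*th)) by ring. apply cos_neg.
Qed.

Lemma ccv_csum (u : nat -> nat -> C) (l : nat -> C) (N : nat) : (forall n, (1 <= n <= N)%nat -> ccv (u n) (l n)) ->
  ccv (fun M => csum (fun n => u n M) N) (csum l N).
Proof.
  intros H. induction N; cbn [csum]; [apply ccv_const|]. apply ccv_plus; [apply IHN; intros; apply H; lia|apply H; lia].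
Qed.

Lemma ccv_RtoC (u : nat -> R) (l : R) : is_lim_seq u l -> ccv (fun n => RtoC (u n)) (RtoC l).
Proof. intros H. apply ccv_of_parts; [exact H|apply is_lim_seq_const]. Qed.

Lemma csum_tail_zero (f : nat -> C) (n N : nat) : (n <= N)%nat -> (forall m, (n < m <= N)%nat -> f m = 0%C) -> csum f N = csum f n.
Proof.
  intros Hn H. replace N with (n+(N-n))%nat by lia. rewrite csum_app.
  rewrite (csum_zero (fun m => f (n+m)%nat)); [ring|]. intros m Hm. apply H. lia.
Qed.

(** * The functional equation *)

Section FunctionalEquation.
Variables (q : nat) (chi : nat -> C).
Hypothesis Hp : prime (Z.of_nat q).
Hypothesis Hq : (3 <= q)%nat.
Hypothesis Hchi : nonprincipal_char q chi.

Let om : R := 2*PI/INR q.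
Let chb : nat -> C := conj_char chi.

(** For [c = cos] and [c = sin] the two parts of the Gauss sum of [chi], of which the parity of
    [chi] kills one. *)
Definition gauss (c : R -> R) : C := csum (fun a => chi a*RtoC (c (2*PI/INR q*INR a)%R))%C q.

Lemma om_pos : 0 < om.
Proof. apply Rdiv_lt_0_compat; [pose proof PI_RGT_0; lra|apply lt_0_INR; lia]. Qed.

Lemma INR_q_pos : 0 < INR q.
Proof. apply lt_0_INR; lia. Qed.

(** For [m] prime to [q] replace [a] by [a m]. Otherwise [q | m], the factor [c] is constant, and
    both sides vanish. *)
Lemma gauss_twist (c : R -> R) (m : nat) : (forall x k, c (x + 2*INR k*PI) = c x) ->
  csum (fun a => chi a*RtoC (c (INR m*(om*INR a))%R))%C q = (chb m*gauss c)%C.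
Proof.
  intros Hc. pose proof INR_q_pos as Hq0. destruct Hchi as [Hd Hn]. pose proof Hd as [Hm [Hper [H0 H1]]].
  destruct (Nat.eq_dec (Nat.gcd m q) 1) as [G|G].
  - assert (E : (chb m*chi m = 1)%C).
    { rewrite Cmult_comm, <- Cmod2_conj, (dchar_mod_1 q Hp chi m Hd G). rewrite pow1. reflexivity. }
    unfold gauss. fold om. rewrite <- (csum_reindex q (fun a => chi a*RtoC (c (om*INR a)%R))%C ltac:(lia)) with (m := m); [|intros n|exact G].
    + rewrite <- csum_scal. apply csum_ext. intros a _. rewrite Hm, mult_INR.
      replace (om*(INR a*INR m)) with (INR m*(om*INR a)) by ring.
      replace (chb m*(chi a*chi m*RtoC (c (INR m*(om*INR a))%R)))%C with ((chb m*chi m)*(chi a*RtoC (c (INR m*(om*INR a))%R)))%C by ring. rewrite E. ring.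
    + rewrite Hper. do 2 f_equal. rewrite plus_INR. replace (om*(INR n+INR q)) with (om*INR n+2*INR 1*PI) by (unfold om; simpl; field; lra). apply Hc.
  - assert (E : chb m = 0%C). { unfold chb, conj_char. rewrite (proj2 (H0 m) G). apply C_ext; simpl; ring. }
    rewrite E. apply nat_prime_gcd_not_1 in G; [|exact Hp]. apply Nat.Lcm0.mod_divide in G. destruct G as [j Ej].
    rewrite (csum_ext _ (fun a => RtoC (c 0)*chi a)%C).
    + rewrite csum_scal, (nonprincipal_sum_0 q Hp chi Hchi). ring.
    + intros a _. rewrite Cmult_comm. do 2 f_equal. rewrite <- (Hc 0 (j*a)%nat). f_equal. rewrite Ej, !mult_INR. unfold om. field. lra.
Qed.

Let tc : C := gauss cos.
Let ts : C := gauss sin.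

Definition theta_sum (k : R -> R) (M : nat) (x : R) : C := csum (fun m => chb m*RtoC (k (INR m*(om*x))%R/(INR m*INR m)))%C M.
(** Truncation of a Fourier expansion: its limit [A x] will be [PI om] times the sum of
    [chi a (x - a)] over [a <= x], the twice summed character. *)
Let AM (M : nat) (x : R) : C := (tc*theta_sum kcos M x+ts*theta_sum ksin M x)%C.

(** Expand [cos (m om (x - a))] by the addition formula and sum over [a]: the twisted Gauss sums
    turn [chi] into [conj chi], and what separates the two sides is affine in [x] for each [M]. *)
Lemma AM_saw (M : nat) (x : R) : AM M x = (csum (fun a => chi a*RtoC (sawsum M (om*(x - INR a)))) q
   + (tc*csum (fun m => chb m*RtoC (/ (INR m*INR m))) M + ts*csum (fun m => chb m*RtoC (INR m*om/(INR m*INR m))) M*x))%C.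
Proof.
  assert (E : csum (fun a => chi a*RtoC (sawsum M (om*(x-INR a))))%C q =
    csum (fun m => - (chb m*RtoC (cos (INR m*(om*x))/(INR m*INR m))*tc)-chb m*RtoC (sin (INR m*(om*x))/(INR m*INR m))*ts)%C M).
  { rewrite (csum_ext _ (fun a => csum (fun m => chi a*RtoC (kcos (INR m*(om*(x-INR a)))/(INR m*INR m))) M)%C).
    2:{ intros a _. unfold sawsum. rewrite <- csum_RtoC, <- csum_scal. reflexivity. }
    rewrite csum_swap. apply csum_ext. intros m Hm. assert (0 < INR m) by (apply lt_0_INR; lia).
    rewrite (csum_ext _ (fun a => RtoC (/ (INR m*INR m))*chi a+(RtoC (- cos (INR m*(om*x))/(INR m*INR m))*(chi a*RtoC (cos (INR m*(om*INR a))))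
       + RtoC (- sin (INR m*(om*x))/(INR m*INR m))*(chi a*RtoC (sin (INR m*(om*INR a))))))%C).
    - rewrite !csum_plus, !csum_scal, (nonprincipal_sum_0 q Hp chi Hchi), (gauss_twist cos m cos_period), (gauss_twist sin m sin_period).
      unfold tc, ts. apply C_ext; unfold Re, Im; simpl; field; lra.
    - intros a _. unfold kcos. replace (INR m*(om*(x-INR a))) with (INR m*(om*x)-INR m*(om*INR a)) by ring. rewrite cos_minus.
      apply C_ext; unfold Re, Im; simpl; field; lra. }
  rewrite E. unfold AM, theta_sum. rewrite !(Cmult_comm _ (csum _ M)). rewrite <- !(Cmult_comm tc), <- !(Cmult_comm ts).
  replace (ts*csum (fun m => chb m*RtoC (INR m*om/(INR m*INR m)))%C M*x)%C with (ts*x*csum (fun m => chb m*RtoC (INR m*om/(INR m*INR m)))%C M)%C by ring.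
  rewrite <- !csum_scal, <- !csum_plus. apply csum_ext. intros m Hm. assert (0 < INR m) by (apply lt_0_INR; lia).
  unfold kcos, ksin. apply C_ext; unfold Re, Im; simpl; field; lra.
Qed.

(** The exponent [be] is left free: large values give smallness as [x] tends to 0, small values give
    slow growth in [x] and fast decay in [M]. *)
Lemma theta_sum_tail (k k' : R -> R) (be x : R) (M N : nat) : (forall u, is_derive k u (k' u)) ->
  (forall be w, 0 <= be <= 1 -> Rabs (k (exp w)) <= 2*exp ((1 + be)*w)) ->
  (forall be w, 0 <= be <= 1 -> Rabs (exp w*k' (exp w)) <= 2*exp ((1 + be)*w)) ->
  0 <= be < 1 -> 0 < x -> (M <= N)%nat ->
  Cmod (theta_sum k N x - theta_sum k M x)%C <= INR q*(6*exp ((1 + be)*ln (om*x)))*(3 + / (1 - be))*exp (- (1 - be)*lnn (S M)).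
Proof.
  intros Hd Hk Hk' Hb Hx HMN. pose proof om_pos as Ho. assert (Hox : 0 < om*x) by nra. set (lt := ln (om*x)).
  set (phi := fun y : R => (RtoC (k (exp (y+lt)))*cexp (RtoC (-2)*y))%C).
  set (phi' := fun y : R => (RtoC (exp (y+lt)*k' (exp (y+lt)))*cexp (RtoC (-2)*y)+RtoC (k (exp (y+lt)))*(RtoC (-2)*cexp (RtoC (-2)*y)))%C).
  assert (E : forall n, theta_sum k n x = csum (fun m => chb m*phi (lnn m))%C n).
  { intros n. apply csum_ext. intros m Hm. assert (0 < INR m) by (apply lt_0_INR; lia). unfold phi, lt. rewrite <- ln_mult, exp_ln by (try assumption; nra).
    rewrite <- RtoC_mult, cexp_RtoC, <- RtoC_mult. replace (-2*lnn m) with (- (lnn m+lnn m)) by ring.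
    rewrite exp_Ropp, exp_plus, exp_ln by assumption. reflexivity. }
  rewrite !E. apply (abel_tail_log chb phi phi'); try lra.
  - apply pos_INR.
  - pose proof (exp_pos ((1+be)*lt)). lra.
  - apply (nonprincipal_partial_sums q Hp). apply conj_nonprincipal. exact Hchi.
  - intros y Hy. apply (rder_mult (fun y => RtoC (k (exp (y+lt)))) (fun y => cexp (RtoC (-2)*y)%C)); [|apply rder_cexp_lin].
    apply (rder_RtoC (fun y => k (exp (y+lt)))). apply (is_derive_comp k (fun y => exp (y+lt))); [apply Hd|]. der_ring.
  - intros y Hy. unfold phi. rewrite Cmod_mult, Cmod_R, Cmod_cexp. pose proof (Hk be (y+lt) ltac:(lra)) as B.
    replace (Re (RtoC (-2)*y)%C) with (-2*y) by Re_ring.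
    apply Rle_trans with (2*exp ((1+be)*(y+lt))*exp (-2*y)); [apply Rmult_le_compat_r; [left; apply exp_pos|exact B]|].
    rewrite !Rmult_assoc, <- !exp_plus. replace ((1+be)*(y+lt) + -2*y) with ((1+be)*lt + - (1-be)*y) by ring.
    pose proof (exp_pos ((1+be)*lt + - (1-be)*y)). lra.
  - intros y Hy. le_via Cmod_triangle. rewrite !Cmod_mult, !Cmod_R, Cmod_cexp.
    pose proof (Hk be (y+lt) ltac:(lra)) as B. pose proof (Hk' be (y+lt) ltac:(lra)) as B'.
    replace (Re (RtoC (-2)*y)%C) with (-2*y) by Re_ring. replace (Rabs (-2)) with 2 by (rewrite Rabs_left; lra).
    pose proof (exp_pos (-2*y)) as P.
    assert (Q : exp ((1+be)*(y+lt))*exp (-2*y) = exp ((1+be)*lt)*exp (- (1-be)*y)) by (rewrite <- !exp_plus; f_equal; ring). nra.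
  - exact HMN.
Qed.

Let Tn : R := Cmod tc+Cmod ts.

Lemma AM_tail (be x : R) (M N : nat) : 0 <= be < 1 -> 0 < x -> (M <= N)%nat ->
  Cmod (AM N x - AM M x)%C <= Tn*(INR q*(6*exp ((1 + be)*ln (om*x)))*(3 + / (1 - be)))*exp (- (1 - be)*lnn (S M)).
Proof.
  intros Hb Hx HMN. unfold AM.
  replace (tc*theta_sum kcos N x+ts*theta_sum ksin N x-(tc*theta_sum kcos M x+ts*theta_sum ksin M x))%C with
    (tc*(theta_sum kcos N x-theta_sum kcos M x)+ts*(theta_sum ksin N x-theta_sum ksin M x))%C by ring.
  le_via Cmod_triangle. rewrite !Cmod_mult.
  pose proof (theta_sum_tail kcos sin be x M N kcos_der (fun be w H => kcos_bound be w ltac:(lra)) kcos_bound' Hb Hx HMN) as B1.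
  pose proof (theta_sum_tail ksin kcos be x M N ksin_der ksin_bound ksin_bound' Hb Hx HMN) as B2.
  pose proof (Cmod_ge_0 tc). pose proof (Cmod_ge_0 ts). rewrite (Rmult_assoc (Cmod tc+Cmod ts)), (Rmult_plus_distr_r (Cmod tc) (Cmod ts)).
  nra.
Qed.

Lemma A_exists (x : R) : 0 < x -> exists l, ccv (fun M => AM M x) l.
Proof.
  intros Hx. eapply ccv_cauchy; [intros m n Hmn; apply (AM_tail (/ 2)); [lra|exact Hx|exact Hmn]|].
  apply lim_scal_decay. lra.
Qed.

Let A (x : R) : C := epsilon (inhabits (RtoC 0)) (fun l => ccv (fun M => AM M x) l).

Lemma A_conv (x : R) : 0 < x -> ccv (fun M => AM M x) (A x).
Proof. intros Hx. apply epsilon_spec. apply A_exists. exact Hx. Qed.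

Lemma A_tail (be x : R) (M : nat) : 0 <= be < 1 -> 0 < x ->
  Cmod (A x - AM M x)%C <= Tn*(INR q*(6*exp ((1 + be)*ln (om*x)))*(3 + / (1 - be)))*exp (- (1 - be)*lnn (S M)).
Proof.
  intros Hb Hx. apply ccv_le with (u := fun N => (AM N x-AM M x)%C) (N0 := M); [apply ccv_minus; [apply A_conv; exact Hx|apply ccv_const]|].
  intros n Hn. apply AM_tail; assumption.
Qed.

Lemma A_bound (be x : R) : 0 <= be < 1 -> 0 < x -> Cmod (A x) <= Tn*(INR q*(6*exp ((1 + be)*ln (om*x)))*(3 + / (1 - be))).
Proof.
  intros Hb Hx. pose proof (A_tail be x 0 Hb Hx) as H. simpl INR in H. rewrite ln_1, Rmult_0_r, exp_0, Rmult_1_r in H.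
  replace (A x-AM 0 x)%C with (A x) in H; [exact H|]. unfold AM, theta_sum. cbn [csum]. ring.
Qed.

Let lin (n : nat) (x : R) : C := csum (fun a => chi a*RtoC (x-INR a))%C n.

(** In the limit [sawsum] becomes [PI |th| / 2 - th^2 / 4]. Here [|x - a|] is [a - x] plus
    [2 (x - a)] for [a <= x], and the terms quadratic in [x] cancel because [chi] sums to 0 over a
    period. *)
Lemma A_affine : exists al be : C, forall n x, (n < q)%nat -> INR n <= x <= INR n + 1 -> 0 < x -> A x = (RtoC (PI*om)*lin n x + al + be*x)%C.
Proof. pose proof om_pos as Ho.
  set (X1 := csum (fun a => RtoC (INR a)*chi a)%C q). set (X2 := csum (fun a => RtoC (INR a*INR a)*chi a)%C q).
  set (R0 := fun x : R => csum (fun a => chi a*RtoC (PI*Rabs (om*(x-INR a))/2-om*(x-INR a)*(om*(x-INR a))/4))%C q).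
  assert (HR : forall n x, (n < q)%nat -> INR n <= x <= INR n+1 -> R0 x = (RtoC (PI*om)*lin n x+(RtoC (PI*om/2)*X1-RtoC (om*om/4)*X2)+RtoC (om*om/2)*X1*x)%C).
  { intros n x Hn Hx. unfold R0. set (pp := fun a => if le_dec a n then (chi a*RtoC (PI*om*(x-INR a)))%C else 0%C).
    rewrite (csum_ext _ (fun a => (pp a+(RtoC (PI*om/2)*(RtoC (INR a)*chi a)+(- RtoC (om*om/4))*(RtoC (INR a*INR a)*chi a)))
        + (RtoC (om*om/2)*x*(RtoC (INR a)*chi a)+RtoC (- (PI*om/2)*x-om*om/4*(x*x))*chi a))%C).
    - rewrite !csum_plus, !csum_scal, (nonprincipal_sum_0 q Hp chi Hchi). fold X1 X2.
      replace (csum pp q) with (RtoC (PI*om)*lin n x)%C; [ring|]. unfold lin. rewrite (csum_tail_zero pp n q ltac:(lia)).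
      + rewrite <- csum_scal. apply csum_ext. intros a Ha. unfold pp. destruct (le_dec a n); [|lia]. C_ring.
      + intros m Hm. unfold pp. destruct (le_dec m n); [lia|reflexivity].
    - intros a Ha. unfold pp. rewrite Rabs_mult, (Rabs_right om) by lra. destruct (le_dec a n) as [Hl|Hl].
      + apply le_INR in Hl. rewrite Rabs_right by lra. apply C_ext; unfold Re, Im; simpl; field.
      + assert (INR n+1 <= INR a) by (rewrite <- S_INR; apply le_INR; lia). rewrite Rabs_left1 by lra. apply C_ext; unfold Re, Im; simpl; field. }
  assert (Hsaw : forall x, 0 < x <= INR q -> ccv (fun M => csum (fun a => chi a*RtoC (sawsum M (om*(x-INR a))))%C q) (R0 x)).
  { intros x Hx. apply (ccv_csum (fun a M => (chi a*RtoC (sawsum M (om*(x-INR a))))%C)). intros a Ha. apply ccv_scal. apply ccv_RtoC.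
    apply sawsum_limit. assert (1 <= INR a <= INR q) by (change 1 with (INR 1); split; apply le_INR; lia).
    rewrite Rabs_mult, (Rabs_right om) by lra. apply Rle_trans with (om*INR q); [|unfold om; right; field; lra]. apply Rmult_le_compat_l; [lra|]. apply Rabs_le. lra. }
  set (cM := fun M => (tc*csum (fun m => chb m*RtoC (/ (INR m*INR m))) M)%C). set (dM := fun M => (ts*csum (fun m => chb m*RtoC (INR m*om/(INR m*INR m))) M)%C).
  assert (L : forall x, 0 < x <= INR q -> ccv (fun M => cM M+dM M*x)%C (A x-R0 x)%C).
  { intros x Hx. eapply ccv_ext; [|apply ccv_minus; [apply (A_conv x); lra|apply (Hsaw x Hx)]]. intros M. cbv beta. rewrite AM_saw. unfold cM, dM. ring. }
  assert (H3 : 3 <= INR q). { replace 3 with (INR 3) by (simpl; ring). apply le_INR. lia. }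
  (* The limit of the affine functions [cM + dM x] is determined by its values at 1 and 2, both
     inside [(0, q]]. *)
  set (e1 := (A 1-R0 1)%C). set (e2 := (A 2-R0 2)%C).
  exists ((RtoC (PI*om/2)*X1-RtoC (om*om/4)*X2)+(2*e1-e2))%C, (RtoC (om*om/2)*X1+(e2-e1))%C.
  intros n x Hn Hx Hx0. assert (Hxq : x <= INR q). { assert (INR n+1 <= INR q) by (rewrite <- S_INR; apply le_INR; lia). lra. }
  assert (E : (A x-R0 x = (2*e1-e2)+(e2-e1)*x)%C).
  { apply ccv_unique with (fun M => cM M+dM M*x)%C; [apply L; lra|].
    apply ccv_ext with (fun M => (2*(cM M+dM M*1)-(cM M+dM M*2))+x*((cM M+dM M*2)-(cM M+dM M*1)))%C; [intros; ring|].
    replace ((2*e1-e2)+(e2-e1)*x)%C with ((2*e1-e2)+x*(e2-e1))%C by ring.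
    apply ccv_plus; [apply ccv_minus; [apply ccv_scal|]|apply ccv_scal; apply ccv_minus]; apply L; lra. }
  replace (A x) with ((A x-R0 x)+R0 x)%C by ring. rewrite E, (HR n x Hn Hx). ring.
Qed.

(** By [A_bound] with [be = 1/2], [A x = O(x^(3/2))] at 0. On [(0,1]] the sum over [a <= x] is
    empty, so the affine remainder has this order as well and must vanish. Evaluating at [x = e^2]
    avoids fractional powers. *)
Lemma A_first_period (n : nat) (x : R) : (n < q)%nat -> INR n <= x <= INR n + 1 -> 0 < x -> A x = (RtoC (PI*om)*lin n x)%C.
Proof.
  destruct A_affine as [al [be H]]. pose proof om_pos as Ho.
  set (K := Tn*(INR q*(6*exp ((1 + / 2)*ln om))*(3 + / (1 - / 2)))).
  assert (HK : 0 <= K).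
  { unfold K, Tn. pose proof (Cmod_ge_0 tc). pose proof (Cmod_ge_0 ts). pose proof (pos_INR q). pose proof (exp_pos ((1 + / 2)*ln om)).
    apply Rmult_le_pos; [lra|]. nra. }
  assert (B : forall e, 0 < e <= 1 -> Cmod (al+be*RtoC (e*e))%C <= K*(e*e*e)).
  { intros e He. pose proof (A_bound (/ 2) (e*e) ltac:(lra) ltac:(nra)) as Hb.
    rewrite (H 0%nat (e*e)) in Hb; [|lia|simpl; nra|nra]. unfold lin in Hb. cbn [csum] in Hb.
    replace (RtoC (PI*om)*0+al+be*RtoC (e*e))%C with (al+be*RtoC (e*e))%C in Hb by ring.
    eapply Rle_trans; [exact Hb|]. unfold K. rewrite ln_mult, ln_mult by nra.
    replace ((1 + / 2)*(ln om+(ln e+ln e))) with ((1 + / 2)*ln om+(ln e+(ln e+ln e))) by field. rewrite !exp_plus, !exp_ln by lra. right. ring. }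
  assert (Hal : Cmod al <= 0).
  { apply Rnot_lt_le. intros Hc. pose proof (Cmod_ge_0 be). set (D := 1+(Cmod be+K)). set (e := Rmin 1 (Cmod al/(2*D))).
    assert (0 < D) by (unfold D; lra). assert (He : 0 < e <= 1 /\ e <= Cmod al/(2*D)).
    { split; [split; [apply Rmin_pos; [lra|div_pos]|apply Rmin_l]|apply Rmin_r]. }
    destruct He as [He1 He2]. specialize (B e He1). pose proof (Cmod_minus_le (al+be*RtoC (e*e)) (be*RtoC (e*e)))%C as T.
    replace (al+be*RtoC (e*e)-be*RtoC (e*e))%C with al in T by ring. rewrite (Cmod_mult be), Cmod_R, Rabs_right in T by nra.
    assert (e*D <= Cmod al/2). { replace (Cmod al/2) with (Cmod al/(2*D)*D) by (field; lra). nra. } assert (e*e*e <= e) by nra. unfold D in *. nra. }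
  assert (al0 : al = 0%C) by (apply Cmod_eq_0; pose proof (Cmod_ge_0 al); lra).
  assert (Hbe : Cmod be <= 0).
  { apply Rnot_lt_le. intros Hc. set (e := Rmin 1 (Cmod be/(2*(1+K)))).
    assert (He : 0 < e <= 1 /\ e <= Cmod be/(2*(1+K))).
    { split; [split; [apply Rmin_pos; [lra|div_pos]|apply Rmin_l]|apply Rmin_r]. }
    destruct He as [He1 He2]. specialize (B e He1). rewrite al0, Cplus_0_l, Cmod_mult, Cmod_R, Rabs_right in B by nra.
    assert (Cmod be <= K*e). { apply Rmult_le_reg_r with (e*e); nra. }
    assert (e*(1+K) <= Cmod be/2). { replace (Cmod be/2) with (Cmod be/(2*(1+K))*(1+K)) by (field; lra). nra. } nra. }
  assert (be0 : be = 0%C) by (apply Cmod_eq_0; pose proof (Cmod_ge_0 be); lra).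
  intros Hn Hx Hx0. rewrite (H n x Hn Hx Hx0), al0, be0. ring.
Qed.

Lemma A_quasi_periodic (x : R) : 0 < x -> A (x + INR q) = (A x + A (INR q))%C.
Proof.
  intros Hx. pose proof INR_q_pos as Hq0. apply ccv_unique with (fun M => AM M (x+INR q)); [apply A_conv; lra|].
  apply ccv_ext with (fun M => AM M x+AM M (INR q))%C; [|apply ccv_plus; apply A_conv; lra].
  intros M. unfold AM, theta_sum. rewrite <- !csum_scal, <- !csum_plus. apply csum_ext. intros m Hm. assert (0 < INR m) by (apply lt_0_INR; lia).
  replace (INR m*(om*(x+INR q))) with (INR m*(om*x)+2*INR m*PI) by (unfold om; field; lra).
  replace (INR m*(om*INR q)) with (0+2*INR m*PI) by (unfold om; field; lra).
  unfold kcos, ksin. rewrite !cos_period, !sin_period, cos_0, sin_0. apply C_ext; unfold Re, Im; simpl; field; lra.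
Qed.

Lemma A_piecewise_linear (n : nat) (x : R) : INR n <= x <= INR n + 1 -> 0 < x -> A x = (RtoC (PI*om)*lin n x)%C.
Proof.
  revert x. induction n as [n IH] using (well_founded_induction lt_wf). intros x Hx Hx0. pose proof INR_q_pos as Hq0.
  destruct (Nat.lt_ge_cases n q) as [Hn|Hn]; [apply A_first_period; assumption|].
  assert (Lq : lin q (INR q) = lin (q-1) (INR q)).
  { apply csum_tail_zero; [lia|]. intros m Hm. replace m with q by lia. rewrite Rminus_diag. ring. }
  assert (Aq : A (INR q) = (RtoC (PI*om)*lin q (INR q))%C).
  { rewrite Lq. apply A_first_period; [lia| |exact Hq0]. rewrite minus_INR by lia. simpl. lra. }
  assert (Ls : forall y, lin n (y+INR q) = (lin q (INR q)+lin (n-q) y)%C).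
  { intros y. unfold lin. replace n with (q+(n-q))%nat at 1 by lia. rewrite csum_app. f_equal.
    - rewrite (csum_ext _ (fun a => chi a*RtoC (INR q-INR a)+y*chi a)%C); [rewrite csum_plus, csum_scal, (nonprincipal_sum_0 q Hp chi Hchi); ring|].
      intros a _. C_ring.
    - apply csum_ext. intros a _. rewrite plus_INR. destruct Hchi as [[_ [Hper _]] _]. rewrite (Nat.add_comm q a), Hper. do 2 f_equal. ring. }
  assert (Hnq : INR n = INR (n-q)+INR q). { rewrite <- plus_INR. f_equal. lia. }
  destruct (Req_dec x (INR q)) as [E|E].
  - rewrite E, Aq. replace (lin n (INR q)) with (lin n (0+INR q)) by (f_equal; ring). rewrite Ls.
    assert (n-q = 0)%nat. { pose proof (pos_INR (n-q)). apply INR_eq. simpl. lra. }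
    rewrite H. unfold lin at 3. cbn [csum]. ring.
  - set (y := x-INR q). replace x with (y+INR q) by (unfold y; ring). pose proof (pos_INR (n-q)). assert (Hy : 0 < y) by (unfold y; lra).
    rewrite A_quasi_periodic, Aq, Ls, (IH (n-q)%nat ltac:(lia) y); [ring|unfold y; lra|exact Hy|exact Hy].
Qed.

(** Both descriptions of [A x] are integrated against [s (s+1) x^(-s-2)], with [x = exp v]. The
    finite sums give [L(s, chi)]; the truncations [AM], integrated termwise, give partial sums of
    [L(1-s, conj chi)] times the Mellin transforms of the kernels. The bound [A_tail] controls the
    difference uniformly in the range of integration, so [M] may tend to infinity last. *)
Lemma functional_equation (s : C) : 0 < Re s < 1 ->
  (RtoC (PI*om)*Fk chi 0 s = s*(s + 1)*cexp ((s + 1)*ln om)*(tc*mellin kcos s + ts*mellin ksin s)*Fk chb 0 (1 - s))%C.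
Proof.
  intros Hs. pose proof om_pos as Ho. pose proof INR_q_pos as Hq0. set (sg := Re s) in *.
  destruct (mellin_spec kcos sin kcos_der (fun be w H => kcos_bound be w ltac:(lra)) s Hs) as [Hc [cp [cm [[_ [Hc1 [Hc2 Hc3]]] Ec]]]].
  destruct (mellin_spec ksin kcos ksin_der ksin_bound s Hs) as [Hi [ip [im [[_ [Hi1 [Hi2 Hi3]]] Ei]]]].
  set (P := (s*(s+1))%C).
  set (U := fun (M : nat) (v : R) => (P*csum (fun m => chb m*RtoC (/ (INR m*INR m))*cexp ((s+1)*ln (INR m*om)) *
       (tc*Hc (v+ln (INR m*om))%R+ts*Hi (v+ln (INR m*om))%R)) M)%C).
  (* A primitive of the integrand with [a <= n]. The constant [a^(-s)] makes each summand vanish at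
     [v = ln a], so that passing from [n] to [n + 1] at [v = ln (n + 1)] causes no jump. *)
  set (V := fun (n : nat) (v : R) => (RtoC (PI*om)*csum (fun a => chi a*(- s*RtoC (exp v-INR a)*cexp (- (s+1)*v)-cexp (- s*v)+cexp (- s*lnn a))) n)%C).
  assert (DU : forall M v, rder (U M) v (P*cexp (- (s+1)*v)*AM M (exp v))%C).
  { intros M v. eapply rder_eq; [|apply (rder_scal P (fun v => csum (fun m => chb m*RtoC (/ (INR m*INR m))*cexp ((s+1)*ln (INR m*om)) *
       (tc*Hc (v+ln (INR m*om))%R+ts*Hi (v+ln (INR m*om))%R))%C M)); apply rder_csum; intros m Hm;
       apply (rder_scal (chb m*RtoC (/ (INR m*INR m))*cexp ((s+1)*ln (INR m*om)))%C (fun v => tc*Hc (v+ln (INR m*om))%R+ts*Hi (v+ln (INR m*om))%R)%C);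
       apply (rder_plus (fun v => tc*Hc (v+ln (INR m*om))%R)%C (fun v => ts*Hi (v+ln (INR m*om))%R)%C);
       [apply (rder_scal tc (fun v => Hc (v+ln (INR m*om)))); apply rder_shift; apply Hc1|apply (rder_scal ts (fun v => Hi (v+ln (INR m*om)))); apply rder_shift; apply Hi1]].
    rewrite <- Cmult_assoc. f_equal. unfold AM, theta_sum. rewrite Cmult_plus_distr_l, <- !csum_scal, <- csum_plus. apply csum_ext. intros m Hm.
    assert (Hm0 : 0 < INR m) by (apply lt_0_INR; lia). unfold mellin_integrand.
    assert (Ex : exp (v+ln (INR m*om)) = INR m*(om*exp v)) by (rewrite exp_plus, exp_ln by nra; ring). rewrite Ex.
    replace (- (s+1)*RtoC (v+ln (INR m*om)))%C with (- (s+1)*v + - (s+1)*ln (INR m*om))%C by (rewrite RtoC_plus; ring). rewrite cexp_plus.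
    assert (Z : (cexp ((s+1)*ln (INR m*om))*cexp (- (s+1)*ln (INR m*om)) = 1)%C).
    { rewrite <- cexp_plus. replace ((s+1)*ln (INR m*om) + - (s+1)*ln (INR m*om))%C with (RtoC 0) by ring. apply cexp_0. }
    unfold Rdiv. rewrite !RtoC_mult. set (X := cexp ((s+1)*ln (INR m*om))%C) in *. set (Y := cexp (- (s+1)*ln (INR m*om))%C) in *.
    replace (chb m*RtoC (/ (INR m*INR m))*X*(tc*(RtoC (kcos (INR m*(om*exp v)))*(cexp (- (s+1)*v)*Y))+ts*(RtoC (ksin (INR m*(om*exp v)))*(cexp (- (s+1)*v)*Y))))%C with
      ((X*Y)*(chb m*RtoC (/ (INR m*INR m))*(tc*(RtoC (kcos (INR m*(om*exp v)))*cexp (- (s+1)*v))+ts*(RtoC (ksin (INR m*(om*exp v)))*cexp (- (s+1)*v)))))%C by ring.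
    rewrite Z. ring. }
  assert (DV : forall n v, rder (V n) v (P*cexp (- (s+1)*v)*(RtoC (PI*om)*lin n (exp v)))%C).
  { intros n v. eapply rder_eq; [|apply (rder_scal (RtoC (PI*om)) (fun v => csum (fun a => chi a*(- s*RtoC (exp v-INR a)*cexp (- (s+1)*v)-cexp (- s*v)+cexp (- s*lnn a)))%C n));
      apply rder_csum; intros a Ha; apply (rder_scal (chi a) (fun v => - s*RtoC (exp v-INR a)*cexp (- (s+1)*v)-cexp (- s*v)+cexp (- s*lnn a))%C);
      apply (rder_plus (fun v => - s*RtoC (exp v-INR a)*cexp (- (s+1)*v)-cexp (- s*v))%C (fun _ => cexp (- s*lnn a)%C)); [|apply rder_const];
      apply (rder_plus (fun v => - s*RtoC (exp v-INR a)*cexp (- (s+1)*v))%C (fun v => - cexp (- s*v))%C);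
      [apply (rder_mult (fun v => - s*RtoC (exp v-INR a))%C (fun v => cexp (- (s+1)*v)%C)); [apply (rder_scal (- s)%C (fun v => RtoC (exp v-INR a))); apply (rder_RtoC (fun v => exp v-INR a) v (exp v)); der_ring|apply rder_cexp_lin]
      |apply (rder_ext (fun v => -1*cexp (- s*v))%C); [intros; ring|]; apply (rder_scal (-1)); apply rder_cexp_lin]].
    replace (P*cexp (- (s+1)*v)*(RtoC (PI*om)*lin n (exp v)))%C with (RtoC (PI*om)*((P*cexp (- (s+1)*v))*lin n (exp v)))%C by ring.
    f_equal. unfold lin. rewrite <- csum_scal. apply csum_ext. intros a _.
    assert (Z : (RtoC (exp v)*cexp (- (s+1)*v) = cexp (- s*v))%C).
    { rewrite <- cexp_RtoC, <- cexp_plus. f_equal. ring. }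
    unfold P. rewrite <- Z. ring. }
  set (W := Tn*INR q).
  assert (HW : 0 <= W) by (unfold W, Tn; pose proof (Cmod_ge_0 tc); pose proof (Cmod_ge_0 ts); nra).
  set (cst := fun be (M : nat) => Cmod P*(W*(6*exp ((1+be)*ln om))*(3 + / (1-be))*exp (- (1-be)*lnn (S M)))).
  assert (Hcst : forall be M, 0 <= be < 1 -> 0 <= cst be M).
  { intros be M Hb. pose proof (exp_pos ((1+be)*ln om)). assert (0 < / (1-be)) by inv_pos.
    apply Rmult_le_pos; [apply Cmod_ge_0|]. apply Rmult_le_pos; [|left; apply exp_pos]. apply Rmult_le_pos; [nra|lra]. }
  (* Taking [be] below [Re s] for [v >= 0] and above it for [v <= 0] makes this error integrable at
     both ends. *)
  assert (DD : forall be M (v : R), 0 <= be < 1 -> Cmod (P*cexp (- (s+1)*v)*(A (exp v)-AM M (exp v)))%C <= cst be M*exp ((be-sg)*v)).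
  { intros be M v Hb. rewrite !Cmod_mult, Cmod_cexp_real_mult. unfold cst. rewrite !Rmult_assoc. apply Rmult_le_compat_l; [apply Cmod_ge_0|].
    eapply Rle_trans; [apply Rmult_le_compat_l; [left; apply exp_pos|apply (A_tail be (exp v) M Hb (exp_pos v))]|].
    rewrite ln_mult, ln_exp by (try apply exp_pos; exact Ho).
    replace ((1+be)*(ln om+v)) with ((1+be)*ln om+(1+be)*v) by ring. rewrite (exp_plus ((1+be)*ln om)).
    replace (exp ((be-sg)*v)) with (exp (- Re (s+1)%C*v)*exp ((1+be)*v)).
    2:{ rewrite <- exp_plus. f_equal. unfold sg, Re; simpl. ring. }
    unfold W. right. ring. }
  assert (B1 : forall M N, (1 <= N)%nat -> Cmod (V N (lnn N)-U M (lnn N)-(V 0%nat 0%R-U M 0%R))%C <= cst (sg/2) M*(2/sg)).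
  { intros M N HN. set (G := fun v => - (cst (sg/2) M*(2/sg))*exp (- (sg/2)*v)).
    assert (Hnn : 0 <= cst (sg/2) M*(2/sg)) by (apply Rmult_le_pos; [apply Hcst; lra|left; div_pos]).
    assert (I : Cmod (V N (lnn N)-U M (lnn N)-(V 0%nat 0%R-U M 0%R))%C <= G (lnn N)-G 0).
    { induction N as [|N IHN]; [lia|]. destruct (Nat.eq_dec N 0) as [->|HN0].
      { simpl INR. rewrite ln_1. replace (V 1%nat 0%R-U M 0%R-(V 0%nat 0%R-U M 0%R))%C with (RtoC 0); [rewrite Cmod_0; lra|].
        unfold V. cbn [csum]. rewrite exp_0. simpl INR. rewrite ln_1, Rminus_diag. ring. }
      assert (N1 : 1 <= INR N) by (change 1 with (INR 1); apply le_INR; lia).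
      assert (Hl : lnn N <= lnn (S N)) by (apply ln_le'; [lra|rewrite S_INR; lra]).
      assert (St : Cmod ((V N (lnn (S N))-U M (lnn (S N)))-(V N (lnn N)-U M (lnn N)))%C <= G (lnn (S N))-G (lnn N)).
      { apply (rder_compare (fun v => V N v-U M v)%C (fun v => P*cexp (- (s+1)*v)*(RtoC (PI*om)*lin N (exp v)) + -1*(P*cexp (- (s+1)*v)*AM M (exp v)))%C G (fun v => cst (sg/2) M*exp (- (sg/2)*v))); [exact Hl| | |].
        - intros t Ht. apply (rder_plus (V N) (fun v => - U M v)%C); [apply DV|]. apply (rder_ext (fun v => -1*U M v)%C); [intros; ring|]. apply (rder_scal (-1) (U M)). apply DU.
        - intros t Ht. unfold G. auto_derive; trivial. field. lra.
        - intros t Ht. rewrite <- (A_piecewise_linear N (exp t)).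
          + replace (P*cexp (- (s+1)*t)*A (exp t) + -1*(P*cexp (- (s+1)*t)*AM M (exp t)))%C with (P*cexp (- (s+1)*t)*(A (exp t)-AM M (exp t)))%C by ring.
            eapply Rle_trans; [apply (DD (sg/2)); lra|]. right. do 2 f_equal. field.
          + rewrite <- S_INR. split; [rewrite <- (exp_ln (INR N)) by lra|rewrite <- (exp_ln (INR (S N))) by (rewrite S_INR; lra)]; apply exp_le; lra.
          + apply exp_pos. }
      assert (VV : V (S N) (lnn (S N)) = V N (lnn (S N))).
      { unfold V. cbn [csum]. rewrite exp_ln, Rminus_diag by (rewrite S_INR; lra). ring. }
      rewrite VV. specialize (IHN ltac:(lia)).
      replace (V N (lnn (S N))-U M (lnn (S N))-(V 0%nat 0%R-U M 0%R))%C with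
       (((V N (lnn (S N))-U M (lnn (S N)))-(V N (lnn N)-U M (lnn N)))+(V N (lnn N)-U M (lnn N)-(V 0%nat 0%R-U M 0%R)))%C by ring.
      le_via Cmod_triangle. lra. }
    eapply Rle_trans; [exact I|]. unfold G. rewrite Rmult_0_r, exp_0. pose proof (exp_pos (- (sg/2)*lnn N)). nra. }
  (* For [exp v <= 1] the sum over [a <= exp v] is empty and [A] vanishes, so that [AM] is its own
     error. *)
  assert (B0 : forall M N, Cmod (U M 0%R-U M (- lnn N)%R)%C <= cst ((1+sg)/2) M*(2/(1-sg))).
  { intros M N. pose proof (ln_INR_nonneg N). set (b := (1+sg)/2).
    assert (Hnn : 0 <= cst b M*(2/(1-sg))) by (apply Rmult_le_pos; [apply Hcst; unfold b; lra|left; div_pos]).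
    le_via (rder_compare (U M) (fun v => P*cexp (- (s+1)*v)*AM M (exp v))%C (fun v => cst b M*(2/(1-sg))*exp ((1-sg)/2*v)) (fun v => cst b M*exp ((1-sg)/2*v))).
    - lra.
    - auto.
    - intros t Ht. auto_derive; trivial. field. lra.
    - intros t Ht. pose proof (DD b M t ltac:(unfold b; lra)) as D. rewrite (A_piecewise_linear 0%nat (exp t)) in D; [| |apply exp_pos].
      + rewrite <- Cmod_opp. replace (- (P*cexp (- (s+1)*t)*AM M (exp t)))%C with (P*cexp (- (s+1)*t)*(RtoC (PI*om)*0-AM M (exp t)))%C by ring.
        eapply Rle_trans; [exact D|]. right. do 2 f_equal. unfold b. field.
      + split; [left; apply exp_pos|]. rewrite Rplus_0_l, <- exp_0. apply exp_le. lra.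
    - rewrite Rmult_0_r, exp_0. pose proof (exp_pos ((1-sg)/2 * - lnn N)). nra. }
  set (Z := (P*cexp ((s+1)*ln om)*(tc*mellin kcos s+ts*mellin ksin s))%C).
  set (LM := fun M => csum (fun m => chb m*log_kernel 0 (1-s) (lnn m))%C M).
  assert (LimV : ccv (fun N => V (S N) (lnn (S N))) (RtoC (PI*om)*Fk chi 0 s)%C).
  { pose proof (nonprincipal_partial_sums q Hp chi Hchi) as HQ.
    replace (RtoC (PI*om)*Fk chi 0 s)%C with (RtoC (PI*om)*(Fk chi 0 s-0)-0)%C by ring.
    apply ccv_ext with (fun N => RtoC (PI*om)*(csum (fun n => chi n*log_kernel 0 s (lnn n)) (S N)-cexp (- s*lnn (S N))*csum chi (S N))
       - s*cexp (- (s+1)*lnn (S N))*A (INR (S N)))%C.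
    { intros N. assert (H0 : 0 < INR (S N)) by (apply lt_0_INR; lia). rewrite (A_piecewise_linear (S N) (INR (S N))) by lra. unfold V, lin.
      rewrite <- !csum_scal, <- csum_minus, <- csum_scal, <- csum_minus. apply csum_ext. intros a _. rewrite exp_ln by exact H0. unfold log_kernel. simpl pow. ring. }
    apply ccv_minus; [apply ccv_scal; apply ccv_minus|].
    - intros eps He. destruct (Fk_conv chi (INR q) HQ 0 s (proj1 Hs) eps He) as [N0 HN0]. exists N0. auto.
    - apply ccv_0_le with (fun N => INR q*exp (- sg*lnn (S N))); [|apply lim_scal_decay; lra]. intros N. rewrite Cmod_mult, Cmod_cexp_real_mult, Rmult_comm.
      apply Rmult_le_compat_r; [left; apply exp_pos|apply HQ].
    - apply ccv_0_le with (fun N => (Cmod s*(W*(6*exp ((1+sg/2)*ln om))*(3 + / (1-sg/2))))*exp (- (sg/2)*lnn (S N))); [|apply lim_scal_decay; lra].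
      intros N. assert (H0 : 0 < INR (S N)) by (apply lt_0_INR; lia). rewrite !Cmod_mult, Cmod_cexp_real_mult. rewrite !Rmult_assoc. apply Rmult_le_compat_l; [apply Cmod_ge_0|].
      eapply Rle_trans; [apply Rmult_le_compat_l; [left; apply exp_pos|apply (A_bound (sg/2) (INR (S N))); lra]|].
      rewrite ln_mult by (try exact Ho; exact H0).
      replace ((1+sg/2)*(ln om+lnn (S N))) with ((1+sg/2)*ln om+(1+sg/2)*lnn (S N)) by ring. rewrite (exp_plus ((1+sg/2)*ln om)).
      replace (exp (- (sg/2)*lnn (S N))) with (exp (- Re (s+1)%C*lnn (S N))*exp ((1+sg/2)*lnn (S N))).
      2:{ rewrite <- exp_plus. f_equal. replace (Re (s+1)%C) with (sg+1) by (unfold sg, Re; simpl; ring). field. }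
      unfold W. right. ring. }
  assert (Hshift : forall (H : R -> C) (hp hm : C) (B1 c1 B2 c2 : R), 0 < c1 -> 0 < c2 -> (forall w, 0 <= w -> Cmod (H w-hp)%C <= B1*exp (- c1*w)) ->
     (forall w, w <= 0 -> Cmod (H w-hm)%C <= B2*exp (c2*w)) -> forall a, ccv (fun N => H (lnn (S N)+a)) hp /\ ccv (fun N => H (- lnn (S N)+a)) hm).
  { intros H hp hm b1 c1 b2 c2 C1 C2 Q1 Q2 a.
    assert (Big : exists N0, forall N, (N0 <= N)%nat -> Rabs a <= lnn (S N)).
    { destruct (nfloor_ex (exp (Rabs a)) (Rlt_le _ _ (exp_pos _))) as [N0 [_ HN0]]. exists N0. intros N HN. rewrite <- (ln_exp (Rabs a)). apply ln_le'; [apply exp_pos|].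
      apply le_INR in HN. rewrite S_INR. lra. }
    destruct Big as [N0 HN0]. pose proof (Rle_abs a) as A1. pose proof (Rle_abs (- a)) as A2. rewrite Rabs_Ropp in A2.
    split; intros eps He.
    - pose proof (lim_scal_decay (b1*exp (- c1*a)) c1 C1) as L. apply is_lim_seq_spec in L. destruct (L (mkposreal eps He)) as [N1 HN1]. exists (max N0 N1). intros n Hn.
      specialize (HN1 n ltac:(lia)). rewrite Rminus_0_r in HN1. specialize (HN0 n ltac:(lia)).
      eapply Rle_lt_trans; [apply Q1; lra|]. eapply Rle_lt_trans; [|eapply Rle_lt_trans; [apply Rle_abs|exact HN1]].
      right. rewrite Rmult_assoc, <- exp_plus. do 2 f_equal. ring.
    - pose proof (lim_scal_decay (b2*exp (c2*a)) c2 C2) as L. apply is_lim_seq_spec in L. destruct (L (mkposreal eps He)) as [N1 HN1]. exists (max N0 N1). intros n Hn.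
      specialize (HN1 n ltac:(lia)). rewrite Rminus_0_r in HN1. specialize (HN0 n ltac:(lia)).
      eapply Rle_lt_trans; [apply Q2; lra|]. eapply Rle_lt_trans; [|eapply Rle_lt_trans; [apply Rle_abs|exact HN1]].
      right. rewrite Rmult_assoc, <- exp_plus. do 2 f_equal. ring. }
  assert (LimU : forall M, ccv (fun N => U M (lnn (S N))-U M (- lnn (S N))%R)%C (Z*LM M)%C).
  { intros M. unfold Z, LM. rewrite Ec, Ei.
    apply ccv_ext with (fun N => P*csum (fun m => chb m*RtoC (/ (INR m*INR m))*cexp ((s+1)*ln (INR m*om)) *
       ((tc*Hc (lnn (S N)+ln (INR m*om))%R+ts*Hi (lnn (S N)+ln (INR m*om))%R)-(tc*Hc (- lnn (S N)+ln (INR m*om))%R+ts*Hi (- lnn (S N)+ln (INR m*om))%R))) M)%C.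
    { intros N. unfold U. rewrite <- !csum_scal, <- csum_minus. apply csum_ext. intros m _. ring. }
    replace (P*cexp ((s+1)*ln om)*(tc*(cp-cm)+ts*(ip-im))*csum (fun m => chb m*log_kernel 0 (1-s) (lnn m)) M)%C with
      (P*csum (fun m => chb m*RtoC (/ (INR m*INR m))*cexp ((s+1)*ln (INR m*om))*((tc*cp+ts*ip)-(tc*cm+ts*im))) M)%C.
    - apply ccv_scal. apply (ccv_csum (fun m N => (chb m*RtoC (/ (INR m*INR m))*cexp ((s+1)*ln (INR m*om)) *
       ((tc*Hc (lnn (S N)+ln (INR m*om))%R+ts*Hi (lnn (S N)+ln (INR m*om))%R)-(tc*Hc (- lnn (S N)+ln (INR m*om))%R+ts*Hi (- lnn (S N)+ln (INR m*om))%R)))%C)).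
      intros m Hm. apply ccv_scal.
      destruct (Hshift Hc cp cm _ (sg/2) _ ((1-sg)/2) ltac:(lra) ltac:(lra) Hc2 Hc3 (ln (INR m*om))) as [X1 X2].
      destruct (Hshift Hi ip im _ (sg/2) _ ((1-sg)/2) ltac:(lra) ltac:(lra) Hi2 Hi3 (ln (INR m*om))) as [X3 X4].
      apply ccv_minus; apply ccv_plus; apply ccv_scal; assumption.
    - rewrite <- !csum_scal. apply csum_ext. intros m Hm. assert (Hm0 : 0 < INR m) by (apply lt_0_INR; lia). unfold log_kernel. simpl pow.
      assert (E : (RtoC (/ (INR m*INR m))*cexp ((s+1)*ln (INR m*om)) = cexp ((s+1)*ln om)*cexp (- (1-s)*lnn m))%C).
      { replace (/ (INR m*INR m)) with (exp (- (lnn m+lnn m))) by (rewrite exp_Ropp, exp_plus, exp_ln by exact Hm0; reflexivity).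
        rewrite <- cexp_RtoC, <- !cexp_plus. f_equal. rewrite ln_mult by assumption. rewrite RtoC_opp, !RtoC_plus. ring. }
      replace (chb m*RtoC (/ (INR m*INR m))*cexp ((s+1)*ln (INR m*om))*(tc*cp+ts*ip-(tc*cm+ts*im)))%C with
        (chb m*(RtoC (/ (INR m*INR m))*cexp ((s+1)*ln (INR m*om)))*(tc*cp+ts*ip-(tc*cm+ts*im)))%C by ring.
      rewrite E. ring. }
  set (Er := fun M => cst (sg/2) M*(2/sg)+cst ((1+sg)/2) M*(2/(1-sg))).
  assert (Fin : forall M, Cmod (RtoC (PI*om)*Fk chi 0 s-Z*LM M)%C <= Er M).
  { intros M. apply ccv_le with (u := fun N => (V (S N) (lnn (S N))-(U M (lnn (S N))-U M (- lnn (S N))%R))%C) (N0 := 0%nat).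
    - apply ccv_minus; [exact LimV|apply LimU].
    - intros N _. specialize (B1 M (S N) ltac:(lia)). specialize (B0 M (S N)).
      replace (V (S N) (lnn (S N))-(U M (lnn (S N))-U M (- lnn (S N))%R))%C with
        ((V (S N) (lnn (S N))-U M (lnn (S N))-(V 0%nat 0%R-U M 0%R))-(U M 0%R-U M (- lnn (S N))%R))%C by (unfold V; cbn [csum]; ring).
      le_via Cmod_minus_le. unfold Er. lra. }
  assert (LE : ccv (fun M => RtoC (PI*om)*Fk chi 0 s-Z*LM M)%C 0).
  { apply ccv_0_le with Er; [exact Fin|]. unfold Er, cst. replace (Finite 0) with (Finite (0+0)) by (f_equal; ring). apply is_lim_seq_plus'.
    - apply is_lim_seq_ext with (fun M => (Cmod P*(W*(6*exp ((1+sg/2)*ln om))*(3 + / (1-sg/2)))*(2/sg))*exp (- (1-sg/2)*lnn (S M))); [intros; ring|]. apply lim_scal_decay. lra.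
    - apply is_lim_seq_ext with (fun M => (Cmod P*(W*(6*exp ((1+(1+sg)/2)*ln om))*(3 + / (1-(1+sg)/2)))*(2/(1-sg)))*exp (- (1-(1+sg)/2)*lnn (S M))); [intros; ring|]. apply lim_scal_decay. lra. }
  pose proof (nonprincipal_partial_sums q Hp chb (conj_nonprincipal q chi Hchi)) as HQ.
  assert (L1 : ccv LM (Fk chb 0 (1-s)%C)). { apply (Fk_conv chb (INR q) HQ 0). unfold sg, Re in *; simpl; lra. }
  assert (L2 : ccv (fun M => RtoC (PI*om)*Fk chi 0 s-Z*LM M)%C (RtoC (PI*om)*Fk chi 0 s-Z*Fk chb 0 (1-s))%C).
  { apply ccv_minus; [apply ccv_const|apply ccv_scal; exact L1]. }
  pose proof (ccv_unique _ _ _ L2 LE) as Q.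
  replace (RtoC (PI*om)*Fk chi 0 s)%C with ((RtoC (PI*om)*Fk chi 0 s-Z*Fk chb 0 (1-s))+Z*Fk chb 0 (1-s))%C by ring. rewrite Q. ring.
Qed.
End FunctionalEquation.

(** * A Phragmen-Lindelof principle and the reflection inequality *)

Lemma strip_principle (U : C -> R) (Bad : C -> Prop) (x1 x2 : R) : x1 < x2 ->
  (forall z, x1 <= Re z <= x2 -> ~ Bad z -> rcont U z) ->
  (forall z, x1 <= Re z <= x2 -> Bad z -> forall M, exists del, 0 < del /\
     forall w, x1 <= Re w <= x2 -> Cmod (w - z)%C < del -> ~ Bad w -> U w < M) ->
  (forall z, Re z = x1 \/ Re z = x2 -> ~ Bad z -> U z <= 0) ->
  (forall x y, x1 < x < x2 -> ~ Bad (x, y) ->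
     (exists lam, 0 <= lam /\ lapl U x y lam) /\ (exists r, 0 < r /\ forall w, Cmod (w - (x, y))%C < r -> ~ Bad w)) ->
  (exists K Y0, 0 <= K /\ forall z, x1 <= Re z <= x2 -> ~ Bad z -> Y0 <= Rabs (Im z) -> U z <= K*(1 + Rabs (Im z))) ->
  forall z, x1 <= Re z <= x2 -> ~ Bad z -> U z <= 0.
Proof.
  intros Hx Hgood Hbad Hside Hin [K [Y0 [HK Hgr]]] z0 Hz0 G0.
  (* The barrier [2 x^2 - y^2 - 2 X^2] has Laplacian 2, which makes [U + eps be] strictly
     subharmonic; it is nonpositive in the strip and falls quadratically, beating the linear growth
     of [U]. *)
  set (X := Rabs x1+Rabs x2). set (be := fun w : C => 2*(Re w*Re w) + -1*(Im w*Im w) + - (2*(X*X))).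
  assert (HX : forall z, x1 <= Re z <= x2 -> be z <= - (Im z*Im z)).
  { intros z Hz. unfold be. assert (Rabs (Re z) <= X).
    { unfold X. apply Rabs_le. pose proof (Rle_abs x2). pose proof (Rle_abs (- x1)). rewrite Rabs_Ropp in H0. pose proof (Rabs_pos x1). pose proof (Rabs_pos x2). lra. }
    apply Rabs_le_between in H. nra. }
  assert (Main : forall eps, 0 < eps -> U z0+eps*be z0 <= 0).
  { intros eps He. set (T := Rabs (Im z0)+Rabs Y0+2+2*K/eps).
    pose proof (Rabs_pos (Im z0)). pose proof (Rabs_pos Y0). assert (HKe : 0 <= 2*K/eps) by (apply Rmult_le_pos; [lra|left; inv_pos]).
    assert (HT : 0 < T) by (unfold T; lra).
    apply (max_principle (fun w => U w+eps*be w) Bad x1 x2 (- T) T); try lra.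
    - intros z [Kz _] Gz e Hep. destruct (rcont_usc _ z (rcont_plus _ _ z (Hgood z Kz Gz) (rcont_scal eps be z (rcont_quadratic 2 (-1) (-(2*(X*X))) z))) e Hep) as [d [Hd H1]].
      exists d. split; [exact Hd|]. intros w _ Hw _. exact (H1 w Hw).
    - intros z [Kz _] Bz M. destruct (Hbad z Kz Bz M) as [d1 [Hd1 H1]]. exists d1. split; [exact Hd1|]. intros w [Kw _] Hw Gw.
      specialize (H1 w Kw Hw Gw). specialize (HX w Kw). nra.
    - intros x y [Kx Ky] Gz Hbd. specialize (HX (x, y) Kx). unfold Re, Im in Kx, Ky, HX; simpl in Kx, Ky, HX.
      destruct Hbd as [E|[E|E]].
      + assert (U (x, y) <= 0) by auto. nra.
      + assert (U (x, y) <= 0) by auto. nra.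
      + assert (Ey : Rabs y = T). { destruct E as [-> | ->]; [rewrite Rabs_Ropp|]; apply Rabs_right; lra. }
        assert (y*y = T*T) by nra.
        assert (B : U (x, y) <= K*(1+Rabs (Im (x, y)))). { apply Hgr; auto. unfold Im; simpl. rewrite Ey. unfold T. pose proof (Rle_abs Y0). lra. }
        unfold Im in B; simpl in B. rewrite Ey in B. assert (2*K <= eps*T). { apply Rle_trans with (eps*(2*K/eps)); [right; field; lra|]. apply Rmult_le_compat_l; unfold T; lra. }
        assert (1 <= T) by (unfold T; lra). nra.
    - intros x y Hxx Hyy Gz. destruct (Hin x y Hxx Gz) as [[lam [Hl L]] HB]. split; [|exact HB]. exists (lam+eps*(2*2+2 * -1)). split; [lra|].
      apply (lapl_plus U (fun w => eps*be w)); [exact L|]. apply (lapl_scal eps be). apply lapl_quadratic.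
    - split; [exact Hz0|]. pose proof (Rle_abs (Im z0)). pose proof (Rle_abs (- Im z0)). rewrite Rabs_Ropp in H2. unfold T. lra.
    - exact G0. }
  apply Rnot_lt_le. intros Hlt. set (B := 1+Rabs (be z0)). pose proof (Rabs_pos (be z0)).
  specialize (Main (U z0/(2*B)) ltac:(apply Rdiv_lt_0_compat; unfold B; lra)).
  assert (U z0/(2*B)*be z0 >= - (U z0/2)).
  { pose proof (Rle_abs (- be z0)) as Q. rewrite Rabs_Ropp in Q. assert (0 < U z0/(2*B)) by (apply Rdiv_lt_0_compat; unfold B; lra).
    replace (- (U z0/2)) with (U z0/(2*B) * - B) by (field; unfold B; lra). apply Rle_ge. apply Rmult_le_compat_l; unfold B in *; lra. }
  lra.
Qed.

Lemma lapl_linear (a b x y : R) : lapl (fun w => a*Re w + b) x y 0.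
Proof.
  exists (fun _ => a), (fun _ => 0), 0, 0. unfold Re; simpl. split; [|split; [|split; [|split]]].
  - exists 1. split; [lra|]. intros. der_ring.
  - apply (is_derive_const a x).
  - exists 1. split; [lra|]. intros. der_ring.
  - apply (is_derive_const 0 y).
  - ring.
Qed.

Lemma Fk_conj (q : nat) (chi : nat -> C) (s : C) : prime (Z.of_nat q) -> nonprincipal_char q chi -> 0 < Re s ->
  Fk (conj_char chi) 0 (Cconj s) = Cconj (Fk chi 0 s).
Proof.
  intros Hp Hchi Hs. pose proof (Fk_conv chi (INR q) (nonprincipal_partial_sums q Hp chi Hchi) 0 s Hs) as H1.
  pose proof (Fk_conv (conj_char chi) (INR q) (nonprincipal_partial_sums q Hp _ (conj_nonprincipal q chi Hchi)) 0 (Cconj s) Hs) as H2.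
  apply ccv_unique with (1 := H2). intros eps He. destruct (H1 eps He) as [N HN]. exists N. intros n Hn. specialize (HN n Hn).
  rewrite (csum_ext _ (fun n => Cconj (chi n*log_kernel 0 s (lnn n))%C)).
  - rewrite csum_conj, <- Cminus_conj, Cmod_conj. exact HN.
  - intros m _. unfold log_kernel. rewrite !Cmult_conj, <- cexp_conj. f_equal. f_equal; [apply C_ext; simpl; ring|].
    f_equal. C_ring.
Qed.

Definition fe_factor (k : R -> R) (s : C) : R := Cmod (s*(s + 1))%C*exp (Re s*ln (2*PI))/PI*Cmod (mellin k s).

(** Replacing [a] by [- a] multiplies the cosine sum by [u] and the sine sum by [- u], where [u] is
    the conjugate of [chi (-1)]; hence one of them vanishes. The modulus [tau] of the surviving
    Gauss sum is left unevaluated: [reflection_bound] recovers the normalization from the symmetry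
    of the equation. *)
Lemma functional_equation_mod (q : nat) (chi : nat -> C) : prime (Z.of_nat q) -> (3 <= q)%nat -> nonprincipal_char q chi ->
  exists k, (k = kcos \/ k = ksin) /\ exists tau : R, 0 <= tau /\ forall x t, 0 < x < 1 ->
    Cmod (Fk chi 0 (x, t)) = tau*exp (- x*lnn q)*fe_factor k (x, t)*Cmod (Fk chi 0 (1 - x, t)).
Proof.
  intros Hp Hq Hchi. pose proof PI_RGT_0 as HPI. assert (Hq0 : 0 < INR q) by (apply lt_0_INR; lia).
  assert (Par : exists k, (k = kcos \/ k = ksin) /\ exists T : C, forall s, (gauss q chi cos*mellin kcos s+gauss q chi sin*mellin ksin s = T*mellin k s)%C).
  {
    assert (Tc : gauss q chi cos = (conj_char chi (q-1)*gauss q chi cos)%C).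
    { rewrite <- (gauss_twist q chi Hp Hq Hchi cos (q-1) cos_period). apply csum_ext. intros a _.
      rewrite minus_INR by lia. simpl INR. replace ((INR q-1)*(2*PI/INR q*INR a)) with (- (2*PI/INR q*INR a)+2*INR a*PI) by (field; lra).
      rewrite cos_period, cos_neg. reflexivity. }
    assert (Ts : (- gauss q chi sin)%C = (conj_char chi (q-1)*gauss q chi sin)%C).
    { rewrite <- (gauss_twist q chi Hp Hq Hchi sin (q-1) sin_period). unfold gauss. replace (- csum (fun a => chi a*RtoC (sin (2*PI/INR q*INR a))) q)%C with (-1*csum (fun a => chi a*RtoC (sin (2*PI/INR q*INR a))) q)%C by ring.
      rewrite <- csum_scal. apply csum_ext. intros a _.
      rewrite minus_INR by lia. simpl INR. replace ((INR q-1)*(2*PI/INR q*INR a)) with (- (2*PI/INR q*INR a)+2*INR a*PI) by (field; lra).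
      rewrite sin_period, sin_neg, RtoC_opp. ring. }
    set (u := conj_char chi (q-1)) in *.
    destruct (classic (gauss q chi cos = 0%C)) as [Z|Z].
    - exists ksin. split; [right; reflexivity|]. exists (gauss q chi sin). intros s. rewrite Z. ring.
    - exists kcos. split; [left; reflexivity|]. exists (gauss q chi cos). intros s.
      assert (u1 : u = 1%C). { replace u with (u*gauss q chi cos/gauss q chi cos)%C by (field; exact Z). rewrite <- Tc. field. exact Z. }
      rewrite u1 in Ts. assert (Z2 : gauss q chi sin = 0%C).
      { replace (gauss q chi sin) with (/ 2*(1*gauss q chi sin - - gauss q chi sin))%C by (field; intros E; injection E; lra). rewrite <- Ts. ring. }
      rewrite Z2. ring. }
  destruct Par as [k [Hk [T HT]]]. exists k. split; [exact Hk|]. exists (Cmod T). split; [apply Cmod_ge_0|]. intros x t Hx.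
  pose proof (functional_equation q chi Hp Hq Hchi (x, t)) as FE. specialize (FE Hx). rewrite HT in FE.
  apply (f_equal Cmod) in FE. rewrite !Cmod_mult, Cmod_R, Cmod_cexp in FE.
  assert (Ec : Cmod (Fk (conj_char chi) 0 (1-(x, t))%C) = Cmod (Fk chi 0 (1-x, t))).
  { replace (1-(x, t))%C with (Cconj ((1-x)%R, t)) by C_ring. rewrite (Fk_conj q chi _ Hp Hchi) by Re_lra. apply Cmod_conj. }
  rewrite Ec in FE. set (om := 2*PI/INR q) in *. assert (Hom : 0 < om) by div_pos.
  rewrite Rabs_right in FE by nra.
  replace (Re (((x, t)+1)*ln om)%C) with (x*(ln (2*PI)-lnn q)+ln om) in FE.
  2:{ rewrite <- ln_div by lra. fold om. unfold Re; simpl. ring. }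
  rewrite exp_plus, exp_ln in FE by exact Hom. replace (x*(ln (2*PI)-lnn q)) with (x*ln (2*PI) + - x*lnn q) in FE by ring. rewrite exp_plus in FE.
  unfold fe_factor. rewrite Cmod_mult. change (Re (x, t)) with x.
  apply Rmult_eq_reg_l with (PI*om); [|nra]. rewrite FE. field. lra.
Qed.

(** An absolute constant for both parities. With [fe_factor_bound] it controls the logarithm of
    [fe_factor k s / fe_factor k half] by [fe_const ln (4 + (Im s)^2)]. *)
Definition fe_const : R := 1 + (Rabs (ln (128/fe_factor kcos half)) + Rabs (ln (128/fe_factor ksin half))).

Lemma ln_quad_ge_1 (t : R) : 1 <= ln (4 + t*t).
Proof. rewrite <- (ln_exp 1). apply ln_le'; [apply exp_pos|]. pose proof exp_le_3. nra. Qed.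

Lemma fe_factor_bound (k : R -> R) (s : C) : k = kcos \/ k = ksin -> / 4 <= Re s <= 3/4 -> fe_factor k s <= 128*(4 + Im s*Im s).
Proof.
  intros Hk Hs. pose proof PI2_1.
  assert (Hm : Cmod (mellin k s) <= 32).
  { destruct Hk as [-> | ->]; [apply (mellin_bound kcos sin kcos_der (fun be w H => kcos_bound be w ltac:(lra)))|apply (mellin_bound ksin kcos ksin_der ksin_bound)]; exact Hs. }
  assert (H1 : Cmod (s*(s+1))%C <= 2*(4+Im s*Im s)).
  { rewrite Cmod_mult. pose proof (Cmod_le_abs s) as A1. pose proof (Cmod_le_abs (s+1)%C) as A2. replace (Im (s+1)%C) with (Im s) in A2 by Re_ring.
    replace (Re (s+1)%C) with (Re s+1) in A2 by Re_ring. rewrite Rabs_right in A1, A2 by lra. assert (Rabs (Im s)*Rabs (Im s) = Im s*Im s) by (rewrite <- Rabs_mult; apply Rabs_right; nra).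
    pose proof (Cmod_ge_0 s). pose proof (Cmod_ge_0 (s+1)%C).
    apply Rle_trans with ((2+Rabs (Im s))*(2+Rabs (Im s))); [apply Rmult_le_compat; lra|]. pose proof (Rle_0_sqr (Rabs (Im s)-2)). unfold Rsqr in *. lra. }
  assert (H2 : exp (Re s*ln (2*PI))/PI <= 2).
  { apply Rmult_le_reg_r with PI; [lra|]. unfold Rdiv. rewrite Rmult_assoc, Rinv_l, Rmult_1_r by lra. rewrite <- (exp_ln (2*PI)) at 2 by lra. apply exp_le.
    assert (0 <= ln (2*PI)) by (apply ln_nonneg; lra). nra. }
  assert (H3 : 0 <= exp (Re s*ln (2*PI))/PI) by (apply Rmult_le_pos; [left; apply exp_pos|left; inv_pos]).
  unfold fe_factor. pose proof (Cmod_ge_0 (s*(s+1))%C). pose proof (Cmod_ge_0 (mellin k s)).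
  replace (Cmod (s*(s+1))%C*exp (Re s*ln (2*PI))/PI*Cmod (mellin k s)) with (Cmod (s*(s+1))%C*(exp (Re s*ln (2*PI))/PI)*Cmod (mellin k s)) by (field; lra).
  replace (128*(4+Im s*Im s)) with (2*(4+Im s*Im s)*2*32) by ring.
  apply Rmult_le_compat; [nra|assumption| |assumption]. nra.
Qed.

Lemma fe_factor_rcont (k : R -> R) (s : C) : k = kcos \/ k = ksin -> 0 < Re s < 1 -> rcont (fe_factor k) s.
Proof.
  intros Hk Hs. apply (rcont_mult (fun s => Cmod (s*(s+1))%C*exp (Re s*ln (2*PI))/PI) (fun s => Cmod (mellin k s))).
  - replace (fun s => Cmod (s*(s+1))%C*exp (Re s*ln (2*PI))/PI) with (fun s => Cmod (s*(s+1))%C*(/ PI*exp (Re s*ln (2*PI)))) by (apply functional_extensionality; intros; unfold Rdiv; ring).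
    apply (rcont_mult (fun s => Cmod (s*(s+1))%C) (fun s => / PI*exp (Re s*ln (2*PI)))).
    + apply cder_rcont_mod with (1*(s+1)+s*1)%C. pose proof (cder_affine 1 0 s) as D1. pose proof (cder_affine 1 1 s) as D2. pose proof (cder_mult _ _ _ _ _ D1 D2) as D.
      replace (fun w : C => (w*(w+1))%C) with (fun w : C => ((1*w+0)*(1*w+1))%C) by fun_ring.
      replace (1*(s+1)+s*1)%C with (1*(1*s+1)+(1*s+0)*1)%C by ring. exact D.
    + apply rcont_scal. apply (rcont_comp (fun u => exp (u*ln (2*PI))) Re); [|apply rcont_Re]. apply derivable_continuous_pt. exists (ln (2*PI)*exp (Re s*ln (2*PI))).
      apply is_derive_Reals. der_ring.
  - assert (L : exists K r, 0 < r /\ forall h, Cmod h < r -> Cmod (mellin k (s+h)-mellin k s)%C <= K*Cmod h).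
    { destruct Hk as [-> | ->]; [apply (mellin_lipschitz kcos sin kcos_der (fun be w H => kcos_bound be w ltac:(lra)))|apply (mellin_lipschitz ksin kcos ksin_der ksin_bound)]; exact Hs. }
    destruct L as [K [r [Hr L]]]. intros eps He. pose proof (Rabs_pos K). exists (Rmin r (eps/(Rabs K+1))). split; [apply Rmin_pos; [exact Hr|div_pos]|].
    intros h Hh. pose proof (Rmin_l r (eps/(Rabs K+1))). pose proof (Rmin_r r (eps/(Rabs K+1))). le_lt_via Cmod_rev_triangle. eapply Rle_lt_trans; [apply L; lra|].
    pose proof (Cmod_ge_0 h). pose proof (Rle_abs K). apply Rle_lt_trans with ((Rabs K+1)*Cmod h); [nra|].
    replace eps with ((Rabs K+1)*(eps/(Rabs K+1))) by (field; lra). nra.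
Qed.

(** In [x] the second derivative is [2 K ln (4 + y^2) >= 2 K], and the [y] part takes away at most
    [K]. The function vanishes on [Re w = 1/2], to first order, which is what produces a bound
    proportional to [b] in [reflection_bound]. *)
Lemma lapl_fe_majorant (K x y : R) : 0 <= K -> / 4 < x < / 2 ->
  exists lam, 0 <= lam /\ lapl (fun w => - K*((/ 4 - Re w*Re w)*ln (4 + Im w*Im w))) x y lam.
Proof. set (g := ln (4+y*y)). set (D := 4+y*y). assert (HD : 4 <= D) by (unfold D; nra).
  exists (2*K*g + - K*((/ 4-x*x)*((8-2*(y*y))/(D*D)))). split.
  - pose proof (ln_quad_ge_1 y) as G. fold g in G. assert ((8-2*(y*y))/(D*D) <= / 2).
    { apply Rmult_le_reg_r with (D*D); [nra|]. unfold Rdiv. rewrite Rmult_assoc, Rinv_l by nra. nra. }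
    assert (B : (/ 4-x*x)*((8-2*(y*y))/(D*D)) <= 1).
    { assert (0 <= / 4-x*x <= / 4) by nra. nra. }
    nra.
  - exists (fun u => 2*K*u*g), (fun v => - K*((/ 4-x*x)*(2*v/(4+v*v)))), (2*K*g), (- K*((/ 4-x*x)*((8-2*(y*y))/(D*D)))).
    unfold Re, Im; simpl. split; [|split; [|split; [|split]]].
    + exists 1. split; [lra|]. intros u _. unfold g. der_ring.
    + der_ring.
    + exists 1. split; [lra|]. intros v _. auto_derive; [nra|]. nra.
    + auto_derive; [nra|]. unfold D. field. nra.
    + ring.
Qed.

Section UnderGRH.
Variables (q : nat) (chi : nat -> C).
Hypothesis Hp : prime (Z.of_nat q).
Hypothesis Hq : (3 <= q)%nat.
Hypothesis Hchi : nonprincipal_char q chi.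

(** Write the functional equation as [|L(x+iy)| = q^(1/2-x) Y |L(1-x+iy)|]. The estimate of [Y],
    usually read off from Stirling's formula, comes from the maximum principle: [ln Y] is harmonic
    in [1/4 < Re s < 1/2] because under GRH [L] has no zeros there or in the mirror strip; it
    vanishes on the critical line and is logarithmically bounded on [Re s = 1/4]. *)
Lemma reflection_bound (HG : GRH_mod q) (b t : R) : 0 < b < / 4 ->
  ln (Cmod (Fk chi 0 (/ 2 - b, t))) - ln (Cmod (Fk chi 0 (/ 2 + b, t))) <= b*lnn q + 16*fe_const*b*ln (4 + t*t).
Proof.
  intros Hb. destruct (functional_equation_mod q chi Hp Hq Hchi) as [k [Hk [tau [Htau FE]]]].
  set (Lq := lnn q). set (Y := fun s => tau*exp (- / 2*Lq)*fe_factor k s).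
  assert (HL : forall x t, 0 < x < 1 -> x <> / 2 -> 0 < Cmod (Fk chi 0 (x, t))).
  { intros x u Hx Hn. apply Cmod_gt_0. intros E. destruct HG as [HG _]. apply Hn. apply (HG chi Hchi (x, u)); [exact Hx|]. rewrite Lfun_Fk. exact E. }
  assert (FY : forall x u, 0 < x < 1 -> Cmod (Fk chi 0 (x, u)) = exp ((/ 2-x)*Lq)*Y (x, u)*Cmod (Fk chi 0 (1-x, u))).
  { intros x u Hx. rewrite (FE x u Hx). unfold Y. fold Lq. replace (- x*Lq) with ((/ 2-x)*Lq + - / 2*Lq) by ring. rewrite exp_plus. ring. }
  assert (Ypos : forall x u, 0 < x < 1 -> x <> / 2 -> 0 < Y (x, u)).
  { intros x u Hx Hn. pose proof (HL x u Hx Hn) as A1. pose proof (HL (1-x) u ltac:(lra) ltac:(lra)) as A2. rewrite (FY x u Hx) in A1.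
    pose proof (exp_pos ((/ 2-x)*Lq)). apply Rnot_le_lt. intros Hle.
    assert (exp ((/ 2-x)*Lq)*Y (x, u) <= 0) by nra. nra. }
  assert (YY : forall x u, 0 < x < 1 -> x <> / 2 -> Y (x, u)*Y (1-x, u) = 1).
  { intros x u Hx Hn. pose proof (HL x u Hx Hn) as A1. pose proof (FY x u Hx) as E1. pose proof (FY (1-x) u ltac:(lra)) as E2. replace (1-(1-x)) with x in E2 by ring.
    rewrite E2 in E1. apply Rmult_eq_reg_l with (Cmod (Fk chi 0 (x, u))); [|lra]. rewrite E1 at 2.
    replace (exp ((/ 2-(1-x))*Lq)) with (/ exp ((/ 2-x)*Lq)); [field; apply Rgt_not_eq, exp_pos|]. rewrite <- exp_Ropp. f_equal. field. }
  assert (Yc : forall s, 0 < Re s < 1 -> rcont Y s).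
  { intros s Hs. apply (rcont_scal (tau*exp (- / 2*Lq)) (fe_factor k)). apply fe_factor_rcont; assumption. }
  assert (Y0 : forall s, 0 <= Y s).
  { intros s. apply Rmult_le_pos; [apply Rmult_le_pos; [exact Htau|left; apply exp_pos]|]. pose proof PI_RGT_0.
    repeat apply Rmult_le_pos; try apply Cmod_ge_0; try (left; apply exp_pos). left; inv_pos. }
  (* Off the critical line [Y (x, u) Y (1 - x, u) = 1] by applying the equation twice; continuity
     extends this to [x = 1/2], where zeros of [L] forbid the division. This fixes the modulus of
     the Gauss sum. *)
  assert (Y1 : forall u, Y (/ 2, u) = 1).
  { intros u. assert (Y (/ 2, u)*Y (/ 2, u) = 1); [|specialize (Y0 (/ 2, u)); nra].
    apply NNPP. intros Hne. set (e := Rabs (Y (/ 2, u)*Y (/ 2, u)-1)). assert (He : 0 < e) by (apply Rabs_pos_lt; lra).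
    set (y := Y (/ 2, u)) in *. assert (Hy : 0 <= y) by apply Y0. set (d := Rmin 1 (e/(2*(2*y+2)))). assert (Hd : 0 < d) by (apply Rmin_pos; [lra|div_pos]).
    assert (d <= 1) by apply Rmin_l. assert (d <= e/(2*(2*y+2))) by apply Rmin_r.
    destruct (Yc (/ 2, u) ltac:(Re_lra) d Hd) as [r [Hr C0]]. set (h := Rmin (r/2) (/ 4)).
    assert (Hh : 0 < h /\ h <= r/2 /\ h <= / 4) by (unfold h; split; [apply Rmin_pos; lra|split; [apply Rmin_l|apply Rmin_r]]).
    pose proof (C0 (RtoC h)) as C1. pose proof (C0 (RtoC (- h))) as C2. rewrite Cmod_R, Rabs_right in C1 by lra. rewrite Cmod_R, Rabs_left in C2 by lra.
    specialize (C1 ltac:(lra)). specialize (C2 ltac:(lra)).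
    replace (((/ 2)%R, u)+RtoC h)%C with ((1-(/ 2-h), u) : C) in C1 by (apply C_ext; Re_lra).
    replace (((/ 2)%R, u)+RtoC (- h)%R)%C with ((/ 2-h, u) : C) in C2 by (apply C_ext; Re_lra).
    pose proof (YY (/ 2-h) u ltac:(lra) ltac:(lra)) as E. fold y in C1, C2. set (p := Y (/ 2-h, u)) in *. set (r' := Y (1-(/ 2-h), u)) in *.
    apply Rabs_def2 in C1. apply Rabs_def2 in C2.
    assert (e*1 <= d*(2*y+2)).
    { rewrite Rmult_1_r. unfold e. replace (y*y-1) with (- ((p-y)*r'+y*(r'-y))) by (rewrite <- E; ring). rewrite Rabs_Ropp. le_via Rabs_triang. rewrite !Rabs_mult.
      assert (Rabs (p-y) <= d) by (apply Rabs_le; lra). assert (Rabs (r'-y) <= d) by (apply Rabs_le; lra). rewrite (Rabs_right y) by lra.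
      assert (Rabs r' <= y+1) by (apply Rabs_le; lra). pose proof (Rabs_pos r'). nra. }
    assert (d*(2*y+2) <= e/2); [|lra]. replace (e/2) with (e/(2*(2*y+2))*(2*y+2)) by (field; lra). nra. }
  assert (Cst : tau*exp (- / 2*Lq)*fe_factor k half = 1) by apply (Y1 0).
  assert (Hf0 : 0 < fe_factor k half).
  { pose proof (exp_pos (- / 2*Lq)). assert (0 <= tau*exp (- / 2*Lq)) by nra. nra. }
  assert (Yp : forall s, / 4 <= Re s <= / 2 -> 0 < Y s).
  { intros [x u] Hs. unfold Re in Hs; simpl in Hs. destruct (Req_dec x (/ 2)) as [->|Hn]; [rewrite Y1; lra|]. apply Ypos; lra. }
  assert (Hcg : 1 <= fe_const) by (unfold fe_const; pose proof (Rabs_pos (ln (128/fe_factor kcos half))); pose proof (Rabs_pos (ln (128/fe_factor ksin half))); lra).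
  assert (LY : forall s, / 4 <= Re s <= / 2 -> ln (Y s) <= fe_const*ln (4+Im s*Im s)).
  { intros s Hs. pose proof (ln_quad_ge_1 (Im s)) as G. pose proof (fe_factor_bound k s Hk ltac:(lra)) as B.
    assert (Ey : Y s = fe_factor k s/fe_factor k half). { unfold Y. replace (tau*exp (- / 2*Lq)) with (/ fe_factor k half); [field; lra|]. apply Rmult_eq_reg_r with (fe_factor k half); [|lra]. rewrite Cst. field. lra. }
    assert (HY := Yp s Hs). assert (ln (Y s) <= ln (128/fe_factor k half)+ln (4+Im s*Im s)).
    { rewrite <- ln_mult; [|div_pos|nra]. apply ln_le'; [exact HY|]. rewrite Ey. unfold Rdiv. rewrite Rmult_assoc, (Rmult_comm (/ fe_factor k half)), <- Rmult_assoc.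
      apply Rmult_le_compat_r; [left; inv_pos|exact B]. }
    pose proof (Rle_abs (ln (128/fe_factor k half))). unfold fe_const in *.
    pose proof (Rabs_pos (ln (128/fe_factor kcos half))). pose proof (Rabs_pos (ln (128/fe_factor ksin half))).
    assert (Rabs (ln (128/fe_factor k half)) <= Rabs (ln (128/fe_factor kcos half))+Rabs (ln (128/fe_factor ksin half))) by (destruct Hk as [-> | ->]; lra). nra. }
  (* On [Re w = 1/4] the factor [1/4 - x^2] equals 3/16, so 16 is more than enough to dominate [LY]
     there. *)
  set (K := 16*fe_const).
  set (U := fun w => ln (Y w) + - K*((/ 4-Re w*Re w)*ln (4+Im w*Im w))).
  assert (HU : forall z, / 4 <= Re z <= / 2 -> ~ False -> U z <= 0).
  { assert (Gr : forall z, / 4 <= Re z <= / 2 -> - K*((/ 4-Re z*Re z)*ln (4+Im z*Im z)) <= 0).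
    { intros z Hz. pose proof (ln_quad_ge_1 (Im z)). assert (0 <= (/ 4-Re z*Re z)*ln (4+Im z*Im z)) by (apply Rmult_le_pos; [nra|lra]). unfold K. nra. }
    apply strip_principle; [lra| | | | |].
    - intros z Hz _. apply (rcont_plus (fun w => ln (Y w)) (fun w => - K*((/ 4-Re w*Re w)*ln (4+Im w*Im w)))).
      + apply (rcont_comp ln Y); [|apply Yc; lra]. apply derivable_continuous_pt. exists (/ Y z). apply derivable_pt_lim_ln. auto.
      + apply rcont_scal. apply (rcont_mult (fun w => / 4-Re w*Re w) (fun w => ln (4+Im w*Im w))).
        * apply (rcont_comp (fun u => / 4-u*u) Re); [|apply rcont_Re]. apply derivable_continuous_pt. exists (- 2*Re z). apply is_derive_Reals. der_ring.
        * apply (rcont_comp (fun u => ln (4+u*u)) Im); [|apply rcont_Im]. apply derivable_continuous_pt. exists (2*Im z/(4+Im z*Im z)). apply is_derive_Reals. auto_derive; [nra|]. nra.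
    - intros z _ [].
    - intros z [E|E] _; unfold U.
      + pose proof (LY z ltac:(lra)). pose proof (ln_quad_ge_1 (Im z)). unfold K. nra.
      + destruct z as [x u]. unfold Re in *; simpl in E. subst x. rewrite Y1, ln_1. simpl fst. lra.
    - intros x y Hx _. split; [|exists 1; split; [lra|auto]].
      destruct (lapl_fe_majorant K x y ltac:(unfold K; lra) Hx) as [lam [Hl L]]. exists (0+lam). split; [lra|]. apply (lapl_plus (fun w => ln (Y w)) (fun w => - K*((/ 4-Re w*Re w)*ln (4+Im w*Im w)))); [|exact L].
      set (r := Rmin (x - / 4) (/ 2-x)). assert (Hr : 0 < r) by (apply Rmin_pos; lra). pose proof (Rmin_l (x - / 4) (/ 2-x)). pose proof (Rmin_r (x - / 4) (/ 2-x)). fold r in H, H0.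
      assert (Hw : forall w, Cmod (w-(x, y))%C < r -> / 4 < Re w < / 2).
      { intros w Hw. pose proof (re_le_Cmod (w-(x, y))%C) as B. apply Rabs_le_between in B. unfold Re in B; simpl in B. unfold Re. lra. }
      (* [ln Y] as a difference of logarithms of moduli plus a linear function; [L(1 - w, conj chi)]
         is the holomorphic function of [w] whose modulus is [|L(1 - x + i y, chi)|]. *)
      apply (lapl_ext_loc (fun w => (ln (Cmod (Fk chi 0 w)) + -1*ln (Cmod (Fk (conj_char chi) 0 (1-w)%C)))+(Lq*Re w + - (/ 2*Lq))) _ x y 0 r Hr).
      + intros [a c] Hac. specialize (Hw _ Hac). unfold Re in Hw; simpl in Hw. pose proof (FY a c ltac:(lra)) as E. pose proof (HL (1-a) c ltac:(lra) ltac:(lra)) as A2.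
        assert (A3 : 0 < Y (a, c)) by (apply Ypos; lra).
        replace (Cmod (Fk (conj_char chi) 0 (1-(a, c))%C)) with (Cmod (Fk chi 0 (1-a, c))).
        * rewrite E, (ln_mult _ (Cmod _)), (ln_mult (exp _)), ln_exp by (assumption || apply exp_pos || (apply Rmult_lt_0_compat; [apply exp_pos|assumption])). unfold Re; simpl. ring.
        * replace (1-(a, c))%C with (Cconj ((1-a)%R, c)) by C_ring. rewrite (Fk_conj q chi _ Hp Hchi) by Re_lra. symmetry. apply Cmod_conj.
      + replace 0 with ((0 + -1*0)+0) by ring.
        apply (lapl_plus (fun w => ln (Cmod (Fk chi 0 w)) + -1*ln (Cmod (Fk (conj_char chi) 0 (1-w)%C))) (fun w => Lq*Re w + - (/ 2*Lq))); [|apply lapl_linear].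
        apply (lapl_plus (fun w => ln (Cmod (Fk chi 0 w))) (fun w => -1*ln (Cmod (Fk (conj_char chi) 0 (1-w)%C)))).
        * apply (lapl_ln_mod (Fk chi 0) (fun w => - Fk chi 1 w)%C (-1 * - Fk chi 2 (x, y))%C x y r Hr).
          -- intros w W. specialize (Hw w W). apply (Lfun_cder q chi Hp Hchi). lra.
          -- replace (fun w => - Fk chi 1 w)%C with (fun w => -1*Fk chi 1 w)%C by fun_ring. apply cder_scal. apply (Lfun_cder q chi Hp Hchi). Re_lra.
          -- apply Cmod_gt_0. apply HL; lra.
        * apply (lapl_scal (-1) (fun w => ln (Cmod (Fk (conj_char chi) 0 (1-w)%C)))). set (cb := conj_char chi). assert (Hcb : nonprincipal_char q cb) by (apply conj_nonprincipal; exact Hchi).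
          assert (Dc : forall j w, Re w < 1 -> cder (fun w => Fk cb j (1-w)%C) w (Fk cb (S j) (1-w)%C)).
          { intros j w W. pose proof (cder_comp (Fk cb j) (fun w => -1*w+1)%C w (- Fk cb (S j) (-1*w+1))%C (-1) (cder_affine (-1) 1 w)) as D.
            replace (fun w : C => Fk cb j (1-w)%C) with (fun w : C => Fk cb j (-1*w+1)%C) by (apply functional_extensionality; intros; f_equal; ring).
            replace (Fk cb (S j) (1-w)%C) with (- Fk cb (S j) (-1*w+1) * -1)%C by (replace (1-w)%C with (-1*w+1)%C by ring; ring). apply D. apply (Lfun_cder q cb Hp Hcb). unfold Re in *; simpl; lra. }
          apply (lapl_ln_mod (fun w => Fk cb 0 (1-w)%C) (fun w => Fk cb 1 (1-w)%C) (Fk cb 2 (1-(x, y))%C) x y r Hr).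
          -- intros w W. specialize (Hw w W). apply Dc. lra.
          -- apply Dc. Re_lra.
          -- intros E. apply (f_equal Cmod) in E. rewrite Cmod_0 in E. replace (1-(x, y))%C with (Cconj ((1-x)%R, y)) in E by C_ring. rewrite (Fk_conj q chi _ Hp Hchi), Cmod_conj in E by Re_lra. pose proof (HL (1-x) y ltac:(lra) ltac:(lra)). lra.
    - exists (4*fe_const), 0. split; [lra|]. intros z Hz _ _. unfold U. pose proof (LY z Hz). pose proof (Gr z Hz).
      assert (ln (4+Im z*Im z) <= 4*(1+Rabs (Im z))); [|nra].
      pose proof (Rabs_pos (Im z)). assert (Rabs (Im z)*Rabs (Im z) = Im z*Im z) by (rewrite <- Rabs_mult; apply Rabs_right; nra).
      apply Rle_trans with (ln ((2+Rabs (Im z))*(2+Rabs (Im z)))); [apply ln_le'; nra|]. rewrite ln_mult by lra. pose proof (ln_lt_self (2+Rabs (Im z)) ltac:(lra)). lra. }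
  specialize (HU (/ 2-b, t)). unfold U, Re, Im in HU; simpl in HU.
  pose proof (HL (/ 2+b) t ltac:(lra) ltac:(lra)) as A2. pose proof (FY (/ 2-b) t ltac:(lra)) as E. replace (1-(/ 2-b)) with (/ 2+b) in E by field.
  rewrite E, (ln_mult _ (Cmod _)), (ln_mult (exp _)), ln_exp by (assumption || apply exp_pos || (apply Ypos; lra) || (apply Rmult_lt_0_compat; [apply exp_pos|apply Ypos; lra])).
  pose proof (ln_quad_ge_1 t).
  assert (K*((b-b*b)*ln (4+t*t)) <= K*b*ln (4+t*t)). { rewrite Rmult_assoc. apply Rmult_le_compat_l; [unfold K; lra|]. nra. } lra.
Qed.
End UnderGRH.

(** * Removing two zeros, and the inequality for the logarithmic derivative *)

Lemma log_derivative_right : exists K, 0 < K /\ forall q chi s, prime (Z.of_nat q) -> nonprincipal_char q chi -> 3 <= Re s ->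
  Cmod (Fk chi 1 s/Fk chi 0 s)%C <= K.
Proof.
  destruct (vonmangoldt_tail 3 ltac:(lra)) as [K [HK T]]. exists K. split; [exact HK|]. intros q chi s Hp Hchi Hs.
  destruct (log_derivative_series q chi Hp Hchi 3 ltac:(lra)) as [K' [_ H]]. destruct (H s Hs) as [g [Hg [E _]]].
  assert (N : Fk chi 0 s <> 0%C) by (apply (Lfun_neq_0_right q chi Hp Hchi); lra).
  rewrite E. replace (g*Fk chi 0 s/Fk chi 0 s)%C with g by (field; exact N). apply (ccv_le _ _ _ 0 Hg). intros n _.
  specialize (T 0%nat n). simpl INR in T. rewrite ln_1, Rmult_0_r, exp_0, Rmult_1_r in T. refine (Rle_trans _ _ _ _ T). le_via Cmod_csum_le. apply rsum_le. intros m Hm.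
  le_via (vm_sum_term_bound q chi Hp Hchi). apply Rmult_le_compat_l; [apply vonmangoldt_nonneg|]. apply exp_le.
  pose proof (ln_INR_nonneg m). nra.
Qed.

Lemma lapl_translate (V : C -> R) (b x y lam : R) : lapl V (x + b) y lam -> lapl (fun w => V (w + RtoC b)%C) x y lam.
Proof.
  intros [p [r [al [be [[d1 [Hd1 H1]] [H2 [[d2 [Hd2 H3]] [H4 H5]]]]]]]].
  assert (E : forall u v, ((u, v)+RtoC b)%C = (u+b, v)) by (intros; C_ring).
  assert (S : forall (f : R -> R) u l, is_derive f (u+b) l -> is_derive (fun u => f (u+b)) u l).
  { intros f u l Hf. replace l with (1*l) by ring. apply (is_derive_comp f (fun u => u+b)); [exact Hf|]. der_ring. }
  exists (fun u => p (u+b)), r, al, be. split; [|split; [|split; [|split]]].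
  - exists d1. split; [exact Hd1|]. intros u Hu. apply (is_derive_ext (fun u => V (u+b, y))); [intros; rewrite E; reflexivity|].
    apply (S (fun u => V (u, y))). apply H1. replace (u+b-(x+b)) with (u-x) by ring. exact Hu.
  - auto.
  - exists d2. split; [exact Hd2|]. intros v Hv. apply (is_derive_ext (fun v => V (x+b, v))); [intros; rewrite E; reflexivity|]. auto.
  - exact H4.
  - exact H5.
Qed.

Lemma rcont_translate (V : C -> R) (b z : C) : rcont V (z + b)%C -> rcont (fun w => V (w + b)%C) z.
Proof.
  intros H eps He. destruct (H eps He) as [d [Hd K]]. exists d. split; [exact Hd|]. intros h Hh. replace (z+h+b)%C with (z+b+h)%C by ring. auto.
Qed.

Lemma Cminus_0_eq (a b : C) : (a - b)%C = 0%C -> a = b.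
Proof. intros E. replace a with (a-b+b)%C by ring. rewrite E. ring. Qed.

(* [mu] is a weight strictly below the order of vanishing of [f] at [rho], or zero. *)
Definition zero_weight (f : C -> C) (rho : C) (mu : R) : Prop := 0 <= mu /\ (mu = 0 \/ (f rho = 0%C /\ exists m c r, mu < m /\ 0 < r /\
  forall w, Cmod (w - rho)%C < r -> f w <> 0%C -> ln (Cmod (f w)) <= c + m*ln (Cmod (w - rho)%C))).

Definition zpot (mu : R) (rho w : C) : R := mu*ln (Cmod (w - rho)%C).

Lemma zpot_rcont (mu : R) (rho z : C) : mu = 0 \/ z <> rho -> rcont (zpot mu rho) z.
Proof.
  intros [-> | H].
  - unfold zpot. replace (fun w => 0*ln (Cmod (w-rho)%C)) with (fun _ : C => 0) by fun_ring. apply rcont_const.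
  - apply (rcont_scal mu (fun w => ln (Cmod (w-rho)%C))). apply (cder_rcont_ln_mod (fun w => w-rho)%C z 1).
    + replace (fun w => w-rho)%C with (fun w => 1*w + - rho)%C by fun_ring. apply cder_affine.
    + intros E. apply H. apply Cminus_0_eq. exact E.
Qed.

Lemma zpot_lapl (mu : R) (rho : C) (x y : R) : mu = 0 \/ (x, y) <> rho -> lapl (zpot mu rho) x y 0.
Proof.
  intros H. replace 0 with (mu*0) by ring. destruct H as [-> | H].
  - unfold zpot. replace (fun w => 0*ln (Cmod (w-rho)%C)) with (fun w : C => 0*(0*Re w+0)) by fun_ring. apply lapl_scal, lapl_linear.
  - apply (lapl_scal mu (fun w => ln (Cmod (w-rho)%C))). apply (lapl_ln_mod (fun w => w-rho)%C (fun _ => 1%C) 0 x y 1 ltac:(lra)).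
    + intros w _. replace (fun w => w-rho)%C with (fun w => 1*w + - rho)%C by fun_ring. apply cder_affine.
    + apply cder_const.
    + intros E. apply H. apply Cminus_0_eq. exact E.
Qed.

Lemma zpot_horizontal (mu : R) (rho : C) (x y : R) : mu = 0 \/ (x, y) <> rho -> is_derive (fun x => zpot mu rho (x, y)) x (mu*Re (/ ((x, y) - rho))%C).
Proof.
  intros [-> | H].
  - apply (is_derive_ext (fun _ => 0)); [intros; symmetry; apply Rmult_0_l|]. rewrite Rmult_0_l. apply (is_derive_const 0 x).
  - apply (is_derive_scal (fun x => ln (Cmod ((x, y)-rho)%C))). replace (/ ((x, y)-rho))%C with (1/((x, y)-rho))%C by (unfold Cdiv; ring).
    apply (rder_ln_mod (fun x => (x, y)-rho)%C).
    + intros E. apply H. apply Cminus_0_eq. exact E.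
    + apply (rder_horizontal (fun w => w-rho)%C). replace (fun w => w-rho)%C with (fun w => 1*w + - rho)%C by fun_ring. apply cder_affine.
Qed.

Lemma ln_lt_of_small (x M : R) : 0 < x < exp M -> ln x < M.
Proof. intros H. rewrite <- (ln_exp M). apply ln_increasing; lra. Qed.

(** At [rho] itself, [ln |f| <= c + m ln |w - rho|] with [m > mu] leaves a positive multiple of
    [ln |w - rho|]; at other zeros the potential is continuous. *)
Lemma zero_weight_minfty (f : C -> C) (rho z0 d : C) (mu : R) : cder f z0 d -> f z0 = 0%C -> zero_weight f rho mu ->
  forall M, exists del, 0 < del /\ forall w, Cmod (w - z0)%C < del -> f w <> 0%C -> ln (Cmod (f w)) - zpot mu rho w < M.
Proof.
  intros Hd Hz [Hmu Hw] M. destruct (classic (mu = 0 \/ z0 <> rho)) as [Hc|Hc].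
  - destruct (rcont_usc _ _ (rcont_scal (-1) _ _ (zpot_rcont mu rho z0 Hc)) 1 ltac:(lra)) as [d1 [Hd1 H1]].
    destruct (cder_continuous f z0 d Hd (exp (M-(-1*zpot mu rho z0+1))) (exp_pos _)) as [d2 [Hd2 H2]].
    exists (Rmin d1 d2). split; [apply Rmin_pos; assumption|]. intros w Hw' Fw. pose proof (H1 w (Rlt_le_trans _ _ _ Hw' (Rmin_l _ _))) as A.
    pose proof (H2 (w-z0)%C (Rlt_le_trans _ _ _ Hw' (Rmin_r _ _))) as B. replace (z0+(w-z0))%C with w in B by ring. rewrite Hz in B. replace (f w-0)%C with (f w) in B by ring.
    pose proof (ln_lt_of_small _ _ (conj (proj1 (Cmod_gt_0 _) Fw) B)). lra.
  - assert (Hn : mu <> 0) by tauto. assert (Er : z0 = rho) by (apply NNPP; tauto). destruct Hw as [Hw|[_ [m [c [r [Hm [Hr Hw]]]]]]]; [contradiction|]. subst rho.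
    exists (Rmin r (exp ((M-c)/(m-mu)))). split; [apply Rmin_pos; [exact Hr|apply exp_pos]|]. intros w Hw' Fw.
    specialize (Hw w (Rlt_le_trans _ _ _ Hw' (Rmin_l _ _)) Fw).
    assert (W : 0 < Cmod (w-z0)%C). { apply Cmod_gt_0. intros E. apply Fw. rewrite (Cminus_0_eq _ _ E). exact Hz. }
    pose proof (ln_lt_of_small _ _ (conj W (Rlt_le_trans _ _ _ Hw' (Rmin_r _ _)))) as B. unfold zpot.
    apply (Rmult_lt_compat_l (m-mu)) in B; [|lra]. replace ((m-mu)*((M-c)/(m-mu))) with (M-c) in B by (field; lra). lra.
Qed.

Section Weights.
Variables (q : nat) (chi : nat -> C) (r1 r2 : C) (mu1 mu2 : R).
Hypothesis Hp : prime (Z.of_nat q).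
Hypothesis Hq : (3 <= q)%nat.
Hypothesis Hchi : nonprincipal_char q chi.
Hypothesis W1 : zero_weight (Fk chi 0) r1 mu1.
Hypothesis W2 : zero_weight (Fk chi 0) r2 mu2.
Hypothesis W12 : r1 <> r2.

Definition zfree (w : C) : R := ln (Cmod (Fk chi 0 w)) + -1*(zpot mu1 r1 w + zpot mu2 r2 w).

Lemma zero_weight_cases (z : C) (r : C) (mu : R) : zero_weight (Fk chi 0) r mu -> Fk chi 0 z <> 0%C -> mu = 0 \/ z <> r.
Proof. intros [_ [E|[E _]]] Hz; [left; exact E|right]. intros ->. contradiction. Qed.

Lemma zfree_rcont (z : C) : 0 < Re z -> Fk chi 0 z <> 0%C -> rcont zfree z.
Proof.
  intros Hz Hn. apply (rcont_plus (fun w => ln (Cmod (Fk chi 0 w)))).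
  - exact (cder_rcont_ln_mod _ _ _ (Lfun_cder q chi Hp Hchi 0 z Hz) Hn).
  - apply (rcont_scal (-1)). apply rcont_plus; apply zpot_rcont; eapply zero_weight_cases; eassumption.
Qed.

Lemma zfree_lapl (x y : R) : 0 < x -> Fk chi 0 (x, y) <> 0%C -> lapl zfree x y 0.
Proof.
  intros Hx Hn. replace 0 with (0 + -1*(0+0)) by ring. apply (lapl_plus (fun w => ln (Cmod (Fk chi 0 w)))).
  - apply (lapl_ln_mod (Fk chi 0) (fun w => - Fk chi 1 w)%C (-1 * - Fk chi 2 (x, y))%C x y x Hx).
    + intros w W. apply (Lfun_cder q chi Hp Hchi). pose proof (re_le_Cmod (w-(x, y))%C) as B. apply Rabs_le_between in B. unfold Re in B; simpl in B. unfold Re. lra.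
    + replace (fun w => - Fk chi 1 w)%C with (fun w => -1*Fk chi 1 w)%C by fun_ring. apply cder_scal. apply (Lfun_cder q chi Hp Hchi). exact Hx.
    + exact Hn.
  - apply (lapl_scal (-1)). apply lapl_plus; apply zpot_lapl; eapply zero_weight_cases; eassumption.
Qed.

(** As [r1 <> r2], at most one of the two potentials is singular at [z]. *)
Lemma zfree_minfty (z : C) : 0 < Re z -> Fk chi 0 z = 0%C ->
  forall M, exists del, 0 < del /\ forall w, Cmod (w - z)%C < del -> Fk chi 0 w <> 0%C -> zfree w < M.
Proof.
  intros Hz E M. assert (D := Lfun_cder q chi Hp Hchi 0 z Hz).
  assert (G : forall ra ma rb mb, zero_weight (Fk chi 0) ra ma -> (mb = 0 \/ z <> rb) ->
    exists del, 0 < del /\ forall w, Cmod (w-z)%C < del -> Fk chi 0 w <> 0%C -> ln (Cmod (Fk chi 0 w))-zpot ma ra w-zpot mb rb w < M).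
  { intros ra ma rb mb Wa Hb. destruct (rcont_usc _ _ (rcont_scal (-1) _ _ (zpot_rcont mb rb z Hb)) 1 ltac:(lra)) as [d1 [Hd1 H1]].
    destruct (zero_weight_minfty _ ra z _ ma D E Wa (M-(-1*zpot mb rb z+1))) as [d2 [Hd2 H2]]. exists (Rmin d1 d2). split; [apply Rmin_pos; assumption|].
    intros w Hw Fw. specialize (H1 w (Rlt_le_trans _ _ _ Hw (Rmin_l _ _))). specialize (H2 w (Rlt_le_trans _ _ _ Hw (Rmin_r _ _)) Fw). lra. }
  destruct (classic (z = r2)) as [E2|E2].
  - destruct (G r2 mu2 r1 mu1 W2) as [d [Hd H]]; [right; congruence|]. exists d. split; [exact Hd|]. intros w Hw Fw. specialize (H w Hw Fw). unfold zfree. lra.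
  - destruct (G r1 mu1 r2 mu2 W1) as [d [Hd H]]; [right; exact E2|]. exists d. split; [exact Hd|]. intros w Hw Fw. specialize (H w Hw Fw). unfold zfree. lra.
Qed.

Lemma zfree_horizontal (x y : R) : 0 < x -> Fk chi 0 (x, y) <> 0%C ->
  is_derive (fun x => zfree (x, y)) x (- Re (Fk chi 1 (x, y)/Fk chi 0 (x, y))%C + -1*(mu1*Re (/ ((x, y) - r1))%C + mu2*Re (/ ((x, y) - r2))%C)).
Proof.
  intros Hx Hn. apply (is_derive_plus (fun x => ln (Cmod (Fk chi 0 (x, y)))) (fun x => -1*(zpot mu1 r1 (x, y)+zpot mu2 r2 (x, y)))).
  - replace (- Re (Fk chi 1 (x, y)/Fk chi 0 (x, y))%C) with (Re (- Fk chi 1 (x, y)/Fk chi 0 (x, y))%C) by (unfold Re, Cdiv; simpl; ring).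
    apply (rder_ln_mod (fun x => Fk chi 0 (x, y)) x); [exact Hn|]. apply (rder_horizontal (Fk chi 0)). apply (Lfun_cder q chi Hp Hchi). exact Hx.
  - apply (is_derive_scal (fun x => zpot mu1 r1 (x, y)+zpot mu2 r2 (x, y))). apply (is_derive_plus (fun x => zpot mu1 r1 (x, y)) (fun x => zpot mu2 r2 (x, y)));
    apply zpot_horizontal; eapply zero_weight_cases; eassumption.
Qed.

Lemma Cmod_inv_le (z : C) (d : R) : 0 < d -> d <= Cmod z -> Rabs (Re (/ z)%C) <= / d.
Proof.
  intros Hd H. le_via re_le_Cmod. rewrite Cmod_inv by (apply Cmod_gt_0; lra). apply Rinv_le_contravar; assumption.
Qed.

Lemma Cmod_Re_ge (z : C) (d : R) : d <= Re z -> d <= Cmod z.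
Proof. pose proof (re_le_Cmod z). pose proof (Rle_abs (Re z)). lra. Qed.

Lemma zpot_diff_le (mu : R) (rho a b : C) : 0 <= mu -> 1 <= Cmod (a - rho)%C -> Cmod (b - a)%C <= 1 -> 0 < Cmod (b - rho)%C -> zpot mu rho b - zpot mu rho a <= mu.
Proof.
  intros Hmu Ha Hb Hb0. unfold zpot. assert (ln (Cmod (b-rho)%C) <= ln (Cmod (a-rho)%C)+1); [|nra].
  assert (B : Cmod (b-rho)%C <= 2*Cmod (a-rho)%C).
  { replace (b-rho)%C with ((a-rho)+(b-a))%C by ring. le_via Cmod_triangle. lra. }
  apply Rle_trans with (ln (2*Cmod (a-rho)%C)); [apply ln_le'; assumption|]. rewrite ln_mult by lra. pose proof (ln_le' 2 (exp 1) ltac:(lra) ltac:(pose proof (exp_ineq1 1); lra)) as L. rewrite ln_exp in L. lra.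
Qed.

Variable K3 : R.
Hypothesis HK3 : forall s, 3 <= Re s -> Cmod (Fk chi 1 s/Fk chi 0 s)%C <= K3.
Hypothesis HG : GRH_mod q.
Hypothesis Hnz : forall s, / 2 < Re s -> Fk chi 0 s <> 0%C.
Hypothesis Hr1 : Re r1 = / 2.
Hypothesis Hr2 : Re r2 = / 2.

(** Harmonic for [Re s > -1]. On the left edge [16 fe_const (1 + 2 ln |s+1|)] dominates the error of
    [reflection_bound]; on the right edge [2 K3 + 1] dominates the variation of [zfree] over the
    length [2 b]. *)
Definition log_majorant (s : C) : R := lnn q + (16*fe_const + 2*K3 + 1) + 32*fe_const*ln (Cmod (s + 1)%C).

Lemma fe_const_ge_1 : 1 <= fe_const.
Proof. unfold fe_const; pose proof (Rabs_pos (ln (128/fe_factor kcos half))); pose proof (Rabs_pos (ln (128/fe_factor ksin half))); lra. Qed.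

(** The strip principle on [1/2 <= Re s <= B], with the zeros of [L(s - b)] as bad points; there
    [zfree (s - b)] tends to [-oo], while [L(s + b)] has no zeros in the strip. *)
Lemma zfree_difference (b : R) (s : C) : 0 < b < / 4 -> / 2 <= Re s -> Fk chi 0 (s + RtoC (- b)%R)%C <> 0%C ->
  zfree (s + RtoC (- b)%R)%C - zfree (s + RtoC b)%C <= b*log_majorant s.
Proof.
  intros Hb Hs Gs. destruct W1 as [Hmu1 _]. destruct W2 as [Hmu2 _]. pose proof fe_const_ge_1 as Hfc.
  assert (HK0 : 0 <= K3) by (eapply Rle_trans; [apply Cmod_ge_0|apply (HK3 3)]; Re_lra).
  assert (Hlq : 0 <= lnn q) by apply ln_INR_nonneg.
  (* So far to the right the potentials change at a rate of at most 1/2, and [s] still lies inside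
     the strip. *)
  set (B := 4+Re s+2*(mu1+mu2)).
  set (U := fun s : C => (zfree (s+RtoC (- b)%R)%C + -1*zfree (s+RtoC b)%C) + - b*log_majorant s).
  assert (RE : forall z c, Re (z+RtoC c)%C = Re z+c) by auto.
  assert (RI : forall z c, Im (z+RtoC c)%C = Im z) by (intros; Re_ring).
  assert (M1 : forall z, 0 <= Re z -> 1 <= Cmod (z+1)%C) by (intros z Hz; apply Cmod_Re_ge; rewrite (RE z 1); lra).
  assert (MP : forall z, 0 <= Re z -> 0 <= ln (Cmod (z+1)%C)) by (intros z Hz; apply ln_nonneg; auto).
  assert (MJ : forall z, 0 <= Re z -> 0 <= log_majorant z) by (intros z Hz; specialize (MP z Hz); unfold log_majorant; nra).
  assert (D1 : forall z, cder (fun w => w+1)%C z 1).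
  { replace (fun w => w+1)%C with (fun w => 1*w+1)%C by fun_ring. apply cder_affine. }
  assert (N1 : forall z, 0 <= Re z -> (z+1)%C <> 0%C) by (intros z Hz; apply Cmod_gt_0; specialize (M1 z Hz); lra).
  assert (RM : forall z, 0 <= Re z -> rcont (fun z => - b*log_majorant z) z).
  { intros z Hz. apply rcont_scal. apply (rcont_plus (fun _ => lnn q+(16*fe_const+2*K3+1))); [apply rcont_const|]. apply (rcont_scal (32*fe_const) (fun s => ln (Cmod (s+1)%C))).
    exact (cder_rcont_ln_mod _ _ _ (D1 z) (N1 z Hz)). }
  assert (RP : forall z, / 2 <= Re z -> rcont (fun s => -1*zfree (s+RtoC b)%C) z).
  { intros z Hz. apply (rcont_scal (-1) (fun s => zfree (s+RtoC b)%C)). apply rcont_translate. apply zfree_rcont; [|apply Hnz]; rewrite RE; lra. }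
  enough (U s <= 0) by (unfold U in *; lra).
  revert Gs. apply (strip_principle U (fun s => Fk chi 0 (s+RtoC (- b)%R)%C = 0%C) (/ 2) B); [unfold B; lra| | | | | |unfold B; lra].
  - intros z Hz Gz. apply (rcont_plus (fun s => zfree (s+RtoC (- b)%R)%C + -1*zfree (s+RtoC b)%C)); [|apply RM; lra].
    apply (rcont_plus (fun s => zfree (s+RtoC (- b)%R)%C)); [|apply RP; lra]. apply rcont_translate. apply zfree_rcont; [rewrite RE; lra|exact Gz].
  - intros z Hz Bz M. destruct (rcont_usc _ _ (rcont_plus _ _ z (RP z ltac:(lra)) (RM z ltac:(lra))) 1 ltac:(lra)) as [d1 [Hd1 H1]].
    set (A := -1*zfree (z+RtoC b)%C + - b*log_majorant z) in *. destruct (zfree_minfty (z+RtoC (- b)%R)%C ltac:(rewrite RE; lra) Bz (M-(A+1))) as [d2 [Hd2 H2]].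
    exists (Rmin d1 d2). split; [apply Rmin_pos; assumption|]. intros w _ Hw Gw. specialize (H1 w (Rlt_le_trans _ _ _ Hw (Rmin_l _ _))).
    specialize (H2 (w+RtoC (- b)%R)%C). replace (w+RtoC (- b)%R-(z+RtoC (- b)%R))%C with (w-z)%C in H2 by ring. specialize (H2 (Rlt_le_trans _ _ _ Hw (Rmin_r _ _)) Gw). unfold U. lra.
  - intros [x y] [E|E] Gz; unfold Re in E; simpl in E; subst x.
    (* The points [1/2 - b + i y] and [1/2 + b + i y] are equidistant from any [rho] on the critical
       line, so the potentials cancel. *)
    + unfold U, zfree. assert (Z : forall mu rho, Re rho = / 2 -> zpot mu rho (((/ 2)%R, y)+RtoC (- b)%R)%C = zpot mu rho (((/ 2)%R, y)+RtoC b)%C).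
      { intros mu [x u] Ex. unfold Re in Ex; simpl in Ex. subst x. unfold zpot. do 2 f_equal. unfold Cmod. f_equal. simpl. ring. }
      rewrite !Z by assumption. replace (((/ 2)%R, y)+RtoC (- b)%R)%C with ((/ 2-b, y) : C) by C_ring.
      replace (((/ 2)%R, y)+RtoC b)%C with ((/ 2+b, y) : C) by C_ring.
      pose proof (reflection_bound q chi Hp Hq Hchi HG b y Hb) as RB. set (X := Cmod (((/ 2)%R, y)+1)%C).
      assert (HX : 1 <= X) by (apply M1; Re_lra).
      assert (X2 : X*X = 9/4+y*y) by (unfold X; rewrite Cmod_sqr; unfold Re, Im; simpl; field).
      assert (LX : ln (4+y*y) <= 1+2*ln X).
      { apply Rle_trans with (ln (exp 1*(X*X))); [|rewrite !ln_mult, ln_exp by (try apply Rmult_lt_0_compat; try apply exp_pos; lra); lra].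
        apply ln_le'; [nra|]. pose proof (exp_ineq1 1 ltac:(lra)). nra. }
      unfold log_majorant. fold X. assert (16*fe_const*b*ln (4+y*y) <= 16*fe_const*b*(1+2*ln X)) by (apply Rmult_le_compat_l; nra).
      nra.
    + set (f' := fun x => - Re (Fk chi 1 (x, y)/Fk chi 0 (x, y))%C + -1*(mu1*Re (/ ((x, y)-r1))%C+mu2*Re (/ ((x, y)-r2))%C)).
      assert (HB : 4 <= B) by (unfold B; lra).
      assert (MV : Rabs (zfree (B+b, y)-zfree (B-b, y)) <= (K3 + / 2)*(B+b-(B-b))).
      { apply (real_mean_value (fun x => zfree (x, y)) f'); [lra| |].
        - intros x Hx. apply zfree_horizontal; [lra|apply Hnz; Re_lra].
        - intros x Hx. unfold f'. assert (A1 : Rabs (Re (Fk chi 1 (x, y)/Fk chi 0 (x, y))%C) <= K3) by (eapply Rle_trans; [apply re_le_Cmod|apply HK3; Re_lra]).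
          assert (A2 : forall r, Re r = / 2 -> Rabs (Re (/ ((x, y)-r))%C) <= / (B-1)).
          { intros r Hr. apply Cmod_inv_le; [lra|]. apply Cmod_Re_ge. unfold Re in *; simpl. lra. }
          pose proof (A2 r1 Hr1) as A3. pose proof (A2 r2 Hr2) as A4. assert (A5 : (mu1+mu2) * / (B-1) <= / 2).
          { apply Rmult_le_reg_r with (B-1); [lra|]. rewrite Rmult_assoc, Rinv_l by lra. unfold B. lra. }
          apply Rabs_le_between in A1. apply Rabs_le_between in A3. apply Rabs_le_between in A4. apply Rabs_le. nra. }
      unfold U. replace ((B, y)+RtoC (- b)%R)%C with ((B-b, y) : C) by C_ring.
      replace ((B, y)+RtoC b)%C with ((B+b, y) : C) by C_ring.
      apply Rabs_le_between in MV. specialize (MP (B, y) ltac:(Re_lra)). unfold log_majorant. set (lx := ln (Cmod ((B, y)+1)%C)) in *.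
      assert (0 <= b*(32*fe_const*lx)) by (apply Rmult_le_pos; nra). nra.
  - intros x y Hx Gz. split.
    + exists ((0 + -1*0) + - b*(0+32*fe_const*0)). split; [lra|]. apply (lapl_plus (fun s => zfree (s+RtoC (- b)%R)%C + -1*zfree (s+RtoC b)%C)).
      * apply (lapl_plus (fun s => zfree (s+RtoC (- b)%R)%C)).
        -- apply lapl_translate. apply zfree_lapl; [lra|]. replace (x + - b, y) with ((x, y)+RtoC (- b)%R)%C by C_ring. exact Gz.
        -- apply (lapl_scal (-1) (fun s => zfree (s+RtoC b)%C)). apply lapl_translate. apply zfree_lapl; [lra|]. apply Hnz. Re_lra.
      * apply lapl_scal. unfold log_majorant. apply (lapl_ext_loc (fun s => (0*Re s+(lnn q+(16*fe_const+2*K3+1)))+32*fe_const*ln (Cmod (s+1)%C)) _ x y (0+32*fe_const*0) 1 ltac:(lra)); [intros; ring|].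
        apply (lapl_plus (fun s => 0*Re s+(lnn q+(16*fe_const+2*K3+1)))); [apply lapl_linear|].
        apply (lapl_scal (32*fe_const) (fun s => ln (Cmod (s+1)%C))). apply (lapl_ln_mod (fun s => s+1)%C (fun _ => 1%C) 0 x y 1 ltac:(lra)); [intros; apply D1|apply cder_const|apply N1; Re_lra].
    + destruct (cder_neq_0_loc _ _ _ (Lfun_cder q chi Hp Hchi 0 ((x, y)+RtoC (- b)%R)%C ltac:(rewrite RE; Re_lra)) Gz) as [r [Hr H]].
      exists r. split; [exact Hr|]. intros w Hw. specialize (H _ Hw). replace ((x, y)+RtoC (- b)%R+(w-(x, y)))%C with (w+RtoC (- b)%R)%C in H by ring. exact H.
  (* This constant depends on [b] and [q]; the strip principle only asks for linear growth. *)
  - destruct (log_derivative_growth q chi Hp Hchi Hnz b ltac:(lra)) as [K [HK G]].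
    assert (HQ : 0 < INR q) by (apply lt_0_INR; lia).
    exists (7*INR q*(B+2)+K+mu1+mu2), (Rabs (Im r1)+Rabs (Im r2)+1). assert (0 < B+2) by (unfold B; lra). pose proof (Rmult_lt_0_compat _ _ HQ H). split; [lra|]. intros z Hz Gz Yz.
    set (a := (z+RtoC (- b)%R)%C) in *. set (c := (z+RtoC b)%C). pose proof (Rabs_pos (Im z)) as P0.
    assert (Ra : Re a = Re z + - b) by apply RE. assert (Ia : Im a = Im z) by apply RI. assert (Rc : Re c = Re z+b) by apply RE. assert (Ic : Im c = Im z) by apply RI.
    assert (A1 : ln (Cmod (Fk chi 0 a)) <= 7*INR q*(B+2)*(1+Rabs (Im z))).
    { eapply Rle_trans; [left; apply ln_lt_self; apply Cmod_gt_0; exact Gz|]. eapply Rle_trans; [apply (Lfun_bound_strip q chi Hp Hchi); lra|].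
      rewrite (Rmult_assoc (7*INR q)). apply Rmult_le_compat_l; [lra|]. pose proof (Cmod_le_abs a) as C0. rewrite Ra, Ia, (Rabs_right (Re z + - b)) in C0 by lra. nra. }
    assert (A2 : - ln (Cmod (Fk chi 0 c)) <= K*(1+Rabs (Im z))) by (rewrite <- Ic; apply G; lra).
    assert (A3 : forall mu r, 0 <= mu -> Re r = / 2 -> Rabs (Im r)+1 <= Rabs (Im z) -> zpot mu r c-zpot mu r a <= mu).
    { intros mu r Hmu Hr Hy. apply zpot_diff_le; [exact Hmu| | |].
      - eapply Rle_trans; [|apply Im_abs_le_Cmod]. replace (Im (a-r)%C) with (Im z-Im r) by (rewrite <- Ia; Re_ring). pose proof (Rabs_triang_inv (Im z) (Im r)). lra.
      - replace (c-a)%C with (RtoC (2*b)) by (unfold c, a; C_ring). rewrite Cmod_R, Rabs_right; lra.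
      - apply Rlt_le_trans with b; [lra|]. apply Cmod_Re_ge. replace (Re (c-r)%C) with (Re c-Re r) by Re_ring. lra. }
    pose proof (Rabs_pos (Im r1)). pose proof (Rabs_pos (Im r2)).
    pose proof (A3 mu1 r1 Hmu1 Hr1 ltac:(lra)). pose proof (A3 mu2 r2 Hmu2 Hr2 ltac:(lra)). specialize (MJ z ltac:(lra)).
    unfold U, zfree. fold a c. nra.
Qed.

(** Divide [zfree_difference] by [b] and let [b] tend to 0: the symmetric difference quotient tends
    to minus twice the horizontal derivative of [zfree]. *)
Lemma log_derivative_positivity (s : C) : / 2 < Re s ->
  mu1*Re (/ (s - r1))%C + mu2*Re (/ (s - r2))%C + Re (Fk chi 1 s/Fk chi 0 s)%C <= / 2*log_majorant s.
Proof.
  intros Hs. destruct s as [x y]. unfold Re in Hs; simpl in Hs. assert (Hn : Fk chi 0 (x, y) <> 0%C) by auto.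
  pose proof (zfree_horizontal x y ltac:(lra) Hn) as D. set (d := - Re _+_) in D. set (h := log_majorant (x, y)).
  enough (- (2)*d <= h) by (unfold d in *; lra). apply Rnot_lt_le. intros Hlt.
  apply is_derive_Reals in D. destruct (D ((- (2)*d-h)/4) ltac:(lra)) as [del Hdel]. pose proof (cond_pos del).
  set (b := Rmin (del/2) (Rmin (/ 8) ((x - / 2)/2))). assert (Hb : 0 < b) by (repeat apply Rmin_pos; lra).
  assert (B1 : b <= del/2) by apply Rmin_l. assert (B2 : b <= / 8) by (eapply Rle_trans; [apply Rmin_r|apply Rmin_l]). assert (B3 : b <= (x - / 2)/2) by (eapply Rle_trans; [apply Rmin_r|apply Rmin_r]).
  assert (E : forall c, ((x, y)+RtoC c)%C = (x+c, y)) by (intros; C_ring).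
  pose proof (zfree_difference b (x, y) ltac:(lra) ltac:(Re_lra)) as Z. rewrite !E in Z. specialize (Z ltac:(apply Hnz; Re_lra)). fold h in Z.
  pose proof (Hdel b ltac:(lra) ltac:(rewrite Rabs_right; lra)) as P1. pose proof (Hdel (- b) ltac:(lra) ltac:(rewrite Rabs_left; lra)) as P2.
  apply Rabs_def2 in P1. apply Rabs_def2 in P2. set (e := (- (2)*d-h)/4) in *.
  assert (Q1 : zfree (x+b, y)-zfree (x, y) < (d+e)*b).
  { replace (zfree (x+b, y)-zfree (x, y)) with ((zfree (x+b, y)-zfree (x, y))/b*b) by (field; lra). apply Rmult_lt_compat_r; [exact Hb|]. apply (Rplus_lt_reg_r (- d)). replace (d+e + - d) with e by ring. apply P1. }
  assert (Q2 : (zfree (x, y)-zfree (x + - b, y)) < (d+e)*b).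
  { replace (zfree (x, y)-zfree (x + - b, y)) with ((zfree (x + - b, y)-zfree (x, y)) / - b*b) by (field; lra). apply Rmult_lt_compat_r; [exact Hb|]. apply (Rplus_lt_reg_r (- d)). replace (d+e + - d) with e by ring. apply P2. }
  assert (b*h > b*(- 2*(d+e))) by lra. apply Rmult_lt_reg_l in H0; [|exact Hb]. unfold e in *. lra.
Qed.
End Weights.

(** A single Blaschke factor for [Re s >= 1/4]: [r2] is the mirror image of [r1] in the line
    [Re s = 1/4], so the two potentials agree on it, where [|L| <= 14 q |s+1|]. At [3 + i g] the
    distances are 3 and 5/2 and [|L|] is bounded below, which limits [mu]. *)
Lemma zero_weight_crude (q : nat) (chi : nat -> C) (g mu : R) : prime (Z.of_nat q) -> nonprincipal_char q chi ->
  zero_weight (Fk chi 0) (/ 2, g) mu -> mu*(ln 3 - ln (5/2)) <= 1 + ln (14*INR q) + ln (4 + Rabs g).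
Proof.
  intros Hp Hchi W1. set (r1 := (/ 2, g) : C) in *. set (r2 := (0, g) : C).
  assert (W2 : zero_weight (Fk chi 0) r2 0) by (split; [lra|left; reflexivity]).
  assert (W12 : r1 <> r2) by (intros E; apply (f_equal fst) in E; simpl in E; lra).
  assert (Hmu : 0 <= mu) by apply W1. assert (HQ : 2 <= INR q) by (apply (le_INR 2); pose proof (nat_prime_gt1 q Hp); lia).
  (* On [Re s = 4 + mu] the quotient of the two distances contributes at most 1/2 and [ln |L|] at
     most 3/8, together less than [A]. *)
  set (B := 4+mu). set (A := ln (14*INR q)).
  assert (RE : forall z c, Re (z+RtoC c)%C = Re z+c) by auto.
  assert (M1 : forall z, 0 <= Re z -> 1 <= Cmod (z+1)%C) by (intros z Hz; apply Cmod_Re_ge; rewrite (RE z 1); lra).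
  assert (N1 : forall z, 0 <= Re z -> (z+1)%C <> 0%C) by (intros z Hz; apply Cmod_gt_0; specialize (M1 z Hz); lra).
  assert (D1 : forall z, cder (fun w => w+1)%C z 1).
  { replace (fun w => w+1)%C with (fun w => 1*w+1)%C by fun_ring. apply cder_affine. }
  assert (N2 : forall z, 0 < Re z -> z <> r2) by (intros z Hz ->; unfold r2, Re in Hz; simpl in Hz; lra).
  assert (LB : forall z, / 4 <= Re z -> Fk chi 0 z <> 0%C -> ln (Cmod (Fk chi 0 z)) <= A+ln (Cmod (z+1)%C)).
  { intros z Hz Gz. specialize (M1 z ltac:(lra)). unfold A. rewrite <- ln_mult by lra. apply ln_le'; [apply Cmod_gt_0; exact Gz|]. le_via (Lfun_bound_strip q chi Hp Hchi z Hz).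
    assert (Cmod z <= Cmod (z+1)%C); [|nra]. apply Rsqr_incr_0; try apply Cmod_ge_0. unfold Rsqr. rewrite !Cmod_sqr. unfold Re, Im in *; simpl. nra. }
  set (P := fun s : C => zpot mu r2 s+(-1*ln (Cmod (s+1)%C) + - A)).
  set (U := fun s : C => zfree chi r1 r2 mu 0 s+P s).
  assert (EU : forall s, U s = (ln (Cmod (Fk chi 0 s))-A-ln (Cmod (s+1)%C))+(zpot mu r2 s-zpot mu r1 s)) by (intros; unfold U, P, zfree, zpot; ring).
  assert (RP : forall z, 0 < Re z -> rcont P z).
  { intros z Hz. apply rcont_plus; [apply zpot_rcont; right; apply N2; exact Hz|]. apply (rcont_plus (fun s => -1*ln (Cmod (s+1)%C))); [|apply rcont_const]. apply (rcont_scal (-1) (fun s => ln (Cmod (s+1)%C))).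
    apply (cder_rcont_ln_mod _ _ _ (D1 z)). apply N1. lra. }
  assert (HU : forall z, / 4 <= Re z <= B -> Fk chi 0 z <> 0%C -> U z <= 0).
  { apply (strip_principle U (fun z => Fk chi 0 z = 0%C)); [unfold B; lra| | | | |].
    - intros z Hz Gz.
      apply rcont_plus; [|apply RP; lra]. apply (zfree_rcont q chi r1 r2 mu 0 Hp Hchi W1 W2); [lra|exact Gz].
    - intros z Hz Bz M. destruct (rcont_usc _ _ (RP z ltac:(lra)) 1 ltac:(lra)) as [d1 [Hd1 H1]].
      destruct (zfree_minfty q chi r1 r2 mu 0 Hp Hchi W1 W2 W12 z ltac:(lra) Bz (M-(P z+1))) as [d2 [Hd2 H2]].
      exists (Rmin d1 d2). split; [apply Rmin_pos; assumption|]. intros w _ Hw Gw. specialize (H1 w (Rlt_le_trans _ _ _ Hw (Rmin_l _ _))).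
      specialize (H2 w (Rlt_le_trans _ _ _ Hw (Rmin_r _ _)) Gw). unfold U. lra.
    - intros [x y] [E|E] Gz; unfold Re in E; simpl in E; subst x; rewrite EU.
      + pose proof (LB (/ 4, y) ltac:(Re_lra) Gz) as L. replace (zpot mu r2 (/ 4, y)) with (zpot mu r1 (/ 4, y)); [lra|].
        unfold zpot. do 2 f_equal. unfold Cmod. f_equal. simpl. field.
      + assert (HB : 4 <= B) by (unfold B; lra). set (a := Cmod ((B, y)-r2)%C). set (b := Cmod ((B, y)-r1)%C). assert (Ha : B <= a) by (apply Cmod_Re_ge; Re_lra).
        assert (Hab : a <= b + / 2). { unfold a. replace ((B, y)-r2)%C with (((B, y)-r1)+RtoC (/ 2))%C by C_ring. le_via Cmod_triangle. rewrite Cmod_R, Rabs_right by lra. unfold b; lra. }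
        assert (L1 : mu*(ln a-ln b) <= / 2).
        { assert (ln a-ln b <= (/ 2) * / b).
          { rewrite <- ln_div by lra. apply Rle_trans with (ln (exp (/ 2 * / b))); [|rewrite ln_exp; lra]. apply ln_le'; [div_pos|].
            eapply Rle_trans; [|apply exp_ineq1_le]. unfold Rdiv. apply Rmult_le_reg_r with b; [lra|]. rewrite Rmult_assoc by lra. rewrite Rmult_plus_distr_r, Rmult_assoc, Rinv_l by lra. lra. }
          assert (mu * / b <= 1). { apply Rmult_le_reg_r with b; [lra|]. rewrite Rmult_assoc, Rinv_l by lra. unfold B in *. lra. } nra. }
        assert (L2 : ln (Cmod (Fk chi 0 (B, y))) <= 11/8-1).
        { rewrite <- (ln_exp (11/8-1)). apply ln_le'; [apply Cmod_gt_0; exact Gz|]. eapply Rle_trans; [apply (Lfun_upper q chi Hp Hchi (B, y)); Re_lra|]. pose proof (exp_ineq1_le (11/8-1)). lra. }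
        assert (L3 : 1 <= A). { rewrite <- (ln_exp 1). apply ln_le'; [apply exp_pos|]. pose proof exp_le_3. lra. }
        assert (L4 : 0 <= ln (Cmod ((B, y)+1)%C)) by (apply ln_nonneg, M1; Re_lra).
        unfold zpot. fold a b. lra.
    - intros x y Hx Gz. split.
      + exists (0+(0+(-1*0+0))). split; [lra|]. apply lapl_plus; [apply (zfree_lapl q chi r1 r2 mu 0 Hp Hchi W1 W2); [lra|exact Gz]|].
        apply lapl_plus; [apply zpot_lapl; right; apply N2; Re_lra|].
        apply (lapl_ext_loc (fun s => -1*ln (Cmod (s+1)%C)+(0*Re s + - A)) _ x y (-1*0+0) 1 ltac:(lra)); [intros; ring|].
        apply (lapl_plus (fun s => -1*ln (Cmod (s+1)%C))); [|apply lapl_linear]. apply (lapl_scal (-1) (fun s => ln (Cmod (s+1)%C))).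
        apply (lapl_ln_mod (fun s => s+1)%C (fun _ => 1%C) 0 x y 1 ltac:(lra)); [intros; apply D1|apply cder_const|apply N1; Re_lra].
      + destruct (cder_neq_0_loc _ _ _ (Lfun_cder q chi Hp Hchi 0 (x, y) ltac:(Re_lra)) Gz) as [r [Hr H]].
        exists r. split; [exact Hr|]. intros w Hw. specialize (H _ Hw). replace ((x, y)+(w-(x, y)))%C with w in H by ring. exact H.
    - exists mu, (Rabs g+1). split; [exact Hmu|]. intros z Hz Gz Yz. rewrite EU. pose proof (LB z ltac:(lra) Gz).
      assert (Z1 : 1 <= Cmod (z-r1)%C).
      { eapply Rle_trans; [|apply Im_abs_le_Cmod]. replace (Im (z-r1)%C) with (Im z-g) by Re_ring. pose proof (Rabs_triang_inv (Im z) g). lra. }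
      pose proof (zpot_diff_le mu r1 z (z+RtoC (/ 2))%C Hmu Z1) as Z. replace (z+RtoC (/ 2)-r1)%C with (z-r2)%C in Z by C_ring.
      replace (z+RtoC (/ 2)-z)%C with (RtoC (/ 2)) in Z by ring. rewrite Cmod_R, Rabs_right in Z by lra.
      assert (Z2 : zpot mu r1 (z+RtoC (/ 2))%C = zpot mu r2 z). { unfold zpot. do 3 f_equal. C_ring. } assert (0 < Cmod (z-r2)%C) by (apply Rlt_le_trans with (/ 4); [lra|apply Cmod_Re_ge; unfold Re in *; simpl; lra]). pose proof (Rabs_pos (Im z)). nra. }
  specialize (HU (3, g)). rewrite EU in HU. specialize (HU ltac:(unfold B, Re; simpl; lra) ltac:(apply (Lfun_neq_0_right q chi Hp Hchi); Re_lra)).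
  pose proof (Lfun_ln_lower_right q chi Hp Hchi (3, g) ltac:(Re_lra)).
  assert (E1 : Cmod ((3, g)-r2)%C = 3). { replace ((3, g)-r2)%C with (RtoC 3) by C_ring. rewrite Cmod_R. apply Rabs_right; lra. }
  assert (E2 : Cmod ((3, g)-r1)%C = 5/2). { replace ((3, g)-r1)%C with (RtoC (5/2)) by (apply C_ext; unfold Re, Im; simpl; field). rewrite Cmod_R. apply Rabs_right; lra. }
  assert (E3 : ln (Cmod ((3, g)+1)%C) <= ln (4+Rabs g)).
  { apply ln_le'; [specialize (M1 (3, g) ltac:(Re_lra)); lra|]. le_via Cmod_le_abs. unfold Re, Im; simpl. rewrite (Rabs_right (3+1)) by lra. right. f_equal; [ring|]. f_equal. ring. }
  unfold zpot in HU. rewrite E1, E2 in HU. lra.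
Qed.

(** * Integrals of continuous functions, Laplace transforms on [[-1,1]], shifting a contour *)

Definition ctn (f : R -> R) : Prop := forall x, continuous f x.

Definition rI (f : R -> R) (a b : R) : R := RInt f a b.

Lemma ctn_ex_RInt (f : R -> R) (a b : R) : ctn f -> ex_RInt f a b.
Proof. intros H. apply (ex_RInt_continuous (V := R_CompleteNormedModule)). auto. Qed.

Lemma ctn_derive (f f' : R -> R) : (forall x, is_derive f x (f' x)) -> ctn f.
Proof. intros H x. apply (ex_derive_continuous f). exists (f' x). apply H. Qed.

Lemma ctn_plus (f g : R -> R) : ctn f -> ctn g -> ctn (fun x => f x + g x).
Proof. intros Hf Hg x. apply (continuous_plus f g); auto. Qed.

Lemma ctn_mult (f g : R -> R) : ctn f -> ctn g -> ctn (fun x => f x*g x).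
Proof. intros Hf Hg x. apply (continuous_mult f g); auto. Qed.

Lemma ctn_comp (f g : R -> R) : ctn f -> ctn g -> ctn (fun x => f (g x)).
Proof. intros Hf Hg x. apply (continuous_comp g f); auto. Qed.

Lemma ctn_const (c : R) : ctn (fun _ => c).
Proof. intros x. apply continuous_const. Qed.

Lemma ctn_id : ctn (fun x => x).
Proof. intros x. apply continuous_id. Qed.

Lemma rint_plus (f g : R -> R) (a b : R) : ctn f -> ctn g -> rI (fun x => f x + g x) a b = rI f a b + rI g a b.
Proof. intros Hf Hg. apply (RInt_plus f g); apply ctn_ex_RInt; assumption. Qed.

Lemma rint_scal (c : R) (f : R -> R) (a b : R) : ctn f -> rI (fun x => c*f x) a b = c*rI f a b.
Proof. intros Hf. apply (RInt_scal f); apply ctn_ex_RInt; assumption. Qed.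

Lemma rint_le (f g : R -> R) (a b : R) : a <= b -> ctn f -> ctn g -> (forall x, a <= x <= b -> f x <= g x) -> rI f a b <= rI g a b.
Proof. intros Hab Hf Hg H. apply RInt_le; try apply ctn_ex_RInt; try assumption. intros; apply H; lra. Qed.

Lemma rint_chasles (f : R -> R) (a b c : R) : ctn f -> rI f a b + rI f b c = rI f a c.
Proof. intros Hf. apply (RInt_Chasles f); apply ctn_ex_RInt; assumption. Qed.

Lemma rint_const (c a b : R) : rI (fun _ => c) a b = (b - a)*c.
Proof. exact (RInt_const a b c). Qed.

Lemma rint_nonneg (f : R -> R) (a b : R) : a <= b -> ctn f -> (forall x, a <= x <= b -> 0 <= f x) -> 0 <= rI f a b.
Proof. intros Hab Hf H. pose proof (rint_le _ _ a b Hab (ctn_const 0) Hf H) as K. rewrite rint_const, Rmult_0_r in K. exact K. Qed.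

Lemma rint_abs_le (f g : R -> R) (a b : R) : a <= b -> ctn f -> ctn g -> (forall x, a <= x <= b -> Rabs (f x) <= g x) -> Rabs (rI f a b) <= rI g a b.
Proof.
  intros Hab Hf Hg H. apply Rabs_le. split.
  - replace (- rI g a b) with (-1*rI g a b) by ring. rewrite <- rint_scal by exact Hg. apply rint_le; [exact Hab| |exact Hf|].
    + apply ctn_mult; [apply ctn_const|exact Hg].
    + intros x Hx. specialize (H x Hx). apply Rabs_le_between in H. lra.
  - apply rint_le; [exact Hab|exact Hf|exact Hg|]. intros x Hx. specialize (H x Hx). apply Rabs_le_between in H. lra.
Qed.

Lemma rint_ftc (F f : R -> R) (a b : R) : (forall x, is_derive F x (f x)) -> ctn f -> rI f a b = F b - F a.
Proof. intros HF Hf. apply is_RInt_unique. apply (is_RInt_derive F f); intros; [apply HF|apply Hf]. Qed.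

Lemma rint_ext (f g : R -> R) (a b : R) : (forall x, f x = g x) -> rI f a b = rI g a b.
Proof. intros H. apply RInt_ext. auto. Qed.

Definition cctn (f : R -> C) : Prop := ctn (fun x => Re (f x)) /\ ctn (fun x => Im (f x)).
Definition cint (f : R -> C) : C := (rI (fun u => Re (f u)) (-1) 1, rI (fun u => Im (f u)) (-1) 1).

Lemma cctn_rder (f f' : R -> C) : (forall x, rder f x (f' x)) -> cctn f.
Proof. split; [apply (ctn_derive _ (fun x => Re (f' x)))|apply (ctn_derive _ (fun x => Im (f' x)))]; intros; apply H. Qed.

Lemma cctn_mult (f g : R -> C) : cctn f -> cctn g -> cctn (fun x => f x*g x)%C.
Proof.
  intros [F1 F2] [G1 G2]. split.
  - intros x. apply (continuous_minus (fun x => Re (f x)*Re (g x)) (fun x => Im (f x)*Im (g x))); [apply (ctn_mult _ _ F1 G1)|apply (ctn_mult _ _ F2 G2)].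
  - apply (ctn_plus (fun x => Re (f x)*Im (g x)) (fun x => Im (f x)*Re (g x))); apply ctn_mult; assumption.
Qed.

Lemma cctn_plus (f g : R -> C) : cctn f -> cctn g -> cctn (fun x => f x + g x)%C.
Proof. intros [F1 F2] [G1 G2]. split; [apply (ctn_plus _ _ F1 G1)|apply (ctn_plus _ _ F2 G2)]. Qed.

Lemma cctn_RtoC (f : R -> R) : ctn f -> cctn (fun x => RtoC (f x)).
Proof. split; [exact H|exact (ctn_const 0)]. Qed.

Lemma cctn_const (c : C) : cctn (fun _ => c).
Proof. split; [exact (ctn_const (Re c))|exact (ctn_const (Im c))]. Qed.

Lemma cctn_cexp (w : C) : cctn (fun u => cexp (RtoC u*w)%C).
Proof. apply (cctn_rder _ (fun u => cexp (RtoC u*w)*w)%C). intros u. rewrite <- (Cplus_0_l (RtoC u*w)%C).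
  replace (fun u => cexp (RtoC u*w)%C) with (fun u : R => cexp (0+RtoC u*w)%C) by (apply functional_extensionality; intros; f_equal; ring). apply (cder_line cexp 0 w). apply cder_cexp.
Qed.

Lemma cint_plus (f g : R -> C) : cctn f -> cctn g -> cint (fun u => f u + g u)%C = (cint f + cint g)%C.
Proof. intros [F1 F2] [G1 G2]. apply C_ext; [apply (rint_plus (fun u => Re (f u)) (fun u => Re (g u)))|apply (rint_plus (fun u => Im (f u)) (fun u => Im (g u)))]; assumption. Qed.

Lemma cint_scal (z : C) (f : R -> C) : cctn f -> cint (fun u => z*f u)%C = (z*cint f)%C.
Proof.
  intros [F1 F2]. apply C_ext; unfold cint.
  - change (rI (fun u => Re z*Re (f u)-Im z*Im (f u)) (-1) 1 = Re z*rI (fun u => Re (f u)) (-1) 1-Im z*rI (fun u => Im (f u)) (-1) 1).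
    transitivity (rI (fun u => Re z*Re (f u) + - Im z*Im (f u)) (-1) 1); [apply rint_ext; intros x; unfold Rminus; ring|].
    rewrite rint_plus, !rint_scal by (try apply ctn_mult; try apply ctn_const; assumption). ring.
  - change (rI (fun u => Re z*Im (f u)+Im z*Re (f u)) (-1) 1 = Re z*rI (fun u => Im (f u)) (-1) 1+Im z*rI (fun u => Re (f u)) (-1) 1).
    rewrite rint_plus, !rint_scal by (try apply ctn_mult; try apply ctn_const; assumption). ring.
Qed.

Lemma cint_bound (f : R -> C) (M : R) : cctn f -> (forall u, -1 <= u <= 1 -> Cmod (f u) <= M) -> Cmod (cint f) <= 4*M.
Proof.
  intros [F1 F2] H. le_via Cmod_le_abs. unfold cint at 1 2. change (Re (?a, ?b)) with a. change (Im (?a, ?b)) with b.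
  pose proof (rint_abs_le _ (fun _ => M) (-1) 1 ltac:(lra) F1 (ctn_const M)) as B1. pose proof (rint_abs_le _ (fun _ => M) (-1) 1 ltac:(lra) F2 (ctn_const M)) as B2. rewrite rint_const in B1, B2.
  specialize (B1 ltac:(intros; eapply Rle_trans; [apply re_le_Cmod|auto])). specialize (B2 ltac:(intros; eapply Rle_trans; [apply Im_abs_le_Cmod|auto])). lra.
Qed.

Lemma cint_ftc (f f' : R -> C) : (forall u, rder f u (f' u)) -> cctn f' -> cint f' = (f 1%R - f (-1)%R)%C.
Proof. intros H [F1 F2]. apply C_ext; [apply (rint_ftc (fun u => Re (f u)) (fun u => Re (f' u)))|apply (rint_ftc (fun u => Im (f u)) (fun u => Im (f' u)))]; try assumption; intros; apply H. Qed.

Definition lap (c : R -> R) (w : C) : C := cint (fun u => RtoC (c u)*cexp (RtoC u*w))%C.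

Lemma lap_cctn (c : R -> R) (w : C) : ctn c -> cctn (fun u => RtoC (c u)*cexp (RtoC u*w))%C.
Proof. intros H. apply cctn_mult; [apply cctn_RtoC; exact H|apply cctn_cexp]. Qed.

Lemma cexp_abs_le (u : R) (w : C) : -1 <= u <= 1 -> Cmod (cexp (RtoC u*w)) <= exp (Rabs (Re w)).
Proof.
  intros Hu. rewrite Cmod_cexp. apply exp_le. replace (Re (RtoC u*w)%C) with (u*Re w) by Re_ring.
  le_via Rle_abs. rewrite Rabs_mult. assert (Rabs u <= 1) by (apply Rabs_le; lra). pose proof (Rabs_pos (Re w)). nra.
Qed.

Lemma lap_bound (c : R -> R) (M : R) (w : C) : ctn c -> (forall u, -1 <= u <= 1 -> Rabs (c u) <= M) -> Cmod (lap c w) <= 4*(M*exp (Rabs (Re w))).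
Proof.
  intros H HM. apply cint_bound; [apply lap_cctn; exact H|]. intros u Hu. rewrite Cmod_mult, Cmod_R. apply Rmult_le_compat; [apply Rabs_pos|apply Cmod_ge_0|auto|apply cexp_abs_le; exact Hu].
Qed.

(** The Taylor error of [exp (u h)] is quadratic in [h] uniformly for [|u| <= 1], so it may be
    integrated. *)
Lemma lap_cder (c : R -> R) (M : R) (w : C) : ctn c -> (forall u, -1 <= u <= 1 -> Rabs (c u) <= M) -> cder (lap c) w (lap (fun u => u*c u) w).
Proof.
  intros H HM. assert (HM0 : 0 <= M) by (eapply Rle_trans; [apply Rabs_pos|apply (HM 0); lra]).
  set (K := 4*(M*exp (Rabs (Re w))*exp 1)). assert (HK : 0 <= K) by (unfold K; pose proof (exp_pos (Rabs (Re w))); pose proof (exp_pos 1); repeat apply Rmult_le_pos; lra).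
  intros eps He. exists (Rmin 1 (eps/(K+1))). split; [apply Rmin_pos; [lra|div_pos]|]. intros h Hh.
  pose proof (Rlt_le_trans _ _ _ Hh (Rmin_l _ _)) as H1. pose proof (Rlt_le_trans _ _ _ Hh (Rmin_r _ _)) as H2. pose proof (Cmod_ge_0 h) as H0.
  set (c1 := fun u => u*c u). assert (Hc' : ctn c1) by (apply ctn_mult; [apply ctn_id|exact H]).
  pose proof (lap_cctn c (w+h) H) as A1. pose proof (lap_cctn c w H) as A2. pose proof (lap_cctn c1 w Hc') as A3.
  pose proof (cctn_mult _ _ (cctn_const (-1)) A2) as A4. pose proof (cctn_mult _ _ (cctn_const (- h)%C) A3) as A5. pose proof (cctn_plus _ _ A4 A5) as A6.
  assert (E : (lap c (w+h)-lap c w-lap c1 w*h)%C =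
    cint (fun u => RtoC (c u)*cexp (RtoC u*(w+h))+(-1*(RtoC (c u)*cexp (RtoC u*w)) + - h*(RtoC (c1 u)*cexp (RtoC u*w))))%C).
  { etransitivity; [|symmetry; apply (cint_plus _ _ A1 A6)]. rewrite (cint_plus _ _ A4 A5), (cint_scal _ _ A2), (cint_scal _ _ A3). unfold lap. ring. }
  rewrite E. apply Rle_trans with (4*(M*exp (Rabs (Re w))*(Cmod h*Cmod h*exp 1))).
  - apply cint_bound.
    + exact (cctn_plus _ _ A1 A6).
    + intros u Hu. replace (RtoC (c u)*cexp (RtoC u*(w+h))+(-1*(RtoC (c u)*cexp (RtoC u*w)) + - h*(RtoC (c1 u)*cexp (RtoC u*w))))%C
        with (RtoC (c u)*cexp (RtoC u*w)*(cexp (RtoC u*h)-1-RtoC u*h))%C.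
      2:{ replace (RtoC u*(w+h))%C with (RtoC u*w+RtoC u*h)%C by ring. rewrite cexp_plus. unfold c1. rewrite RtoC_mult. ring. }
      rewrite !Cmod_mult, Cmod_R. assert (U : Rabs u <= 1) by (apply Rabs_le; lra).
      assert (Uh : Cmod (RtoC u*h)%C <= Cmod h) by (rewrite Cmod_mult, Cmod_R; nra). pose proof (Cmod_ge_0 (RtoC u*h)%C).
      apply Rmult_le_compat; [apply Rmult_le_pos; [apply Rabs_pos|apply Cmod_ge_0]|apply Cmod_ge_0| |].
      * apply Rmult_le_compat; [apply Rabs_pos|apply Cmod_ge_0|auto|apply cexp_abs_le; exact Hu].
      * le_via cexp_taylor_bound. apply Rmult_le_compat; [nra|left; apply exp_pos|nra|apply exp_le; lra].
  - replace (4*(M*exp (Rabs (Re w))*(Cmod h*Cmod h*exp 1))) with (K*Cmod h*Cmod h) by (unfold K; ring). apply Rmult_le_compat_r; [exact H0|].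
    apply Rle_trans with (K*(eps/(K+1))); [apply Rmult_le_compat_l; lra|]. apply Rmult_le_reg_r with (K+1); [lra|].
    replace (K*(eps/(K+1))*(K+1)) with (K*eps) by (field; lra). nra.
Qed.

Lemma lap_parts (c c' : R -> R) (w : C) : (forall u, is_derive c u (c' u)) -> ctn c' ->
  (w*lap c w)%C = (RtoC (c 1%R)*cexp w - RtoC (c (-1)%R)*cexp (- w) - lap c' w)%C.
Proof.
  intros Hd Hc'. assert (Hc : ctn c) by exact (ctn_derive _ _ Hd).
  assert (D : forall u, rder (fun u => RtoC (c u)*cexp (RtoC u*w))%C u (RtoC (c' u)*cexp (RtoC u*w)+w*(RtoC (c u)*cexp (RtoC u*w)))%C).
  { intros u. replace (RtoC (c' u)*cexp (RtoC u*w)+w*(RtoC (c u)*cexp (RtoC u*w)))%C with (RtoC (c' u)*cexp (RtoC u*w)+RtoC (c u)*(cexp (RtoC u*w)*w))%C by ring.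
    apply (rder_mult (fun u => RtoC (c u)) (fun u => cexp (RtoC u*w)%C)); [apply rder_RtoC; apply Hd|].
    rewrite <- (Cplus_0_l (RtoC u*w)%C). replace (fun u => cexp (RtoC u*w)%C) with (fun u : R => cexp (0+RtoC u*w)%C) by (apply functional_extensionality; intros; f_equal; ring).
    apply (cder_line cexp 0 w). apply cder_cexp. }
  pose proof (lap_cctn c w Hc) as A1. pose proof (lap_cctn c' w Hc') as A2.
  assert (A3 : cctn (fun u => w*(RtoC (c u)*cexp (RtoC u*w)))%C) by (apply cctn_mult; [apply cctn_const|exact A1]).
  pose proof (cint_ftc _ _ D (cctn_plus _ _ A2 A3)) as E. rewrite cint_plus, cint_scal in E by assumption. fold (lap c w) in E. fold (lap c' w) in E.
  replace (RtoC 1*w)%C with w in E by ring. replace (RtoC (-1)*w)%C with (- w)%C in E by ring.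
  replace (w*lap c w)%C with (lap c' w+w*lap c w-lap c' w)%C by ring. rewrite E. ring.
Qed.

(* Two complex derivatives on a half - plane, which is all that differentiation under the integral sign needs. *)
Definition holo2 (lo : R) (f : C -> C) : Prop := exists f' f'' : C -> C, forall z, lo < Re z -> cder f z (f' z) /\ cder f' z (f'' z).

Lemma holo2_plus (lo : R) (f g : C -> C) : holo2 lo f -> holo2 lo g -> holo2 lo (fun z => f z + g z)%C.
Proof.
  intros [f' [f'' F]] [g' [g'' G]]. exists (fun z => f' z+g' z)%C, (fun z => f'' z+g'' z)%C. intros z Hz. destruct (F z Hz), (G z Hz). split; apply cder_plus; assumption.
Qed.

Lemma holo2_mult (lo : R) (f g : C -> C) : holo2 lo f -> holo2 lo g -> holo2 lo (fun z => f z*g z)%C.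
Proof.
  intros [f' [f'' F]] [g' [g'' G]]. exists (fun z => f' z*g z+f z*g' z)%C, (fun z => (f'' z*g z+f' z*g' z)+(f' z*g' z+f z*g'' z))%C. intros z Hz. destruct (F z Hz), (G z Hz).
  split; [apply cder_mult; assumption|]. apply cder_plus; apply cder_mult; assumption.
Qed.

Lemma holo2_const (lo : R) (c : C) : holo2 lo (fun _ => c).
Proof. exists (fun _ => 0%C), (fun _ => 0%C). intros; split; apply cder_const. Qed.

Lemma holo2_cexp (lo : R) (a b : C) : holo2 lo (fun z => cexp (a*z + b))%C.
Proof.
  exists (fun z => a*cexp (a*z+b))%C, (fun z => a*(a*cexp (a*z+b)))%C. intros z _.
  assert (D : cder (fun z => cexp (a*z+b))%C z (a*cexp (a*z+b))%C).
  { rewrite Cmult_comm. apply (cder_comp cexp (fun z => a*z+b)%C); [apply cder_affine|apply cder_cexp]. }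
  split; [exact D|apply cder_scal; exact D].
Qed.

Lemma holo2_affine (lo lo' : R) (f : C -> C) (a b : C) : (forall z, lo < Re z -> lo' < Re (a*z + b)%C) -> holo2 lo' f -> holo2 lo (fun z => f (a*z + b))%C.
Proof.
  intros H [f' [f'' F]]. exists (fun z => f' (a*z+b)*a)%C, (fun z => a*(f'' (a*z+b)*a))%C. intros z Hz. destruct (F _ (H z Hz)).
  split; [apply (cder_comp f (fun z => a*z+b)%C); [apply cder_affine|assumption]|].
  replace (fun z => f' (a*z+b)*a)%C with (fun z => a*f' (a*z+b))%C by fun_ring.
  apply cder_scal. apply (cder_comp f' (fun z => a*z+b)%C); [apply cder_affine|assumption].
Qed.

(** By the Cauchy-Riemann equations the derivative in [x] of the integral of [Re f(x + i y)] over
    [|y| <= k] is [Im f(x + i k) - Im f(x - i k)], which only involves the horizontal edges. *)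
Lemma contour_shift (lo : R) (f : C -> C) (x1 x2 k B : R) : holo2 lo f -> lo < x1 -> x1 <= x2 ->
  (forall x, x1 <= x <= x2 -> Cmod (f (x, k)) <= B /\ Cmod (f (x, - k)) <= B) ->
  Rabs (rI (fun y => Re (f (x2, y))) (- k) k - rI (fun y => Re (f (x1, y))) (- k) k) <= 2*B*(x2 - x1).
Proof.
  intros [f' [f'' H]] Hlo Hx HB. set (J := fun x => rI (fun y => Re (f (x, y))) (- k) k).
  apply (real_mean_value J (fun x => Im (f (x, k))-Im (f (x, - k)))); [exact Hx| |].
  2:{ intros x Hx'. destruct (HB x Hx') as [B1 B2]. pose proof (Im_abs_le_Cmod (f (x, k))). pose proof (Im_abs_le_Cmod (f (x, - k))). le_via Rabs_triang. rewrite Rabs_Ropp. lra. }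
  intros x Hx'. assert (DH : forall u v, lo < u -> is_derive (fun z => Re (f (z, v))) u (Re (f' (u, v)))).
  { intros u v Hu. apply (rder_horizontal f). apply H. exact Hu. }
  assert (DV : forall u v, lo < u -> is_derive (fun z => Im (f (u, z))) v (Re (f' (u, v)))).
  { intros u v Hu. destruct (rder_vertical f u v (f' (u, v)) (proj1 (H (u, v) Hu))) as [_ D].
    replace (Im (f' (u, v)*Ci)%C) with (Re (f' (u, v))) in D by Re_ring. exact D. }
  assert (CV : forall u, lo < u -> ctn (fun v => Re (f' (u, v)))).
  { intros u Hu. apply (ctn_derive _ (fun v => Re (f'' (u, v)*Ci)%C)). intros v. apply (rder_vertical f'). apply H. exact Hu. }
  assert (CR : forall u, lo < u -> ctn (fun v => Re (f (u, v)))).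
  { intros u Hu. apply (ctn_derive _ (fun v => Re (f' (u, v)*Ci)%C)). intros v. apply (rder_vertical f). apply H. exact Hu. }
  assert (Hd : 0 < x-lo) by lra. assert (Loc : forall u, Rabs (u-x) < x-lo -> lo < u) by (intros u Hu; apply Rabs_def2 in Hu; lra).
  assert (P : is_derive J x (RInt (fun t => Derive (fun u => Re (f (u, t))) x) (- k) k)).
  { apply (is_derive_RInt_param (fun x y => Re (f (x, y)))).
    - exists (mkposreal _ Hd). intros u Hu t _. exists (Re (f' (u, t))). auto.
    - intros t _. apply (continuity_2d_pt_ext_loc (fun u v => Re (f' (u, v)))).
      + exists (mkposreal _ Hd). intros u v Hu _. symmetry. apply is_derive_unique. auto.
      + intros eps. destruct (cder_continuous f' (x, t) _ (proj2 (H (x, t) ltac:(Re_lra))) eps (cond_pos eps)) as [d [Hd' C0]].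
        exists (mkposreal (d/2) ltac:(lra)). simpl. intros u v Hu Hv. specialize (C0 ((u, v)-(x, t))%C). replace ((x, t)+((u, v)-(x, t)))%C with ((u, v) : C) in C0 by C_ring.
        eapply Rle_lt_trans; [|apply C0].
        * change (Re (f' (u, v))-Re (f' (x, t))) with (Re (f' (u, v)-f' (x, t))%C). apply re_le_Cmod.
        * le_lt_via Cmod_le_abs. change (Rabs (u-x)+Rabs (v-t) < d). lra.
    - exists (mkposreal _ Hd). intros u Hu. apply ctn_ex_RInt. auto. }
  replace (Im (f (x, k))-Im (f (x, - k))) with (RInt (fun t => Derive (fun u => Re (f (u, t))) x) (- k) k); [exact P|].
  rewrite (RInt_ext _ (fun t => Re (f' (x, t)))); [|intros t _; apply is_derive_unique; apply DH; lra].
  apply (rint_ftc (fun v => Im (f (x, v))) (fun v => Re (f' (x, v)))); [intros v; apply DV; lra|apply CV; lra].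
Qed.

Lemma rint_reflect (f : R -> R) (a b : R) : ctn f -> rI (fun u => f (- u)) a b = rI f (- b) (- a).
Proof.
  intros Hf. assert (Hg : ctn (fun u => f (- u))) by (apply (ctn_comp f Ropp); [exact Hf|apply (ctn_derive _ (fun _ => -1)); intros; der_ring]).
  pose proof (RInt_comp_lin f (-1) 0 a b (ctn_ex_RInt f _ _ Hf)) as E. rewrite <- (opp_RInt_swap f) in E by (apply ctn_ex_RInt; exact Hf).
  replace (-1*a+0) with (- a) in E by ring. replace (-1*b+0) with (- b) in E by ring.
  assert (E2 : RInt (fun y => scal (-1) (f (-1*y+0))) a b = -1*rI (fun u => f (- u)) a b).
  { rewrite <- rint_scal by exact Hg. apply RInt_ext. intros x _. change (-1*f (-1*x+0) = -1*f (- x)). do 2 f_equal. ring. }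
  assert (E3 : -1*rI (fun u => f (- u)) a b = - rI f (- b) (- a)) by exact (eq_trans (eq_sym E2) E). lra.
Qed.

Lemma rint_odd (f : R -> R) (a : R) : ctn f -> (forall u, f (- u) = - f u) -> rI f (- a) a = 0.
Proof.
  intros Hf Ho. pose proof (rint_reflect f (- a) a Hf) as E. rewrite Ropp_involutive in E.
  rewrite (rint_ext _ (fun u => -1*f u)) in E by (intros; rewrite Ho; ring). rewrite rint_scal in E by exact Hf. lra.
Qed.

(** * The Poisson kernel and the test function *)

Lemma poisson_derive (X y0 y : R) : 0 < X -> is_derive (fun y => atan ((y - y0)/X)) y (X/(X*X + (y - y0)*(y - y0))).
Proof.
  intros HX.
  replace (X/(X*X+(y-y0)*(y-y0))) with (/ X * / (1+Rsqr ((y-y0) * / X))) by (unfold Rsqr; field; split; [pose proof (Rle_0_sqr (y-y0)); unfold Rsqr in *; nra|lra]).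
  apply (is_derive_comp atan (fun y => (y-y0) * / X)); [apply is_derive_atan|]. der_ring.
Qed.

Lemma poisson_ctn (X y0 : R) : 0 < X -> ctn (fun y => X/(X*X + (y - y0)*(y - y0))).
Proof.
  intros HX y. apply (ex_derive_continuous (fun y => X/(X*X+(y-y0)*(y-y0)))). auto_derive. pose proof (Rle_0_sqr (y-y0)). unfold Rsqr in *. nra.
Qed.

Lemma poisson_int (X y0 a b : R) : 0 < X -> rI (fun y => X/(X*X + (y - y0)*(y - y0))) a b = atan ((b - y0)/X) - atan ((a - y0)/X).
Proof. intros HX. apply (rint_ftc (fun y => atan ((y-y0)/X))); [intros; apply poisson_derive; exact HX|apply poisson_ctn; exact HX]. Qed.

(** The cosine and sine cases in parallel: [k1] is the derivative of [k], and [s] is both its parity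
    and the sign in the product formula [trig_mult]. *)
Definition trig (k k1 : R -> R) (s : R) : Prop := (k = cos /\ k1 = (fun x => - sin x) /\ s = 1) \/ (k = sin /\ k1 = cos /\ s = -1).

Section TestFunction.
Variables (k k1 : R -> R) (s y0 : R).
Hypothesis Hk : trig k k1 s.
Hypothesis Hy0 : 0 < y0.

Lemma trig_derive (x : R) : is_derive k x (k1 x).
Proof. destruct Hk as [[-> [-> _]]|[-> [-> _]]]; der_ring. Qed.

Lemma trig_ctn : ctn k.
Proof. exact (ctn_derive _ _ trig_derive). Qed.

Lemma trig_bound (x : R) : Rabs (k x) <= 1 /\ Rabs (k1 x) <= 1.
Proof. pose proof (COS_bound x). pose proof (SIN_bound x). destruct Hk as [[-> [-> _]]|[-> [-> _]]]; split; try rewrite Rabs_Ropp; apply Rabs_le; lra. Qed.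

Lemma trig_mult (a b : R) : k a*k b = / 2*(cos (a - b) + s*cos (a + b)).
Proof. rewrite cos_minus, cos_plus. destruct Hk as [[-> [_ ->]]|[-> [_ ->]]]; field. Qed.

Lemma trig_lipschitz (a b : R) : Rabs (k a - k b) <= Rabs (a - b).
Proof.
  assert (G : forall a b, a <= b -> Rabs (k b-k a) <= Rabs (b-a)).
  { intros x y H. rewrite (Rabs_right (y-x)) by lra. rewrite <- (Rmult_1_l (y-x)). apply (real_mean_value k k1); [exact H|intros; apply trig_derive|intros; apply trig_bound]. }
  destruct (Rle_dec b a) as [H|H]; [apply G; exact H|]. rewrite (Rabs_minus_sym (k a)), (Rabs_minus_sym a). apply G. lra.
Qed.

Definition tc (u : R) : R := k (u*y0).
Definition tG (y : R) : R := rI (fun u => tc u*k (u*y)) (-1) 1.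
(** The holomorphic extension of [tG^2] from the imaginary axis. In the sine case the Laplace
    transform is [i tG] there, which the sign [s] corrects. *)
Definition tPhi (w : C) : C := (RtoC s*(lap tc w*lap tc w))%C.

Lemma scaled_ctn (y : R) : ctn (fun u => k (u*y)).
Proof. apply (ctn_comp k (fun u => u*y)); [exact trig_ctn|apply ctn_mult; [apply ctn_id|apply ctn_const]]. Qed.

Lemma tc_ctn : ctn tc.
Proof. exact (scaled_ctn y0). Qed.

Lemma tc_bound (u : R) : Rabs (tc u) <= 1.
Proof. apply trig_bound. Qed.

Lemma tPhi_imaginary (y : R) : tPhi (0, y) = RtoC (tG y*tG y).
Proof.
  assert (E : forall u, cexp (RtoC u*(0, y))%C = (cos (u*y), sin (u*y))).
  { intros u. unfold cexp. replace (Re (RtoC u*(0, y))%C) with 0 by Re_ring. replace (Im (RtoC u*(0, y))%C) with (u*y) by Re_ring. rewrite exp_0. f_equal; ring. }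
  assert (L : lap tc (0, y) = (rI (fun u => tc u*cos (u*y)) (-1) 1, rI (fun u => tc u*sin (u*y)) (-1) 1)).
  { unfold lap, cint. apply C_ext; unfold Re at 1, Im at 1; apply rint_ext; intros u; rewrite E; Re_ring. }
  assert (Cc : forall f, f = cos \/ f = sin -> ctn (fun u => tc u*f (u*y))).
  { intros f Hf. apply ctn_mult; [exact tc_ctn|]. apply (ctn_comp f (fun u => u*y)); [|apply ctn_mult; [apply ctn_id|apply ctn_const]].
    destruct Hf as [-> | ->]; [apply (ctn_derive _ (fun x => - sin x))|apply (ctn_derive _ cos)]; intros; der_ring. }
  unfold tPhi. rewrite L. unfold tG. unfold tc in *. pose proof (Cc cos (or_introl eq_refl)) as C1. pose proof (Cc sin (or_intror eq_refl)) as C2. destruct Hk as [[-> [_ ->]]|[-> [_ ->]]].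
  - replace (rI (fun u => cos (u*y0)*sin (u*y)) (-1) 1) with 0; [C_ring|]. symmetry. apply rint_odd; [exact C2|].
    intros u. rewrite <- !Ropp_mult_distr_l, cos_neg, sin_neg. ring.
  - replace (rI (fun u => sin (u*y0)*cos (u*y)) (-1) 1) with 0; [C_ring|]. symmetry. apply rint_odd; [exact C1|].
    intros u. rewrite <- !Ropp_mult_distr_l, cos_neg, sin_neg. ring.
Qed.

(** From one integration by parts: the boundary terms are at most 2, and the derivative of [tc], at
    most [y0], passes through the factor 4 of [lap_bound]. *)
Definition tcst : R := (2 + 4*y0)*(2 + 4*y0).

Lemma tPhi_bound (w : C) : Cmod w*Cmod w*Cmod (tPhi w) <= tcst*exp (2*Rabs (Re w)).
Proof.
  set (X := exp (Rabs (Re w))).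
  assert (D : forall u : R, is_derive tc u (y0*k1 (u*y0))).
  { intros u. apply (is_derive_comp k (fun u => u*y0)); [apply trig_derive|]. der_ring. }
  assert (Ck1 : ctn (fun u => y0*k1 (u*y0))).
  { apply ctn_mult; [apply ctn_const|]. apply (ctn_comp k1 (fun u => u*y0)); [|apply ctn_mult; [apply ctn_id|apply ctn_const]].
    destruct Hk as [[_ [-> _]]|[_ [-> _]]]; [apply (ctn_derive _ (fun x => - cos x))|apply (ctn_derive _ (fun x => - sin x))]; intros; der_ring. }
  assert (B : Cmod w*Cmod (lap tc w) <= (2+4*y0)*X).
  { rewrite <- Cmod_mult, (lap_parts tc (fun u : R => y0*k1 (u*y0)) w D Ck1). unfold Cminus.
    assert (T : forall c z, Rabs c <= 1 -> Cmod (cexp z) <= X -> Cmod (RtoC c*cexp z)%C <= X).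
    { intros c z Hc Hz. rewrite Cmod_mult, Cmod_R. pose proof (Cmod_ge_0 (cexp z)). nra. }
    pose proof (lap_bound _ y0 w Ck1) as LB. specialize (LB ltac:(intros u _; cbv beta; rewrite Rabs_mult, (Rabs_right y0) by lra; pose proof (proj2 (trig_bound (u*y0))); nra)). fold X in LB.
    pose proof (T (tc 1) w (tc_bound 1)) as T1. pose proof (T (tc (-1)) (- w)%C (tc_bound (-1))) as T2.
    pose proof (cexp_abs_le 1 w ltac:(lra)) as E1. pose proof (cexp_abs_le (-1) w ltac:(lra)) as E2. replace (RtoC 1*w)%C with w in E1 by ring. replace (RtoC (-1)*w)%C with (- w)%C in E2 by ring.
    specialize (T1 E1). specialize (T2 E2). le_via Cmod_triangle. rewrite Cmod_opp. pose proof (Cmod_triangle (RtoC (tc 1)*cexp w) (- (RtoC (tc (-1))*cexp (- w)))%C) as TT. rewrite Cmod_opp in TT. lra. }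
  unfold tPhi. rewrite !Cmod_mult, Cmod_R. replace (Rabs s) with 1 by (destruct Hk as [[_ [_ ->]]|[_ [_ ->]]]; [rewrite Rabs_R1|rewrite Rabs_left by lra]; lra).
  replace (exp (2*Rabs (Re w))) with (X*X) by (unfold X; rewrite <- exp_plus; f_equal; ring). unfold tcst.
  pose proof (Cmod_ge_0 w). pose proof (Cmod_ge_0 (lap tc w)). set (m := Cmod w*Cmod (lap tc w)) in *. assert (0 <= m) by (apply Rmult_le_pos; assumption).
  replace (Cmod w*Cmod w*(1*(Cmod (lap tc w)*Cmod (lap tc w)))) with (m*m) by (unfold m; ring).
  nra.
Qed.

Lemma tPhi_holo2 (lo : R) : holo2 lo tPhi.
Proof.
  apply holo2_mult; [apply holo2_const|]. assert (L : holo2 lo (lap tc)).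
  { exists (lap (fun u => u*tc u)), (lap (fun u => u*(u*tc u))).
    assert (C1 : ctn (fun u => u*tc u)) by (apply ctn_mult; [apply ctn_id|apply tc_ctn]).
    split; apply (lap_cder _ 1); try assumption; try apply tc_ctn; intros u Hu; [apply tc_bound|]. rewrite Rabs_mult. pose proof (tc_bound u). assert (Rabs u <= 1) by (apply Rabs_le; lra). pose proof (Rabs_pos (tc u)). nra. }
  apply holo2_mult; exact L.
Qed.

Lemma tG_integrand_ctn (y : R) : ctn (fun u => tc u*k (u*y)).
Proof. apply ctn_mult; [apply tc_ctn|apply scaled_ctn]. Qed.

Lemma tG_bound (y : R) : Rabs (tG y) <= 2.
Proof.
  eapply Rle_trans; [apply (rint_abs_le _ (fun _ => 1) (-1) 1 ltac:(lra) (tG_integrand_ctn y) (ctn_const 1))|rewrite rint_const; lra].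
  intros u _. rewrite Rabs_mult. pose proof (tc_bound u). pose proof (proj1 (trig_bound (u*y))). pose proof (Rabs_pos (k (u*y))). nra.
Qed.

Lemma tG_lipschitz (y z : R) : Rabs (tG y - tG z) <= 2*Rabs (y - z).
Proof.
  assert (E : tG y-tG z = rI (fun u => tc u*k (u*y) + -1*(tc u*k (u*z))) (-1) 1).
  { rewrite rint_plus, rint_scal by (repeat first [apply tG_integrand_ctn|apply ctn_mult; [apply ctn_const|]]). unfold tG. ring. }
  rewrite E. eapply Rle_trans; [apply (rint_abs_le _ (fun _ => Rabs (y-z)) (-1) 1 ltac:(lra)); [|apply ctn_const|]|rewrite rint_const; lra].
  - apply ctn_plus; [apply tG_integrand_ctn|apply ctn_mult; [apply ctn_const|apply tG_integrand_ctn]].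
  - intros u Hu. replace (tc u*k (u*y) + -1*(tc u*k (u*z))) with (tc u*(k (u*y)-k (u*z))) by ring. rewrite Rabs_mult.
    pose proof (trig_lipschitz (u*y) (u*z)) as L. replace (u*y-u*z) with (u*(y-z)) in L by ring. rewrite Rabs_mult in L.
    assert (Rabs u <= 1) by (apply Rabs_le; lra). pose proof (tc_bound u). pose proof (Rabs_pos (y-z)). pose proof (Rabs_pos (k (u*y)-k (u*z))). nra.
Qed.

Lemma tG_sqr_lipschitz (y z : R) : Rabs (tG y*tG y - tG z*tG z) <= 8*Rabs (y - z).
Proof.
  replace (tG y*tG y-tG z*tG z) with ((tG y-tG z)*(tG y+tG z)) by ring. rewrite Rabs_mult. pose proof (tG_lipschitz y z). pose proof (tG_bound y). pose proof (tG_bound z).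
  pose proof (Rabs_triang (tG y) (tG z)). pose proof (Rabs_pos (tG y+tG z)). pose proof (Rabs_pos (y-z)). nra.
Qed.

Lemma tG_sqr_ctn : ctn (fun y => tG y*tG y).
Proof.
  intros y. apply continuity_pt_filterlim. intros eps He. exists (eps/8). split; [lra|]. intros z [_ Hz]. simpl in *. unfold Rdist in *.
  le_lt_via tG_sqr_lipschitz. lra.
Qed.

Lemma tG_even (y : R) : tG (- y)*tG (- y) = tG y*tG y.
Proof.
  assert (E : tG (- y) = s*tG y).
  { unfold tG. rewrite <- rint_scal by apply tG_integrand_ctn. apply rint_ext. intros u. rewrite <- Ropp_mult_distr_r. destruct Hk as [[-> [_ ->]]|[-> [_ ->]]]; [rewrite cos_neg|rewrite sin_neg]; ring. }
  rewrite E. destruct Hk as [[_ [_ ->]]|[_ [_ ->]]]; ring.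
Qed.

Lemma tG_decay (y : R) : tG y*tG y*((3 + Rabs y)*(3 + Rabs y)) <= 72 + 2*tcst.
Proof.
  pose proof (tPhi_bound (0, y)) as B. rewrite tPhi_imaginary, Cmod_R, Cmod_sqr in B. unfold Re, Im in B; simpl in B. rewrite Rabs_R0 in B. replace (2*0) with 0 in B by ring. rewrite exp_0 in B.
  assert (0 <= tG y*tG y) by nra. rewrite (Rabs_right (tG y*tG y)) in B by lra. pose proof (tG_bound y) as B2. apply Rabs_le_between in B2.
  assert (Rabs y*Rabs y = y*y) by (rewrite <- Rabs_mult; apply Rabs_right; nra).
  assert ((3+Rabs y)*(3+Rabs y) <= 18+2*(y*y)) by (pose proof (Rle_0_sqr (Rabs y-3)); unfold Rsqr in *; lra). nra.
Qed.

Lemma cos_int (b A : R) : b <> 0 -> sin (A*b) = 0 -> rI (fun u => cos (u*b)) (- A) A = 0.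
Proof.
  intros Hb HA. rewrite (rint_ftc (fun u => sin (u*b)/b)).
  - rewrite <- Ropp_mult_distr_l, sin_neg, HA. lra.
  - intros u. auto_derive; trivial. field. exact Hb.
  - apply (ctn_derive _ (fun u => - sin (u*b)*b)). intros u. auto_derive; trivial. ring.
Qed.

Lemma cos_scaled_ctn (b : R) : ctn (fun u => cos (u*b)).
Proof. apply (ctn_derive _ (fun u => - sin (u*b)*b)). intros u. auto_derive; trivial. ring. Qed.

Lemma trig_orthogonal (d : R) (n m : nat) : 0 < d -> (1 <= n)%nat -> (1 <= m)%nat ->
  rI (fun u => k (u*(INR n*d))*k (u*(INR m*d))) (- (PI/d)) (PI/d) = if Nat.eq_dec n m then PI/d else 0.
Proof.
  intros Hd Hn Hm. assert (Z0 : forall j : Z, j <> 0%Z -> rI (fun u => cos (u*(IZR j*d))) (- (PI/d)) (PI/d) = 0).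
  { intros j Hj. apply cos_int; [apply Rmult_integral_contrapositive_currified; [apply not_0_IZR; exact Hj|lra]|]. apply sin_eq_0_1. exists j. field. lra. }
  rewrite (rint_ext _ (fun u => / 2*(cos (u*(IZR (Z.of_nat n-Z.of_nat m)*d))+s*cos (u*(IZR (Z.of_nat n+Z.of_nat m)*d))))).
  2:{ intros u. rewrite trig_mult, minus_IZR, plus_IZR, <- !INR_IZR_INZ. replace (u*(INR n*d)-u*(INR m*d)) with (u*((INR n-INR m)*d)) by ring.
      replace (u*(INR n*d)+u*(INR m*d)) with (u*((INR n+INR m)*d)) by ring. reflexivity. } pose proof (ctn_mult _ _ (ctn_const s) (cos_scaled_ctn (IZR (Z.of_nat n+Z.of_nat m)*d))) as C2.
  rewrite rint_scal, rint_plus, rint_scal by (try apply ctn_plus; try assumption; apply cos_scaled_ctn). rewrite (Z0 (Z.of_nat n+Z.of_nat m)%Z) by lia.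
  destruct (Nat.eq_dec n m) as [->|Hne].
  - rewrite Z.sub_diag, (rint_ext _ (fun _ => 1)) by (intros; rewrite Rmult_0_l, Rmult_0_r; apply cos_0). rewrite rint_const. lra.
  - rewrite Z0 by lia. ring.
Qed.

(** Bessel's inequality on [[-PI/d, PI/d]], which contains [[-1,1]]: the functions [k (u n d)] are
    orthogonal with squared norm [PI/d], the numbers [tG (n d)] are the inner products with [tc] cut
    off to [[-1,1]], and [tG y0] is its squared norm. *)
Lemma bessel (d : R) (N : nat) : 0 < d <= PI -> d*rsum (fun n => tG (INR n*d)*tG (INR n*d)) N <= PI*tG y0.
Proof.
  intros Hd. set (A := PI/d). assert (HA : 1 <= A). { unfold A. apply Rmult_le_reg_r with d; [lra|]. unfold Rdiv. rewrite Rmult_assoc, Rinv_l by lra. lra. }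
  set (e := fun n u => k (u*(INR n*d))). set (a := fun n => tG (INR n*d)). set (p := fun N u => rsum (fun n => a n*e n u) N).
  assert (Ce : forall n, ctn (e n)) by (intros; apply scaled_ctn).
  assert (Cp : forall N, ctn (p N)). { induction N0; [apply ctn_const|]. apply ctn_plus; [exact IHN0|apply ctn_mult; [apply ctn_const|apply Ce]]. }
  assert (O : forall N m, (N < m)%nat -> rI (fun u => p N u*e m u) (- A) A = 0).
  { induction N0; intros m Hm.
    - rewrite (rint_ext _ (fun _ => 0)) by (intros; apply Rmult_0_l). rewrite rint_const. ring.
    - rewrite (rint_ext _ (fun u => p N0 u*e m u+a (S N0)*(e (S N0) u*e m u))) by (intros u; unfold p; cbn [rsum]; ring).
      pose proof (ctn_mult _ _ (Cp N0) (Ce m)) as C1. pose proof (ctn_mult _ _ (Ce (S N0)) (Ce m)) as C2.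
      rewrite (rint_plus _ _ _ _ C1 (ctn_mult _ _ (ctn_const _) C2)), (rint_scal _ _ _ _ C2), IHN0 by lia. unfold e at 1 2. rewrite trig_orthogonal by (lra || lia).
      destruct (Nat.eq_dec (S N0) m); [lia|ring]. }
  assert (Q : forall N, rI (fun u => p N u*p N u) (- A) A = A*rsum (fun n => a n*a n) N).
  { induction N0.
    - rewrite (rint_ext _ (fun _ => 0)) by (intros; apply Rmult_0_l). rewrite rint_const. cbn [rsum]. ring.
    - rewrite (rint_ext _ (fun u => p N0 u*p N0 u+(2*a (S N0)*(p N0 u*e (S N0) u)+a (S N0)*a (S N0)*(e (S N0) u*e (S N0) u)))) by (intros u; unfold p; cbn [rsum]; ring).
      pose proof (ctn_mult _ _ (Cp N0) (Cp N0)) as C1. pose proof (ctn_mult _ _ (Cp N0) (Ce (S N0))) as C2. pose proof (ctn_mult _ _ (Ce (S N0)) (Ce (S N0))) as C3.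
      pose proof (ctn_mult _ _ (ctn_const (2*a (S N0))) C2) as C4. pose proof (ctn_mult _ _ (ctn_const (a (S N0)*a (S N0))) C3) as C5.
      rewrite (rint_plus _ _ _ _ C1 (ctn_plus _ _ C4 C5)), (rint_plus _ _ _ _ C4 C5), (rint_scal _ _ _ _ C2), (rint_scal _ _ _ _ C3), IHN0, O by lia. unfold e at 1 2. rewrite trig_orthogonal by (lra || lia).
      destruct (Nat.eq_dec (S N0) (S N0)); [|lia]. cbn [rsum]. fold A. ring. }
  assert (P : forall N, rI (fun u => tc u*p N u) (-1) 1 = rsum (fun n => a n*a n) N).
  { induction N0.
    - rewrite (rint_ext _ (fun _ => 0)) by (intros; apply Rmult_0_r). rewrite rint_const. cbn [rsum]. ring.
    - rewrite (rint_ext _ (fun u => tc u*p N0 u+a (S N0)*(tc u*e (S N0) u))) by (intros u; unfold p; cbn [rsum]; ring).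
      pose proof (ctn_mult _ _ tc_ctn (Cp N0)) as C1. pose proof (ctn_mult _ _ tc_ctn (Ce (S N0))) as C2.
      rewrite (rint_plus _ _ _ _ C1 (ctn_mult _ _ (ctn_const _) C2)), (rint_scal _ _ _ _ C2), IHN0. reflexivity. }
  set (Sg := rsum (fun n => a n*a n) N).
  pose proof (ctn_mult _ _ (Cp N) (Cp N)) as C1. pose proof (ctn_mult _ _ tc_ctn (Cp N)) as C2. pose proof (ctn_mult _ _ tc_ctn tc_ctn) as C3.
  assert (I1 : rI (fun u => p N u*p N u) (-1) 1 <= A*Sg).
  { unfold Sg. rewrite <- Q, <- (rint_chasles _ (- A) (-1) A C1), <- (rint_chasles _ (-1) 1 A C1).
    assert (0 <= rI (fun u => p N u*p N u) (- A) (-1)) by (apply rint_nonneg; [lra|exact C1|intros; nra]).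
    assert (0 <= rI (fun u => p N u*p N u) 1 A) by (apply rint_nonneg; [lra|exact C1|intros; nra]). lra. }
  pose proof (ctn_mult _ _ (ctn_const (- 2 * / A)) C2) as C4. pose proof (ctn_mult _ _ (ctn_const (/ A * / A)) C1) as C5.
  (* The integrand is the square of [tc - p/A], where [p/A] is the orthogonal projection of the
     cut-off [tc]. *)
  assert (I2 : 0 <= rI (fun u => tc u*tc u+(- 2 * / A*(tc u*p N u) + / A * / A*(p N u*p N u))) (-1) 1).
  { apply rint_nonneg; [lra|exact (ctn_plus _ _ C3 (ctn_plus _ _ C4 C5))|]. intros u _. replace (tc u*tc u+(- 2 * / A*(tc u*p N u) + / A * / A*(p N u*p N u))) with ((tc u - / A*p N u)*(tc u - / A*p N u)) by ring. apply Rle_0_sqr. }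
  rewrite (rint_plus _ _ _ _ C3 (ctn_plus _ _ C4 C5)), (rint_plus _ _ _ _ C4 C5), (rint_scal _ _ _ _ C2), (rint_scal _ _ _ _ C1), P in I2. fold Sg in I2. change (rI (fun u => tc u*tc u) (-1) 1) with (tG y0) in I2. assert (I3 : / A * / A*rI (fun u => p N u*p N u) (-1) 1 <= / A*Sg).
  { replace (/ A*Sg) with (/ A * / A*(A*Sg)) by (field; lra). nra. }
  assert (I4 : / A*Sg <= tG y0) by lra. unfold A in I4. apply (Rmult_le_compat_l PI) in I4; [|lra]. replace (PI*(/ (PI/d)*Sg)) with (d*Sg) in I4 by (field; lra). exact I4.
Qed.

(** Half of Plancherel's formula as an inequality: [bessel] bounds the Riemann sums of mesh [d], and
    the Lipschitz bound limits the error to [8 d^2] per cell, in total [8 T^2 / N]. *)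
Lemma tG_sqr_int_half (T : R) : 0 <= T -> rI (fun y => tG y*tG y) 0 T <= PI*tG y0.
Proof.
  intros HT. pose proof PI_RGT_0 as HPI. assert (Rm : forall d N, 0 < d -> rI (fun y => tG y*tG y) 0 (INR N*d) <= d*rsum (fun n => tG (INR n*d)*tG (INR n*d)) N+INR N*(8*d*d)).
  { intros d N Hd. induction N.
    - rewrite Rmult_0_l. unfold rI. rewrite RInt_point. unfold zero; simpl. lra.
    - rewrite <- (rint_chasles _ 0 (INR N*d) (INR (S N)*d) tG_sqr_ctn). cbn [rsum]. rewrite S_INR in *.
      set (g := tG ((INR N+1)*d)*tG ((INR N+1)*d)).
      pose proof (rint_le _ (fun _ => g+8*d) (INR N*d) ((INR N+1)*d) ltac:(nra) tG_sqr_ctn (ctn_const _)) as B. rewrite rint_const in B.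
      enough (rI (fun y => tG y*tG y) (INR N*d) ((INR N+1)*d) <= ((INR N+1)*d-INR N*d)*(g+8*d)) by lra. apply B.
      intros y Hy. pose proof (tG_sqr_lipschitz y ((INR N+1)*d)) as L. fold g in L. apply Rabs_le_between in L. assert (Rabs (y-(INR N+1)*d) <= d) by (apply Rabs_le; lra). lra. }
  destruct (Req_dec T 0) as [->|HT0].
  { unfold rI. rewrite RInt_point. apply Rmult_le_pos; [lra|]. apply rint_nonneg; [lra|exact (ctn_mult _ _ tc_ctn tc_ctn)|intros; unfold tc; nra]. }
  apply Rnot_lt_le. intros Hlt. set (g := rI (fun y => tG y*tG y) 0 T-PI*tG y0). assert (Hg : 0 < g) by (unfold g; lra).
  destruct (nfloor_ex (8*T*T/g+T) ltac:(apply Rplus_le_le_0_compat; [apply Rmult_le_pos; [nra|left; inv_pos]|lra])) as [n [_ Hn]].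
  set (N := S n). assert (HN : 8*T*T/g+T < INR N) by (unfold N; rewrite S_INR; lra).
  assert (0 <= 8*T*T/g) by (apply Rmult_le_pos; [nra|left; inv_pos]). assert (HN0 : 0 < INR N) by lra.
  set (d := T/INR N). assert (Hd : 0 < d) by div_pos.
  assert (Ed : INR N*d = T) by (unfold d; field; lra).
  assert (d <= PI). { assert (d*INR N < 1*INR N) by lra. apply Rmult_lt_reg_r in H0; [|exact HN0]. pose proof PI2_1. lra. }
  pose proof (Rm d N Hd) as B. rewrite Ed in B. pose proof (bessel d N ltac:(lra)) as B2.
  assert (INR N*(8*d*d) < g); [|unfold g in *; lra]. replace (INR N*(8*d*d)) with (8*T*T/INR N) by (unfold d; field; lra).
  apply Rmult_lt_reg_r with (INR N); [exact HN0|]. replace (8*T*T/INR N*INR N) with (8*T*T/g*g) by (field; lra). nra.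
Qed.

Lemma tG_sqr_int (T : R) : 0 <= T -> rI (fun y => tG y*tG y) (- T) T <= 2*PI*tG y0.
Proof.
  intros HT. rewrite <- (rint_chasles _ (- T) 0 T tG_sqr_ctn). pose proof (rint_reflect _ 0 T tG_sqr_ctn) as E. rewrite Ropp_0 in E. rewrite <- E.
  rewrite (rint_ext _ (fun y => tG y*tG y)) by (intros; apply tG_even). pose proof (tG_sqr_int_half T HT). lra.
Qed.

Lemma tG_y0 : tG y0 = 1 + s*(sin (2*y0)/(2*y0)).
Proof.
  unfold tG, tc. rewrite (rint_ext _ (fun u => / 2*(1+s*cos (u*(2*y0))))).
  2:{ intros u. rewrite trig_mult, Rminus_diag, cos_0. do 4 f_equal. ring. }
  rewrite (rint_ftc (fun u => / 2*(u+s*(sin (u*(2*y0))/(2*y0))))).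
  - replace (-1*(2*y0)) with (- (2*y0)) by ring. rewrite sin_neg, Rmult_1_l. lra.
  - intros u. auto_derive; trivial. field. lra.
  - apply ctn_mult; [apply ctn_const|]. apply ctn_plus; [apply ctn_const|]. apply ctn_mult; [apply ctn_const|apply cos_scaled_ctn].
Qed.

Lemma ln_quad_ctn : ctn (fun y => ln (9 + y*y)).
Proof. apply (ctn_derive _ (fun y => 2*y/(9+y*y))). intros y. auto_derive; [nra|]. nra. Qed.

Lemma tG_sqr_log_int (T : R) : 0 <= T -> rI (fun y => tG y*tG y*ln (9 + y*y)) (- T) T <= 8*(72 + 2*tcst).
Proof.
  intros HT. set (K := 72+2*tcst). assert (HK : 0 <= K) by (unfold K, tcst; nra).
  assert (Cf := ctn_mult _ _ tG_sqr_ctn ln_quad_ctn). set (f := fun y => tG y*tG y*ln (9+y*y)) in *.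
  (* An antiderivative of [2 K ln (3+y) / (3+y)^2], the majorant that [tG_decay] provides. *)
  set (P := fun y => - (2*K)*((ln (3+y)+1)/(3+y))).
  assert (B : rI f 0 T + - P T <= rI f 0 0 + - P 0).
  { apply (derive_nonpos_le (fun y => rI f 0 y + - P y) (fun y => f y + - (2*K*(ln (3+y)/((3+y)*(3+y)))))); [exact HT| |].
    - intros y Hy. apply (is_derive_plus (fun y => rI f 0 y) (fun y => - P y)).
      + apply (is_derive_RInt f (fun y => rI f 0 y) 0 y); [|apply Cf]. exists (mkposreal 1 ltac:(lra)). intros z _. apply (RInt_correct f). apply ctn_ex_RInt. exact Cf.
      + unfold P. auto_derive; [lra|]. field. lra.
    - intros y Hy. assert (D := tG_decay y). rewrite (Rabs_right y) in D by lra.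
      assert (L0 : 0 <= ln (3+y)) by (apply ln_nonneg; lra). assert (L1 : ln (9+y*y) <= 2*ln (3+y)).
      { replace (2*ln (3+y)) with (ln ((3+y)*(3+y))) by (rewrite ln_mult by lra; ring). apply ln_le'; nra. }
      assert (0 <= tG y*tG y) by nra. assert (f y <= tG y*tG y*(2*ln (3+y))) by (apply Rmult_le_compat_l; assumption).
      assert (tG y*tG y <= K/((3+y)*(3+y))). { apply Rmult_le_reg_r with ((3+y)*(3+y)); [nra|]. replace (K/((3+y)*(3+y))*((3+y)*(3+y))) with K by (field; lra). exact D. }
      nra. }
  assert (E0 : rI f 0 0 = 0) by (unfold rI; rewrite RInt_point; reflexivity).
  assert (PT : P T <= 0). { unfold P. assert (0 <= (ln (3+T)+1)/(3+T)) by (apply Rmult_le_pos; [pose proof (ln_nonneg (3+T) ltac:(lra)); lra|left; inv_pos]). nra. }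
  assert (P0 : - P 0 <= 4*K). { unfold P. rewrite Rplus_0_r. assert (ln 3 <= 3) by (left; apply ln_lt_self; lra). nra. }
  rewrite <- (rint_chasles _ (- T) 0 T Cf). pose proof (rint_reflect _ 0 T Cf) as E. rewrite Ropp_0 in E. rewrite <- E.
  rewrite (rint_ext _ f) by (intros y; unfold f; rewrite tG_even; do 2 f_equal; ring). lra.
Qed.

Definition tapp (v : R) (n : nat) : R := rI (fun y => tG y*tG y*cos (v*y)) (- INR n) (INR n).
(** The Fourier transform of [tG^2], that is, [2 PI] times the autocorrelation of [tc] cut off to
    [[-1,1]]; hence its support in [[-2,2]] and its linear vanishing at 2. *)
Definition that (v : R) : R := real (Lim_seq (tapp v)).

Lemma tapp_ctn (v : R) : ctn (fun y => tG y*tG y*cos (v*y)).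
Proof. apply ctn_mult; [exact tG_sqr_ctn|]. apply (ctn_derive _ (fun y => - sin (v*y)*v)). intros y. auto_derive; trivial. ring. Qed.

(** The integrals of [tG^2] and of [tG^2 (1 + cos (v y))] increase with the range and stay bounded;
    their difference converges. *)
Lemma tapp_lim (v : R) : is_lim_seq (tapp v) (that v).
Proof.
  apply Lim_seq_correct'. set (f := fun y => tG y*tG y*cos (v*y)). assert (Cf : ctn f) by apply tapp_ctn.
  assert (Mono : forall h B, ctn h -> (forall y, 0 <= h y) -> (forall T, 0 <= T -> rI h (- T) T <= B) -> ex_finite_lim_seq (fun n => rI h (- INR n) (INR n))).
  { intros h B Ch Hh HB. apply ex_finite_lim_seq_incr with B; [|intros; apply HB; apply pos_INR]. intros n. rewrite S_INR.
    rewrite <- (rint_chasles h (- (INR n+1)) (- INR n) (INR n+1) Ch), <- (rint_chasles h (- INR n) (INR n) (INR n+1) Ch).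
    assert (0 <= rI h (- (INR n+1)) (- INR n)) by (apply rint_nonneg; [lra|exact Ch|auto]). assert (0 <= rI h (INR n) (INR n+1)) by (apply rint_nonneg; [lra|exact Ch|auto]). lra. }
  assert (P : forall y, 0 <= tG y*tG y) by (intros; nra).
  destruct (Mono _ _ tG_sqr_ctn P tG_sqr_int) as [l1 L1]. pose proof (ctn_plus _ _ tG_sqr_ctn Cf) as Cg.
  destruct (Mono _ (2*(2*PI*tG y0)) Cg) as [l2 L2].
  - intros y. unfold f. pose proof (COS_bound (v*y)). nra.
  - intros T HT. rewrite (rint_plus _ _ _ _ tG_sqr_ctn Cf). pose proof (tG_sqr_int T HT). enough (rI f (- T) T <= rI (fun y => tG y*tG y) (- T) T) by lra.
    apply rint_le; [lra|exact Cf|exact tG_sqr_ctn|]. intros y _. unfold f. pose proof (COS_bound (v*y)). nra.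
  - exists (l2-l1). apply is_lim_seq_ext with (2 := is_lim_seq_minus' _ _ _ _ L2 L1). intros n. rewrite (rint_plus _ _ _ _ tG_sqr_ctn Cf). unfold tapp, f. ring.
Qed.

Lemma lim_abs_le (u : nat -> R) (l K : R) : is_lim_seq u l -> (forall eps, 0 < eps -> exists N, forall n, (N <= n)%nat -> Rabs (u n) <= K + eps) -> Rabs l <= K.
Proof.
  intros Hu H. apply le_epsilon. intros eps He. destruct (H (eps/2) ltac:(lra)) as [N HN]. apply is_lim_seq_spec in Hu. destruct (Hu (mkposreal (eps/2) ltac:(lra))) as [N' HN']. simpl in HN'.
  specialize (HN (max N N') ltac:(lia)). specialize (HN' (max N N') ltac:(lia)). pose proof (Rabs_triang (u (max N N')) (l-u (max N N'))) as T. replace (u (max N N')+(l-u (max N N'))) with l in T by ring. rewrite (Rabs_minus_sym l) in T. lra.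
Qed.

Lemma eventually_div_le (c eps : R) : 0 < eps -> exists N, (1 <= N)%nat /\ forall n, (N <= n)%nat -> c/INR n <= eps.
Proof.
  intros He. destruct (nfloor_ex (Rabs c/eps) ltac:(apply Rmult_le_pos; [apply Rabs_pos|left; inv_pos])) as [N [_ HN]]. exists (S N). split; [lia|]. intros n Hn. apply le_INR in Hn. rewrite S_INR in Hn. pose proof (pos_INR N).
  apply Rmult_le_reg_r with (INR n); [lra|]. replace (c/INR n*INR n) with c by (field; lra). pose proof (Rle_abs c). apply Rle_trans with (Rabs c/eps*eps); [|nra]. replace (Rabs c/eps*eps) with (Rabs c) by (field; lra). lra.
Qed.

Lemma vertical_bound (h : R -> R) (X M T : R) : 0 < X -> 0 <= M -> 0 <= T -> ctn h -> (forall y, Rabs (h y)*(X*X + y*y) <= M) -> Rabs (rI h (- T) T) <= M*PI/X.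
Proof.
  intros HX HM HT Ch Hh. pose proof (poisson_ctn X 0 HX) as Cp. apply Rle_trans with (rI (fun y => M/X*(X/(X*X+(y-0)*(y-0)))) (- T) T).
  - apply rint_abs_le; [lra|exact Ch|exact (ctn_mult _ _ (ctn_const _) Cp)|]. intros y _. specialize (Hh y). assert (0 < X*X+y*y) by nra. rewrite Rminus_0_r. apply Rmult_le_reg_r with (X*X+y*y); [assumption|].
    replace (M/X*(X/(X*X+y*y))*(X*X+y*y)) with M by (field; lra). exact Hh.
  - rewrite (rint_scal _ _ _ _ Cp), (poisson_int X 0 (- T) T HX). pose proof (atan_bound ((T-0)/X)). pose proof (atan_bound ((- T-0)/X)).
    replace (M*PI/X) with (M/X*PI) by (field; lra). apply Rmult_le_compat_l; [apply Rmult_le_pos; [exact HM|left; inv_pos]|lra].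
Qed.

(** Shift the integral of [exp (- v w) tPhi w] from the imaginary axis to [Re w = X]. There the
    integrand is at most [tcst exp ((2 - v) X) / |w|^2], and [1 / (X^2 + y^2)] has integral [PI/X].
    The abscissa [X] remains at disposal. *)
Lemma that_bound (v X : R) : 0 <= v -> 0 < X -> Rabs (that v) <= tcst*PI*(exp ((2 - v)*X)/X).
Proof.
  intros Hv HX. assert (Ht : 0 < tcst) by (unfold tcst; nra). apply (lim_abs_le _ _ _ (tapp_lim v)). intros eps He.
  set (f := fun w => (cexp (RtoC (- v)*w+0)*tPhi w)%C). assert (Hf : forall lo, holo2 lo f) by (intros lo; apply holo2_mult; [apply holo2_cexp|apply tPhi_holo2]).
  assert (Mf : forall x y, 0 <= x -> Cmod (f (x, y))*(x*x+y*y) <= exp (- v*x)*(tcst*exp (2*x))).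
  { intros x y Hx. unfold f. rewrite Cmod_mult, Cmod_cexp. replace (Re (RtoC (- v)*(x, y)+0)%C) with (- v*x) by Re_ring.
    pose proof (tPhi_bound (x, y)) as B. rewrite Cmod_sqr in B. unfold Re, Im in B; simpl in B. rewrite (Rabs_right x) in B by lra. rewrite Rmult_assoc. apply Rmult_le_compat_l; [left; apply exp_pos|]. lra. }
  destruct (eventually_div_le (2*(tcst*exp (2*X))*X) eps He) as [N [HN1 HN]]. exists N. intros n Hn. specialize (HN n Hn).
  assert (Hn1 : 1 <= INR n) by (apply (le_INR 1); lia). set (B := tcst*exp (2*X)/INR n).
  assert (Edge : forall x y, 0 <= x <= X -> Rabs y = INR n -> Cmod (f (x, y)) <= B).
  { intros x y Hx Hy. specialize (Mf x y ltac:(lra)). assert (Ey : y*y = INR n*INR n) by (rewrite <- Hy, <- Rabs_mult; symmetry; apply Rabs_right; nra).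
    assert (exp (- v*x) <= 1) by (rewrite <- exp_0; apply exp_le; nra). assert (exp (2*x) <= exp (2*X)) by (apply exp_le; lra). pose proof (exp_pos (2*x)). pose proof (Cmod_ge_0 (f (x, y))).
    assert (M2 : Cmod (f (x, y))*INR n <= tcst*exp (2*X)).
    { apply Rle_trans with (Cmod (f (x, y))*(x*x+y*y)); [apply Rmult_le_compat_l; [lra|nra]|]. eapply Rle_trans; [exact Mf|]. apply Rle_trans with (1*(tcst*exp (2*x))); [apply Rmult_le_compat_r; [apply Rmult_le_pos; lra|lra]|nra]. }
    unfold B. apply Rmult_le_reg_r with (INR n); [lra|]. replace (tcst*exp (2*X)/INR n*INR n) with (tcst*exp (2*X)) by (field; lra). exact M2. }
  pose proof (contour_shift (-1) f 0 X (INR n) B (Hf _) ltac:(lra) ltac:(lra)) as S0.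
  assert (S1 := S0 ltac:(intros x Hx; split; apply Edge; [exact Hx|apply Rabs_right; lra|exact Hx|rewrite Rabs_Ropp; apply Rabs_right; lra])).
  rewrite (rint_ext (fun y => Re (f (0, y))) (fun y => tG y*tG y*cos (v*y))) in S1.
  2:{ intros y. unfold f. rewrite tPhi_imaginary. unfold cexp. replace (Re (RtoC (- v)*(0, y)+0)%C) with 0 by Re_ring. replace (Im (RtoC (- v)*(0, y)+0)%C) with (- (v*y)) by Re_ring.
    rewrite exp_0, cos_neg. unfold Re; simpl. ring. }
  fold (tapp v n) in S1. destruct (Hf (X-1)) as [f' [f'' D]].
  assert (Cx : ctn (fun y => Re (f (X, y)))) by (apply (ctn_derive _ (fun y => Re (f' (X, y)*Ci)%C)); intros y; apply (rder_vertical f); apply D; Re_lra).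
  pose proof (vertical_bound (fun y => Re (f (X, y))) X (exp (- v*X)*(tcst*exp (2*X))) (INR n) HX) as V.
  specialize (V ltac:(pose proof (exp_pos (- v*X)); pose proof (exp_pos (2*X)); repeat apply Rmult_le_pos; lra) ltac:(lra) Cx).
  specialize (V ltac:(intros y; eapply Rle_trans; [|apply (Mf X y); lra]; apply Rmult_le_compat_r; [nra|apply re_le_Cmod])).
  replace (exp (- v*X)*(tcst*exp (2*X))*PI/X) with (tcst*PI*(exp ((2-v)*X)/X)) in V.
  2:{ replace ((2-v)*X) with (- v*X+2*X) by ring. rewrite exp_plus. lra. }
  replace (2*B*(X-0)) with (2*(tcst*exp (2*X))*X/INR n) in S1 by (unfold B; field; lra). apply Rabs_le_between in S1. apply Rabs_le_between in V. apply Rabs_le. lra.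
Qed.
End TestFunction.

(** What the sequel uses of the test function. The quotient of peak [S^2] and mass [2 PI S] is what
    yields the factor [1/S] of the theorem. *)
Record test_function (y0 S : R) (g : R -> R) (Phi : C -> C) (ghat : R -> R) (K : R) : Prop := {
  tf_const : 0 < K;
  tf_nonneg : forall y, 0 <= g y;
  tf_lipschitz : forall y z, Rabs (g y - g z) <= 8*Rabs (y - z);
  tf_ctn : ctn g;
  tf_even : forall y, g (- y) = g y;
  tf_peak : g y0 = S*S /\ g (- y0) = S*S;
  tf_mass : forall T, 0 <= T -> rI g (- T) T <= 2*PI*S;
  tf_log_mass : forall T, 0 <= T -> rI (fun y => g y*ln (9 + y*y)) (- T) T <= K;
  tf_imaginary : forall y, Phi (0, y) = RtoC (g y);
  tf_holo : forall lo, holo2 lo Phi;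
  tf_bound : forall w, Cmod w*Cmod w*Cmod (Phi w) <= K*exp (2*Rabs (Re w));
  tf_lim : forall v, is_lim_seq (fun n => rI (fun y => g y*cos (v*y)) (- INR n) (INR n)) (ghat v);
  tf_support : forall v, 2 <= v -> ghat v = 0;
  tf_hat : forall v, 0 <= v < 2 -> Rabs (ghat v) <= K*(2 - v) }.

Lemma test_function_exists (y0 : R) : 0 < y0 -> exists g Phi ghat K, test_function y0 (1 + Rabs (sin (2*y0)/(2*y0))) g Phi ghat K.
Proof.
  intros Hy. pose proof PI_RGT_0 as HPI. assert (Tr : exists k k1 s, trig k k1 s /\ 1+s*(sin (2*y0)/(2*y0)) = 1+Rabs (sin (2*y0)/(2*y0))).
  { destruct (Rle_dec 0 (sin (2*y0)/(2*y0))) as [H|H].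
    - exists cos, (fun x => - sin x), 1. split; [left; auto|]. rewrite Rabs_right by lra. ring.
    - exists sin, cos, (-1). split; [right; auto|]. rewrite Rabs_left by lra. ring. }
  destruct Tr as [k [k1 [s [Tr E]]]]. rewrite <- E, <- (tG_y0 k k1 s y0 Tr Hy). assert (Ht : 4 <= tcst y0) by (unfold tcst; pose proof (Rmult_lt_0_compat _ _ Hy Hy); lra).
  exists (fun y => tG k y0 y*tG k y0 y), (tPhi k s y0), (that k y0), (8*(72+2*tcst y0)+tcst y0*PI*exp 1). pose proof (exp_pos 1).
  assert (0 <= tcst y0*PI*exp 1) by (apply Rmult_le_pos; [apply Rmult_le_pos|]; lra). split.
  - lra.
  - intros; nra.
  - exact (tG_sqr_lipschitz k k1 s y0 Tr).
  - exact (tG_sqr_ctn k k1 s y0 Tr).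
  - exact (tG_even k k1 s y0 Tr).
  - split; [reflexivity|apply (tG_even k k1 s y0 Tr)].
  - exact (tG_sqr_int k k1 s y0 Tr).
  - intros T HT. pose proof (tG_sqr_log_int k k1 s y0 Tr Hy T HT). lra.
  - exact (tPhi_imaginary k k1 s y0 Tr).
  - exact (tPhi_holo2 k k1 s y0 Tr).
  - intros w. le_via (tPhi_bound k k1 s y0 Tr Hy). apply Rmult_le_compat_r; [left; apply exp_pos|lra].
  - exact (tapp_lim k k1 s y0 Tr).
  (* For [v >= 2] the exponential in [that_bound] is at most 1, and [X] with [tcst PI / X = eps]
     makes the bound arbitrarily small. *)
  - intros v Hv. apply Rabs_eq_0. apply Rle_antisym; [|apply Rabs_pos]. apply le_epsilon. intros eps He. set (X := tcst y0*PI/eps). assert (0 < tcst y0*PI) by nra. assert (HX : 0 < X) by div_pos.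
    eapply Rle_trans; [apply (that_bound k k1 s y0 Tr Hy v X); lra|]. assert (exp ((2-v)*X) <= 1) by (rewrite <- exp_0; apply exp_le; nra).
    rewrite Rplus_0_l. replace eps with (tcst y0*PI*(1/X)) by (unfold X; field; lra). apply Rmult_le_compat_l; [lra|]. apply Rmult_le_compat_r; [left; apply Rinv_0_lt_compat; exact HX|exact H2].
  (* The choice [X = 1 / (2 - v)] keeps the exponential at [e] and turns [1/X] into the linear
     factor. *)
  - intros v Hv. eapply Rle_trans; [apply (that_bound k k1 s y0 Tr Hy v (/ (2-v))); [lra|inv_pos]|]. rewrite Rinv_r by lra. replace (exp 1 / / (2-v)) with (exp 1*(2-v)) by (field; lra). nra.
Qed.

(** * The inequality for a single character *)

Lemma holo2_div (lo : R) (f g : C -> C) : (forall z, lo < Re z -> g z <> 0%C) -> holo2 lo f -> holo2 lo g -> holo2 lo (fun z => f z/g z)%C.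
Proof.
  intros Hg Hf [g' [g'' G]]. apply holo2_mult; [exact Hf|].
  exists (fun z => - g' z/(g z*g z))%C, (fun z => - g'' z/(g z*g z) - - g' z*(g' z*g z+g z*g' z)/(g z*g z*(g z*g z)))%C. intros z Hz. destruct (G z Hz) as [G1 G2]. specialize (Hg z Hz).
  split; [apply cder_inv; assumption|]. apply (cder_div (fun z => - g' z)%C (fun z => g z*g z)%C).
  - apply Cmult_neq_0; assumption.
  - replace (fun z => - g' z)%C with (fun z => -1*g' z)%C by fun_ring. replace (- g'' z)%C with (-1*g'' z)%C by ring. apply cder_scal. exact G2.
  - apply cder_mult; assumption.
Qed.

Lemma holo2_vertical_ctn (lo x : R) (f : C -> C) : holo2 lo f -> lo < x -> ctn (fun y => Re (f (x, y))).
Proof. intros [f' [f'' D]] Hx. apply (ctn_derive _ (fun y => Re (f' (x, y)*Ci)%C)). intros y. apply (rder_vertical f). apply D. exact Hx. Qed.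

Lemma le_of_linear_error (A B Z : R) : (forall r, 0 < r <= / 2 -> A <= B + r*Z) -> A <= B.
Proof.
  intros H. apply Rnot_lt_le. intros Hlt. set (r := Rmin (/ 2) ((A-B)/(2*(Rabs Z+1)))). pose proof (Rabs_pos Z).
  assert (Hr : 0 < r) by (apply Rmin_pos; [lra|div_pos]). specialize (H r (conj Hr (Rmin_l _ _))).
  assert (r*Z <= r*(Rabs Z+1)) by (apply Rmult_le_compat_l; [lra|pose proof (Rle_abs Z); lra]).
  assert (r*(Rabs Z+1) <= (A-B)/(2*(Rabs Z+1))*(Rabs Z+1)) by (apply Rmult_le_compat_r; [lra|apply Rmin_r]).
  replace ((A-B)/(2*(Rabs Z+1))*(Rabs Z+1)) with ((A-B)/2) in * by (field; lra). lra.
Qed.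

Lemma rint_rsum (f : nat -> R -> R) (N : nat) (a b : R) : (forall n, ctn (f n)) -> ctn (fun y => rsum (fun n => f n y) N) /\ rI (fun y => rsum (fun n => f n y) N) a b = rsum (fun n => rI (f n) a b) N.
Proof.
  intros Hf. induction N as [|N [IH1 IH2]]; cbn [rsum].
  - split; [apply ctn_const|]. rewrite rint_const. ring.
  - split; [apply ctn_plus; [exact IH1|apply Hf]|]. rewrite (rint_plus _ _ _ _ IH1 (Hf (S N))), IH2. reflexivity.
Qed.

Lemma is_lim_seq_rsum (u : nat -> nat -> R) (l : nat -> R) (N : nat) : (forall m, is_lim_seq (u m) (l m)) -> is_lim_seq (fun n => rsum (fun m => u m n) N) (rsum l N).
Proof. intros H. induction N; cbn [rsum]; [apply is_lim_seq_const|]. apply (is_lim_seq_plus' _ _ _ _ IHN (H (S N))). Qed.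

(* The Poisson kernel of width [r*r], restricted to the window of radius [r]. *)
Lemma poisson_lower (g : R -> R) (y1 r T : R) : ctn g -> (forall y, 0 <= g y) -> (forall y z, Rabs (g y - g z) <= 8*Rabs (y - z)) ->
  0 < r -> Rabs y1 + r <= T ->
  PI*g y1 - r*(8*PI + 2*g y1) <= rI (fun y => r*r/(r*r*(r*r) + (y - y1)*(y - y1))*g y) (- T) T.
Proof.
  intros Cg Pg Lg Hr HT. assert (Ha : 0 < r*r) by nra. set (P := fun y => r*r/(r*r*(r*r)+(y-y1)*(y-y1))).
  assert (Cp : ctn P) by (apply poisson_ctn; exact Ha). pose proof (ctn_mult _ _ Cp Cg) as Cf.
  assert (PP : forall y, 0 < P y). { intros y. apply Rdiv_lt_0_compat; [exact Ha|]. pose proof (Rmult_lt_0_compat _ _ Ha Ha). pose proof (Rle_0_sqr (y-y1)). unfold Rsqr in *. lra. }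
  assert (Hy : - T <= y1-r /\ y1+r <= T). { pose proof (Rle_abs y1). pose proof (Rle_abs (- y1)). rewrite Rabs_Ropp in *. lra. }
  change (PI*g y1-r*(8*PI+2*g y1) <= rI (fun y => P y*g y) (- T) T).
  rewrite <- (rint_chasles _ (- T) (y1-r) T Cf), <- (rint_chasles _ (y1-r) (y1+r) T Cf).
  assert (0 <= rI (fun y => P y*g y) (- T) (y1-r)) by (apply rint_nonneg; [lra|exact Cf|intros; apply Rmult_le_pos; [left; apply PP|apply Pg]]).
  assert (0 <= rI (fun y => P y*g y) (y1+r) T) by (apply rint_nonneg; [lra|exact Cf|intros; apply Rmult_le_pos; [left; apply PP|apply Pg]]).
  assert (M : rI (fun y => (g y1-8*r)*P y) (y1-r) (y1+r) <= rI (fun y => P y*g y) (y1-r) (y1+r)).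
  { apply rint_le; [lra|exact (ctn_mult _ _ (ctn_const _) Cp)|exact Cf|]. intros y Hy'. rewrite (Rmult_comm (P y)). apply Rmult_le_compat_r; [left; apply PP|].
    specialize (Lg y y1). apply Rabs_le_between in Lg. assert (Rabs (y-y1) <= r) by (apply Rabs_le; lra). lra. }
  rewrite (rint_scal _ _ _ _ Cp) in M. rewrite (poisson_int (r*r) y1 _ _ Ha) in M.
  (* The mass of the kernel in the window is [2 atan (1/r) = PI - 2 atan r >= PI - 2 r]. *)
  replace ((y1+r-y1)/(r*r)) with (/ r) in M by (field; lra). replace ((y1-r-y1)/(r*r)) with (- / r) in M by (field; lra). rewrite atan_opp, (atan_inv r Hr) in M.
  assert (A : 0 <= atan r <= r).
  { split; [left; rewrite <- atan_0; apply atan_increasing; exact Hr|]. pose proof (real_mean_value atan (fun x => / (1+Rsqr x)) 0 r 1 ltac:(lra)) as MV. rewrite atan_0, !Rminus_0_r in MV.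
    le_via Rle_abs. rewrite <- (Rmult_1_l r) at 2. apply MV; intros; [apply is_derive_atan|]. pose proof (Rle_0_sqr t). rewrite Rabs_right by (apply Rle_ge; left; inv_pos). rewrite <- Rinv_1. apply Rinv_le_contravar; lra. }
  specialize (Pg y1). nra.
Qed.

Section CharacterInequality.
Variables (q : nat) (chi : nat -> C) (y0 S : R) (g : R -> R) (Phi : C -> C) (ghat : R -> R) (K K3 mu1 mu2 : R).
Hypothesis TF : test_function y0 S g Phi ghat K.
Hypothesis Hy0 : 0 < y0.
Hypothesis Hp : prime (Z.of_nat q).
Hypothesis Hq : (3 <= q)%nat.
Hypothesis Hchi : nonprincipal_char q chi.
Hypothesis HK3 : forall s, 3 <= Re s -> Cmod (Fk chi 1 s/Fk chi 0 s)%C <= K3.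
Hypothesis HG : GRH_mod q.
Hypothesis Hnz : forall s, / 2 < Re s -> Fk chi 0 s <> 0%C.
Let L := lnn q.
Let r1 : C := (/ 2, y0/L).
Let r2 : C := (/ 2, - (y0/L)).
Hypothesis W1 : zero_weight (Fk chi 0) r1 mu1.
Hypothesis W2 : zero_weight (Fk chi 0) r2 mu2.

Lemma L_ge_1 : 1 <= L.
Proof. rewrite <- (ln_exp 1). apply ln_le'; [apply exp_pos|]. le_via exp_le_3. replace 3 with (INR 3) by (simpl; ring). apply le_INR. exact Hq.
Qed.

(** The variable of the test function is scaled by [L = log q], so that the zeros at heights [y0/L]
    and [- y0/L] sit at the peaks [y0] and [- y0] of [g]. *)
Definition sline (a : R) (w : C) : C := (RtoC (/ L)*w + RtoC (/ 2 + a))%C.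

Lemma sline_pair (a x y : R) : sline a (x, y) = (x/L + (/ 2 + a), y/L).
Proof. unfold Rdiv. C_ring. Qed.

(** Where the series converges this is the tail of [-L'/L] after [N] terms; nearer to the critical
    line it is merely holomorphic, and its integral is moved to the right. *)
Definition ldiff (N : nat) (s : C) : C := (Fk chi 1 s/Fk chi 0 s + -1*vm_sum chi s N)%C.

Lemma ldiff_holo2 (N : nat) : holo2 (/ 2) (ldiff N).
Proof.
  assert (HF : forall j, holo2 (/ 2) (Fk chi j)).
  { intros j. exists (fun z => - Fk chi (Datatypes.S j) z)%C, (fun z => -1 * - Fk chi (Datatypes.S (Datatypes.S j)) z)%C. split; [apply (Lfun_cder q chi Hp Hchi); lra|].
    replace (fun z => - Fk chi (Datatypes.S j) z)%C with (fun z => -1*Fk chi (Datatypes.S j) z)%C by fun_ring. apply cder_scal. apply (Lfun_cder q chi Hp Hchi). lra. }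
  apply holo2_plus; [apply holo2_div; [exact Hnz|apply HF|apply HF]|]. apply holo2_mult; [apply holo2_const|].
  induction N; [apply (holo2_const _ 0)|]. apply holo2_plus; [exact IHN|]. apply holo2_mult; [apply holo2_const|]. apply holo2_mult; [apply holo2_const|].
  replace (fun z => cexp (- z*lnn (Datatypes.S N)))%C with (fun z => cexp (RtoC (- lnn (Datatypes.S N))*z+0))%C by (apply functional_extensionality; intros z; f_equal; rewrite RtoC_opp; ring). apply holo2_cexp.
Qed.

Lemma ldiff_line_holo2 (a : R) (N : nat) : 0 < a -> holo2 (- (a*L/2)) (fun w => ldiff N (sline a w)*Phi w)%C.
Proof.
  intros Ha. pose proof L_ge_1. apply holo2_mult; [|apply (tf_holo _ _ _ _ _ _ TF)]. apply (holo2_affine _ (/ 2) (ldiff N) (RtoC (/ L)) (RtoC (/ 2+a))); [|apply ldiff_holo2]. intros z Hz.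
  replace (Re (RtoC (/ L)*z+RtoC (/ 2+a))%C) with (/ L*Re z+(/ 2+a)) by Re_ring. assert (0 < / L) by inv_pos.
  assert (/ L * - (a*L/2) < / L*Re z) by nra. replace (/ L * - (a*L/2)) with (- (a/2)) in * by (field; lra). lra.
Qed.

Lemma vm_sum_line (a y : R) (N : nat) : Re (vm_sum chi (sline a (0, y)) N) =
  rsum (fun n => vonmangoldt n*exp (- (/ 2 + a)*lnn n)*(Re (chi n)*cos (lnn n/L*y) + Im (chi n)*sin (lnn n/L*y))) N.
Proof.
  unfold vm_sum. rewrite Re_csum. apply rsum_ext. intros n _. rewrite sline_pair. unfold cexp.
  replace (Re (- ((0/L+(/ 2+a))%R, (y/L)%R)*lnn n)%C) with (- (/ 2+a)*lnn n) by (unfold Re; simpl; unfold Rdiv; ring).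
  replace (Im (- ((0/L+(/ 2+a))%R, (y/L)%R)*lnn n)%C) with (- (lnn n/L*y)) by (unfold Im; simpl; unfold Rdiv; ring).
  rewrite cos_neg, sin_neg. unfold Re, Im; simpl. ring.
Qed.

Definition psum (a : R) (N : nat) (h : R -> R) : R := rsum (fun n => vonmangoldt n*exp (- (/ 2 + a)*lnn n)*(Re (chi n)*h (lnn n/L))) N.

(** The sine terms, which carry [Im (chi m)], integrate to 0 because [g] is even. *)
Lemma vm_sum_int (a : R) (N n : nat) :
  ctn (fun y => Re (vm_sum chi (sline a (0, y)) N)*g y) /\
  rI (fun y => Re (vm_sum chi (sline a (0, y)) N)*g y) (- INR n) (INR n) = psum a N (fun v => rI (fun y => g y*cos (v*y)) (- INR n) (INR n)).
Proof.
  destruct TF as [_ _ _ Cg Ev _ _ _ _ _ _ _ _ _].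
  set (f := fun m y => vonmangoldt m*exp (- (/ 2+a)*lnn m)*(Re (chi m)*(g y*cos (lnn m/L*y))+Im (chi m)*(g y*sin (lnn m/L*y)))).
  assert (Cc : forall v, ctn (fun y => g y*cos (v*y))) by (intros v; apply ctn_mult; [exact Cg|apply (ctn_derive _ (fun y => - sin (v*y)*v)); intros y; der_ring]).
  assert (Cs : forall v, ctn (fun y => g y*sin (v*y))) by (intros v; apply ctn_mult; [exact Cg|apply (ctn_derive _ (fun y => cos (v*y)*v)); intros y; der_ring]).
  assert (Cf : forall m, ctn (f m)).
  { intros m. apply ctn_mult; [apply ctn_const|]. apply ctn_plus; (apply ctn_mult; [apply ctn_const|]); [apply Cc|apply Cs]. }
  assert (E : (fun y => Re (vm_sum chi (sline a (0, y)) N)*g y) = (fun y => rsum (fun m => f m y) N)).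
  { apply functional_extensionality. intros y. rewrite vm_sum_line, Rmult_comm, <- rsum_scal. apply rsum_ext. intros m _. unfold f. ring. }
  rewrite E. destruct (rint_rsum f N (- INR n) (INR n) Cf) as [A B]. split; [exact A|]. rewrite B. apply rsum_ext. intros m _. unfold f.
  pose proof (ctn_mult _ _ (ctn_const (Re (chi m))) (Cc (lnn m/L))) as C1. pose proof (ctn_mult _ _ (ctn_const (Im (chi m))) (Cs (lnn m/L))) as C2.
  rewrite (rint_scal _ _ _ _ (ctn_plus _ _ C1 C2)), (rint_plus _ _ _ _ C1 C2), (rint_scal _ _ _ _ (Cc _)), (rint_scal _ _ _ _ (Cs _)).
  rewrite (rint_odd (fun y => g y*sin (lnn m/L*y)) (INR n) (Cs _)); [ring|]. intros u. rewrite Ev, <- Ropp_mult_distr_r, sin_neg. ring.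
Qed.

(* Moving the line of integration to [Re s = 3], where the Dirichlet series of [L'/L] converges. *)
Lemma ldiff_integral (a : R) : 0 < a <= / 2 -> exists Z, 0 <= Z /\ forall N eps, 0 < eps -> exists n0, forall n, (n0 <= n)%nat ->
  Rabs (rI (fun y => Re (ldiff N (sline a (0, y))*Phi (0, y))%C) (- INR n) (INR n)) <= Z/INR (Datatypes.S N) + eps.
Proof.
  intros Ha. pose proof L_ge_1 as HL. pose proof PI_RGT_0 as HPI. destruct TF as [HK _ _ _ _ _ _ _ Im0 Ho Bd _ _ _].
  destruct (log_derivative_growth q chi Hp Hchi Hnz a ltac:(lra)) as [Kg [HKg Gr]]. destruct (log_derivative_series q chi Hp Hchi 3 ltac:(lra)) as [K' [HK' Se]].
  (* [sline a] takes [Re w = X] to [Re s = 3]. *)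
  set (X := (5/2-a)*L). assert (HX : 0 < X) by (unfold X; nra). pose proof (exp_pos (2*X)) as HE.
  exists (K'*(K*exp (2*X))*PI/X). split; [apply Rmult_le_pos; [apply Rmult_le_pos; [apply Rmult_le_pos; [|apply Rmult_le_pos]|]; lra|left; inv_pos]|]. intros N eps He.
  set (f := fun w => (ldiff N (sline a w)*Phi w)%C).
  assert (Hf : holo2 (- (a*L/2)) f) by (apply ldiff_line_holo2; lra).
  assert (HaL : 0 < a*L) by nra.
  assert (Bw : forall x y, 0 <= x <= X -> Cmod (Phi (x, y))*(x*x+y*y) <= K*exp (2*X)).
  { intros x y Hx. pose proof (Bd (x, y)) as B. rewrite Cmod_sqr in B. unfold Re, Im in B; simpl in B. rewrite (Rabs_right x) in B by lra. rewrite Rmult_comm. eapply Rle_trans; [exact B|]. apply Rmult_le_compat_l; [lra|apply exp_le; lra]. }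
  set (V := rsum (fun n => vonmangoldt n) N). assert (HV : 0 <= V) by (apply rsum_nonneg; intros; apply vonmangoldt_nonneg).
  assert (Re_s : forall x y, 0 <= x -> / 2+a <= Re (sline a (x, y))) by (intros x y Hx; rewrite sline_pair; unfold Re; simpl; assert (0 <= x/L) by (apply Rmult_le_pos; [lra|left; inv_pos]); lra).
  assert (Be : forall x y, 0 <= x -> Cmod (ldiff N (sline a (x, y))) <= (Kg+V)*(1+Rabs y)).
  { intros x y Hx. specialize (Re_s x y Hx). le_via Cmod_triangle. rewrite Cmod_mult, Cmod_R, (Rabs_left (-1)) by lra. pose proof (Rabs_pos y).
    assert (G1 : Cmod (Fk chi 1 (sline a (x, y))/Fk chi 0 (sline a (x, y)))%C <= Kg*(1+Rabs y)).
    { eapply Rle_trans; [apply Gr; exact Re_s|]. apply Rmult_le_compat_l; [lra|]. rewrite sline_pair. unfold Im; simpl. unfold Rdiv. rewrite Rabs_mult, (Rabs_right (/ L)) by (left; inv_pos).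
      assert (/ L <= 1) by (rewrite <- Rinv_1; apply Rinv_le_contravar; lra). nra. }
    assert (G2 : Cmod (vm_sum chi (sline a (x, y)) N) <= V).
    { le_via Cmod_csum_le. apply rsum_le. intros n _. le_via (vm_sum_term_bound q chi Hp Hchi). rewrite <- (Rmult_1_r (vonmangoldt n)) at 2.
      apply Rmult_le_compat_l; [apply vonmangoldt_nonneg|]. rewrite <- exp_0. apply exp_le. pose proof (ln_INR_nonneg n). nra. }
    nra. }
  (* On the horizontal edges the linear growth of [ldiff] meets the decay [1/y^2] of [Phi], which
     leaves [O(1/n)]. *)
  destruct (eventually_div_le (2*X*(2*(Kg+V)*(K*exp (2*X)))) eps He) as [n0 [Hn0 Ev]]. exists n0. intros n Hn. specialize (Ev n Hn). assert (Hn1 : 1 <= INR n) by (apply (le_INR 1); lia).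
  set (B := 2*(Kg+V)*(K*exp (2*X))/INR n).
  assert (Edge : forall x y, 0 <= x <= X -> Rabs y = INR n -> Cmod (f (x, y)) <= B).
  { intros x y Hx Hy. specialize (Bw x y Hx). specialize (Be x y ltac:(lra)). assert (Ey : y*y = INR n*INR n) by (rewrite <- Hy, <- Rabs_mult; symmetry; apply Rabs_right; nra).
    unfold f. rewrite Cmod_mult. pose proof (Cmod_ge_0 (Phi (x, y))) as P0.
    assert (P1 : Cmod (Phi (x, y))*(INR n*INR n) <= K*exp (2*X)) by nra.
    apply Rmult_le_reg_r with (INR n); [lra|]. unfold B. replace (2*(Kg+V)*(K*exp (2*X))/INR n*INR n) with (2*(Kg+V)*(K*exp (2*X))) by (field; lra).
    apply Rle_trans with (((Kg+V)*(2*INR n))*Cmod (Phi (x, y))*INR n).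
    - apply Rmult_le_compat_r; [lra|]. apply Rmult_le_compat_r; [exact P0|]. nra.
    - nra. }
  pose proof (contour_shift _ f 0 X (INR n) B Hf ltac:(lra) ltac:(lra)) as S0.
  assert (S1 := S0 ltac:(intros x Hx; split; apply Edge; [exact Hx|apply Rabs_right; lra|exact Hx|rewrite Rabs_Ropp; apply Rabs_right; lra])).
  set (NN := INR (Datatypes.S N)). assert (HNN : 0 < NN) by (apply lt_0_INR; lia).
  pose proof (vertical_bound (fun y => Re (f (X, y))) X (K'/NN*(K*exp (2*X))) (INR n) HX) as Vb.
  specialize (Vb ltac:(repeat apply Rmult_le_pos; try lra; left; inv_pos) ltac:(lra) (holo2_vertical_ctn _ X f Hf ltac:(lra))).
  assert (B3 : forall y, Cmod (ldiff N (sline a (X, y))) <= K'/NN).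
  { intros y. assert (R3 : 3 <= Re (sline a (X, y))) by (rewrite sline_pair; unfold Re, X; simpl; right; field; lra).
    destruct (Se _ R3) as [h [_ [Eh Hh]]]. specialize (Hh N). replace (- ((3-1)/2)*lnn (Datatypes.S N)) with (- ln NN) in Hh by (unfold NN; field). rewrite exp_Ropp, exp_ln in Hh by exact HNN.
    unfold ldiff. rewrite Eh. replace (h*Fk chi 0 (sline a (X, y))/Fk chi 0 (sline a (X, y)) + -1*vm_sum chi (sline a (X, y)) N)%C with (h-vm_sum chi (sline a (X, y)) N)%C; [exact Hh|]. field. apply Hnz. lra. }
  assert (Vb1 : Rabs (rI (fun y => Re (f (X, y))) (- INR n) (INR n)) <= K'/NN*(K*exp (2*X))*PI/X).
  { apply Vb. intros y. apply Rle_trans with (K'/NN*Cmod (Phi (X, y))*(X*X+y*y)).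
    - apply Rmult_le_compat_r; [nra|]. le_via re_le_Cmod. unfold f. rewrite Cmod_mult. apply Rmult_le_compat_r; [apply Cmod_ge_0|apply B3].
    - rewrite Rmult_assoc. apply Rmult_le_compat_l; [apply Rmult_le_pos; [lra|left; inv_pos]|apply Bw; lra]. }
  replace (2*B*(X-0)) with (2*X*(2*(Kg+V)*(K*exp (2*X)))/INR n) in S1 by (unfold B; field; lra). change (fun y => Re (ldiff N (sline a (0, y))*Phi (0, y))%C) with (fun y => Re (f (0, y))).
  apply Rabs_le_between in S1. apply Rabs_le_between in Vb1. apply Rabs_le. lra.
Qed.

Definition cerr : R := 16*fe_const + 2*K3 + 1.

(** [log_derivative_positivity] multiplied by [g y >= 0]; in the scaled variable [Re (1/(s - rho))]
    is [L] times a Poisson kernel of width [a L]. *)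
Lemma positivity_on_line (a y : R) : 0 < a <= / 2 ->
  mu1*(L*(a*L/(a*L*(a*L) + (y - y0)*(y - y0))*g y)) + (mu2*(L*(a*L/(a*L*(a*L) + (y - - y0)*(y - - y0))*g y)) +
  Re (Fk chi 1 (sline a (0, y))/Fk chi 0 (sline a (0, y)))%C*g y) <= / 2*(L + cerr)*g y + 8*fe_const*(g y*ln (9 + y*y)).
Proof.
  intros Ha. pose proof L_ge_1 as HL. pose proof fe_const_ge_1 as Hf. pose proof (tf_nonneg _ _ _ _ _ _ TF y) as Hg. set (s := sline a (0, y)).
  assert (Es : s = (/ 2+a, y/L)) by (unfold s; rewrite sline_pair; f_equal; unfold Rdiv; ring).
  assert (HyL : 0 < y0/L) by div_pos.
  assert (N12 : r1 <> r2) by (unfold r1, r2; intros E; apply (f_equal snd) in E; simpl in E; lra).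
  pose proof (log_derivative_positivity q chi r1 r2 mu1 mu2 Hp Hq Hchi W1 W2 N12 K3 HK3 HG Hnz eq_refl eq_refl s ltac:(rewrite Es; Re_lra)) as P.
  assert (Ker : forall y1, Re (/ (s-((/ 2)%R, (y1/L)%R)))%C = L*(a*L/(a*L*(a*L)+(y-y1)*(y-y1)))).
  { intros y1. assert (HaL : 0 < a*L) by nra. pose proof (Rmult_lt_0_compat _ _ HaL HaL). assert (0 < a*L*(a*L)+(y-y1)*(y-y1)) by (pose proof (Rle_0_sqr (y-y1)); unfold Rsqr in *; lra).
    unfold Re, Cinv; simpl. field. lra. }
  replace r1 with ((/ 2, y0/L) : C) in P by reflexivity. replace r2 with ((/ 2, - y0/L) : C) in P by (unfold r2; f_equal; field; lra).
  rewrite !Ker in P.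
  assert (Mj : log_majorant q K3 s <= L+cerr+16*fe_const*ln (9+y*y)).
  { unfold log_majorant. fold L. unfold cerr. enough (ln (Cmod (s+1)%C) <= / 2*ln (9+y*y)) by nra.
    assert (1 <= Cmod (s+1)%C) by (apply Cmod_Re_ge; rewrite Es; Re_lra).
    replace (ln (Cmod (s+1)%C)) with (/ 2*ln (Cmod (s+1)%C*Cmod (s+1)%C)) by (rewrite ln_mult by lra; field). apply Rmult_le_compat_l; [lra|]. apply ln_le'; [nra|]. rewrite Cmod_sqr. unfold Re, Im; simpl.
    assert (Hi : 0 < / L <= 1) by (split; [inv_pos|rewrite <- Rinv_1; apply Rinv_le_contravar; lra]). assert (y * / L*(y * / L) <= y*y). { replace (y * / L*(y * / L)) with (y*y*(/ L * / L)) by ring. rewrite <- (Rmult_1_r (y*y)) at 2. apply Rmult_le_compat_l; [nra|nra]. } nra. } nra.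
Qed.

(** Three limits in this order: the height [n] of the segment, the number [N] of terms in the prime
    sum, and the width [a L = r^2]. The constant [Z] of the contour shift depends on [a], so [N]
    must go to infinity before [r] tends to 0. *)
Lemma character_inequality :
  (mu1 + mu2)*(L*(PI*(S*S))) <= (L + cerr)*(PI*S) + 8*fe_const*K - psum 0 (q*q) ghat.
Proof.
  pose proof L_ge_1 as HL. pose proof fe_const_ge_1 as Hfe. assert (Hm1 : 0 <= mu1) by apply W1. assert (Hm2 : 0 <= mu2) by apply W2.
  pose proof TF as [HK Pg Lg Cg Ev [Pk1 Pk2] Ms Lm Im0 Ho Bd Li Su Ha].
  set (Q := rsum (fun n => vonmangoldt n*lnn n*Rabs (ghat (lnn n/L))) (q*q)).
  (* The width [a L = r^2] is the one that [poisson_lower] expects; as [L >= 1], also [a <= r]. *)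
  apply (le_of_linear_error _ _ ((mu1+mu2)*L*(8*PI+2*(S*S))+Q)). intros r Hr. set (a := r*r/L).
  assert (HaL : a*L = r*r) by (unfold a; field; lra).
  assert (Har : 0 < a <= r). { nra. }
  destruct (ldiff_integral a ltac:(lra)) as [Z [HZ LI]].
  assert (Main : forall N, (mu1+mu2)*(L*(PI*(S*S))) <= (L+cerr)*(PI*S)+8*fe_const*K-psum a N ghat+r*((mu1+mu2)*L*(8*PI+2*(S*S)))+Z/INR (Datatypes.S N)).
  { intros N. apply le_epsilon. intros eps He. destruct (LI N (eps/2) ltac:(lra)) as [n0 Hn0].
    assert (Lim : is_lim_seq (fun n => psum a N (fun v => rI (fun y => g y*cos (v*y)) (- INR n) (INR n))) (psum a N ghat)).
    { apply (is_lim_seq_rsum (fun m n => vonmangoldt m*exp (- (/ 2+a)*lnn m)*(Re (chi m)*rI (fun y => g y*cos (lnn m/L*y)) (- INR n) (INR n)))). intros m.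
      apply (is_lim_seq_scal_l _ _ (Finite _)). apply (is_lim_seq_scal_l _ _ (Finite _)). apply Li. }
    apply is_lim_seq_spec in Lim. destruct (Lim (mkposreal (eps/2) ltac:(lra))) as [n1 Hn1]. simpl in Hn1.
    destruct (nfloor_ex (y0+1) ltac:(lra)) as [n2 [_ Hn2]]. set (n := (n0+n1+Datatypes.S n2)%nat). specialize (Hn0 n ltac:(lia)). specialize (Hn1 n ltac:(lia)). apply Rabs_def2 in Hn1.
    assert (HT : y0+1 <= INR n). { apply Rle_trans with (INR (Datatypes.S n2)); [rewrite S_INR; lra|apply le_INR; lia]. } set (T := INR n) in *.
    destruct (vm_sum_int a N n) as [Cv Iv]. fold T in Iv. set (ps := psum a N (fun v => rI (fun y => g y*cos (v*y)) (- T) T)) in *.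
    set (D := fun y => Re (Fk chi 1 (sline a (0, y))/Fk chi 0 (sline a (0, y)))%C*g y).
    assert (ED : forall y, D y = Re (ldiff N (sline a (0, y))*Phi (0, y))%C+Re (vm_sum chi (sline a (0, y)) N)*g y).
    { intros y. rewrite Im0. unfold D. unfold Re; simpl. ring. }
    assert (Cl : ctn (fun y => Re (ldiff N (sline a (0, y))*Phi (0, y))%C)).
    { apply (holo2_vertical_ctn (- (a*L/2)) 0 (fun w => ldiff N (sline a w)*Phi w)%C); [apply ldiff_line_holo2; lra|rewrite HaL; nra]. }
    assert (CD : ctn D). { replace D with (fun y => Re (ldiff N (sline a (0, y))*Phi (0, y))%C+Re (vm_sum chi (sline a (0, y)) N)*g y) by (apply functional_extensionality; intros; symmetry; apply ED). exact (ctn_plus _ _ Cl Cv). }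
    assert (ID : ps-Z/INR (Datatypes.S N)-eps/2 <= rI D (- T) T).
    { rewrite (rint_ext _ _ (- T) T ED), (rint_plus _ _ _ _ Cl Cv). apply Rabs_le_between in Hn0. lra. }
    assert (Pl : forall y1, Rabs y1 = y0 -> g y1 = S*S -> PI*(S*S)-r*(8*PI+2*(S*S)) <= rI (fun y => a*L/(a*L*(a*L)+(y-y1)*(y-y1))*g y) (- T) T).
    { intros y1 Hy1 Eg. rewrite HaL, <- Eg. apply poisson_lower; try assumption; lra. }
    assert (Cq : forall y1, ctn (fun y => a*L/(a*L*(a*L)+(y-y1)*(y-y1))*g y)) by (intros; apply ctn_mult; [apply poisson_ctn; rewrite HaL; nra|exact Cg]).
    pose proof (Pl y0 (Rabs_right y0 ltac:(lra)) Pk1) as Q1. pose proof (Pl (- y0) ltac:(rewrite Rabs_Ropp; apply Rabs_right; lra) Pk2) as Q2.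
    pose proof (ctn_mult _ _ (ctn_const L) (Cq y0)) as D1. pose proof (ctn_mult _ _ (ctn_const L) (Cq (- y0))) as D2. pose proof (ctn_mult _ _ (ctn_const mu1) D1) as D3. pose proof (ctn_mult _ _ (ctn_const mu2) D2) as D4.
    pose proof (ctn_mult _ _ Cg ln_quad_ctn) as D5. pose proof (ctn_mult _ _ (ctn_const (/ 2*(L+cerr))) Cg) as D6. pose proof (ctn_mult _ _ (ctn_const (8*fe_const)) D5) as D7.
    pose proof (rint_le _ _ (- T) T ltac:(lra) (ctn_plus _ _ D3 (ctn_plus _ _ D4 CD)) (ctn_plus _ _ D6 D7) (fun y _ => positivity_on_line a y ltac:(lra))) as I.
    rewrite (rint_plus _ _ _ _ D3 (ctn_plus _ _ D4 CD)), (rint_plus _ _ _ _ D4 CD), (rint_plus _ _ _ _ D6 D7), (rint_scal _ _ _ _ D1), (rint_scal _ _ _ _ D2), (rint_scal _ _ _ _ (Cq y0)), (rint_scal _ _ _ _ (Cq (- y0))), (rint_scal _ _ _ _ Cg), (rint_scal _ _ _ _ D5) in I.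
    specialize (Ms T ltac:(lra)). specialize (Lm T ltac:(lra)).
    assert (HK0 : 0 <= K3) by (eapply Rle_trans; [apply Cmod_ge_0|apply (HK3 3)]; Re_lra).
    assert (M1 : / 2*(L+cerr)*rI g (- T) T <= (L+cerr)*(PI*S)).
    { replace ((L+cerr)*(PI*S)) with (/ 2*(L+cerr)*(2*PI*S)) by field. apply Rmult_le_compat_l; [unfold cerr; lra|exact Ms]. }
    assert (M2 : 8*fe_const*rI (fun y => g y*ln (9+y*y)) (- T) T <= 8*fe_const*K) by nra.
    assert (M3 := Rmult_le_compat_l _ _ _ Hm1 (Rmult_le_compat_l L _ _ ltac:(lra) Q1)). assert (M4 := Rmult_le_compat_l _ _ _ Hm2 (Rmult_le_compat_l L _ _ ltac:(lra) Q2)). lra. }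
  assert (Stab : forall j, psum a (q*q+j) ghat = psum a (q*q) ghat).
  { intros j. unfold psum. rewrite rsum_app. rewrite <- (Rplus_0_r (rsum _ (q*q))) at 2. f_equal. apply rsum_zero. intros n Hn. rewrite Su; [ring|].
    apply Rmult_le_reg_r with L; [lra|]. unfold Rdiv. rewrite Rmult_assoc, Rinv_l, Rmult_1_r by lra. assert (0 < INR q) by (apply lt_0_INR; lia). replace (2*L) with (ln (INR q*INR q)) by (rewrite ln_mult by assumption; unfold L; ring).
    apply ln_le'; [nra|]. rewrite <- mult_INR. apply le_INR. lia. }
  assert (Main2 : (mu1+mu2)*(L*(PI*(S*S))) <= (L+cerr)*(PI*S)+8*fe_const*K-psum a (q*q) ghat+r*((mu1+mu2)*L*(8*PI+2*(S*S)))).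
  { apply le_epsilon. intros eps He. destruct (eventually_div_le Z eps He) as [j [_ Hj]]. specialize (Hj (Datatypes.S (q*q+j)) ltac:(lia)). specialize (Main (q*q+j)%nat). rewrite Stab in Main. lra. }
  (* Since [n^(-1/2) - n^(-1/2-a) <= a ln n], replacing [a] by 0 in the finite sum costs an error
     linear in [r]. *)
  assert (Dif : psum 0 (q*q) ghat-psum a (q*q) ghat <= r*Q).
  { unfold psum, Q. rewrite <- rsum_scal. enough (forall N, rsum (fun n => vonmangoldt n*exp (- (/ 2+0)*lnn n)*(Re (chi n)*ghat (lnn n/L))) N -
      rsum (fun n => vonmangoldt n*exp (- (/ 2+a)*lnn n)*(Re (chi n)*ghat (lnn n/L))) N <= rsum (fun n => r*(vonmangoldt n*lnn n*Rabs (ghat (lnn n/L)))) N) by auto.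
    induction N; cbn [rsum]; [lra|]. set (n := Datatypes.S N). set (l := lnn n). set (G := ghat (l/L)). assert (Hl : 0 <= l) by apply ln_INR_nonneg. pose proof (vonmangoldt_nonneg n) as HV.
    enough (vonmangoldt n*exp (- (/ 2+0)*l)*(Re (chi n)*G)-vonmangoldt n*exp (- (/ 2+a)*l)*(Re (chi n)*G) <= r*(vonmangoldt n*l*Rabs G)) by lra.
    set (e0 := exp (- (/ 2+0)*l)). set (e1 := exp (- (/ 2+a)*l)). assert (E01 : 0 <= e0-e1 <= r*l).
    { assert (e1 = e0*exp (- (a*l))) by (unfold e0, e1; rewrite <- exp_plus; f_equal; ring). assert (exp (- (a*l)) <= 1) by (rewrite <- exp_0; apply exp_le; nra). pose proof (exp_ineq1_le (- (a*l))).
      assert (e0 <= 1) by (unfold e0; rewrite <- exp_0; apply exp_le; nra). assert (0 < e0) by apply exp_pos. nra. }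
    assert (Rc : Rabs (Re (chi n)) <= 1) by (eapply Rle_trans; [apply re_le_Cmod|apply (dchar_mod_le_1 q Hp); apply Hchi]).
    replace (vonmangoldt n*e0*(Re (chi n)*G)-vonmangoldt n*e1*(Re (chi n)*G)) with (vonmangoldt n*((e0-e1)*(Re (chi n)*G))) by ring. replace (r*(vonmangoldt n*l*Rabs G)) with (vonmangoldt n*(r*l*Rabs G)) by ring.
    apply Rmult_le_compat_l; [exact HV|]. le_via Rle_abs. rewrite Rabs_mult, (Rabs_right (e0-e1)) by lra. apply Rmult_le_compat; [lra|apply Rabs_pos|lra|]. rewrite Rabs_mult. pose proof (Rabs_pos G). nra. }
  lra.
Qed.
End CharacterInequality.

(** * Averaging over the characters *)

Ltac mpos := solve [lra | apply Rmult_lt_0_compat; mpos].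

(** Fourth roots serve the bound [ln x <= 4 x^(1/4)] and turn the telescoping estimate for the sum
    of [k^(-3/4)] into a polynomial inequality. *)
Definition qroot (n : nat) : R := exp (/ 4*lnn n).

Lemma qroot_pow (n : nat) : (1 <= n)%nat -> 0 < qroot n /\ qroot n*qroot n*(qroot n*qroot n) = INR n /\ exp (- / 2*lnn n) = / (qroot n*qroot n).
Proof. split; [apply exp_pos|]. unfold qroot. rewrite <- !exp_plus. split.
  - replace (/ 4*lnn n + / 4*lnn n+(/ 4*lnn n + / 4*lnn n)) with (lnn n) by field. apply exp_ln. apply lt_0_INR. lia.
  - rewrite <- exp_Ropp. f_equal. field.
Qed.

Lemma rsum_qroot (N : nat) : (1 <= N)%nat -> rsum (fun k => / (qroot k*qroot k*qroot k)) N <= 4*qroot N.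
Proof. induction N as [|N IH]; [lia|]. cbn [rsum]. destruct (Nat.eq_dec N 0) as [->|H0].
  - cbn [rsum]. unfold qroot. simpl INR. rewrite ln_1, Rmult_0_r, exp_0. lra.
  - specialize (IH ltac:(lia)). destruct (qroot_pow N ltac:(lia)) as [A1 [A2 _]]. destruct (qroot_pow (S N) ltac:(lia)) as [B1 [B2 _]]. rewrite S_INR in B2.
    set (a := qroot N) in *. set (b := qroot (S N)) in *. enough (/ (b*b*b) <= 4*b-4*a) by lra. assert (0 < b*b*b) by nra.
    apply Rmult_le_reg_r with (b*b*b); [assumption|]. rewrite Rinv_l by lra.
    (* With [b^4 = a^4 + 1] the claim [1 <= 4 (b - a) b^3] reads [3 b^4 - 4 a b^3 + a^4 >= 0]. *)
    enough (0 <= (b-a)*(b-a)*(3*(b*b)+2*(a*b)+a*a)) by lra. apply Rmult_le_pos; [apply Rle_0_sqr|]. nra.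
Qed.

(** The factor [ln (M/k)], supplied by the vanishing of the transform at 2, keeps the sum at the
    order [M^(1/2)]; a factor [ln M] in its place would cost a logarithm and with it the error term
    of the theorem. *)
Lemma rsum_log_decay (M : nat) : (1 <= M)%nat -> rsum (fun k => exp (- / 2*lnn k)*(lnn M - lnn k)) M <= 16*(qroot M*qroot M).
Proof.
  intros HM. set (B := qroot M). assert (HB : 0 < B) by apply exp_pos. apply Rle_trans with (rsum (fun k => 4*B * / (qroot k*qroot k*qroot k)) M).
  - apply rsum_le. intros k Hk. destruct (qroot_pow k ltac:(lia)) as [A1 [_ A3]]. rewrite A3. set (b := qroot k) in *.
    assert (Lb : lnn M-lnn k <= 4*(B/b)).
    { pose proof (ln_lt_self (B/b) ltac:(apply Rdiv_lt_0_compat; assumption)) as Ls. rewrite ln_div in Ls by assumption. replace (ln B) with (/ 4*lnn M) in Ls by (symmetry; apply ln_exp). replace (ln b) with (/ 4*lnn k) in Ls by (symmetry; apply ln_exp). lra. }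
    apply Rle_trans with (/ (b*b)*(4*(B/b))); [apply Rmult_le_compat_l; [left; apply Rinv_0_lt_compat; nra|exact Lb]|]. right. field. lra.
  - rewrite rsum_scal. pose proof (rsum_qroot M HM). fold B in H. nra.
Qed.

(** Each block of [q] consecutive integers contributes its first element [q k + 1]; in the first
    block this is [n = 1], where [f] vanishes. *)
Lemma rsum_residue_one (q J : nat) (f h : nat -> R) : (2 <= q)%nat -> f 1%nat = 0 -> (forall k, (1 <= k <= J)%nat -> f (q*k + 1)%nat <= h k) ->
  rsum (fun n => if Nat.eq_dec (n mod q) 1 then f n else 0) (q*(J + 1)) <= rsum h J.
Proof.
  intros Hq H1 Hh.
  assert (Blk : forall j, rsum (fun n => if Nat.eq_dec ((q*j+n) mod q) 1 then f (q*j+n)%nat else 0) q = f (q*j+1)%nat).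
  { intros j. assert (E : forall n, ((q*j+n) mod q = n mod q)%nat) by (intros n; rewrite Nat.add_comm, Nat.mul_comm; apply Nat.Div0.mod_add).
    set (F := fun n => if Nat.eq_dec ((q*j+n) mod q) 1 then f (q*j+n)%nat else 0). pose proof (rsum_app F 1 (q-1)) as A. replace (1+(q-1))%nat with q in A by lia. rewrite A, (rsum_zero (fun n => F (1+n)%nat)).
    - cbn [rsum]. unfold F; cbv beta. rewrite E, Nat.mod_small by lia. destruct (Nat.eq_dec 1 1); [ring|lia].
    - intros n Hn. unfold F. rewrite E. destruct (Nat.eq_dec n (q-1)) as [->|Hne].
      + replace (1+(q-1))%nat with q by lia. rewrite Nat.Div0.mod_same. reflexivity.
      + rewrite Nat.mod_small by lia. destruct (Nat.eq_dec (1+n) 1); [lia|reflexivity]. }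
  induction J as [|J IH].
  - pose proof (Blk 0%nat) as B. rewrite Nat.mul_0_r in B. replace (q*(0+1))%nat with q by lia. right. exact (eq_trans B H1).
  - replace (q*(S J+1))%nat with (q*(J+1)+q)%nat by lia. rewrite rsum_app. rewrite (Blk (J+1)%nat). apply Rplus_le_compat; [apply IH; intros; apply Hh; lia|]. replace (J+1)%nat with (S J) by lia. apply Hh. lia.
Qed.

Lemma rsum_last (f : nat -> R) (N : nat) : (1 <= N)%nat -> rsum f N = rsum f (N - 1) + f N.
Proof. destruct N; [lia|]. rewrite Nat.sub_succ, Nat.sub_0_r. reflexivity. Qed.

Lemma vonmangoldt_1 : vonmangoldt 1 = 0.
Proof. apply Rle_antisym; [|apply vonmangoldt_nonneg]. pose proof (vonmangoldt_le_ln 1 ltac:(lia)) as H. simpl INR in H. rewrite ln_1 in H. exact H. Qed.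

Lemma zero_weight_conj (q : nat) (chi : nat -> C) (r : C) (mu : R) : prime (Z.of_nat q) -> nonprincipal_char q chi -> Re r = / 2 ->
  zero_weight (Fk (conj_char chi) 0) r mu -> zero_weight (Fk chi 0) (Cconj r) mu.
Proof.
  intros Hp Hchi Hr [H0 [H|[E [m [c [rr [Hm [Hrr H]]]]]]]]; (split; [exact H0|]); [left; exact H|right].
  assert (Hc : forall w, 0 < Re w -> Cmod (Fk chi 0 w) = Cmod (Fk (conj_char chi) 0 (Cconj w))) by (intros w Hw; rewrite (Fk_conj q chi w Hp Hchi Hw), Cmod_conj; reflexivity).
  assert (Z : forall z, Cmod z = 0 -> z = 0%C) by (intros z Hz; apply Cmod_eq_0; exact Hz).
  split.
  - apply Z. rewrite Hc by (change (0 < Re r); lra). rewrite Cconj_conj, E. apply Cmod_0.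
  - exists m, c, (Rmin rr (/ 4)). split; [exact Hm|]. split; [apply Rmin_pos; lra|]. intros w Hw Fw. pose proof (Rlt_le_trans _ _ _ Hw (Rmin_l _ _)) as Hw1. pose proof (Rlt_le_trans _ _ _ Hw (Rmin_r _ _)) as Hw2.
    assert (Rw : 0 < Re w). { pose proof (re_le_Cmod (w-Cconj r)%C) as B. apply Rabs_le_between in B. replace (Re (w-Cconj r)%C) with (Re w-Re r) in B by Re_ring. lra. }
    assert (Ec : Cmod (Cconj w-r)%C = Cmod (w-Cconj r)%C) by (rewrite <- Cmod_conj, Cminus_conj, Cconj_conj; reflexivity).
    rewrite (Hc w Rw), <- Ec. apply H; [rewrite Ec; exact Hw1|]. intros E2. apply Fw. apply Z. rewrite (Hc w Rw), E2. apply Cmod_0.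
Qed.

Section Average.
Variable t : R.
Hypothesis Ht : 0 < t.
Let y0 := 2*PI*t.
Let Sm := 1+Rabs (sin (2*y0)/(2*y0)).

(** What is used of the order of vanishing. The two parts of the theorem take for [m] the order
    itself and the indicator of a zero. *)
Definition weighted (q : nat) (m : (nat -> C) -> nat) : Prop := forall chi, nonprincipal_char q chi -> forall mu, 0 <= mu < INR (m chi) -> zero_weight (Fk chi 0) (/ 2, y0/lnn q) mu.

(** Summed over all characters, the left sides of [character_inequality] and the main terms have
    order [q L], while the prime sums and the allowance for the quadratic character amount to
    [O(q)]; dividing leaves [O(1/log q)]. *)
Lemma weight_bound : exists K Q, 0 < K /\ forall q l m, prime (Z.of_nat q) -> (Q <= q)%nat -> GRH_mod q -> enum_nonprincipal q l -> weighted q m ->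
  lsum (fun chi => INR (m chi)) l/INR (q - 2) <= / 2 * / Sm + K/lnn q.
Proof.
  pose proof PI_RGT_0 as HPI. assert (Hy : 0 < y0) by (unfold y0; mpos). assert (HS : 1 <= Sm) by (unfold Sm; pose proof (Rabs_pos (sin (2*y0)/(2*y0))); lra).
  destruct (test_function_exists y0 Hy) as [g [Phi [gh [K TF]]]]. destruct log_derivative_right as [K3 [HK3 LD]]. pose proof fe_const_ge_1 as Hfe. pose proof (tf_const _ _ _ _ _ _ TF) as HK.
  assert (Hd : 0 < ln 3-ln (5/2)) by (pose proof (ln_increasing (5/2) 3 ltac:(lra) ltac:(lra)); lra).
  (* [zero_weight_crude] at height [y0/L] gives [m chi <= C4 L], using [L >= 1] to factor out
     [L]. *)
  set (C4 := (1+ln 14+1+ln (4+y0))/(ln 3-ln (5/2))). assert (l14 : 0 <= ln 14) by (apply ln_nonneg; lra). assert (l4 : 0 <= ln (4+y0)) by (apply ln_nonneg; lra).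
  assert (HC4 : 0 < C4) by div_pos. destruct (pow_le_exp 2 1 ltac:(lra)) as [K5 [HK5 PE]].
  set (D := PI*(Sm*Sm)). assert (HD : 0 < D) by (unfold D; apply Rmult_lt_0_compat; nra). set (E1 := cerr K3*(PI*Sm)+8*fe_const*K). assert (HE1 : 0 < E1) by (unfold E1, cerr; apply Rplus_lt_0_compat; mpos).
  exists (E1/(2*D)+2*K5*C4+96*K/D), 5%nat. split; [assert (0 < E1/(2*D)) by div_pos; assert (0 < 96*K/D) by div_pos; nra|].
  intros q l m Hp Hq HG Hl Hm. set (L := lnn q). assert (HL : 1 <= L) by (apply L_ge_1; lia). assert (Hq5 : 5 <= INR q) by (replace 5 with (INR 5) by (simpl; ring); apply le_INR; exact Hq).
  set (f := fun n => vonmangoldt n*exp (- (/ 2+0)*lnn n)*Rabs (gh (lnn n/L))).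
  assert (Hf0 : forall n, 0 <= f n) by (intros n; unfold f; apply Rmult_le_pos; [apply Rmult_le_pos; [apply vonmangoldt_nonneg|left; apply exp_pos]|apply Rabs_pos]).
  (* From [vonmangoldt n <= ln n <= 2 L] and the linear bound of the transform; the two factors [L]
     cancel. *)
  assert (Hf : forall n, (1 <= n <= q*q)%nat -> f n <= 2*K*(exp (- / 2*lnn n)*(2*L-lnn n))).
  { intros n Hn. set (x := lnn n). assert (Hx : 0 <= x) by apply ln_INR_nonneg. assert (Hx2 : x <= 2*L).
    { replace (2*L) with (lnn (q*q)) by (rewrite mult_INR, ln_mult by lra; unfold L; ring). apply ln_le'; [apply lt_0_INR; lia|apply le_INR; lia]. }
    assert (Gb : Rabs (gh (x/L)) <= K*((2*L-x)/L)).
    { replace ((2*L-x)/L) with (2-x/L) by (field; lra). assert (0 <= x/L <= 2). { split; [apply Rmult_le_pos; [lra|left; inv_pos]|]. apply Rmult_le_reg_r with L; [lra|]. replace (x/L*L) with x by (field; lra). exact Hx2. }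
      destruct (Rle_dec 2 (x/L)) as [H2|H2]; [rewrite (tf_support _ _ _ _ _ _ TF _ H2), Rabs_R0; apply Rmult_le_pos; lra|apply (tf_hat _ _ _ _ _ _ TF); lra]. }
    unfold f. fold x. rewrite Rplus_0_r. pose proof (vonmangoldt_le_ln n ltac:(lia)) as V1. fold x in V1. pose proof (vonmangoldt_nonneg n) as V0. pose proof (exp_pos (- / 2*x)) as Ep. pose proof (Rabs_pos (gh (x/L))).
    apply Rle_trans with (2*L*exp (- / 2*x)*(K*((2*L-x)/L))); [|right; field; lra].
    apply Rmult_le_compat; [apply Rmult_le_pos; lra|assumption| |exact Gb]. nra. }
  assert (qq : qroot (q*q)*qroot (q*q) = INR q).
  { unfold qroot. rewrite <- exp_plus, mult_INR, ln_mult by lra. replace (/ 4*(lnn q+lnn q) + / 4*(lnn q+lnn q)) with (lnn q) by field. apply exp_ln. lra. }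
  assert (lqq : lnn (q*q) = 2*L) by (rewrite mult_INR, ln_mult by lra; unfold L; ring).
  (* The trivial bound for one character; it is also what the -1 in the orthogonality relation
     costs. *)
  assert (P1 : rsum f (q*q) <= 32*K*INR q).
  { eapply Rle_trans; [apply rsum_le; exact Hf|]. rewrite rsum_scal. pose proof (rsum_log_decay (q*q) ltac:(nia)) as R0. rewrite lqq in R0. nra. }
  (* Writing [n = q k + 1], the terms are at most [q^(-1/2) k^(-1/2) ln (q/k)] up to a constant, and
     their sum is bounded. This compensates the factor [q] from orthogonality. *)
  assert (P2 : rsum (fun n => if Nat.eq_dec (n mod q) 1 then f n else 0) (q*q) <= 32*K).
  { replace (q*q)%nat with (q*((q-1)+1))%nat by nia. set (h := fun k => 2*K*exp (- / 2*L)*(exp (- / 2*lnn k)*(L-lnn k))).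
    apply Rle_trans with (rsum h (q-1)).
    - apply rsum_residue_one; [lia|unfold f; rewrite vonmangoldt_1; ring|]. intros k Hk. eapply Rle_trans; [apply Hf; nia|]. unfold h. rewrite (Rmult_assoc (2*K)). apply Rmult_le_compat_l; [lra|].
      assert (Ik : 1 <= INR k) by (apply (le_INR 1); lia). assert (Lk : L+lnn k <= lnn (q*k+1)).
      { unfold L. rewrite <- ln_mult by lra. apply ln_le'; [nra|]. rewrite <- mult_INR. apply le_INR. lia. }
      assert (Lk2 : lnn (q*k+1) <= 2*L) by (rewrite <- lqq; apply ln_le'; [apply lt_0_INR; lia|apply le_INR; nia]). replace (exp (- / 2*L)*(exp (- / 2*lnn k)*(L-lnn k))) with (exp (- / 2*(L+lnn k))*(L-lnn k)) by (rewrite Rmult_plus_distr_l, exp_plus; ring).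
      apply Rmult_le_compat; [left; apply exp_pos|lra|apply exp_le; lra|lra].
    - unfold h. rewrite rsum_scal. assert (R0 : rsum (fun k => exp (- / 2*lnn k)*(L-lnn k)) (q-1) <= 16*(qroot q*qroot q)).
      { refine (Rle_trans _ _ _ _ (rsum_log_decay q ltac:(lia))). rewrite (rsum_last _ q) by lia. fold L. lra. }
      destruct (qroot_pow q ltac:(lia)) as [A1 [_ A3]]. fold L in A3. rewrite A3. set (b := qroot q) in *.
      apply Rle_trans with (2*K * / (b*b)*(16*(b*b))); [apply Rmult_le_compat_l; [apply Rmult_le_pos; [lra|left; apply Rinv_0_lt_compat; nra]|exact R0]|]. right. field. lra. }
  assert (PS : forall chi, nonprincipal_char q chi -> Rabs (psum q chi 0 (q*q) gh) <= rsum f (q*q)).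
  { intros chi Hchi. unfold psum. rewrite <- Cmod_R, <- csum_RtoC. le_via Cmod_csum_le. apply rsum_le. intros n _. rewrite Cmod_R. fold L. rewrite !Rabs_mult, (Rabs_right (vonmangoldt n)), (Rabs_right (exp _)) by (apply Rle_ge; try apply vonmangoldt_nonneg; left; apply exp_pos).
    apply Rmult_le_compat_l; [apply Rmult_le_pos; [apply vonmangoldt_nonneg|left; apply exp_pos]|]. assert (Rabs (Re (chi n)) <= 1) by (eapply Rle_trans; [apply re_le_Cmod|apply (dchar_mod_le_1 q Hp); apply Hchi]). pose proof (Rabs_pos (gh (lnn n/L))). nra. }
  set (B := (L+cerr K3)*(PI*Sm)+8*fe_const*K). assert (HB : 0 <= B) by (unfold B; unfold E1 in HE1; assert (0 < L*(PI*Sm)) by mpos; lra).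
  (* The allowance for the quadratic character: its weights by the crude bound and its prime sum
     trivially. It is [O(q)], since [L^2 <= K5 q], and occurs at most once. *)
  set (B2 := 2*C4*L*(L*D)+rsum f (q*q)). assert (HB2 : 0 <= B2) by (unfold B2; assert (0 <= rsum f (q*q)) by (apply rsum_nonneg; intros; apply Hf0); assert (0 < C4*L*(L*D)) by mpos; lra).
  set (W := fun chi => INR (m chi)+INR (m (conj_char chi))).
  set (isq := fun chi => sqr_char chi = principal_char q).
  assert (Each : forall chi, In chi l -> W chi*(L*D)+psum q chi 0 (q*q) gh <= B+(if excluded_middle_informative (isq chi) then B2 else 0)).
  { intros chi Hin. assert (Hchi : nonprincipal_char q chi) by (apply Hl; exact Hin). specialize (PS chi Hchi). apply Rabs_le_between in PS. pose proof (conj_nonprincipal q chi Hchi) as Hcb.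
    destruct (excluded_middle_informative (isq chi)) as [Hs|Hs].
    - assert (Cr : forall ch, nonprincipal_char q ch -> INR (m ch) <= C4*L).
      { intros ch Hch. apply (le_of_linear_error _ _ (INR (m ch))). intros r Hr. pose proof (pos_INR (m ch)) as Pm. enough ((1-r)*INR (m ch) <= C4*L) by lra.
        destruct (Req_dec (INR (m ch)) 0) as [E0|E0]; [rewrite E0, Rmult_0_r; apply Rmult_le_pos; lra|].
        pose proof (zero_weight_crude q ch (y0/L) ((1-r)*INR (m ch)) Hp Hch (Hm ch Hch ((1-r)*INR (m ch)) ltac:(split; [apply Rmult_le_pos; lra|enough (0 < r*INR (m ch)) by lra; apply Rmult_lt_0_compat; lra]))) as Z.
        assert (Yl : 0 < y0/L <= y0). { split; [div_pos|]. apply Rmult_le_reg_r with L; [lra|]. replace (y0/L*L) with y0 by (field; lra). nra. }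
        rewrite (Rabs_right (y0/L)), ln_mult in Z by lra. fold L in Z. pose proof (ln_le' (4+y0/L) (4+y0) ltac:(lra) ltac:(lra)).
        apply Rmult_le_reg_r with (ln 3-ln (5/2)); [exact Hd|]. unfold C4. replace ((1+ln 14+1+ln (4+y0))/(ln 3-ln (5/2))*L*(ln 3-ln (5/2))) with ((1+ln 14+1+ln (4+y0))*L) by (field; lra). nra. }
      pose proof (Cr chi Hchi). pose proof (Cr _ Hcb). assert (W chi*(L*D) <= 2*C4*L*(L*D)); [|unfold B2; lra]. apply Rmult_le_compat_r; [apply Rmult_le_pos; lra|unfold W; lra].
    -
      assert (Hnz : forall s, / 2 < Re s -> Fk chi 0 s <> 0%C) by (apply (Lfun_neq_0_half q chi Hp Hchi); [split; [apply sqr_is_dchar; apply Hchi|exact Hs]|exact HG]).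
      (* Weights have to stay strictly below the order, so [(1 - r) m] is used and [r] tends to
         0. *)
      apply (le_of_linear_error _ _ (W chi*(L*D))). intros r Hr.
      assert (ZW : forall ch, nonprincipal_char q ch -> zero_weight (Fk ch 0) (/ 2, y0/L) ((1-r)*INR (m ch))).
      { intros ch Hch. pose proof (pos_INR (m ch)). destruct (Req_dec (INR (m ch)) 0) as [E0|E0]; [rewrite E0, Rmult_0_r; split; [lra|left; reflexivity]|]. apply Hm; [exact Hch|]. nra. }
      pose proof (zero_weight_conj q chi (/ 2, y0/L) _ Hp Hchi eq_refl (ZW _ Hcb)) as Z2.
      pose proof (character_inequality q chi y0 Sm g Phi gh K K3 _ _ TF Hy Hp ltac:(lia) Hchi (fun s => LD q chi s Hp Hchi) HG Hnz (ZW chi Hchi) Z2) as CI. fold L in CI. fold D in CI. fold B in CI. unfold W in *. lra. }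
  apply lsum_le in Each. rewrite !lsum_plus, lsum_const, (enum_nonprincipal_length q Hp l Hl) in Each.
  pose proof (lsum_unique_le isq l B2 HB2 (proj1 Hl) (fun a b Ia Ib => quadratic_unique q Hp a b (proj1 (proj2 Hl a) Ia) (proj1 (proj2 Hl b) Ib))) as U.
  assert (SW : lsum (fun chi => W chi*(L*D)) l = 2*lsum (fun chi => INR (m chi)) l*(L*D)).
  { rewrite (lsum_ext _ (fun chi => L*D*(INR (m chi)+INR (m (conj_char chi))))) by (intros; unfold W; ring). rewrite lsum_scal, lsum_plus.
    rewrite <- (lsum_map conj_char (fun chi => INR (m chi))), (lsum_perm _ _ _ (conj_char_perm q l Hl)). ring. }
  assert (SP : - (rsum f (q*q)+INR q*(32*K)) <= lsum (fun chi => psum q chi 0 (q*q) gh) l).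
  { unfold psum. rewrite lsum_rsum_swap. match goal with |- _ <= ?X => set (S1 := X) end. enough (Rabs S1 <= rsum f (q*q)+INR q*(32*K)) by (apply Rabs_le_between in H; lra).
    (* Orthogonality: at most [q + 1] for [n = 1 mod q] and at most 1 otherwise. *)
    apply Rle_trans with (rsum (fun n => f n+INR q*(if Nat.eq_dec (n mod q) 1 then f n else 0)) (q*q)).
    - unfold S1. rewrite <- Cmod_R, <- csum_RtoC. le_via Cmod_csum_le. apply rsum_le. intros n _. rewrite Cmod_R.
      rewrite (lsum_ext _ (fun chi => vonmangoldt n*exp (- (/ 2+0)*lnn n)*gh (lnn n/L)*Re (chi n))) by (intros; unfold L; ring). rewrite lsum_scal, Rabs_mult.
      replace (Rabs (vonmangoldt n*exp (- (/ 2+0)*lnn n)*gh (lnn n/L))) with (f n) by (unfold f; rewrite !Rabs_mult, (Rabs_right (vonmangoldt n)), (Rabs_right (exp _)) by (apply Rle_ge; try apply vonmangoldt_nonneg; left; apply exp_pos); reflexivity).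
      pose proof (enum_nonprincipal_orthogonality q Hp l n Hl) as O. apply (Rmult_le_compat_l (f n)) in O; [|apply Hf0]. destruct (Nat.eq_dec (n mod q) 1); lra.
    - rewrite rsum_plus, rsum_scal. nra. } set (T := lsum (fun chi => INR (m chi)) l) in *. set (q2 := INR (q-2)) in *. assert (Eq2 : q2 = INR q-2) by (unfold q2; rewrite minus_INR by lia; reflexivity).
  (* Here [96 = 3 * 32]: the sum of [f], [q] times its sum over [n = 1 mod q], and the prime sum of
     the quadratic character. *)
  assert (Tot : 2*T*(L*D) <= q2*B+2*C4*L*(L*D)+96*K*INR q) by (unfold B2 in *; lra).
  assert (LL : L*L <= K5*INR q). { specialize (PE L ltac:(lra)). rewrite Rmult_1_l in PE. unfold L in PE at 2. rewrite exp_ln in PE by lra. lra. }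
  apply Rmult_le_reg_r with (2*q2*(L*D)); [mpos|].
  replace (T/q2*(2*q2*(L*D))) with (2*T*(L*D)) by (field; lra).
  replace ((/ 2 * / Sm+(E1/(2*D)+2*K5*C4+96*K/D)/L)*(2*q2*(L*D))) with (q2*(L*(PI*Sm)+E1)+2*C4*D*(K5*(2*q2))+96*K*(2*q2)) by (unfold D; field; repeat split; lra).
  assert (X1 : q2*B = q2*(L*(PI*Sm)+E1)) by (unfold B, E1; ring). assert (X2 : 2*C4*L*(L*D) <= 2*C4*D*(K5*(2*q2))).
  { replace (2*C4*L*(L*D)) with (2*C4*D*(L*L)) by ring. apply Rmult_le_compat_l; [apply Rmult_le_pos; lra|]. nra. }
  nra.
Qed.
End Average.

(** * Orders of vanishing, and the theorem *)

Lemma Cmod_Cpow (z : C) (n : nat) : Cmod (Cpow z n) = Cmod z ^ n.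
Proof. induction n; simpl; [apply Cmod_1|]. rewrite Cmod_mult, IHn. reflexivity. Qed.

Lemma ex_derive_locally_bounded (g : C -> C) (z : C) : ex_derive (K := C_AbsRing) (V := C_NormedModule) g z ->
  exists d M, 0 < d /\ 0 < M /\ forall w, Cmod (w - z)%C < d -> Cmod (g w) <= M.
Proof.
  intros H. apply ex_derive_continuous in H.
  destruct (H _ (locally_le_locally_norm (g z) _ (ex_intro _ (mkposreal 1 Rlt_0_1) (fun y Hy => Hy)))) as [d P].
  exists d, (Cmod (g z)+1). split; [apply cond_pos|]. split; [pose proof (Cmod_ge_0 (g z)); lra|]. intros w Hw. specialize (P w Hw).
  change (Cmod (g w-g z)%C < 1) in P. replace (g w) with (g z+(g w-g z))%C by ring. le_via Cmod_triangle. lra.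
Qed.

Lemma power_bound_zero_weight (f : C -> C) (rho : C) (m : nat) (M d mu : R) : 0 < M -> 0 < d -> 0 <= mu < INR m ->
  (forall w, Cmod (w - rho)%C < d -> Cmod (f w) <= M*Cmod (w - rho)%C ^ m) -> zero_weight f rho mu.
Proof.
  intros HM Hd Hmu H. split; [lra|]. right. destruct m as [|m]; [simpl in Hmu; lra|]. assert (E0 : f rho = 0%C).
  { apply Cmod_eq_0. apply Rle_antisym; [|apply Cmod_ge_0]. specialize (H rho). replace (rho-rho)%C with (RtoC 0) in H by ring. rewrite Cmod_0 in H. simpl in H. lra. }
  split; [exact E0|]. exists (INR (S m)), (ln M), d. split; [lra|]. split; [exact Hd|]. intros w Hw Fw.
  assert (W : 0 < Cmod (w-rho)%C) by (apply Cmod_gt_0; intros E; apply Fw; rewrite (Cminus_0_eq _ _ E); exact E0).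
  rewrite <- ln_pow, <- ln_mult by (try apply pow_lt; assumption). apply ln_le'; [apply Cmod_gt_0; exact Fw|]. auto.
Qed.

(** Whichever exponent [m] the description picks, the cofactor is bounded near the point, so [|L|]
    is at most a multiple of [|w - rho|^m] there. *)
Lemma ord_at_zero_weight (chi : nat -> C) (sh : C) (mu : R) : 0 <= mu < INR (ord_at (fun s => Lfun chi (s + sh)%C) half) -> zero_weight (Fk chi 0) (half + sh)%C mu.
Proof.
  (* Without a finite order the default value 0 leaves no admissible [mu]. *)
  unfold ord_at. destruct ClassicalDescription.excluded_middle_informative as [H|_]; [|simpl; lra]. destruct (constructive_indefinite_description _ H) as [m V]. simpl proj1_sig. intros Hmu. destruct V as [r [Hr [g [Hg [_ E]]]]].
  destruct (ex_derive_locally_bounded g half) as [d [M [Hd [HM B]]]]; [apply Hg; replace (half-half)%C with (RtoC 0) by ring; rewrite Cmod_0; exact Hr|].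
  apply (power_bound_zero_weight _ _ m M (Rmin r d) mu HM); [apply Rmin_pos; assumption|exact Hmu|]. intros w Hw.
  specialize (E (w-sh)%C). specialize (B (w-sh)%C). rewrite Lfun_Fk in E. replace (w-sh+sh)%C with w in E by ring. replace (w-sh-half)%C with (w-(half+sh))%C in E, B by ring.
  rewrite E, Cmod_mult, Cmod_Cpow, Rmult_comm by exact (Rlt_le_trans _ _ _ Hw (Rmin_l _ _)). apply Rmult_le_compat_r; [apply pow_le, Cmod_ge_0|]. apply B. exact (Rlt_le_trans _ _ _ Hw (Rmin_r _ _)).
Qed.

Lemma simple_zero_weight (q : nat) (chi : nat -> C) (rho : C) (mu : R) : prime (Z.of_nat q) -> nonprincipal_char q chi -> 0 < Re rho -> Fk chi 0 rho = 0%C -> 0 <= mu < 1 -> zero_weight (Fk chi 0) rho mu.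
Proof.
  intros Hp Hchi Hr E Hmu. destruct (cder_locally_lipschitz _ _ _ (Lfun_cder q chi Hp Hchi 0 rho Hr)) as [d [Hd B]]. set (D := (- Fk chi 1 rho)%C) in B. pose proof (Cmod_ge_0 D).
  apply (power_bound_zero_weight _ _ 1 (Cmod D+1) d); [lra|exact Hd|simpl; lra|]. intros w Hw. specialize (B (w-rho)%C Hw). replace (rho+(w-rho))%C with w in B by ring. rewrite E in B. replace (Fk chi 0 w-0)%C with (Fk chi 0 w) in B by ring. lra.
Qed.

Lemma INR_sumN {A : Type} (f : A -> nat) (l : list A) : INR (sumN (map f l)) = lsum (fun a => INR (f a)) l.
Proof. induction l as [|a l IH]; [reflexivity|]. change (INR (f a+sumN (map f l)) = INR (f a)+lsum (fun a => INR (f a)) l). rewrite plus_INR, IH. reflexivity. Qed.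

Theorem theorem1 :
  forall t : R, 0 < t ->
  (exists (K : R) (Q : nat),
     forall q : nat, prime (Z.of_nat q) -> (Q <= q)%nat -> GRH_mod q ->
     forall l : list (nat -> C), enum_nonprincipal q l ->
       INR (sumN (map (fun chi => ord_at (fun s => Lfun chi (Cplus s (Lshift t q))) half) l))
         / INR (q - 2)
       <= zbound t + K / ln (INR q))
  /\
  (forall eps : R, 0 < eps ->
     exists Q : nat,
     forall q : nat, prime (Z.of_nat q) -> (Q <= q)%nat -> GRH_mod q ->
     forall l : list (nat -> C), enum_nonprincipal q l ->
       INR (nonvanishing_count t q l) / INR (q - 2) >= 1 - zbound t - eps).
Proof.
  intros t Ht. destruct (weight_bound t Ht) as [K [Q [HK WB]]].
  assert (Ez : / 2 * / (1+Rabs (sin (2*(2*PI*t))/(2*(2*PI*t)))) = zbound t) by (unfold zbound; replace (2*(2*PI*t)) with (4*PI*t) by ring; reflexivity).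
  rewrite Ez in WB. assert (Er : forall q, (half+Lshift t q)%C = (/ 2, 2*PI*t/lnn q)) by (intros q; unfold half, Lshift; C_ring).
  split.
  - exists K, Q. intros q Hp Hq HG l Hl. rewrite INR_sumN. apply (WB q l (fun chi => ord_at (fun s => Lfun chi (s+Lshift t q)%C) half)); try assumption.
    intros chi _ mu Hmu. rewrite <- Er. apply ord_at_zero_weight. exact Hmu.
  - intros eps He. destruct (nfloor_ex (exp (K/eps)) ltac:(left; apply exp_pos)) as [n [_ Hn]]. exists (Q+S n+5)%nat. intros q Hp Hq HG l Hl.
    (* The indicator of vanishing is an admissible weight, because a zero of a differentiable
       function admits every [mu < 1]; its total is [q - 2] minus the nonvanishing count. *)
    set (m := fun chi => if ClassicalDescription.excluded_middle_informative (Lfun chi (half+Lshift t q)%C <> 0%C) then 0%nat else 1%nat).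
    assert (Hm : weighted t q m).
    { intros chi Hchi mu Hmu. rewrite <- Er. unfold m in Hmu. destruct ClassicalDescription.excluded_middle_informative as [H|H]; [simpl in Hmu; lra|]. apply NNPP in H. rewrite Lfun_Fk in H.
      apply (simple_zero_weight q chi _ mu Hp Hchi); [rewrite Er; Re_lra|exact H|simpl in Hmu; lra]. }
    pose proof (WB q l m Hp ltac:(lia) HG Hl Hm) as B. assert (Hq2 : 0 < INR (q-2)) by (apply lt_0_INR; lia).
    assert (Cn : INR (nonvanishing_count t q l)+lsum (fun chi => INR (m chi)) l = INR (q-2)).
    { unfold nonvanishing_count. rewrite INR_sumN, <- lsum_plus, (lsum_ext _ (fun _ => 1)), lsum_const, (enum_nonprincipal_length q Hp l Hl); [ring|]. intros chi _. unfold m. destruct ClassicalDescription.excluded_middle_informative; simpl; ring. }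
    assert (Lq : K/eps <= lnn q). { rewrite <- (ln_exp (K/eps)). apply ln_le'; [apply exp_pos|]. apply Rle_trans with (INR (S n)); [rewrite S_INR; lra|apply le_INR; lia]. }
    assert (Kq : K/lnn q <= eps). { assert (0 < K/eps) by div_pos. apply Rmult_le_reg_r with (lnn q); [lra|]. replace (K/lnn q*lnn q) with K by (field; lra). apply (Rmult_le_compat_l eps) in Lq; [|lra]. replace (eps*(K/eps)) with K in Lq by (field; lra). lra. }
    replace (INR (nonvanishing_count t q l)) with (INR (q-2)-lsum (fun chi => INR (m chi)) l) by lra.
    replace ((INR (q-2)-lsum (fun chi => INR (m chi)) l)/INR (q-2)) with (1-lsum (fun chi => INR (m chi)) l/INR (q-2)) by (field; lra). lra.
Qed.
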